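(* Let $\Omega\subset\mathbb{R}^n$ be an open convex set that does not contain affine lines. Then there is a constant $C>0$ such that for every $f\in\mathrm{PW}^1(\Omega)$ there are orthogonal sequences $(f_j)$ and $(g_j)$ in $\mathrm{PW}(\tfrac12\Omega)$ with $$f=\lim_{N\to\infty}\sum_{j=1}^N f_jg_j\ \text{ in } \mathcal{W}_2(\tfrac12\Omega),\qquad\text{and}\qquad \sum_j\big(\|f_j\|_{L^2}\|g_j\|_{L^2}\big)^2\le C\|f\|_{L^1}^2.$$
   Context: The Fourier transform is $\hat f(x)=\int_{\mathbb{R}^n}f(y)e^{-2\pi i\langle x,y\rangle}\,dy$. For an open set $U\subset\mathbb{R}^n$ and $1\le p\le\infty$, $\mathrm{PW}^p(U)=\{f\in L^p(\mathbb{R}^n):\operatorname{supp}\hat f\subset U\}$ with the $L^p$ norm, where the support condition means that $\hat f$ vanishes (a.e., for $p\le 2$) outside $U$, and $\mathrm{PW}(U)=\mathrm{PW}^2(U)$. Here $\tfrac12\Omega=\{x/2:x\in\Omega\}$. For an open convex $U$ containing no affine lines and $1\le p\le\infty$, $W_p(U)$ is the set of all functions of the form $f=\sum_{j=1}^N f_jg_j$, where $N\in\mathbb{Z}_+$ and $(f_j)_{j=1}^N$, $(g_j)_{j=1}^N$ are each orthogonal families in $\mathrm{PW}(U)\setminus\{0\}$, endowed with the norm $\|f\|_{W_p(U)}=\inf\big\|(\|f_j\|_{L^2}\|g_j\|_{L^2})_{1\le j\le N}\big\|_{\ell^p}$, the infimum being over all such representations of $f$. $\mathcal{W}_p(U)$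 is the completion of $W_p(U)$. One has $W_p(U)\subset \mathrm{PW}^1(2U)$, and $W_p(U)$ is $L^1$-dense in $\mathrm{PW}^1(2U)$; an $f\in\mathrm{PW}^1(2U)$ is regarded as an element of $\mathcal{W}_p(U)$ by taking the limit in $\mathcal{W}_p(U)$ of a sequence in $W_p(U)$ that converges to $f$ in $L^1$ (that this is meaningful for $p=2$, i.e. that $\|\cdot\|_{W_2(U)}\lesssim\|\cdot\|_{L^1}$ on $W_2(U)$, is implicit in the claim). Terms of the sequences are allowed to be zero. *)

(* Defs.v *)
From HB Require Import structures.
From mathcomp Require Import all_boot all_order all_algebra complex.
From mathcomp Require Import all_classical all_reals all_analysis.

Set Implicit Arguments.
Unset Strict Implicit.
Unset Printing Implicit Defensive.

Import Order.TTheory GRing.Theory Num.Theory.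
Import numFieldNormedType.Exports.

Local Open Scope classical_set_scope.
Local Open Scope ring_scope.

Definition rV_display : measure_display.
Proof. exact: default_measure_display. Qed.

Section rV_measurable.
Variables (R : realType) (n : nat).

Definition rV_coord (i : 'I_n) (x : 'rV[R]_n) : measurableTypeR R := x 0 i.

Let rV_set0 : g_sigma_preimage rV_coord set0.
Proof. exact: sigma_algebra0. Qed.

Let rV_setC A : g_sigma_preimage rV_coord A -> g_sigma_preimage rV_coord (~` A).
Proof. exact: sigma_algebraC. Qed.

Let rV_bigcup (F : (set 'rV[R]_n)^nat) :
  (forall i, g_sigma_preimage rV_coord (F i)) ->
  g_sigma_preimage rV_coord (\bigcup_i F i).
Proof. exact: sigma_algebra_bigcup. Qed.

(* The Borel sigma-algebra of R^n; measurable functions are taken up to a.e.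
   equality below, so completing it would not change the function spaces. *)
HB.instance Definition _ :=
  @isMeasurable.Build rV_display 'rV[R]_n (g_sigma_preimage rV_coord)
    rV_set0 rV_setC rV_bigcup.

End rV_measurable.

Section lebesgue_rV.
Variable R : realType.

Definition rV_cons n (p : measurableTypeR R * 'rV[R]_n) : 'rV[R]_n.+1 :=
  row_mx (p.1%:M : 'M[R]_1) p.2.

Lemma measurable_rV_coord n (i : 'I_n) :
  measurable_fun setT (@rV_coord R n i).
Proof.
move=> _ Y mY; rewrite setTI; apply: sub_sigma_algebra => /=.
rewrite -bigcup_seq/=; exists i => /=; first by rewrite mem_index_enum.
by exists Y => //; rewrite setTI.
Qed.

Lemma measurable_rV_cons n : measurable_fun setT (@rV_cons n).
Proof.
have coordm i : measurable_fun setT (rV_coord i \o @rV_cons n).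
  rewrite (_ : _ \o _ = fun p => match fintype.split (i : 'I_(1 + n)) with
    | inl _ => p.1 | inr j => rV_coord j p.2 end); last first.
    apply/funext => p /=; rewrite /rV_coord /rV_cons mxE.
    by case: (fintype.split _) => j //; rewrite !ord1 mxE.
  case: (fintype.split _) => j; first exact: measurable_fst.
  exact: measurableT_comp (@measurable_rV_coord n j) measurable_snd.
apply: (measurability (\big[setU/set0]_(i < n.+1)
  preimage_set_system setT (@rV_coord R n.+1 i) measurable)) => //.
move=> _ [A + <-]; rewrite -bigcup_seq => -[i _ [B mB <-]].
rewrite [X in _ @^-1` X]setTI -comp_preimage.
exact: coordm.
Qed.

#[local] Hint Extern 0 (measurable_fun _ (@rV_cons _)) =>
  solve [apply: measurable_rV_cons] : core.

Section lebesgue_cons.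
Variables (n : nat) (mu : {measure set 'rV[R]_n -> \bar R}).

Definition lebesgue_cons : set 'rV[R]_n.+1 -> \bar R :=
  pushforward (lebesgue_measure \x^ mu)%E (@rV_cons n).

Let lebesgue_cons0 : lebesgue_cons set0 = 0%E.
Proof. exact: measure0. Qed.

Let lebesgue_cons_ge0 A : (0 <= lebesgue_cons A)%E.
Proof. exact: measure_ge0. Qed.

Let lebesgue_cons_sigma_additive : semi_sigma_additive lebesgue_cons.
Proof. exact: measure_semi_sigma_additive. Qed.

HB.instance Definition _ := isMeasure.Build _ _ _ lebesgue_cons
  lebesgue_cons0 lebesgue_cons_ge0 lebesgue_cons_sigma_additive.

End lebesgue_cons.

(* Lebesgue measure on R^n as an iterated product; on R^0 it is a unit mass. *)
Fixpoint lebesgue_rV n : {measure set 'rV[R]_n -> \bar R} :=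
  match n with
  | 0 => dirac (0 : 'rV[R]_0)
  | m.+1 => lebesgue_cons (lebesgue_rV m)
  end.

End lebesgue_rV.

Section euclidean.
Variables (R : realType) (n : nat).
Implicit Types (U : set 'rV[R]_n) (f g h F : 'rV[R]_n -> R[i]) (p : \bar R).

Local Notation mu := (lebesgue_rV R n).

Definition dotrV (x y : 'rV[R]_n) : R := \sum_(i < n) x 0 i * y 0 i.

Definition has_affine_line U : Prop :=
  exists x v : 'rV[R]_n, v != 0 /\ forall t : R, U (x + t *: v).

Definition half_set U : set 'rV[R]_n := [set 2^-1 *: x | x in U].

Definition cis (t : R) : R[i] := (cos t +i* sin t)%C.

Definition measurable_cfun f : Prop :=
  measurable_fun setT (fun x => complex.Re (f x)) /\
  measurable_fun setT (fun x => complex.Im (f x)).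

Definition cintegral f : R[i] :=
  ((\int[mu]_x complex.Re (f x)) +i* (\int[mu]_x complex.Im (f x)))%C.

Definition eLpnorm p f : \bar R :=
  Lnorm mu p (fun x => (ComplexField.Normc.normc (f x))%:E).

Definition Lpnorm p f : R := fine (eLpnorm p f).

Definition in_Lp p f : Prop := measurable_cfun f /\ (eLpnorm p f < +oo)%E.

Definition cvg_Lp p (u : nat -> 'rV[R]_n -> R[i]) f : Prop :=
  (fun k => eLpnorm p (u k \- f)) @ \oo --> (0 : \bar R).

Definition fourier f (x : 'rV[R]_n) : R[i] :=
  cintegral (fun y => f y * cis (- (2 * pi * dotrV x y))).

(* [F] represents the Fourier transform of [f] in L^2, i.e. the image of [f]
   under the L^2-continuous extension of [fourier] from L^1 /\ L^2. *)
Definition is_fourier2 f F : Prop :=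
  exists u : nat -> 'rV[R]_n -> R[i],
    [/\ forall k, in_Lp 1%:E (u k) /\ in_Lp 2%:E (u k),
        cvg_Lp 2%:E u f &
        cvg_Lp 2%:E (fun k => fourier (u k)) F].

Definition ae_vanish_outside U F : Prop :=
  {ae mu, forall x, ~ U x -> F x = 0}.

Definition PW1 U f : Prop := in_Lp 1%:E f /\ ae_vanish_outside U (fourier f).

Definition PW2 U f : Prop :=
  in_Lp 2%:E f /\
  exists F, [/\ in_Lp 2%:E F, is_fourier2 f F & ae_vanish_outside U F].

Definition L2dot f g : R[i] := cintegral (fun x => f x * (g x)^*%C).

Definition orthogonal_family (I : Type) (f : I -> 'rV[R]_n -> R[i]) : Prop :=
  forall i j, i <> j -> L2dot (f i) (f j) = 0.

Definition ellp_norm p N (a : 'I_N -> R) : R :=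
  match p with
  | q%:E => (\sum_(j < N) `|a j| `^ q) `^ q^-1
  | +oo%E => \big[Num.max/0]_(j < N) `|a j|
  | -oo%E => 0
  end.

(* [h = \sum_(j < N) f_ j * g_ j] as classes modulo a.e. equality; the empty
   sum [N = 0] is allowed. *)
Definition W_repr U h N (f_ g_ : 'I_N -> 'rV[R]_n -> R[i]) : Prop :=
  [/\ forall j, PW2 U (f_ j) /\ ~ (f_ j = cst 0 %[ae mu]),
      forall j, PW2 U (g_ j) /\ ~ (g_ j = cst 0 %[ae mu]),
      orthogonal_family f_, orthogonal_family g_ &
      h = (fun x => \sum_(j < N) f_ j x * g_ j x) %[ae mu]].

Definition W_space U h : Prop := exists N (f_ g_ : 'I_N -> _), W_repr U h f_ g_.

(* equal to [+oo] on functions that are not in [W_space U] *)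
Definition W_norm p U h : \bar R :=
  ereal_inf [set r | exists N (f_ g_ : 'I_N -> 'rV[R]_n -> R[i]),
    W_repr U h f_ g_ /\
    r = (ellp_norm p (fun j => Lpnorm 2%:E (f_ j) * Lpnorm 2%:E (g_ j)))%:E].

(* The completion of [W_space U] for [W_norm p U]: its points are the classes
   of Cauchy sequences modulo sequences whose norm tends to zero. *)
Definition W_cauchy p U (u : nat -> 'rV[R]_n -> R[i]) : Prop :=
  (forall k, W_space U (u k)) /\
  forall e : R, 0 < e -> exists K, forall k l, (K <= k)%N -> (K <= l)%N ->
    (W_norm p U (u k \- u l)%R < e%:E)%E.

Definition W_class p U (u : nat -> 'rV[R]_n -> R[i]) :
    set (nat -> 'rV[R]_n -> R[i]) :=
  [set v | W_cauchy p U v /\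
           (fun k => W_norm p U (u k \- v k)) @ \oo --> (0 : \bar R)].

Definition W_completion p U : set (set (nat -> 'rV[R]_n -> R[i])) :=
  [set W_class p U u | u in W_cauchy p U].

Definition W_embed p U h : set (nat -> 'rV[R]_n -> R[i]) :=
  W_class p U (fun=> h).

(* The distance between two classes is the limit of [W_norm p U (u k \- v k)],
   which does not depend on the representatives [u] and [v]; the infimum only
   serves to pick this value. *)
Definition W_dist p U (X Y : set (nat -> 'rV[R]_n -> R[i])) : \bar R :=
  ereal_inf [set d | exists u v, [/\ X u, Y v &
    (fun k => W_norm p U (u k \- v k)) @ \oo --> d]].

(* convergence in the completion of a sequence of elements of [W_space U] *)
Definition W_cvg p U (u : nat -> 'rV[R]_n -> R[i])
    (X : set (nat -> 'rV[R]_n -> R[i])) : Prop :=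
  (fun k => W_dist p U (W_embed p U (u k)) X) @ \oo --> (0 : \bar R).

(* [X] is the element of the completion as which the L^1 function [f] is
   regarded: [f] is an L^1 limit of elements of [W_space U], and every such
   sequence tends to [X] in the completion. *)
Definition regarded_in_W p U f (X : set (nat -> 'rV[R]_n -> R[i])) : Prop :=
  [/\ W_completion p U X,
      exists u, (forall k, W_space U (u k)) /\ cvg_Lp 1%:E u f &
      forall u, (forall k, W_space U (u k)) -> cvg_Lp 1%:E u f ->
        W_cvg p U u X].

End euclidean.

(* Main.v *)
(* Put U = Omega / 2 and w(x) = |U /\ (x - U)|. A kernel K in L^2(U x U) is pushed forward to
   TK(x) = int K(y, x - y) dy; if K = sum_j a_j (x) b_j has finite rank, TK is the Fourier transform
   of sum_j f_j g_j, where a_j and b_j are the Fourier transforms of f_j and g_j. A kernel orthogonal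
   to all finite-rank elements of ker T is a function of y + z, so these elements are dense in ker T,
   and therefore the norm of h in W_2(U) is at most |K| for every K in L^2(U x U) with TK = h^.

   For f in PW^1(Omega) take K_f(y, z) = f^(y + z) / w(y + z): then T K_f = f^ and
   |K_f|^2 = int_Omega |f^|^2 / w. This is at most C |f|_1^2: if h is the support function of
   Omega - x0, the function G = e^(- 2 pi i h) (1 + 2 pi i eps h)^(- 2n) is bounded by 1, hence
   |int |f^|^2 G^| <= |f|_1^2 since the Fourier transform of |f^|^2 is an autocorrelation of f; on
   the other hand rotating the path of integration evaluates G^(x), up to the constant
   (2 pi i)^(-n), as the volume of {t : h(t) - (x - x0).t < 1} as eps -> 0. By convex geometry
   (inscribed simplices of almost maximal volume in the polar body) this volume dominates 1 / w(x).

   The singular value decomposition of K_f gives the sequences (f_j) and (g_j). *)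

From HB Require Import structures.
Require Import Defs.
From mathcomp Require Import all_boot all_order all_algebra complex perm.
From mathcomp Require Import all_classical all_reals all_analysis measurable_realfun.
From mathcomp Require Import ring lra.
Import Order.TTheory GRing.Theory Num.Theory.
Import numFieldNormedType.Exports.
Import ComplexField.Normc.
Set Implicit Arguments.
Unset Strict Implicit.
Unset Printing Implicit Defensive.
Local Open Scope classical_set_scope.
Local Open Scope ring_scope.

(** * Complex-valued integration *)

(** An [f] in [PW1 Omega] need not lie in [W_space], nor even in L^2, so neither its W_2 norm nor
    the distance to a partial sum is available directly. Everything is routed through kernels: if
    [kap] is pushed forward to the transform of [s - f], then the distance from [s] to the class of
    [f] is at most the Hilbert-Schmidt norm of [kap]. The same estimate for a single element of
    [W_space] bounds its norm by its L^1 norm, without which that class would not exist; for the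
    remainders of the singular value decomposition it gives the convergence.

    The L^1-density of [W_space] is proved too: the spectrum of [f] is contracted into [Omega], then
    [f] is smoothed by a kernel that splits into finitely many pieces, each localising the spectrum
    near one point, where a function is nearly a product of two.

    The exponent 2n in [G] comes from |1 + 2 pi i a|^(-2n) = (1 + 4 pi^2 a^2)^(-n), which is
    dominated by a product of n one-dimensional Cauchy densities. *)

Section complex_numbers.
Variable R : realType.
Implicit Types z w : R[i].

Lemma normc_ge0 z : 0 <= normc z.
Proof. by case: z => a b; rewrite /normc sqrtr_ge0. Qed.

Lemma normcSq z : normc z ^+ 2 = complex.Re z ^+ 2 + complex.Im z ^+ 2.
Proof. by case: z => a b; rewrite /normc sqr_sqrtr// addr_ge0// sqr_ge0. Qed.

Lemma normcE' z : normc z = Num.sqrt (complex.Re z ^+ 2 + complex.Im z ^+ 2).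
Proof. by case: z. Qed.

Lemma Re_le_normc z : `|complex.Re z| <= normc z.
Proof.
rewrite -(ler_pXn2r (n:=2))// ?nnegrE ?normc_ge0//.
by rewrite normcSq real_normK ?num_real// lerDl sqr_ge0.
Qed.

Lemma Im_le_normc z : `|complex.Im z| <= normc z.
Proof.
rewrite -(ler_pXn2r (n:=2))// ?nnegrE ?normc_ge0//.
by rewrite normcSq real_normK ?num_real// lerDr sqr_ge0.
Qed.

Lemma normc_le_ReIm z : normc z <= `|complex.Re z| + `|complex.Im z|.
Proof.
rewrite -(ler_pXn2r (n:=2))// ?nnegrE ?normc_ge0// ?addr_ge0//.
rewrite normcSq sqrrD !real_normK ?num_real// -addrA lerD2l lerDr.
by rewrite mulrn_wge0// mulr_ge0.
Qed.

Lemma normc_real (r : R) : normc (r%:C)%C = `|r|.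
Proof. by rewrite normcE'/= expr0n/= addr0 sqrtr_sqr. Qed.

Lemma normc_conj z : normc (z^*)%C = normc z.
Proof. by rewrite !normcE'; case: z => a b /=; rewrite sqrrN. Qed.

Lemma normcD_le z w : normc (z + w) <= normc z + normc w.
Proof. exact: le_normcD. Qed.

Lemma normcB_le z w : normc (z - w) <= normc z + normc w.
Proof. by rewrite (le_trans (le_normcD _ _))// normcN. Qed.

Lemma normcBC z w : normc (z - w) = normc (w - z).
Proof. by rewrite -normcN opprB. Qed.

Lemma normc_gt0 z : (0 < normc z) = (z != 0).
Proof.
rewrite lt_neqAle normc_ge0 andbT eq_sym; congr (~~ _).
by apply/eqP/eqP => [/eq0_normc//|->]; rewrite normc0.
Qed.

Lemma mul_conj z : z * (z^*)%C = ((normc z ^+ 2)%:C)%C.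
Proof.
rewrite normcSq; case: z => a b /=; apply/eqP; rewrite eq_complex/=.
by apply/andP; split; apply/eqP; ring.
Qed.

Lemma conj_mul z : (z^*)%C * z = ((normc z ^+ 2)%:C)%C.
Proof. by rewrite mulrC mul_conj. Qed.

Lemma normcX z n : normc (z ^+ n) = normc z ^+ n.
Proof.
elim: n => [|n IH]; first by rewrite !expr0 normc1.
by rewrite !exprS normcM IH.
Qed.

Lemma cReD z w : complex.Re (z + w) = complex.Re z + complex.Re w.
Proof. by case: z; case: w. Qed.
Lemma cImD z w : complex.Im (z + w) = complex.Im z + complex.Im w.
Proof. by case: z; case: w. Qed.
Lemma cReN z : complex.Re (- z) = - complex.Re z. Proof. by case: z. Qed.
Lemma cImN z : complex.Im (- z) = - complex.Im z. Proof. by case: z. Qed.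
Lemma cReB z w : complex.Re (z - w) = complex.Re z - complex.Re w.
Proof. by rewrite cReD cReN. Qed.
Lemma cImB z w : complex.Im (z - w) = complex.Im z - complex.Im w.
Proof. by rewrite cImD cImN. Qed.
Lemma cReM z w : complex.Re (z * w) =
  complex.Re z * complex.Re w - complex.Im z * complex.Im w.
Proof. by case: z; case: w. Qed.
Lemma cImM z w : complex.Im (z * w) =
  complex.Re z * complex.Im w + complex.Im z * complex.Re w.
Proof. by case: z => a b; case: w => c d /=. Qed.
Lemma cReJ z : complex.Re (z^*)%C = complex.Re z. Proof. by case: z. Qed.
Lemma cImJ z : complex.Im (z^*)%C = - complex.Im z. Proof. by case: z. Qed.
Lemma conjcM z w : ((z * w)^*)%C = conjc z * conjc w.
Proof. by rewrite rmorphM. Qed.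
Lemma conjcD z w : ((z + w)^*)%C = conjc z + conjc w.
Proof. by rewrite rmorphD. Qed.
Lemma conjcB z w : ((z - w)^*)%C = conjc z - conjc w.
Proof. by rewrite rmorphB. Qed.

Lemma eqcP z w : complex.Re z = complex.Re w -> complex.Im z = complex.Im w -> z = w.
Proof. by case: z => a b; case: w => c d /= -> ->. Qed.

Lemma rcM (a b : R) : ((a * b)%:C)%C = (a%:C)%C * (b%:C)%C :> R[i].
Proof. exact: (rmorphM (@real_complex_def R (Phant R))). Qed.
Lemma rcD (a b : R) : ((a + b)%:C)%C = (a%:C)%C + (b%:C)%C :> R[i].
Proof. exact: (rmorphD (@real_complex_def R (Phant R))). Qed.
Lemma rcN (a : R) : ((- a)%:C)%C = - (a%:C)%C :> R[i].
Proof. exact: (rmorphN (@real_complex_def R (Phant R))). Qed.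
Lemma rcB (a b : R) : ((a - b)%:C)%C = (a%:C)%C - (b%:C)%C :> R[i].
Proof. by rewrite rcD rcN. Qed.
Lemma rcV (a : R) : ((a^-1)%:C)%C = (a%:C)%C^-1 :> R[i].
Proof. exact: (fmorphV (@real_complex_def R (Phant R))). Qed.
Lemma rc_eq0 (a : R) : (((a%:C)%C : R[i]) == 0) = (a == 0).
Proof. exact: (fmorph_eq0 (@real_complex_def R (Phant R))). Qed.

Lemma cisD (s t : R) : cis (s + t) = cis s * cis t.
Proof.
apply: eqcP; rewrite /cis /= ?cosD ?sinD//.
by rewrite addrC.
Qed.
Lemma cis0 : cis (0 : R) = 1.
Proof. by apply: eqcP; rewrite /cis/= ?cos0 ?sin0. Qed.
Lemma normc_cis (t : R) : normc (cis t) = 1.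
Proof. by rewrite /cis /normc cos2Dsin2 sqrtr1. Qed.
Lemma conj_cis (t : R) : ((cis t)^*)%C = cis (- t).
Proof. by rewrite /cis/= cosN sinN. Qed.

(** Rotating an integral onto the positive axis in this way reduces the triangle inequality
    [cint_le] to the monotonicity of real integrals. *)
Lemma polar z : exists t : R[i], normc t = 1 /\ t * z = ((normc z)%:C)%C.
Proof.
have [->|z0] := eqVneq z 0; first by exists 1; rewrite normc1 mulr0 normc0.
have nz0 : normc z != 0 by rewrite gt_eqF// normc_gt0.
exists (((normc z)^-1)%:C * (z^*))%C; split.
  by rewrite normcM normc_real normc_conj ger0_norm ?invr_ge0 ?normc_ge0// mulVf.
rewrite -mulrA (mulrC (z^*)%C) mul_conj.
apply: eqcP => /=; last by ring.
by rewrite mulr0 subr0 expr2 mulrA mulVf// mul1r.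
Qed.

End complex_numbers.

(** * Measurable complex functions *)

Section cfun.
Context d (T : measurableType d) (R : realType).
Implicit Types f g : T -> R[i].

Definition mc f := measurable_fun setT (fun x => complex.Re (f x)) /\
  measurable_fun setT (fun x => complex.Im (f x)).

Lemma mc_real (h : T -> R) : measurable_fun setT h -> mc (fun x => ((h x)%:C)%C).
Proof. by move=> mh; split => /=. Qed.
Lemma mc_cst (c : R[i]) : mc (fun=> c).
Proof. by split => /=. Qed.
Lemma mcD f g : mc f -> mc g -> mc (fun x => f x + g x).
Proof.
move=> [f1 f2] [g1 g2]; split.
  by under eq_fun do rewrite cReD; exact: measurable_funD.
by under eq_fun do rewrite cImD; exact: measurable_funD.
Qed.
Lemma mcN f : mc f -> mc (fun x => - f x).
Proof.
move=> [f1 f2]; split.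
  by under eq_fun do rewrite cReN; exact: measurableT_comp.
by under eq_fun do rewrite cImN; exact: measurableT_comp.
Qed.
Lemma mcB f g : mc f -> mc g -> mc (fun x => f x - g x).
Proof. by move=> mf mg; apply: mcD => //; exact: mcN. Qed.
Lemma mcM f g : mc f -> mc g -> mc (fun x => f x * g x).
Proof.
move=> [f1 f2] [g1 g2]; split.
  by under eq_fun do rewrite cReM; apply: measurable_funB; exact: measurable_funM.
by under eq_fun do rewrite cImM; apply: measurable_funD; exact: measurable_funM.
Qed.
Lemma mc_conj f : mc f -> mc (fun x => (f x)^*%C).
Proof.
move=> [f1 f2]; split.
  by under eq_fun do rewrite cReJ.
by under eq_fun do rewrite cImJ; exact: measurableT_comp.
Qed.
Lemma mc_sum (I : Type) (r : seq I) (P : pred I) (F : I -> T -> R[i]) :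
  (forall i, mc (F i)) -> mc (fun x => \sum_(i <- r | P i) F i x).
Proof.
move=> mF; elim: r => [|i r IH].
  by under eq_fun do rewrite big_nil; exact: mc_cst.
under eq_fun do rewrite big_cons; case: (P i) => //; exact: mcD.
Qed.
Lemma mcX f n : mc f -> mc (fun x => f x ^+ n).
Proof.
move=> mf; elim: n => [|n IH].
  by under eq_fun do rewrite expr0; exact: mc_cst.
by under eq_fun do rewrite exprS; exact: mcM.
Qed.
Lemma mc_cis (h : T -> R) : measurable_fun setT h -> mc (fun x => cis (h x)).
Proof.
move=> mh; split => /=.
  apply: measurableT_comp => //.
  by apply: continuous_measurable_fun; exact: continuous_cos.
apply: measurableT_comp => //.
by apply: continuous_measurable_fun; exact: continuous_sin.
Qed.
Lemma mc_normc f : mc f -> measurable_fun setT (fun x => normc (f x)).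
Proof.
move=> [f1 f2]; under eq_fun do rewrite normcE'.
apply: measurableT_comp => //.
  by apply: continuous_measurable_fun; exact: sqrt_continuous.
by apply: measurable_funD; exact: measurable_funX.
Qed.

End cfun.

Lemma mc_comp d1 d2 (T1 : measurableType d1) (T2 : measurableType d2) (R : realType)
  (f : T2 -> R[i]) (phi : T1 -> T2) : measurable_fun setT phi ->
  mc f -> mc (fun x => f (phi x)).
Proof.
by move=> mp [f1 f2]; split;
  [exact: (measurableT_comp f1 mp)|exact: (measurableT_comp f2 mp)].
Qed.

Lemma mc_if d1 (T1 : measurableType d1) (R : realType) (A : set T1)
  (f : T1 -> R[i]) : measurable A -> mc f -> mc (fun x => f x * ((\1_A x : R)%:C)%C).
Proof. by move=> mA mf; apply: mcM => //; apply: mc_real. Qed.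

(** * Real integrable functions *)

Section real_integrable.
Context d (T : measurableType d) (R : realType) (mu : {measure set T -> \bar R}).
Implicit Types f g : T -> R.
Local Notation rint f := (mu.-integrable setT (EFin \o f)).

Lemma rint_meas f : rint f -> measurable_fun setT f.
Proof. by move=> /integrableP[/measurable_EFinP]. Qed.
Lemma rintD f g : rint f -> rint g -> rint (fun x => f x + g x).
Proof. by move=> fi gi; have := integrableD measurableT fi gi; apply. Qed.
Lemma rintZ (c : R) f : rint f -> rint (fun x => c * f x).
Proof. by move=> fi; have := integrableZl measurableT c fi; apply. Qed.
Lemma rint_norm f : rint f -> rint (fun x => `|f x|).
Proof. by move=> fi; have := integrable_norm fi; apply. Qed.
Lemma rintN f : rint f -> rint (fun x => - f x).
Proof. by move=> /(rintZ (-1)); under eq_fun do rewrite mulN1r. Qed.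
Lemma rintB f g : rint f -> rint g -> rint (fun x => f x - g x).
Proof. by move=> fi gi; apply: rintD => //; exact: rintN. Qed.
Lemma rint_le f g : measurable_fun setT f -> (forall x, `|f x| <= g x) ->
  rint g -> rint f.
Proof.
move=> mf fg gi; apply: (le_integrable measurableT _ _ gi).
  exact/measurable_EFinP.
by move=> x _ /=; rewrite lee_fin (le_trans (fg x))// ler_norm.
Qed.
Lemma rint_fin f : measurable_fun setT f -> (forall x, 0 <= f x) ->
  (\int[mu]_x (f x)%:E < +oo)%E -> rint f.
Proof.
move=> mf f0 fi; apply/integrableP; split; first exact/measurable_EFinP.
by rewrite (eq_integral (fun x => (f x)%:E))// => x _; rewrite gee0_abs// lee_fin.
Qed.
Lemma rint_lty f : rint f -> (forall x, 0 <= f x) -> (\int[mu]_x (f x)%:E < +oo)%E.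
Proof.
move=> /integrableP[_ fi] f0.
by rewrite (eq_integral (fun x => `|(EFin \o f) x|%E))// => x _; rewrite gee0_abs// lee_fin.
Qed.

End real_integrable.

(** * The complex integral and the classes L^1 and L^2 *)

Section cint.
Context d (T : measurableType d) (R : realType) (mu : {measure set T -> \bar R}).
Implicit Types f g : T -> R[i].

(** [cintegral] for an arbitrary measure. On Lebesgue measure the two are convertible, so [fourier]
    and [L2dot] fall under this calculus. *)
Definition cint f : R[i] :=
  ((\int[mu]_x complex.Re (f x)) +i* (\int[mu]_x complex.Im (f x)))%C.

Definition L1n f : \bar R := (\int[mu]_x (normc (f x))%:E)%E.
(** The square of the L^2 norm; working with it keeps roots out of the integration theory. *)
Definition L2n f : \bar R := (\int[mu]_x (normc (f x) ^+ 2)%:E)%E.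
Definition L1c f := mc f /\ (L1n f < +oo)%E.
Definition L2c f := mc f /\ (L2n f < +oo)%E.

Lemma L1n_ge0 f : (0 <= L1n f)%E.
Proof. by apply: integral_ge0 => x _; rewrite lee_fin normc_ge0. Qed.
Lemma L2n_ge0 f : (0 <= L2n f)%E.
Proof. by apply: integral_ge0 => x _; rewrite lee_fin exprn_ge0// normc_ge0. Qed.

Lemma L1n_fin f : L1c f -> L1n f \is a fin_num.
Proof. by move=> [_ f1]; rewrite ge0_fin_numE ?L1n_ge0. Qed.
Lemma L2n_fin f : L2c f -> L2n f \is a fin_num.
Proof. by move=> [_ f1]; rewrite ge0_fin_numE ?L2n_ge0. Qed.

Lemma L1c_int f : L1c f -> mu.-integrable setT (fun x => (normc (f x))%:E).
Proof.
move=> [mf f1]; apply/integrableP; split.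
  by apply/measurable_EFinP; exact: mc_normc.
rewrite (eq_integral (fun x => (normc (f x))%:E))// => x _.
by rewrite gee0_abs// lee_fin normc_ge0.
Qed.
Lemma L1c_dom f (h : T -> R) : mc f -> mu.-integrable setT (EFin \o h) ->
  (forall x, normc (f x) <= h x) -> L1c f.
Proof.
move=> mf ih fh; split => //; apply: rint_lty => [|x]; last exact: normc_ge0.
apply: rint_le ih => [|x]; first exact: mc_normc.
by rewrite ger0_norm ?normc_ge0.
Qed.
Lemma L1c_Re f : L1c f -> mu.-integrable setT (EFin \o (fun x => complex.Re (f x))).
Proof.
move=> f1; apply: rint_le (L1c_int f1) => [|x]; first by case: f1 => [] [].
exact: Re_le_normc.
Qed.
Lemma L1c_Im f : L1c f -> mu.-integrable setT (EFin \o (fun x => complex.Im (f x))).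
Proof.
move=> f1; apply: rint_le (L1c_int f1) => [|x]; first by case: f1 => [] [].
exact: Im_le_normc.
Qed.
Lemma L1cP f : mu.-integrable setT (EFin \o (fun x => complex.Re (f x))) ->
  mu.-integrable setT (EFin \o (fun x => complex.Im (f x))) -> L1c f.
Proof.
move=> iR iI.
have mf : mc f by split; [exact: (rint_meas iR)|exact: (rint_meas iI)].
apply: (@L1c_dom f (fun x => `|complex.Re (f x)| + `|complex.Im (f x)|)) => //.
  by apply: rintD; exact: rint_norm.
by move=> x; exact: normc_le_ReIm.
Qed.

Lemma L1cD f g : L1c f -> L1c g -> L1c (fun x => f x + g x).
Proof.
move=> f1 g1; apply: (@L1c_dom _ (fun x => normc (f x) + normc (g x))).
- by apply: mcD; [case: f1|case: g1].
- by apply: rintD; exact: L1c_int.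
- by move=> x; exact: normcD_le.
Qed.
Lemma L1cZ c f : L1c f -> L1c (fun x => c * f x).
Proof.
move=> f1; apply: (@L1c_dom _ (fun x => normc c * normc (f x))).
- by apply: mcM; [exact: mc_cst|case: f1].
- by apply: rintZ; exact: L1c_int.
- by move=> x; rewrite normcM.
Qed.
Lemma L1cN f : L1c f -> L1c (fun x => - f x).
Proof.
by move=> /(L1cZ (-1)); rewrite (_ : (fun x => -1 * f x) = fun x => - f x)//;
  apply/funext => x; rewrite mulN1r.
Qed.
Lemma L1cB f g : L1c f -> L1c g -> L1c (fun x => f x - g x).
Proof. by move=> f1 g1; apply: L1cD => //; exact: L1cN. Qed.
Lemma L1c_bound f g (M : R) : L1c f -> mc g -> (forall x, normc (g x) <= M) ->
  L1c (fun x => f x * g x).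
Proof.
move=> f1 mg gM; apply: (@L1c_dom _ (fun x => M * normc (f x))).
- by apply: mcM => //; case: f1.
- by apply: rintZ; exact: L1c_int.
- by move=> x; rewrite normcM mulrC ler_wpM2r// normc_ge0.
Qed.
Lemma L1c_conj f : L1c f -> L1c (fun x => (f x)^*%C).
Proof.
move=> f1; apply: (@L1c_dom _ (fun x => normc (f x))).
- by apply: mc_conj; case: f1.
- exact: L1c_int.
- by move=> x; rewrite normc_conj.
Qed.
Lemma L1c0 : L1c (fun=> 0).
Proof.
split; first exact: mc_cst.
by rewrite /L1n normc0 integral0.
Qed.

Lemma L1c_sum (I : Type) (r : seq I) (P : pred I) (F : I -> T -> R[i]) :
  (forall i, L1c (F i)) -> L1c (fun x => \sum_(i <- r | P i) F i x).
Proof.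
move=> mF; elim: r => [|i r IH].
  by under eq_fun do rewrite big_nil; exact: L1c0.
under eq_fun do rewrite big_cons; case: (P i) => //; exact: L1cD.
Qed.

Lemma cintD f g : L1c f -> L1c g ->
  cint (fun x => f x + g x) = cint f + cint g.
Proof.
move=> f1 g1; apply: eqcP => /=.
  under eq_Rintegral do rewrite cReD.
  by rewrite RintegralD//; exact: L1c_Re.
under eq_Rintegral do rewrite cImD.
by rewrite RintegralD//; exact: L1c_Im.
Qed.
Lemma cintZ c f : L1c f -> cint (fun x => c * f x) = c * cint f.
Proof.
move=> f1; apply: eqcP => /=.
  under eq_Rintegral do rewrite cReM.
  rewrite RintegralB//; last 2 first.
  - by apply: rintZ; exact: L1c_Re.
  - by apply: rintZ; exact: L1c_Im.
  rewrite !RintegralZl//; [|exact: L1c_Im|exact: L1c_Re].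
  by case: c.
under eq_Rintegral do rewrite cImM.
rewrite RintegralD//; last 2 first.
- by apply: rintZ; exact: L1c_Im.
- by apply: rintZ; exact: L1c_Re.
rewrite !RintegralZl//; [|exact: L1c_Re|exact: L1c_Im].
by case: c.
Qed.
Lemma cintZr c f : L1c f -> cint (fun x => f x * c) = cint f * c.
Proof.
move=> f1; rewrite mulrC -cintZ//; congr cint.
by apply/funext => x; rewrite mulrC.
Qed.
Lemma cintN f : L1c f -> cint (fun x => - f x) = - cint f.
Proof.
move=> f1; rewrite -mulN1r -cintZ//; congr cint.
by apply/funext => x; rewrite mulN1r.
Qed.
Lemma cintB f g : L1c f -> L1c g ->
  cint (fun x => f x - g x) = cint f - cint g.
Proof. by move=> f1 g1; rewrite cintD ?cintN//; exact: L1cN. Qed.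
Lemma cint_conj f : L1c f -> cint (fun x => (f x)^*%C) = (cint f)^*%C.
Proof.
move=> f1; apply: eqcP => /=.
  by under eq_Rintegral do rewrite cReJ.
under eq_Rintegral do rewrite cImJ -mulN1r.
by rewrite RintegralZl ?mulN1r//; exact: L1c_Im.
Qed.
Lemma cint0 : cint (fun=> 0) = 0.
Proof. by apply: eqcP => /=; rewrite /Rintegral integral0. Qed.
Lemma cint_sum (I : Type) (r : seq I) (P : pred I) (F : I -> T -> R[i]) :
  (forall i, L1c (F i)) ->
  cint (fun x => \sum_(i <- r | P i) F i x) = \sum_(i <- r | P i) cint (F i).
Proof.
move=> mF; elim: r => [|i r IH].
  by under eq_fun do rewrite big_nil; rewrite cint0 big_nil.
under eq_fun do rewrite big_cons; rewrite big_cons; case: (P i) => //.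
by rewrite cintD ?IH//; exact: L1c_sum.
Qed.
Lemma cint_real (h : T -> R) : cint (fun x => ((h x)%:C)%C) = ((\int[mu]_x h x)%:C)%C.
Proof. by apply: eqcP => //=; rewrite /Rintegral integral0. Qed.

Lemma cint_le f : L1c f -> normc (cint f) <= fine (L1n f).
Proof.
move=> f1; have [t [t1 tE]] := polar (cint f).
have -> : normc (cint f) = complex.Re (cint (fun x => t * f x)).
  by rewrite cintZ// tE.
rewrite /= /L1n; apply: le_Rintegral => //.
- by apply: L1c_Re; exact: L1cZ.
- exact: L1c_int.
- move=> x _; rewrite (le_trans (ler_norm _))// (le_trans (Re_le_normc _))//.
  by rewrite normcM t1 mul1r.
Qed.

Lemma eq_cint f g : f =1 g -> cint f = cint g.
Proof. by move=> /funext ->. Qed.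

Lemma ae_eq_cint f g : mc f -> mc g -> {ae mu, forall x, f x = g x} ->
  cint f = cint g.
Proof.
move=> [f1 f2] [g1 g2] fg; apply: eqcP => /=; congr fine.
  apply: ae_eq_integral => //; try exact/measurable_EFinP.
  by apply: filterS fg => x ->.
apply: ae_eq_integral => //; try exact/measurable_EFinP.
by apply: filterS fg => x ->.
Qed.

End cint.

(** * Hilbert spaces and the singular value decomposition *)

Section complex_convergence.
Context (R : realType) (T : Type) (F : set_system T) {FF : ProperFilter F}.
Implicit Types z w : T -> R[i].

(** The filter is left arbitrary because weak limits are taken along ultrafilters, all other limits
    along [\oo]. *)
Definition ccvg z (l : R[i]) := normc (z k - l) @[k --> F] --> (0 : R).

Lemma norm0_cvg (f g : T -> R) : (forall k, 0 <= f k <= g k) ->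
  g k @[k --> F] --> (0 : R) -> f k @[k --> F] --> (0 : R).
Proof.
move=> fg g0; apply: (@squeeze_cvgr _ _ _ _ (fun=> 0) g) => //; last exact: cvg_cst.
by apply: nearW => k; exact: fg.
Qed.
Lemma cvgD0 (f g : T -> R) : f k @[k --> F] --> (0 : R) ->
  g k @[k --> F] --> (0 : R) -> f k + g k @[k --> F] --> (0 : R).
Proof. by move=> f0 g0; rewrite -(addr0 0); exact: cvgD. Qed.
Lemma cvgZ0 (c : R) (f : T -> R) : f k @[k --> F] --> (0 : R) ->
  c * f k @[k --> F] --> (0 : R).
Proof. by move=> f0; rewrite -(mulr0 c); apply: cvgM => //; exact: cvg_cst. Qed.

Lemma cvg_dist0 (f : T -> R) (a : R) :
  `|f k - a| @[k --> F] --> (0 : R) -> f k @[k --> F] --> a.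
Proof.
move=> h; apply/cvgrPdist_lt => e e0; move/cvgrPdist_lt : h => /(_ _ e0).
by apply: filterS => k /=; rewrite sub0r normrN normr_id distrC.
Qed.
Lemma dist0_cvg (f : T -> R) (a : R) :
  f k @[k --> F] --> a -> `|f k - a| @[k --> F] --> (0 : R).
Proof.
move=> h; apply/cvgrPdist_lt => e e0; move/cvgrPdist_lt : h => /(_ _ e0).
by apply: filterS => k /=; rewrite sub0r normrN normr_id distrC.
Qed.

Lemma ccvg_cst c : ccvg (fun=> c) c.
Proof. by rewrite /ccvg subrr normc0; exact: cvg_cst. Qed.
Lemma ccvgD z w a b : ccvg z a -> ccvg w b -> ccvg (fun k => z k + w k) (a + b).
Proof.
move=> za wb; apply: norm0_cvg (cvgD0 za wb) => k.
rewrite normc_ge0/= (_ : _ - _ = (z k - a) + (w k - b)); first exact: normcD_le.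
by rewrite opprD addrACA.
Qed.
Lemma ccvgZ c z a : ccvg z a -> ccvg (fun k => c * z k) (c * a).
Proof.
move=> za; apply: norm0_cvg (cvgZ0 (normc c) za) => k.
by rewrite normc_ge0/= -mulrBr normcM.
Qed.
Lemma ccvgM z w a b : ccvg z a -> ccvg w b ->
  ccvg (fun k => z k * w k) (a * b).
Proof.
move=> za wb; have zw : normc (z k - a) * normc (w k - b) @[k --> F] --> (0 : R).
  by rewrite -(mulr0 0); exact: cvgM.
apply: norm0_cvg (cvgD0 zw (cvgD0 (cvgZ0 (normc a) wb) (cvgZ0 (normc b) za))) => k.
rewrite normc_ge0/= -!normcM.
rewrite (_ : _ - _ = (z k - a) * (w k - b) + (a * (w k - b) + b * (z k - a))); last by ring.
by rewrite (le_trans (normcD_le _ _))// lerD2l normcD_le.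
Qed.
Lemma ccvgB z w a b : ccvg z a -> ccvg w b -> ccvg (fun k => z k - w k) (a - b).
Proof.
move=> za wb; apply: ccvgD => //.
by rewrite -mulN1r; under eq_fun do rewrite -mulN1r; exact: ccvgZ.
Qed.
Lemma ccvg_normc z a : ccvg z a -> normc (z k) @[k --> F] --> normc a.
Proof.
move=> za; apply: cvg_dist0; apply: norm0_cvg za => k.
rewrite normr_ge0/= ler_norml; apply/andP; split.
  rewrite lerNl opprB lerBlDr.
  by rewrite -(normcN (z k - a)) opprB (le_trans _ (normcD_le _ _))// subrK.
by rewrite lerBlDr (le_trans _ (normcD_le _ _))// subrK.
Qed.
Lemma ccvg_Re z a : ccvg z a -> complex.Re (z k) @[k --> F] --> complex.Re a.
Proof.
move=> za; apply: cvg_dist0; apply: norm0_cvg za => k.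
by rewrite normr_ge0/= -cReB (le_trans (Re_le_normc _)).
Qed.
Lemma ccvg_Im z a : ccvg z a -> complex.Im (z k) @[k --> F] --> complex.Im a.
Proof.
move=> za; apply: cvg_dist0; apply: norm0_cvg za => k.
by rewrite normr_ge0/= -cImB (le_trans (Im_le_normc _)).
Qed.
Lemma ccvgP z (a b : R) : complex.Re (z k) @[k --> F] --> a ->
  complex.Im (z k) @[k --> F] --> b -> ccvg z (a +i* b)%C.
Proof.
move=> /dist0_cvg za /dist0_cvg zb; apply: norm0_cvg (cvgD0 za zb) => k.
rewrite normc_ge0/= (le_trans (normc_le_ReIm _))//.
by rewrite cReB cImB.
Qed.
Lemma ccvg_uniq z a b : ccvg z a -> ccvg z b -> a = b.
Proof.
move=> za zb; apply: eqcP.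
  by apply: (cvg_unique _ (ccvg_Re za) (ccvg_Re zb)); exact: norm_hausdorff.
by apply: (cvg_unique _ (ccvg_Im za) (ccvg_Im zb)); exact: norm_hausdorff.
Qed.
Lemma ccvg_ext z w a : z =1 w -> ccvg z a -> ccvg w a.
Proof. by move=> /funext ->. Qed.
(** An epsilon / 3 argument: the approximation is uniform in [k], so the two limits may be
    exchanged. *)
Lemma ccvg_approx z a (e : nat -> R) : e k @[k --> \oo] --> (0 : R) ->
  (forall m, exists zm am, [/\ ccvg zm am, normc (am - a) <= e m &
     forall k, normc (z k - zm k) <= e m]) -> ccvg z a.
Proof.
move=> e0 H; apply/cvgrPdist_lt => eps eps0.
have e30 : 0 < eps / 3 by rewrite divr_gt0.
have [m _ em] : \forall k \near \oo, e k < eps / 3.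
  exact: (cvgr_lt 0).
have [zm [am [zam ama zzm]]] := H m.
have {}em := em m (leqnn _).
move/cvgrPdist_lt : zam => /(_ _ e30); apply: filterS => k /=.
rewrite !sub0r !normrN !ger0_norm ?normc_ge0// => zk.
rewrite (_ : z k - a = (z k - zm k) + ((zm k - am) + (am - a))); last first.
  by ring.
have h1 := normcD_le (z k - zm k) ((zm k - am) + (am - a)).
have h2 := normcD_le (zm k - am) (am - a).
have h3 := zzm k.
lra.
Qed.

End complex_convergence.

(** A complete space for a semi-definite inner product: [ip x x = 0] does not force [x = hz], so
    that L^2 can be modelled by functions instead of classes. Algebraic identities between vectors
    are only read through [ip], and equality of vectors becomes [n2 (hsub x y) = 0]. *)
Record preHilb (R : realType) := PreHilb {
  car :> Type;
  hz : car;
  hadd : car -> car -> car;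
  hscl : R[i] -> car -> car;
  ip : car -> car -> R[i];
  ip0l : forall x, ip hz x = 0;
  ipDl : forall x y z, ip (hadd x y) z = ip x z + ip y z;
  ipZl : forall a x y, ip (hscl a x) y = a * ip x y;
  ipJ : forall x y, ip y x = ((ip x y)^*)%C;
  ip_ge0 : forall x, 0 <= complex.Re (ip x x);
  hcomplete : forall u : nat -> car,
    (forall e : R, 0 < e -> exists N, forall m n, (N <= m)%N -> (N <= n)%N ->
      complex.Re (ip (hadd (u m) (hscl (-1) (u n)))
                     (hadd (u m) (hscl (-1) (u n)))) < e) ->
    exists x, complex.Re (ip (hadd (u n) (hscl (-1) x))
                     (hadd (u n) (hscl (-1) x))) @[n --> \oo] --> (0 : R) }.

Arguments hz {R p}.
Arguments hadd {R p}.
Arguments hscl {R p}.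
Arguments ip {R p}.

Definition hsub (R : realType) (H : preHilb R) (x y : H) : H := hadd x (hscl (-1) y).
Definition n2 (R : realType) (H : preHilb R) (x : H) : R := complex.Re (ip x x).

(** * Cauchy-Schwarz, projections and the Riesz representation *)

Section hilbert_basics.
Context (R : realType) (H : preHilb R).
Implicit Types x y z : H.

Lemma ipDr x y z : ip z (hadd x y) = ip z x + ip z y.
Proof. by rewrite ipJ ipDl conjcD -!ipJ. Qed.
Lemma ipZr a x y : ip y (hscl a x) = (a^*)%C * ip y x.
Proof. by rewrite ipJ ipZl conjcM -ipJ. Qed.
Lemma ip0r x : ip x hz = 0.
Proof. by rewrite ipJ ip0l conjc0. Qed.
Lemma ipBl x y z : ip (hsub x y) z = ip x z - ip y z.
Proof. by rewrite ipDl ipZl mulN1r. Qed.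
Lemma ipBr x y z : ip z (hsub x y) = ip z x - ip z y.
Proof. by rewrite ipJ ipBl conjcB -!ipJ. Qed.
Lemma n2_ge0 x : 0 <= n2 x. Proof. exact: ip_ge0. Qed.
Lemma ipE x : ip x x = ((n2 x)%:C)%C.
Proof.
rewrite /n2; have := ipJ x x; case: (ip x x) => a b /= [] /eqP.
rewrite -addr_eq0 -mulr2n mulrn_eq0/= => /eqP ->.
by apply: eqcP.
Qed.
Lemma n2Z a x : n2 (hscl a x) = normc a ^+ 2 * n2 x.
Proof. by rewrite {1}/n2 ipZl ipZr ipE mulrA mul_conj -rcM. Qed.
Lemma n20 : n2 (hz : H) = 0. Proof. by rewrite /n2 ip0l. Qed.
Lemma n2D x y : n2 (hadd x y) = n2 x + n2 y + 2 * complex.Re (ip x y).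
Proof.
rewrite /n2 ipDl !ipDr !cReD (ipJ x y) cReJ; ring.
Qed.
Lemma n2B x y : n2 (hsub x y) = n2 x + n2 y - 2 * complex.Re (ip x y).
Proof.
rewrite {1}/n2 ipBl !ipBr !cReB (ipJ x y) cReJ /n2; ring.
Qed.
Lemma n2BC x y : n2 (hsub x y) = n2 (hsub y x).
Proof. by rewrite !n2B (ipJ x y) cReJ (addrC (n2 x)). Qed.

Lemma cauchy_schwarz x y : normc (ip x y) ^+ 2 <= n2 x * n2 y.
Proof.
pose c := ip x y.
have key (t : R) : 0 <= n2 x - 2 * t * normc c ^+ 2 + t ^+ 2 * normc c ^+ 2 * n2 y.
  have := n2_ge0 (hsub x (hscl (t%:C%C * c) y)).
  rewrite n2B n2Z ipZr conjcM -mulrA (mulrC (c^*)%C) mul_conj conjc_real.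
  rewrite -rcM /= normcM normc_real exprMn real_normK ?num_real//.
  by rewrite addrAC !mulrA.
have [y0|y0] := eqVneq (n2 y) 0.
  rewrite y0 mulr0; apply/negP => /negP; rewrite -ltNge => c0.
  (* With [n2 y = 0] the lower bound is affine in [t]; this [t] gives it the value -1. *)
  have := key ((n2 x + 1) / (2 * normc c ^+ 2)); rewrite y0 mulr0 addr0.
  have -> : 2 * ((n2 x + 1) / (2 * normc c ^+ 2)) * normc c ^+ 2 = n2 x + 1.
    by field; move: c0; rewrite -/c lt_neqAle eq_sym sqrf_eq0 => /andP[].
  by lra.
have yp : 0 < n2 y by rewrite lt_neqAle eq_sym y0 n2_ge0.
have := key (n2 y)^-1; rewrite -/c.
rewrite (_ : _ + _ = n2 x - normc c ^+ 2 / n2 y); last by field.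
by rewrite subr_ge0 ler_pdivrMr.
Qed.

Lemma ip_null x y : n2 y = 0 -> ip x y = 0.
Proof.
move=> y0; have := cauchy_schwarz x y; rewrite y0 mulr0 => h.
apply/eq0_normc/eqP; rewrite -sqrf_eq0 eq_le h; exact: exprn_ge0 (normc_ge0 _).
Qed.
Lemma ip_nulll x y : n2 x = 0 -> ip x y = 0.
Proof. by move=> x0; rewrite ipJ ip_null// conjc0. Qed.

(** Together with [ip_eql] this replaces rewriting along an equality of vectors. *)
Lemma n2_eq x y : n2 (hsub x y) = 0 -> n2 x = n2 y.
Proof.
move=> xy0; have h1 := ip_null x xy0; have h2 := ip_nulll y xy0.
move: h1 h2; rewrite ipBr ipBl => /eqP; rewrite subr_eq0 => /eqP h1 /eqP.
by rewrite subr_eq0 => /eqP h2; rewrite /n2 h1 h2.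
Qed.
Lemma ip_eql x y z : n2 (hsub x y) = 0 -> ip x z = ip y z.
Proof.
by move=> /ip_nulll => /(_ z); rewrite ipBl => /eqP; rewrite subr_eq0 => /eqP.
Qed.

Definition hcvg (u : nat -> H) x := n2 (hsub (u k) x) @[k --> \oo] --> (0 : R).

Lemma cvg_sqrt0 (u : nat -> R) : u k @[k --> \oo] --> (0 : R) ->
  Num.sqrt (u k) @[k --> \oo] --> (0 : R).
Proof.
move=> u0; rewrite -sqrtr0.
exact: (continuous_cvg _ (@sqrt_continuous R 0) u0).
Qed.

Lemma ip_le x y : normc (ip x y) <= Num.sqrt (n2 x) * Num.sqrt (n2 y).
Proof.
rewrite -sqrtrM ?n2_ge0// -(ler_pXn2r (n:=2))// ?nnegrE ?normc_ge0 ?sqrtr_ge0//.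
by rewrite sqr_sqrtr ?mulr_ge0 ?n2_ge0// cauchy_schwarz.
Qed.

Lemma hcvg_ip u x y : hcvg u x -> ccvg \oo (fun k => ip (u k) y) (ip x y).
Proof.
move=> /cvg_sqrt0 /(cvgZ0 (Num.sqrt (n2 y))) h; apply: norm0_cvg h => k.
by rewrite normc_ge0/= -ipBl mulrC ip_le.
Qed.
Lemma hcvg_n2 u x : hcvg u x -> n2 (u k) @[k --> \oo] --> n2 x.
Proof.
move=> ux; have /ccvg_Re h := hcvg_ip x ux.
rewrite (_ : (fun k => n2 (u k)) = fun k => n2 (hsub (u k) x) - n2 x + 2 * complex.Re (ip (u k) x)).
  rewrite [X in _ --> X](_ : _ = 0 - n2 x + 2 * n2 x); last by ring.
  apply: cvgD; last by apply: cvgM => //; exact: cvg_cst.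
  by apply: cvgB => //; exact: cvg_cst.
by apply/funext => k; rewrite n2B; ring.
Qed.

Definition hsubspace (S : H -> Prop) := [/\ S hz, (forall x y, S x -> S y -> S (hadd x y)) &
  forall a x, S x -> S (hscl a x)].

(** [S] may fail to be closed, so the nearest point can lie outside it. What is kept is a minimising
    sequence [s] in [S] and the limit [phi] of [hadd x (s k)], the component of [x] orthogonal to
    [S]. *)
Lemma projection (S : H -> Prop) x : hsubspace S -> exists phi (s : nat -> H),
  [/\ forall k, S (s k), hcvg (fun k => hadd x (s k)) phi &
   forall y, S y -> ip phi y = 0].
Proof.
move=> [S0 SD SZ].
pose A := [set n2 (hadd x s) | s in S].
have A0 : A !=set0 by exists (n2 (hadd x hz)); exists hz.
have Alb : lbound A 0 by move=> _ [s _ <-]; exact: n2_ge0.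
have hA : has_inf A by split => //; exists 0.
pose d := inf A.
have dS s : S s -> d <= n2 (hadd x s).
  by move=> Ss; apply: ge_inf; [exists 0|exists s].
have ex k : exists s, S s /\ n2 (hadd x s) < d + k.+1%:R^-1.
  have [_ [s Ss <-] h] := @inf_adherent _ A (k.+1%:R^-1) (ltac:(by rewrite invr_gt0)) hA.
  by exists s.
pose s k := projT1 (cid (ex k)).
have Ss k : S (s k) by rewrite /s; case: cid => /= ? [].
have sd k : n2 (hadd x (s k)) < d + k.+1%:R^-1 by rewrite /s; case: cid => /= ? [].
(* Parallelogram law: the midpoint of [s k] and [s l] is in [S], so its value is at least the
   infimum [d], which forces the minimising sequence to be Cauchy. *)
have par k l : n2 (hsub (hadd x (s k)) (hadd x (s l))) <= 2 * k.+1%:R^-1 + 2 * l.+1%:R^-1.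
  have Sh : S (hscl (2^-1)%:C%C (hadd (s k) (s l))) by apply: SZ; exact: SD.
  have e : n2 (hadd (hadd x (s k)) (hadd x (s l))) = 4 * n2 (hadd x (hscl (2^-1)%:C%C (hadd (s k) (s l)))).
    have -> : 4 * n2 (hadd x (hscl (2^-1)%:C%C (hadd (s k) (s l)))) =
      n2 (hscl 2%:C%C (hadd x (hscl (2^-1)%:C%C (hadd (s k) (s l))))).
      by rewrite n2Z normc_real ger0_norm// -natrX.
    apply: n2_eq; set q := (2^-1)%:C%C.
    have q2 : 2%:C%C * q = 1 :> R[i] by rewrite /q -rcM divff.
    have qn z : ip (hsub (hadd (hadd x (s k)) (hadd x (s l)))
          (hscl 2%:C%C (hadd x (hscl q (hadd (s k) (s l)))))) z = 0.
      rewrite ipBl !ipDl ipZl ipDl ipZl ipDl mulrDr mulrA q2 mul1r.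
      rewrite (_ : 2%:C%C = 1 + 1 :> R[i]); last by rewrite -rcD.
      by ring.
    by rewrite /n2 qn.
  have h := dS _ Sh; have hk := sd k; have hl := sd l.
  move: e hk hl h; rewrite n2D n2B.
  move: (k.+1%:R^-1) (l.+1%:R^-1) => ak al e hk hl h; lra.
have [phi hphi] : exists phi, hcvg (fun k => hadd x (s k)) phi.
  apply: hcomplete => e e0.
  have e4 : 0 < e / 4 by rewrite divr_gt0.
  have [N _ hN] : \forall k \near \oo, k.+1%:R^-1 < e / 4 :> R.
    exact: near_infty_natSinv_lt (PosNum e4).
  exists N => m n Nm Nn; apply: le_lt_trans (par m n) _.
  have := hN m Nm; have := hN n Nn; rewrite /=.
  by move: (m.+1%:R^-1) (n.+1%:R^-1) => am an h1 h2; lra.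
exists phi, s; split => // y Sy.
have b k : normc (ip (hadd x (s k)) y) ^+ 2 <= (1 + n2 y) * k.+1%:R^-1.
  (* Moving the near-minimiser along [y] cannot gain more than [1 / (k + 1)]. Taking [1 + n2 y] in
     place of the optimal [n2 y] keeps [tau] meaningful when [y] is null. *)
  set c := ip _ y; pose tau := (1 + n2 y)^-1.
  have y1 : 0 < 1 + n2 y by rewrite ltr_pwDl// n2_ge0.
  have tau0 : 0 < tau by rewrite invr_gt0.
  have h : d <= n2 (hsub (hadd x (s k)) (hscl (tau%:C%C * c) y)).
    have Sy' : S (hadd (s k) (hscl (-1) (hscl (tau%:C%C * c) y))).
      by apply: SD => //; exact/SZ/SZ.
    apply: le_trans (dS _ Sy') _; rewrite le_eqVlt; apply/orP; left; apply/eqP.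
    apply: n2_eq; rewrite /n2; set v := hsub _ _.
    suff -> : ip v v = 0 by [].
    have qn z : ip v z = 0 by rewrite /v /hsub !(ipDl, ipZl); ring.
    exact: qn.
  move: h; rewrite n2B n2Z ipZr conjcM conjc_real -mulrA (mulrC (c^*)%C) -/c mul_conj.
  rewrite -rcM /= normcM normc_real exprMn real_normK ?num_real// => h.
  have hk := sd k.
  have h2 : normc c ^+ 2 * (2 * tau - tau ^+ 2 * n2 y) < k.+1%:R^-1.
    rewrite (_ : normc c ^+ 2 * _ = 2 * (tau * normc c ^+ 2) - tau ^+ 2 * normc c ^+ 2 * n2 y); last by ring.
    by move: hk; move: (k.+1%:R^-1) => ak hk; lra.
  have h3 : tau <= 2 * tau - tau ^+ 2 * n2 y.
    have : tau * (1 + n2 y) = 1 by rewrite /tau mulVf ?gt_eqF.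
    by nra.
  have h4 : normc c ^+ 2 * tau <= k.+1%:R^-1.
    by apply: le_trans (ltW h2); rewrite ler_wpM2l// exprn_ge0// normc_ge0.
  by rewrite mulrC -ler_pdivrMr.
have c0 : ccvg \oo (fun k => ip (hadd x (s k)) y) 0.
  rewrite /ccvg; under eq_fun do rewrite subr0.
  have h : (1 + n2 y) * k.+1%:R^-1 @[k --> \oo] --> (0 : R).
    by apply: cvgZ0; exact: cvg_harmonic.
  apply: norm0_cvg (cvg_sqrt0 h) => k; rewrite normc_ge0/=.
  have e : 0 <= (1 + n2 y) * k.+1%:R^-1 by rewrite mulr_ge0 ?invr_ge0// addr_ge0 ?n2_ge0.
  rewrite -(ler_pXn2r (n:=2))// ?nnegrE ?normc_ge0 ?sqrtr_ge0// sqr_sqrtr//.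
apply: (ccvg_uniq (hcvg_ip y hphi) c0).
Qed.

Lemma hsubspace_dense (S : H -> Prop) : hsubspace S ->
  (forall h, (forall y, S y -> ip h y = 0) -> n2 h = 0) ->
  forall K, exists s : nat -> H, (forall k, S (s k)) /\ hcvg s K.
Proof.
move=> ss dense K; have [phi [s [ts sphi ophi]]] := projection K ss.
exists (fun k => hscl (-1) (s k)); split; first by move=> k; case: ss => _ _; exact.
have := hcvg_n2 sphi; rewrite (dense _ ophi) /hcvg.
suff -> : (fun k => n2 (hadd K (s k))) = (fun k => n2 (hsub (hscl (-1) (s k)) K)) by [].
apply/funext => k; rewrite n2D n2B n2Z ipZl (ipJ K) normcN normc1.
by case: (ip K (s k)) => u v /=; ring.
Qed.

(** The representing vector is a multiple of [phi], the component of some [x] with [l x] non-zero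
    orthogonal to the kernel of [l]. Continuity of [l] gives [l phi = l x], since adding elements of
    the kernel to [x] does not change [l]. *)
Lemma riesz (l : H -> R[i]) (M : R) : (forall x y, l (hadd x y) = l x + l y) ->
  (forall a x, l (hscl a x) = a * l x) -> (forall x, normc (l x) <= M * Num.sqrt (n2 x)) ->
  exists a, forall x, l x = ip x a.
Proof.
move=> lD lZ lM.
have lB x y : l (hsub x y) = l x - l y by rewrite /hsub lD lZ mulN1r.
have l0 : l hz = 0.
  apply/eq0_normc/eqP; rewrite eq_le normc_ge0 andbT.
  by have := lM hz; rewrite n20 sqrtr0 mulr0.
have [ez|/existsNP[x lx]] := pselect (forall x, l x = 0).
  by exists hz => x; rewrite ez ip0r.
have sK : hsubspace (fun x => l x = 0).
  split => //; first by move=> y z y0 z0; rewrite lD y0 z0 addr0.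
  by move=> a y y0; rewrite lZ y0 mulr0.
have [phi [s [s0 sphi ophi]]] := projection x sK.
have lphi : l phi = l x.
  apply: (@ccvg_uniq _ _ \oo _ (fun=> l x) _ _ _ (ccvg_cst _)).
  apply: norm0_cvg (cvgZ0 M (cvg_sqrt0 sphi)) => k.
  by rewrite normc_ge0/= (_ : l x - l phi = l (hsub (hadd x (s k)) phi))// lB lD s0 addr0.
have nz : n2 phi != 0.
  apply/eqP => p0; apply: lx; rewrite -lphi; apply/eq0_normc/eqP.
  by rewrite eq_le normc_ge0 andbT; have := lM phi; rewrite p0 sqrtr0 mulr0.
have lp0 : l phi != 0 by rewrite lphi; apply/eqP.
exists (hscl ((l phi)^* / (n2 phi)%:C)%C phi) => v.
have := ophi (hsub v (hscl (l v / l phi) phi)).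
rewrite lB lZ divfK// subrr => /(_ erefl).
rewrite ipBr ipZr => /eqP; rewrite subr_eq0 => /eqP h.
have {}h : ip v phi = l v / l phi * (n2 phi)%:C%C.
  by rewrite ipJ h conjcM conjcK -ipJ ipE.
have nzc : (n2 phi)%:C%C != 0 :> R[i] by rewrite rc_eq0.
rewrite ipZr h conjcM conjcK conjc_inv conjc_real.
by field; rewrite nzc lp0.
Qed.

End hilbert_basics.

(** * Weak compactness along an ultrafilter *)

Section weak_limits.
Context (R : realType) (H : preHilb R).
Variable U : set_system nat.
Hypothesis UU : UltraFilter U.

Lemma ultra_bounded (r : nat -> R) (M : R) : (forall k, `|r k| <= M) ->
  exists l : R, r k @[k --> U] --> l.
Proof.
move=> rM; have := @segment_compact R (- M) M.
move=> /(_ (r @ U) _) [].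
  change (U (r @^-1` `[- M, M]%classic)); apply: filterE => k /=.
  by rewrite in_itv/= -ler_norml.
move=> l [_ h]; exists l => B lB.
have [//|nB] := in_ultra_setVsetC (r @^-1` B) UU.
by have [x []] := h (~` B) B nB lB.
Qed.

Lemma ultra_cbounded (z : nat -> R[i]) (M : R) : (forall k, normc (z k) <= M) ->
  exists l, ccvg U z l.
Proof.
move=> zM.
have [a ha] := @ultra_bounded (fun k => complex.Re (z k)) M
  (fun k => le_trans (Re_le_normc _) (zM k)).
have [b hb] := @ultra_bounded (fun k => complex.Im (z k)) M
  (fun k => le_trans (Im_le_normc _) (zM k)).
by exists (a +i* b)%C; exact: ccvgP.
Qed.

Lemma ccvg_normc_le (z : nat -> R[i]) l (M : R) : ccvg U z l ->
  (forall k, normc (z k) <= M) -> normc l <= M.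
Proof.
move=> /ccvg_normc zl zM; apply: (ler_cvg_to zl (cvg_cst M)).
by apply: nearW => k; exact: zM.
Qed.

(** The ultrafilter plays the role of a diagonal extraction: every bounded scalar sequence converges
    along it, and the limits form a bounded functional to which [riesz] applies. *)
Lemma weak_limit (a : nat -> H) : (forall k, n2 (a k) <= 1) ->
  exists b, n2 b <= 1 /\ forall v, ccvg U (fun k => ip v (a k)) (ip v b).
Proof.
move=> a1.
have av v k : normc (ip v (a k)) <= 1 * Num.sqrt (n2 v).
  rewrite (le_trans (ip_le _ _))// mulrC ler_wpM2r ?sqrtr_ge0//.
  by rewrite -(sqrtr1 R) ler_wsqrtr.
pose l v := projT1 (cid (ultra_cbounded (av v))).
have lv v : ccvg U (fun k => ip v (a k)) (l v) by rewrite /l; case: cid.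
have [b lb] : exists b, forall v, l v = ip v b.
  apply: (@riesz _ _ l 1).
  - move=> x y; apply: ccvg_uniq (lv _) _.
    by apply: ccvg_ext (ccvgD (lv x) (lv y)) => k; rewrite ipDl.
  - move=> c x; apply: ccvg_uniq (lv _) _.
    by apply: ccvg_ext (ccvgZ c (lv x)) => k; rewrite ipZl.
  - by move=> x; exact: ccvg_normc_le (lv x) (av x).
exists b; split; last by move=> v; rewrite -lb.
have h := ccvg_normc_le (lv b) (av b); rewrite lb ipE normc_real mul1r in h.
rewrite ger0_norm ?n2_ge0// in h.
have [b0|b0] := eqVneq (n2 b) 0; first by rewrite b0.
have sb : 0 < Num.sqrt (n2 b) by rewrite sqrtr_gt0 lt_neqAle eq_sym b0 n2_ge0.
have e := sqr_sqrtr (n2_ge0 b); move: h e sb; move: (Num.sqrt (n2 b)) => r h e r0.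
by rewrite (le_trans h)// -(ler_pM2l r0) mulr1 -expr2 e.
Qed.

End weak_limits.

(** * The singular value decomposition *)

Section svd.
Context (R : realType) (H1 H2 H : preHilb R).
(** The tensor product enters through two properties, the product formula for inner products and
    density. Bilinearity follows up to null vectors, as seen by [ip]. *)
Variable tens : H1 -> H2 -> H.
Hypothesis ip_tens : forall a b a' b', ip (tens a b) (tens a' b') = ip a a' * ip b b'.
Hypothesis dense : forall K, (forall a b, ip K (tens a b) = 0) -> n2 K = 0.
Implicit Types (K : H) (a : H1) (b : H2).

Lemma n2_tens a b : n2 (tens a b) = n2 a * n2 b.
Proof. by rewrite {1}/n2 ip_tens !ipE -rcM. Qed.

Lemma ip_tensDl K a a' b : ip K (tens (hadd a a') b) = ip K (tens a b) + ip K (tens a' b).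
Proof.
rewrite -ipDr ipJ [RHS]ipJ; congr (_^*)%C; apply: ip_eql.
rewrite n2B !n2D !n2_tens n2D /n2 ipDr !ip_tens !ipDl !ipE.
by rewrite (ipJ a a') /=; case: (ip a a') => u v /=; ring.
Qed.
Lemma ip_tensDr K a b b' : ip K (tens a (hadd b b')) = ip K (tens a b) + ip K (tens a b').
Proof.
rewrite -ipDr ipJ [RHS]ipJ; congr (_^*)%C; apply: ip_eql.
rewrite n2B !n2D !n2_tens n2D /n2 ipDr !ip_tens !ipDl !ipE.
by rewrite (ipJ b b') /=; case: (ip b b') => u v /=; ring.
Qed.
Lemma ip_tensZl K c a b : ip K (tens (hscl c a) b) = (c^*)%C * ip K (tens a b).
Proof.
rewrite -ipZr ipJ [RHS]ipJ; congr (_^*)%C; apply: ip_eql.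
rewrite n2B n2Z !n2_tens n2Z /n2 ipZr !ip_tens ipZl.
rewrite (_ : (c^*)%C * _ = c * (c^*)%C * ip a a * ip b b); last by ring.
by rewrite mul_conj !ipE -!rcM /=; ring.
Qed.
Lemma ip_tensZr K c a b : ip K (tens a (hscl c b)) = (c^*)%C * ip K (tens a b).
Proof.
rewrite -ipZr ipJ [RHS]ipJ; congr (_^*)%C; apply: ip_eql.
rewrite n2B n2Z !n2_tens n2Z /n2 ipZr !ip_tens ipZl.
rewrite (_ : (c^*)%C * _ = c * (c^*)%C * ip a a * ip b b); last by ring.
by rewrite mul_conj !ipE -!rcM /=; ring.
Qed.

Inductive tspan : H -> Prop :=
| tspan0 : tspan hz
| tspanT a b : tspan (tens a b)
| tspanD x y : tspan x -> tspan y -> tspan (hadd x y)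
| tspanZ c x : tspan x -> tspan (hscl c x).

Lemma tspan_approx K : exists s : nat -> H, (forall k, tspan (s k)) /\ hcvg s K.
Proof.
apply: hsubspace_dense => [|h hS]; first by split; [exact: tspan0|exact: tspanD|exact: tspanZ].
by apply: dense => a b; apply: hS; exact: tspanT.
Qed.

(** This is the compactness of Hilbert-Schmidt operators. For [K] in the span of the tensors the
    claim is the weak convergence of the factors; the approximation of a general [K] is uniform over
    pairs of norm at most 1. *)
Lemma weak_tens U (UU : UltraFilter U) (a : nat -> H1) (b : nat -> H2) a0 b0 K :
  (forall k, n2 (a k) <= 1) -> (forall k, n2 (b k) <= 1) ->
  n2 a0 <= 1 -> n2 b0 <= 1 ->
  (forall v, ccvg U (fun k => ip v (a k)) (ip v a0)) ->
  (forall v, ccvg U (fun k => ip v (b k)) (ip v b0)) ->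
  ccvg U (fun k => ip K (tens (a k) (b k))) (ip K (tens a0 b0)).
Proof.
move=> a1 b1 a01 b01 aa0 bb0.
have [s [ts sK]] := tspan_approx K.
have ts_cvg x : tspan x -> ccvg U (fun k => ip x (tens (a k) (b k))) (ip x (tens a0 b0)).
  elim => [|c d|y z _ IHy _ IHz|c y _ IH].
  - by rewrite ip0l; apply: ccvg_ext (ccvg_cst _) => k; rewrite ip0l.
  - rewrite ip_tens; apply: ccvg_ext (ccvgM (aa0 c) (bb0 d)) => k.
    by rewrite ip_tens.
  - by rewrite ipDl; apply: ccvg_ext (ccvgD IHy IHz) => k; rewrite ipDl.
  - by rewrite ipZl; apply: ccvg_ext (ccvgZ c IH) => k; rewrite ipZl.
have bd (x : H) a' b' : n2 a' <= 1 -> n2 b' <= 1 ->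
    normc (ip x (tens a' b')) <= Num.sqrt (n2 x).
  move=> a1' b1'; rewrite (le_trans (ip_le _ _))// ler_piMr ?sqrtr_ge0//.
  by rewrite -(sqrtr1 R) ler_wsqrtr// n2_tens mulr_ile1// n2_ge0.
apply: (ccvg_approx (cvg_sqrt0 sK)) => m.
exists (fun k => ip (s m) (tens (a k) (b k))), (ip (s m) (tens a0 b0)); split.
- exact: ts_cvg.
- by rewrite -ipBl bd.
- by move=> k; rewrite normcBC -ipBl bd.
Qed.

(** The largest singular value is attained: a maximising sequence of pairs has a weak limit, and
    [weak_tens] carries the supremum over to it. Homogeneity then extends the bound from the unit
    balls to all pairs. *)
Lemma tens_max K : exists a b, [/\ n2 a <= 1, n2 b <= 1 & forall a' b',
  normc (ip K (tens a' b')) ^+ 2 <= normc (ip K (tens a b)) ^+ 2 * (n2 a' * n2 b')].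
Proof.
pose A := [set r | exists a b, [/\ n2 a <= 1, n2 b <= 1 & normc (ip K (tens a b)) = r]].
have A0 : A !=set0.
  by exists (normc (ip K (tens hz hz))), hz, hz; rewrite !n20.
have Aub : ubound A (Num.sqrt (n2 K)).
  move=> _ [a [b [a1 b1 <-]]].
  rewrite (le_trans (ip_le _ _))// ler_piMr ?sqrtr_ge0//.
  by rewrite -(sqrtr1 R) ler_wsqrtr// n2_tens mulr_ile1// n2_ge0.
have hA : has_sup A by split => //; exists (Num.sqrt (n2 K)).
pose s := sup A.
have As a b : n2 a <= 1 -> n2 b <= 1 -> normc (ip K (tens a b)) <= s.
  by move=> a1 b1; apply: ub_le_sup; [exists (Num.sqrt (n2 K))|exists a, b].
have ex k : exists ab : H1 * H2, [/\ n2 ab.1 <= 1, n2 ab.2 <= 1 &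
    s - k.+1%:R^-1 < normc (ip K (tens ab.1 ab.2))].
  have [_ [a [b [a1 b1 <-]]] h] := @sup_adherent _ A (k.+1%:R^-1) (ltac:(by rewrite invr_gt0)) hA.
  by exists (a, b).
pose ab k := projT1 (cid (ex k)).
have abP k : [/\ n2 (ab k).1 <= 1, n2 (ab k).2 <= 1 &
    s - k.+1%:R^-1 < normc (ip K (tens (ab k).1 (ab k).2))] by rewrite /ab; case: cid.
have [U [UU sU]] := ultraFilterLemma (eventually_filter : ProperFilter \oo).
have ab1 k : n2 (ab k).1 <= 1 by case: (abP k).
have ab2 k : n2 (ab k).2 <= 1 by case: (abP k).
have [a0 [a01 aa0]] := weak_limit UU ab1.
have [b0 [b01 bb0]] := weak_limit UU ab2.
have h := weak_tens UU K ab1 ab2 a01 b01 aa0 bb0.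
have hs : s <= normc (ip K (tens a0 b0)).
  have h1 : s - k.+1%:R^-1 @[k --> U] --> s.
    rewrite -[X in _ --> X]subr0; apply: cvgB; first exact: cvg_cst.
    apply: cvg_trans (@cvg_harmonic R).
    by move=> B /= hB; exact: sU.
  have pU : ProperFilter U := @ultra_proper _ _ UU.
  have h2 := @ccvg_normc _ _ U _ _ _ h.
  apply: (ler_cvg_to h1 (h2 pU)); apply: nearW => k; apply: ltW.
  by case: (abP k).
exists a0, b0; split => // a' b'.
have [z|nz] := eqVneq (n2 a' * n2 b') 0.
  rewrite z mulr0 le_eqVlt; apply/orP; left.
  by rewrite ip_null ?normc0 ?expr0n// n2_tens.
have pos : 0 < n2 a' * n2 b' by rewrite lt_neqAle eq_sym nz mulr_ge0 ?n2_ge0.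
have pa : 0 < n2 a' by rewrite lt_neqAle eq_sym n2_ge0 andbT; apply: contraNneq nz => ->; rewrite mul0r.
have pb : 0 < n2 b' by rewrite lt_neqAle eq_sym n2_ge0 andbT; apply: contraNneq nz => ->; rewrite mulr0.
pose ca := (Num.sqrt (n2 a'))^-1; pose cb := (Num.sqrt (n2 b'))^-1.
have ca0 : 0 < ca by rewrite invr_gt0 sqrtr_gt0.
have cb0 : 0 < cb by rewrite invr_gt0 sqrtr_gt0.
have ca2 : ca ^+ 2 * n2 a' = 1 by rewrite exprVn sqr_sqrtr ?ltW// mulVf ?gt_eqF.
have cb2 : cb ^+ 2 * n2 b' = 1 by rewrite exprVn sqr_sqrtr ?ltW// mulVf ?gt_eqF.
have := As (hscl ca%:C%C a') (hscl cb%:C%C b').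
rewrite !n2Z !normc_real !real_normK ?num_real// ca2 cb2 => /(_ (lexx _) (lexx _)).
rewrite ip_tensZl ip_tensZr !conjc_real !normcM !normc_real.
rewrite !gtr0_norm// => hh.
have {}hh := le_trans hh hs.
have : (ca * (cb * normc (ip K (tens a' b')))) ^+ 2 <= normc (ip K (tens a0 b0)) ^+ 2.
  by rewrite ler_pXn2r// nnegrE ?normc_ge0// !mulr_ge0 ?normc_ge0// ltW.
move=> h3; have h4 : (ca * (cb * normc (ip K (tens a' b')))) ^+ 2 * (n2 a' * n2 b') <=
  normc (ip K (tens a0 b0)) ^+ 2 * (n2 a' * n2 b') by rewrite ler_wpM2r// ltW.
apply: le_trans h4; rewrite le_eqVlt; apply/orP; left; apply/eqP.
rewrite -[LHS]mul1r -[X in X * _ = _]mul1r -{1}ca2 -cb2; ring.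
Qed.

(** The alternative [(hz, hz)] occurs when [K] annihilates every tensor; it makes the deflation step
    total, at the price of zero terms. *)
Definition maxpair K (ab : H1 * H2) :=
  (forall a' b', normc (ip K (tens a' b')) ^+ 2 <=
     normc (ip K (tens ab.1 ab.2)) ^+ 2 * (n2 a' * n2 b')) /\
  ((ab = (hz, hz)) \/
   [/\ ip K (tens ab.1 ab.2) != 0, n2 ab.1 = 1 & n2 ab.2 = 1]).

Lemma maxpair_ex K : exists ab, maxpair K ab.
Proof.
have [a [b [a1 b1 hab]]] := tens_max K.
have [z|nz] := eqVneq (ip K (tens a b)) 0.
  exists (hz, hz); split; last by left.
  move=> a' b' /=; apply: le_trans (hab a' b') _.
  rewrite z normc0 expr0n mul0r; apply: mulr_ge0.
    by rewrite exprn_ge0 ?normc_ge0.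
  by rewrite mulr_ge0 ?n2_ge0.
exists (a, b); split => //; right; split => //=.
  have := hab a b; rewrite -[X in X <= _]mulr1 ler_pM2l ?exprn_gt0 ?normc_gt0// => h.
  by apply/eqP; rewrite eq_le a1/=; have := n2_ge0 a; have := n2_ge0 b; nra.
have := hab a b; rewrite -[X in X <= _]mulr1 ler_pM2l ?exprn_gt0 ?normc_gt0// => h.
by apply/eqP; rewrite eq_le b1/=; have := n2_ge0 a; have := n2_ge0 b; nra.
Qed.

(** First-variation principle: a gain of first order in [t] cannot stay below a cost of second
    order. *)
Lemma small_quadratic (p q : R) : 0 <= p -> 0 < q ->
  (forall t : R, 0 < t -> 2 * t * q <= t ^+ 2 * p) -> False.
Proof.
move=> p0 q0 h; have p1 : 0 < p + 1 by rewrite ltr_wpDl.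
have := h (q / (p + 1)) (divr_gt0 q0 p1).
have -> : 2 * (q / (p + 1)) * q = 2 * (p + 1) * (q / (p + 1)) ^+ 2.
  by field; rewrite gt_eqF.
have : 0 < (q / (p + 1)) ^+ 2 by rewrite exprn_gt0// divr_gt0.
by nra.
Qed.

Lemma variationl K a b a' : maxpair K (a, b) -> ip a a' = 0 -> ip K (tens a' b) = 0.
Proof.
move=> [hm /= [[-> ->]|[s0 a1 b1]]] aa'; first by rewrite ip_null// n2_tens n20 mulr0.
set s := ip K (tens a b) in s0 hm; set c := ip K _.
apply/eqP/negP => /negP c0.
apply: (@small_quadratic (normc s ^+ 2 * n2 a') 1) => //.
  by rewrite mulr_ge0 ?n2_ge0// exprn_ge0// normc_ge0.
move=> t t0.
(* The coefficient is tuned so that the new value of the pairing is [s (1 + t |c|^2)], a gain of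
   first order in [t], while [a'] being orthogonal to [a] the squared norm only grows by a multiple
   of [t ^+ 2]. *)
have := hm (hadd a (hscl (conjc (t%:C%C * (s * (c^*)%C))) a')) b.
rewrite ip_tensDl ip_tensZl -/s -/c n2D n2Z ipZr aa' mulr0 b1 a1 /=.
rewrite conjcK normc_conj !(mulr0, mulr1, addr0).
rewrite (_ : s + _ = s * (1 + t%:C%C * (c * (c^*)%C))); last by ring.
rewrite mul_conj -rcM -[1]/(1%:C)%C -rcD normcM normc_real.
rewrite !normcM normc_real normc_conj.
have [n0 m0] : 0 < normc s /\ 0 < normc c by rewrite !normc_gt0.
move: (normc s) (normc c) n0 m0 => n m n0 m0.
rewrite !gtr0_norm//; last by rewrite addr_gt0// mulr_gt0// exprn_gt0.
rewrite exprMn ler_pM2l ?exprn_gt0// => h.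
rewrite -(ler_pM2r (exprn_gt0 2 m0)).
have : 0 <= (t * m ^+ 2) ^+ 2 by rewrite sqr_ge0.
move: h; rewrite !exprMn => h h'.
rewrite -subr_ge0 (_ : _ - _ = (1 + t ^+ 2 * (n ^+ 2 * m ^+ 2) * n2 a') - (1 + t * m ^+ 2) ^+ 2 +
  t ^+ 2 * (m ^+ 2) ^+ 2); last by ring.
by rewrite addr_ge0// subr_ge0.
Qed.
Lemma variationr K a b b' : maxpair K (a, b) -> ip b b' = 0 -> ip K (tens a b') = 0.
Proof.
move=> [hm /= [[-> ->]|[s0 a1 b1]]] aa'; first by rewrite ip_null// n2_tens n20 mul0r.
set s := ip K (tens a b) in s0 hm; set c := ip K _.
apply/eqP/negP => /negP c0.
apply: (@small_quadratic (normc s ^+ 2 * n2 b') 1) => //.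
  by rewrite mulr_ge0 ?n2_ge0// exprn_ge0// normc_ge0.
move=> t t0.
have := hm a (hadd b (hscl (conjc (t%:C%C * (s * (c^*)%C))) b')).
rewrite ip_tensDr ip_tensZr -/s -/c n2D n2Z ipZr aa' mulr0 b1 a1 /=.
rewrite conjcK normc_conj !(mulr0, mul1r, mulr1, addr0).
rewrite (_ : s + _ = s * (1 + t%:C%C * (c * (c^*)%C))); last by ring.
rewrite mul_conj -rcM -[1]/(1%:C)%C -rcD normcM normc_real.
rewrite !normcM normc_real normc_conj.
have [n0 m0] : 0 < normc s /\ 0 < normc c by rewrite !normc_gt0.
move: (normc s) (normc c) n0 m0 => n m n0 m0.
rewrite !gtr0_norm//; last by rewrite addr_gt0// mulr_gt0// exprn_gt0.
rewrite exprMn ler_pM2l ?exprn_gt0// => h.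
rewrite -(ler_pM2r (exprn_gt0 2 m0)).
have : 0 <= (t * m ^+ 2) ^+ 2 by rewrite sqr_ge0.
move: h; rewrite !exprMn => h h'.
rewrite -subr_ge0 (_ : _ - _ = (1 + t ^+ 2 * (n ^+ 2 * m ^+ 2) * n2 b') - (1 + t * m ^+ 2) ^+ 2 +
  t ^+ 2 * (m ^+ 2) ^+ 2); last by ring.
by rewrite addr_ge0// subr_ge0.
Qed.

Lemma ip_tensBl K a a' b : ip K (tens (hsub a a') b) = ip K (tens a b) - ip K (tens a' b).
Proof. by rewrite ip_tensDl ip_tensZl rmorphN rmorph1 mulN1r. Qed.
Lemma ip_tensBr K a b b' : ip K (tens a (hsub b b')) = ip K (tens a b) - ip K (tens a b').
Proof. by rewrite ip_tensDr ip_tensZr rmorphN rmorph1 mulN1r. Qed.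

Definition step K := projT1 (cid (maxpair_ex K)).
Lemma stepP K : maxpair K ((step K).1, (step K).2).
Proof. by rewrite -surjective_pairing /step; case: cid. Qed.
(** The singular value is absorbed into the first factor, so that the second one is a unit vector or
    [hz]. *)
Definition stepA K := hscl (ip K (tens (step K).1 (step K).2)) (step K).1.
Definition stepB K := (step K).2.
Definition stepK K := hsub K (tens (stepA K) (stepB K)).
Definition stepS K := ip K (tens (step K).1 (step K).2).

Lemma stepP0 K : (step K).1 = hz -> (step K).2 = hz -> stepS K = 0.
Proof. by move=> e1 e2; rewrite /stepS e1 e2 ip_null// n2_tens n20 mul0r. Qed.

(** By the first variation, [ip K (tens v b)] only sees the component of [v] along the maximising
    vector, and the subtracted tensor removes exactly that contribution. *)
Lemma step_orthb K v : ip (stepK K) (tens v (stepB K)) = 0.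
Proof.
rewrite ipBl ip_tens ipZl -/(stepS K) /stepB.
have [hm /= [[a0 b0]|[s0 a1 b1]]] := stepP K.
  by rewrite stepP0// b0 !mul0r subr0 ip_null// n2_tens n20 mulr0.
have h : ip (step K).1 (hsub v (hscl (ip v (step K).1) (step K).1)) = 0.
  by rewrite ipBr ipZr ipE a1 -ipJ mulr1 subrr.
have := variationl (stepP K) h; rewrite ip_tensBl ip_tensZl -ipJ -/(stepS K).
move/eqP; rewrite subr_eq0 => /eqP ->.
by rewrite !ipE b1 mulr1 mulrC subrr.
Qed.
Lemma step_ortha K v : ip (stepK K) (tens (step K).1 v) = 0.
Proof.
rewrite ipBl ip_tens ipZl -/(stepS K) /stepB.
have [hm /= [[a0 b0]|[s0 a1 b1]]] := stepP K.
  by rewrite stepP0// a0 !mul0r subr0 ip_null// n2_tens n20 mul0r.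
have h : ip (step K).2 (hsub v (hscl (ip v (step K).2) (step K).2)) = 0.
  by rewrite ipBr ipZr ipE b1 -ipJ mulr1 subrr.
have := variationr (stepP K) h; rewrite ip_tensBr ip_tensZr -ipJ -/(stepS K).
move/eqP; rewrite subr_eq0 => /eqP ->.
by rewrite !ipE a1 mulr1 mulrC subrr.
Qed.
Lemma step_n2AB K : n2 (stepA K) * n2 (stepB K) = normc (stepS K) ^+ 2.
Proof.
rewrite n2Z -/(stepS K) /stepB.
have [hm /= [[a0 b0]|[s0 a1 b1]]] := stepP K; last by rewrite a1 b1 !mulr1.
by rewrite stepP0// normc0 expr0n !mul0r.
Qed.
Lemma step_n2 K : n2 (stepK K) = n2 K - n2 (stepA K) * n2 (stepB K).
Proof.
rewrite n2B n2_tens step_n2AB ip_tensZl -/(stepS K) conj_mul/=; ring.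
Qed.

Fixpoint kseq K N := if N is M.+1 then stepK (kseq K M) else K.
Definition svA K j := stepA (kseq K j).
Definition svB K j := stepB (kseq K j).
Definition svS K j := stepS (kseq K j).

(** [kseq] with the factors as parameters: the form in which the decomposition exposes its
    remainder. *)
Fixpoint hrem K (A : nat -> H1) (B : nat -> H2) N :=
  if N is M.+1 then hsub (hrem K A B M) (tens (A M) (B M)) else K.

Lemma kseqE K N : kseq K N = hrem K (svA K) (svB K) N.
Proof. by elim: N => //= N <-. Qed.

(** If [K] annihilates all tensors with first factor [a], deleting the component along [a] from the
    maximiser leaves the value unchanged but shortens the vector; maximality leaves no room for
    that. *)
Lemma max_kill K a i : n2 a = 1 -> (forall v, ip K (tens a v) = 0) ->
  i = ip (step K).1 a -> (step K).2 <> hz -> i = 0.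
Proof.
move=> a1 h ei nz.
have [hm /= [[_ b0]//|[s0 p1 q1]]] := stepP K.
have := hm (hsub (step K).1 (hscl i a)) (step K).2.
rewrite ip_tensBl ip_tensZl h mulr0 subr0 q1 mulr1.
rewrite -[X in X <= _]mulr1 ler_pM2l ?exprn_gt0 ?normc_gt0//.
rewrite n2B n2Z a1 p1 ipZr -ei conj_mul /= => le1.
apply/eq0_normc/eqP; rewrite -sqrf_eq0 eq_le exprn_ge0 ?normc_ge0// andbT.
lra.
Qed.

Lemma max_killr K b i : n2 b = 1 -> (forall v, ip K (tens v b) = 0) ->
  i = ip (step K).2 b -> (step K).2 <> hz -> i = 0.
Proof.
move=> a1 h ei nz.
have [hm /= [[_ b0]//|[s0 p1 q1]]] := stepP K.
have := hm (step K).1 (hsub (step K).2 (hscl i b)).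
rewrite ip_tensBr ip_tensZr h mulr0 subr0 p1 mul1r.
rewrite -[X in X <= _]mulr1 ler_pM2l ?exprn_gt0 ?normc_gt0//.
rewrite n2B n2Z a1 q1 ipZr -ei conj_mul /= => le1.
apply/eq0_normc/eqP; rewrite -sqrf_eq0 eq_le exprn_ge0 ?normc_ge0// andbT.
lra.
Qed.

Lemma step_dich K : ((step K).1 = hz /\ (step K).2 = hz) \/
  [/\ stepS K != 0, n2 (step K).1 = 1, n2 (step K).2 = 1 & (step K).2 <> hz].
Proof.
have [hm /= [[a0 b0]|[s0 p1 q1]]] := stepP K; [by left|right; split => //].
by move=> e; move/eqP: q1; rewrite e n20 eq_sym oner_eq0.
Qed.

(** Annihilation survives later deflations because, by [max_kill], later maximisers are orthogonal
    to the earlier vectors. *)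
Lemma kseq_orth K i j : (i < j)%N ->
  (forall v, ip (kseq K j) (tens v (svB K i)) = 0) /\
  (forall v, ip (kseq K j) (tens (step (kseq K i)).1 v) = 0).
Proof.
elim: j => // j IH; rewrite ltnS leq_eqVlt => /orP[/eqP <-|ij].
  by split => v; [exact: step_orthb|exact: step_ortha].
have [hB hA] := IH ij; split => v /=.
  rewrite /stepK ipBl hB sub0r ip_tens.
  case: (step_dich (kseq K i)) => [[_ e]|[_ _ b1 _]].
    by rewrite /svB /stepB e ip0r mulr0 oppr0.
  case: (step_dich (kseq K j)) => [[_ e]|[_ _ _ nz]].
    by rewrite {1}/stepB e ip0l mulr0 oppr0.
  by rewrite {1}/stepB (max_killr b1 hB erefl nz) mulr0 oppr0.
rewrite /stepK ipBl hA sub0r ip_tens ipZl.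
case: (step_dich (kseq K i)) => [[e _]|[_ a1 _ _]].
  by rewrite e ip0r mulr0 mul0r oppr0.
case: (step_dich (kseq K j)) => [[e _]|[_ _ _ nz]].
  by rewrite e ip0l mulr0 mul0r oppr0.
by rewrite (max_kill a1 hA erefl nz) mulr0 mul0r oppr0.
Qed.

Lemma sv_orth K i j : (i < j)%N ->
  ip (step (kseq K j)).1 (step (kseq K i)).1 = 0 /\ ip (svB K j) (svB K i) = 0.
Proof.
move=> ij; have [hB hA] := kseq_orth K ij.
case: (step_dich (kseq K i)) => [[e e']|[_ a1 b1 _]].
  by rewrite e /svB /stepB e' !ip0r.
case: (step_dich (kseq K j)) => [[e e']|[_ _ _ nz]].
  by rewrite e /svB /stepB e' !ip0l.
by split; [exact: (max_kill a1 hA erefl nz)|exact: (max_killr b1 hB erefl nz)].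
Qed.

Lemma sv_orthA K i j : i <> j -> ip (svA K i) (svA K j) = 0.
Proof.
rewrite /svA /stepA ipZl ipZr; move/eqP; rewrite neq_ltn => /orP[ij|ji].
  by rewrite (ipJ (step (kseq K j)).1) (sv_orth K ij).1 conjc0 !mulr0.
by rewrite (sv_orth K ji).1 !mulr0.
Qed.
Lemma sv_orthB K i j : i <> j -> ip (svB K i) (svB K j) = 0.
Proof.
move/eqP; rewrite neq_ltn => /orP[ij|ji].
  by rewrite ipJ (sv_orth K ij).2 conjc0.
exact: (sv_orth K ji).2.
Qed.

Lemma n2_kseq K N : n2 (kseq K N) = n2 K - \sum_(j < N) n2 (svA K j) * n2 (svB K j).
Proof.
elim: N => [|N IH]; first by rewrite big_ord0 subr0.
by rewrite /= step_n2 IH big_ord_recr/= opprD addrA.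
Qed.

Lemma sv_sum K N : \sum_(j < N) n2 (svA K j) * n2 (svB K j) <= n2 K.
Proof. by rewrite -subr_ge0 -n2_kseq n2_ge0. Qed.

Lemma kseq_nincr K N M : (N <= M)%N -> n2 (kseq K M) <= n2 (kseq K N).
Proof.
move=> /subnK <-; elim: (M - N)%N => [//|k IH].
rewrite addSn /=; apply: le_trans IH; rewrite step_n2 gerBl mulr_ge0 ?n2_ge0//.
Qed.

Lemma ip_kseq K N M : (N <= M)%N -> ip (kseq K M) (kseq K N) = ip (kseq K M) (kseq K M).
Proof.
move=> NM; suff h j : (j <= M)%N -> ip (kseq K M) (kseq K j) = ip (kseq K M) K by rewrite !h.
elim: j => // j IH jM /=; rewrite ipBr IH ?(ltnW jM)// ip_tensZl.
have [_ hA] := kseq_orth K jM.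
by rewrite hA mulr0 subr0.
Qed.

Lemma kseq_cauchy K N M : (N <= M)%N ->
  n2 (hsub (kseq K M) (kseq K N)) = n2 (kseq K N) - n2 (kseq K M).
Proof. by move=> NM; rewrite n2B ip_kseq// ipE/=; ring. Qed.

Lemma svS_le K j : normc (svS K j) ^+ 2 <= n2 (kseq K j) - n2 (kseq K j.+1).
Proof. by rewrite /= step_n2 step_n2AB opprB addrC subrK. Qed.

(** Remainders decrease in norm and are Cauchy by [kseq_cauchy]. Squared singular values are
    differences of consecutive norms, hence tend to 0; as they bound all pairings, the limit
    annihilates every tensor and is null by density. *)
Lemma kseq_cvg0 K : n2 (kseq K N) @[N --> \oo] --> (0 : R).
Proof.
have hd : {homo (fun N => n2 (kseq K N)) : n m / (n <= m)%N >-> m <= n}.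
  by move=> a b; exact: kseq_nincr.
have cv : cvgn (fun N => n2 (kseq K N)).
  apply: (nonincreasing_is_cvgn hd); exists 0 => _ [N _ <-]; exact: n2_ge0.
have [L hL] : exists L, hcvg (kseq K) L.
  apply: hcomplete => e e0; have e2 : 0 < e / 2 by rewrite divr_gt0.
  have [l hl] : exists l : R, n2 (kseq K N) @[N --> \oo] --> l.
    by exists (limn (fun N => n2 (kseq K N))).
  move/cvgrPdist_lt : hl => /(_ _ e2) [N _ hN].
  exists N => m n.
  wlog mn : m n / (n <= m)%N.
    move=> H0 hm hn; have [nm|nm] := leqP n m; first exact: H0.
    by have := H0 n m (ltnW nm) hn hm; rewrite -!/(hsub _ _) -!/(n2 _) n2BC.
  move=> hm hn; rewrite -!/(hsub _ _) -!/(n2 _) kseq_cauchy//.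
  have := hN m hm; have := hN n hn; rewrite /= !ltr_norml => /andP[h1 h2] /andP[h3 h4].
  lra.
have tL a b : ip L (tens a b) = 0.
  have s0 : normc (svS K j) ^+ 2 @[j --> \oo] --> (0 : R).
    have h : n2 (kseq K j) - n2 (kseq K j.+1) @[j --> \oo] --> (0 : R).
      rewrite -(subrr (n2 L)); apply: cvgB; first exact: hcvg_n2.
      have := hcvg_n2 hL; rewrite -cvg_shiftS; exact.
    apply: norm0_cvg h => k; rewrite svS_le andbT exprn_ge0 ?normc_ge0//.
  apply: (ccvg_uniq (hcvg_ip (tens a b) hL)).
  rewrite /ccvg; under eq_fun do rewrite subr0.
  have h2 := cvg_sqrt0 (cvgZ0 (n2 a * n2 b) s0).
  refine (norm0_cvg _ (h2 _)) => k.
  rewrite normc_ge0/= -(ler_pXn2r (n:=2))// ?nnegrE ?normc_ge0 ?sqrtr_ge0//.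
  rewrite sqr_sqrtr; last by rewrite mulr_ge0 ?exprn_ge0 ?normc_ge0// mulr_ge0 ?n2_ge0.
  by have [hm _] := stepP (kseq K k); rewrite mulrC; exact: hm.
by have := hcvg_n2 hL; rewrite (dense tL).
Qed.

Theorem svd K : exists (A : nat -> H1) (B : nat -> H2), [/\ forall i j, i <> j -> ip (A i) (A j) = 0,
  forall i j, i <> j -> ip (B i) (B j) = 0,
  forall N : nat, \sum_(j < N) n2 (A j) * n2 (B j) <= n2 K &
  n2 (hrem K A B N) @[N --> \oo] --> (0 : R)].
Proof.
exists (svA K), (svB K); split.
- exact: sv_orthA.
- exact: sv_orthB.
- exact: sv_sum.
- by have := kseq_cvg0 K; under eq_fun do rewrite kseqE.
Qed.

Fixpoint htsum (r : seq (H1 * H2)) : H :=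
  if r is ab :: r' then hadd (tens ab.1 ab.2) (htsum r') else hz.

Lemma ip_htsum r a b : ip (htsum r) (tens a b) =
  \sum_(i < size r) ip (nth (hz, hz) r i).1 a * ip (nth (hz, hz) r i).2 b.
Proof.
elim: r => [|ab r IH]; first by rewrite /= big_ord0 ip0l.
by rewrite /= ipDl IH big_ord_recl/= ip_tens.
Qed.

Lemma ip_kseqS K v j : ip K (tens v (svB K j)) = ip (kseq K j) (tens v (svB K j)).
Proof.
suff h i : (i <= j)%N -> ip (kseq K i) (tens v (svB K j)) = ip K (tens v (svB K j)).
  by rewrite h.
elim: i => // i IH ij; rewrite /= ipBl ip_tens IH ?(ltnW ij)//.
by rewrite (ipJ (svB K j)) (sv_orth K ij).2 conjc0 mulr0 subr0.
Qed.

Lemma svS_ip K j v : ip K (tens v (svB K j)) = svS K j * ip (step (kseq K j)).1 v.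
Proof.
rewrite ip_kseqS; case: (step_dich (kseq K j)) => [[e e']|[s0 a1 b1 _]].
  by rewrite e ip0l mulr0 /svB /stepB e' ip_null// n2_tens n20 mulr0.
have := step_orthb (kseq K j) v; rewrite ipBl ip_tens ipZl -/(stepS _) -/(svS K j).
by move/eqP; rewrite subr_eq0 => /eqP ->; rewrite ipE b1 mulr1.
Qed.

(** Rank argument: [Q] has more rows than columns, so some combination [c] of the [svB K j] is
    annihilated by [K] in the second variable. Pairing with the k-th left singular vector isolates
    [c k] times the k-th singular value, so not all of the first [size r + 1] values can be
    non-zero. *)
Lemma svS_fin r : exists j, (j <= size r)%N /\ svS (htsum r) j = 0.
Proof.
set K := htsum r; set N := size r.
apply: contrapT => /forallNP nz.
have {}nz j : (j <= N)%N -> svS K j != 0 by move=> jN; apply/eqP => e; exact: (nz j).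
pose Q := \matrix_(j < N.+1, i < N) ip (nth (hz, hz) r i).2 (svB K j) : 'M[R[i]]_(N.+1, N).
have : kermx Q != 0.
  by rewrite -mxrank_eq0 mxrank_ker subn_eq0 -ltnNge (leq_ltn_trans (rank_leq_col Q)).
case/rowV0Pn => c /sub_kermxP cQ c0.
move/eqP: c0; apply; apply/rowP => k; rewrite mxE.
pose v := (step (kseq K k)).1.
have e : \sum_(j < N.+1) c 0 j * ip K (tens v (svB K j)) = 0.
  under eq_bigr => j _ do rewrite ip_htsum mulr_sumr.
  rewrite exchange_big/= big1// => i _.
  have := congr1 (fun M : 'rV[R[i]]_N => M 0 i) cQ; rewrite !mxE => h.
  rewrite (eq_bigr (fun j : 'I_N.+1 => ip (nth (hz, hz) r i).1 v * (c 0 j * Q j i))).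
    by rewrite -mulr_sumr h mulr0.
  by move=> j _; rewrite mxE; ring.
move: e; rewrite (bigD1 k)//= big1 ?addr0.
  rewrite svS_ip; case: (step_dich (kseq K k)) => [[e e']|[s0 a1 b1 _]].
    have := nz k (ltac:(by rewrite -ltnS)); rewrite /svS stepP0// eqxx//.
  move/eqP; rewrite mulf_eq0 => /orP[/eqP//|].
  rewrite /v ipE a1 mulr1 => /eqP z.
  by move: s0; rewrite -/(svS K k) z eqxx.
move=> j jk; rewrite svS_ip /v.
have := jk; rewrite -val_eqE/= neq_ltn => /orP[h|h].
  by rewrite ipJ (sv_orth K h).1 conjc0 !mulr0.
by rewrite (sv_orth K h).1 !mulr0.
Qed.

Theorem fin_svd r : exists (M : nat) (A : nat -> H1) (B : nat -> H2), [/\ forall i j, i <> j -> ip (A i) (A j) = 0,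
  forall i j, i <> j -> ip (B i) (B j) = 0,
  (forall j, (j < M)%N -> n2 (A j) != 0 /\ n2 (B j) != 0),
  n2 (hrem (htsum r) A B M) = 0 &
  \sum_(j < M) n2 (A j) * n2 (B j) = n2 (htsum r)].
Proof.
have [j0 [_ z0]] := svS_fin r; set K := htsum r in z0 *.
have ex : exists j, svS K j == 0 by exists j0; apply/eqP.
(* Stopping at the first vanishing singular value keeps all factors non-null, as [W_repr]
   demands. *)
pose M := ex_minn ex.
have zM : svS K M = 0 by rewrite /M; case: ex_minnP => m /eqP.
have nz j : (j < M)%N -> svS K j != 0.
  rewrite /M; case: ex_minnP => m _ h jm; apply/negP => /h; rewrite leqNgt.
  by rewrite jm.
have nM : n2 (kseq K M) = 0.
  apply: dense => a b; apply/eq0_normc/eqP; rewrite -sqrf_eq0 eq_le exprn_ge0 ?normc_ge0// andbT.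
  have [hm _] := stepP (kseq K M); apply: le_trans (hm a b) _.
  by rewrite -/(stepS _) -/(svS K M) zM normc0 expr0n mul0r.
exists M, (svA K), (svB K); split.
- exact: sv_orthA.
- exact: sv_orthB.
- move=> j /nz s0; have : n2 (svA K j) * n2 (svB K j) != 0.
    by rewrite step_n2AB sqrf_eq0 gt_eqF// normc_gt0.
  by rewrite mulf_eq0 negb_or => /andP[].
- by rewrite -kseqE.
- by have := n2_kseq K M; rewrite nM => /esym/eqP; rewrite subr_eq0 => /eqP.
Qed.

End svd.

(** * Lebesgue measure on R^n *)

Section rV_measurability.
Context (R : realType).

Lemma measurable_rV d (T : measurableType d) n (f : T -> 'rV[R]_n) :
  (forall i, measurable_fun setT (fun x => f x 0 i)) -> measurable_fun setT f.
Proof.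
move=> mf; apply: (measurability (\big[setU/set0]_(i < n)
  preimage_set_system setT (@rV_coord R n i) measurable)) => //.
move=> _ [A + <-]; rewrite -bigcup_seq => -[i _ [B mB <-]].
rewrite [X in _ @^-1` X]setTI -comp_preimage.
exact: (mf i).
Qed.

Lemma measurable_coord n (i : 'I_n) : measurable_fun setT (fun x : 'rV[R]_n => x 0 i).
Proof. exact: measurable_rV_coord. Qed.

Lemma mcoord d (T : measurableType d) n (f : T -> 'rV[R]_n) i :
  measurable_fun setT f -> measurable_fun setT (fun x => f x 0 i).
Proof. by move=> mf; exact: (measurableT_comp (measurable_coord i) mf). Qed.

Lemma measurable_rVD d (T : measurableType d) n (f g : T -> 'rV[R]_n) :
  measurable_fun setT f -> measurable_fun setT g ->
  measurable_fun setT (fun x => f x + g x).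
Proof.
move=> mf mg; apply: measurable_rV => i; under eq_fun do rewrite mxE.
by apply: measurable_funD; exact: mcoord.
Qed.
Lemma measurable_rVZ d (T : measurableType d) n (c : R) (f : T -> 'rV[R]_n) :
  measurable_fun setT f -> measurable_fun setT (fun x => c *: f x).
Proof.
move=> mf; apply: measurable_rV => i; under eq_fun do rewrite mxE.
by apply: measurable_funM => //; exact: mcoord.
Qed.
Lemma measurable_rVN d (T : measurableType d) n (f : T -> 'rV[R]_n) :
  measurable_fun setT f -> measurable_fun setT (fun x => - f x).
Proof.
by move=> /(measurable_rVZ (-1)); under eq_fun do rewrite scaleN1r.
Qed.
Lemma measurable_rVB d (T : measurableType d) n (f g : T -> 'rV[R]_n) :
  measurable_fun setT f -> measurable_fun setT g ->
  measurable_fun setT (fun x => f x - g x).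
Proof. by move=> mf mg; apply: measurable_rVD => //; exact: measurable_rVN. Qed.
Lemma measurable_rVM d (T : measurableType d) n m (f : T -> 'rV[R]_n) (A : 'M[R]_(n, m)) :
  measurable_fun setT f -> measurable_fun setT (fun x => f x *m A).
Proof.
move=> mf; apply: measurable_rV => i; under eq_fun do rewrite mxE.
by apply: measurable_sum => j; apply: measurable_funM => //; exact: mcoord.
Qed.
Lemma measurable_dotrV d (T : measurableType d) n (f g : T -> 'rV[R]_n) :
  measurable_fun setT f -> measurable_fun setT g ->
  measurable_fun setT (fun x => dotrV (f x) (g x)).
Proof.
move=> mf mg; apply: measurable_sum => j.
by apply: measurable_funM; exact: mcoord.
Qed.

Lemma ball_rVE n (x y : 'rV[R]_n) (e : R) : 0 < e ->
  ball x e y <-> forall i, `|x 0 i - y 0 i| < e.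
Proof.
move=> e0; split => [[_ h] i|h]; first exact: h.
by split => // i j; rewrite (ord1 i); exact: h.
Qed.

Lemma measurable_ball_rV n (x : 'rV[R]_n) (e : R) : 0 < e -> measurable (ball x e).
Proof.
move=> e0; rewrite (_ : ball x e = \bigcap_(i in [set: 'I_n]) [set y : 'rV[R]_n | `|x 0 i - y 0 i| < e]).
  apply: fin_bigcap_measurable => // i _.
  rewrite -[X in measurable X]setTI.
  have -> : [set y : 'rV[R]_n | `|x 0 i - y 0 i| < e] = (fun y : 'rV[R]_n => `|x 0 i - y 0 i|) @^-1` `]-oo, e[%classic.
    by apply/seteqP; split => y /=; rewrite in_itv.
  have m : measurable_fun setT (fun y : 'rV[R]_n => `|x 0 i - y 0 i|).
    apply: measurableT_comp => //; apply: measurable_funB => //.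
    exact: measurable_coord.
  exact: m.
apply/seteqP; split => y; first by move/(ball_rVE _ _ e0) => h i _; exact: h.
by move=> h; apply/ball_rVE => // i; exact: h.
Qed.

(** Sup-norm balls with rational centres and radii [1 / (k + 1)] form a countable base, and each of
    them is a finite intersection of coordinate conditions. *)
Lemma open_measurable_rV n (O : set 'rV[R]_n) : open O -> measurable O.
Proof.
move=> oO.
pose q2r (p : 'rV[rat]_n) : 'rV[R]_n := map_mx ratr p.
pose rad (k : nat) : R := k.+1%:R^-1.
have rad0 k : 0 < rad k by rewrite invr_gt0.
pose I := [set pk : 'rV[rat]_n * nat | ball (q2r pk.1) (rad pk.2) `<=` O].
rewrite (_ : O = \bigcup_(pk in I) ball (q2r pk.1) (rad pk.2)).
  rewrite bigcup_mkcond; apply: countable_bigcupT_measurable => // -[p k].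
  by case: ifP => // _; exact: measurable_ball_rV.
apply/seteqP; split; last by move=> x [pk pkI xb]; exact: pkI xb.
move=> x Ox; move: oO; rewrite openE => /(_ _ Ox); rewrite /interior => /nbhs_ballP[e /= e0 eO].
have [k ke] : exists k, rad k < e / 2.
  have e2 : 0 < e / 2 by rewrite divr_gt0.
  have [N _ hN] := near_infty_natSinv_lt (PosNum e2).
  by exists N; exact: (hN N (leqnn N)).
have ex (i : 'I_n) : exists p : rat, `|ratr p - x 0 i| < rad k.
  have [p] := @rat_in_itvoo R (x 0 i - rad k) (x 0 i + rad k) (ltac:(by rewrite ltrD2l gtrN)).
  by rewrite in_itv/= => h; exists p; rewrite ltr_distl.
pose p := \row_i projT1 (cid (ex i)).
have px : ball (q2r p) (rad k) x.
  by apply/ball_rVE => // i; rewrite !mxE; case: cid.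
exists (p, k) => //= y /(ball_rVE _ _ (rad0 k)) py.
apply: eO; apply/ball_rVE => // i.
have /(ball_rVE _ _ (rad0 k))/(_ i) h1 := px; have h2 := py i.
rewrite (_ : x 0 i - y 0 i = - (q2r p 0 i - x 0 i) + (q2r p 0 i - y 0 i)); last by ring.
rewrite (le_lt_trans (ler_normD _ _))// normrN.
by move: h1 h2 ke; move: (rad k) => r; lra.
Qed.

End rV_measurability.

(** * Change of variables for Lebesgue measure *)

Section lebn.
Context (R : realType).
Local Notation lam := (@lebesgue_measure R).

Definition rV_hd n (v : 'rV[R]_n.+1) : R := v 0 0.
Definition rV_tl n (v : 'rV[R]_n.+1) : 'rV[R]_n := \row_j v 0 (lift 0 j).

Lemma rV_cons0 n (p : measurableTypeR R * 'rV[R]_n) : rV_cons p 0 0 = p.1.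
Proof.
transitivity ((row_mx (p.1%:M : 'M[R]_1) p.2 : 'rV_(1 + n)) 0 (lshift n 0)).
  by congr (row_mx _ _ _ _); exact: val_inj.
by rewrite row_mxEl mxE eqxx mulr1n.
Qed.
Lemma rV_consS n (p : measurableTypeR R * 'rV[R]_n) j : rV_cons p 0 (lift 0 j) = p.2 0 j.
Proof.
transitivity ((row_mx (p.1%:M : 'M[R]_1) p.2 : 'rV_(1 + n)) 0 (rshift 1 j)).
  by congr (row_mx _ _ _ _); exact: val_inj.
by rewrite row_mxEr.
Qed.
Lemma rV_cons_eta n (v : 'rV[R]_n.+1) : rV_cons (rV_hd v : measurableTypeR R, rV_tl v) = v.
Proof.
apply/rowP => i; case: (unliftP 0 i) => [j ->|->]; last by rewrite rV_cons0.
by rewrite rV_consS mxE.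
Qed.
Lemma rV_consD n (x y : measurableTypeR R) (v w : 'rV[R]_n) :
  rV_cons (x, v) + rV_cons (y, w) = rV_cons (x + y : measurableTypeR R, v + w).
Proof.
apply/rowP => i; rewrite mxE; case: (unliftP 0 i) => [j ->|->].
  by rewrite !rV_consS mxE.
by rewrite !rV_cons0.
Qed.
Lemma dotrV_cons n (x y : measurableTypeR R) (v w : 'rV[R]_n) :
  dotrV (rV_cons (x, v)) (rV_cons (y, w)) = x * y + dotrV v w.
Proof.
rewrite /dotrV big_ord_recl !rV_cons0; congr (_ + _).
by apply: eq_bigr => i _; rewrite !rV_consS.
Qed.

Definition cube n (k : R) : set 'rV[R]_n := [set x | forall i, `|x 0 i| <= k].

Lemma measurable_cube n k : measurable (@cube n k).
Proof.
rewrite (_ : cube k = \bigcap_(i in [set: 'I_n]) [set y : 'rV[R]_n | `|y 0 i| <= k]).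
  apply: fin_bigcap_measurable => // i _.
  rewrite -[X in measurable X]setTI.
  have -> : [set y : 'rV[R]_n | `|y 0 i| <= k] = (fun y : 'rV[R]_n => `|y 0 i|) @^-1` `]-oo, k]%classic.
    by apply/seteqP; split => y /=; rewrite in_itv.
  have m : measurable_fun setT (fun y : 'rV[R]_n => `|y 0 i|).
    by apply: measurableT_comp => //; exact: measurable_coord.
  exact: m.
by apply/seteqP; split => y h i; [move=> _; exact: h|exact: h].
Qed.

Lemma cons_cube n k : @rV_cons R n @^-1` (@cube n.+1 k) = `[-k, k]%classic `*` cube k.
Proof.
apply/seteqP; split => [[x v] h|[x v] [/= h1 h2] i].
  split => /=; first by have := h 0; rewrite rV_cons0 /= in_itv/= ler_norml.
  by move=> i; have := h (lift 0 i); rewrite rV_consS.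
case: (unliftP 0 i) => [j ->|->]; first by rewrite rV_consS; exact: h2.
by rewrite rV_cons0/= ler_norml; move: h1; rewrite in_itv.
Qed.

Lemma lebesgue_cube n (k : R) : 0 <= k -> lebesgue_rV R n (cube k) = ((2 * k) ^+ n)%:E.
Proof.
move=> k0; elim: n => [|n IH].
  by rewrite /= expr0 diracE mem_set// => -[].
rewrite /= /lebesgue_cons /pushforward cons_cube product_measure2E//; last first.
  exact: measurable_cube.
transitivity (lam `[(- k)%R, k]%classic * lebesgue_rV R n (cube k))%E => //.
rewrite IH lebesgue_measure_itv/=.
rewrite exprS EFinM; congr (_ * _)%E; rewrite lte_fin.
case: ltP => [_|]; first by rewrite opprK; congr EFin; ring.
move=> h; have -> : k = 0 by apply/eqP; rewrite eq_le; apply/andP; split; lra.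
by rewrite mulr0.
Qed.

Lemma sigma_finite_lebesgue_rV n : sigma_finite setT (lebesgue_rV R n).
Proof.
exists (fun k : nat => cube k%:R).
  apply/esym/seteqP; split => // x _.
  exists (\sum_(i < n) (Num.truncn `|x 0%R i|).+1)%N => // i.
  rewrite (le_trans (ltW (truncnS_gt _)))// ler_nat.
  by rewrite (bigD1 i)//= leq_addr.
move=> k; split; first exact: measurable_cube.
by rewrite lebesgue_cube// ltry.
Qed.

(** A copy of [lebesgue_rV] that carries a sigma-finite structure, as required by Fubini's
    theorem. *)
Definition lebn n : set 'rV[R]_n -> \bar R := lebesgue_rV R n.
Arguments lebn : clear implicits.

Let lebn0 n : lebn n set0 = 0%E. Proof. exact: measure0. Qed.
Let lebn_ge0 n A : (0 <= lebn n A)%E. Proof. exact: measure_ge0. Qed.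
Let lebn_sa n : semi_sigma_additive (lebn n).
Proof. exact: measure_semi_sigma_additive. Qed.
HB.instance Definition _ n := isMeasure.Build _ _ _ (lebn n) (lebn0 n) (lebn_ge0 (n:=n)) (@lebn_sa n).
HB.instance Definition _ n := @Measure_isSigmaFinite.Build _ _ _ (lebn n) (sigma_finite_lebesgue_rV n).

Lemma lebn_int0 (f : 'rV[R]_0 -> \bar R) : (\int[lebn 0%N]_x f x = f 0%R)%E.
Proof.
rewrite (_ : lebn 0%N = dirac (0 : 'rV[R]_0))//.
rewrite (_ : f = fun=> f 0); last by apply/funext => x; rewrite (thinmx0 x).
by rewrite integral_cst//= diracE in_setT mule1.
Qed.

Lemma lebn_intS n (f : 'rV[R]_n.+1 -> \bar R) : measurable_fun setT f ->
  (forall x, (0 <= f x)%E) ->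
  (\int[lebn n.+1]_x f x = \int[lam]_x \int[lebn n]_y f (rV_cons (x, y)))%E.
Proof.
move=> mf f0.
have mc : measurable_fun setT (@rV_cons R n) by exact: measurable_rV_cons.
rewrite (_ : lebn n.+1 = pushforward (lam \x^ (lebn n))%E (@rV_cons R n))//.
rewrite (@ge0_integral_pushforward _ _ _ _ _ _ mc)//= preimage_setT.
rewrite -(@fubini_tonelli1 _ _ _ _ _ lam (lebn n) (f \o @rV_cons R n)); last 2 first.
- exact: measurableT_comp.
- by move=> z; exact: f0.
apply: eq_measure_integral => A mA _; apply/esym.
by apply: product_measure_unique => //= B C mB mC; rewrite product_measure2E.
Qed.

Lemma lebn_intS' n (f : 'rV[R]_n.+1 -> \bar R) : measurable_fun setT f ->
  (forall x, (0 <= f x)%E) ->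
  (\int[lebn n.+1]_x f x = \int[lebn n]_y \int[lam]_x f (rV_cons (x, y)))%E.
Proof.
move=> mf f0; rewrite lebn_intS//.
apply: (@fubini_tonelli _ _ _ _ _ lam (lebn n) (f \o @rV_cons R n)).
  by apply: measurableT_comp => //; exact: measurable_rV_cons.
by move=> z; exact: f0.
Qed.

Lemma lam_affine_set (a b : R) (A : set R) : a != 0 -> measurable A ->
  lam ((fun x : R => a * x + b) @^-1` A) = ((`|a|^-1)%:E * lam A)%E.
Proof.
move=> a0 mA.
have mphi : measurable_fun setT (fun x : measurableTypeR R => a * x + b : measurableTypeR R).
  by apply: measurable_funD => //; exact: measurable_funM.
pose m1 : {measure set (measurableTypeR R) -> \bar R} :=
  measure_function_pushforward__canonical__measure_function_Measure lam mphi.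
pose m := mscale (NngNum (normr_ge0 a)) m1.
have h : forall X, ocitv X -> lam X = m X.
  move=> _ [[u v]/= _ <-].
  rewrite /m /mscale/= /pushforward lebesgue_measure_itv/=.
  have [ap|an|/eqP] := ltgtP a 0; last by rewrite (negbTE a0).
    rewrite (_ : _ @^-1` _ = `[(v - b) / a, (u - b) / a[%classic).
      rewrite lebesgue_measure_itv/= !lte_fin ltr_nM2r ?invr_lt0// ltrD2r.
      case: ltP => uv; last by rewrite mule0.
      by rewrite -!EFinD -EFinM ltr0_norm//; congr EFin; field.
    apply/seteqP; split => x /=; rewrite !in_itv/= ler_ndivrMr// ltr_ndivlMr// lerBrDr ltrBlDr.
      by rewrite (mulrC x) andbC.
    by rewrite (mulrC x) andbC.
  rewrite (_ : _ @^-1` _ = `](u - b) / a, (v - b) / a]%classic).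
    rewrite lebesgue_measure_itv/= !lte_fin ltr_pM2r ?invr_gt0// ltrD2r.
    case: ltP => uv; last by rewrite mule0.
    by rewrite -!EFinD -EFinM gtr0_norm//; congr EFin; field.
  apply/seteqP; split => x /=; rewrite !in_itv/= ler_pdivlMr// ltr_pdivrMr// lerBrDr ltrBlDr.
    by rewrite (mulrC x).
  by rewrite (mulrC x).
have -> := lebesgue_measure_unique h mA.
rewrite /m /mscale/= /pushforward muleA -EFinM mulVf ?normr_eq0// mul1e//.
Qed.

(** A change of variables packaged as a property of the map. It is stable under composition and
    covers translations, dilations, linear maps and shears of product spaces alike. *)
Definition mscales d (T : measurableType d) (m : {measure set T -> \bar R}) (phi : T -> T) (c : R) :=
  [/\ 0 < c, measurable_fun setT phi & forall f : T -> \bar R, measurable_fun setT f ->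
   (forall x, (0 <= f x)%E) -> (\int[m]_x f (phi x) = c%:E * \int[m]_x f x)%E].

Lemma mscalesP d (T : measurableType d) (m : {measure set T -> \bar R}) (phi : T -> T) (c : R) :
  0 < c -> measurable_fun setT phi ->
  (forall A, measurable A -> m (phi @^-1` A) = (c%:E * m A)%E) -> mscales m phi c.
Proof.
move=> c0 mphi h; split => // f mf f0.
transitivity (\int[mscale (NngNum (ltW c0)) m]_x f x)%E; last first.
  by rewrite ge0_integral_mscale.
rewrite -(@ge0_integral_pushforward _ _ _ _ _ _ mphi m setT f)//=.
by apply: eq_measure_integral => A mA _; exact: h.
Qed.

Lemma mscales_comp d (T : measurableType d) (m : {measure set T -> \bar R}) (p q : T -> T) (a b : R) :
  mscales m p a -> mscales m q b -> mscales m (fun x => p (q x)) (a * b).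
Proof.
move=> [a0 mp hp] [b0 mq hq]; split; [exact: mulr_gt0|exact: measurableT_comp|].
move=> f mf f0; rewrite (hq (fun x => f (p x))) ?hp ?muleA -?EFinM ?(mulrC a)//.
exact: measurableT_comp.
Qed.

Lemma lam_affine (a b : R) : a != 0 ->
  mscales lam (fun x : measurableTypeR R => a * x + b : measurableTypeR R) (`|a|^-1).
Proof.
move=> a0; apply: mscalesP; first by rewrite invr_gt0 normr_gt0.
  by apply: measurable_funD => //; exact: measurable_funM.
by move=> A mA; exact: lam_affine_set.
Qed.

Lemma lebn_translate n (v : 'rV[R]_n) : mscales (lebn n) (fun x => x + v) 1.
Proof.
have mtr k (w : 'rV[R]_k) : measurable_fun setT (fun x : 'rV[R]_k => x + w).
  by apply: measurable_rVD.
split => //; first exact: mtr.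
elim: n v => [|n IH] v f mf f0.
  by rewrite !lebn_int0 mul1e (thinmx0 (0 + v)).
have mcons : measurable_fun setT (@rV_cons R n) := @measurable_rV_cons R n.
rewrite mul1e (@lebn_intS n f mf f0) (@lebn_intS n (fun x => f (x + v))); last 2 first.
- exact: (measurableT_comp mf (mtr _ v)).
- by move=> x; exact: f0.
transitivity (\int[lam]_x \int[lebn n]_y f (rV_cons ((1 * x + rV_hd v)%R : measurableTypeR R, y)))%E.
  apply: eq_integral => x _.
  rewrite -[RHS]mul1e -(IH (rV_tl v) (fun y => f (rV_cons (1 * x + rV_hd v : measurableTypeR R, y)))) //.
    by apply: eq_integral => y _; rewrite -{1}(rV_cons_eta v) rV_consD mul1r.
  by apply: (measurableT_comp mf); apply: (measurableT_comp mcons).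
have [_ _ h] := @lam_affine 1 (rV_hd v) (oner_neq0 _).
rewrite (h (fun x => \int[lebn n]_y f (rV_cons (x, y))))%E.
- by rewrite normr1 invr1 mul1e.
- apply: (@measurable_fun_fubini_tonelli_F _ _ _ _ _ (lebn n) (f \o @rV_cons R n)).
    exact: measurableT_comp.
  by move=> z; exact: f0.
- by move=> x; exact: integral_ge0.
Qed.

Lemma mulmx_cons n m (x : measurableTypeR R) (v : 'rV[R]_n) (a : 'M[R]_1) (b : 'rV[R]_m)
   (c : 'cV[R]_n) (D : 'M[R]_(n, m)) :
  rV_cons (x, v) *m (block_mx a b c D) =
  rV_cons (a 0 0 * x + (v *m c) 0 0 : measurableTypeR R, x *: b + v *m D).
Proof.
rewrite /rV_cons/= [LHS](@mul_row_block _ 1 1 n 1 m (x%:M) v a b c D).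
congr row_mx; last by rewrite mul_scalar_mx.
by apply/matrixP => i j; rewrite !ord1 !mxE big_ord1 !mxE eqxx !mulr1n mulrC.
Qed.

Lemma lebn_ublock n (a : R) (b : 'rV[R]_n) (D : 'M[R]_n) (d : R) : a != 0 ->
  mscales (lebn n) (fun x => x *m D) d ->
  mscales (lebn n.+1) (fun x => x *m (block_mx (a%:M : 'M[R]_1) b 0 D)) (`|a|^-1 * d).
Proof.
move=> a0 [d0 mD hD]; have mB : measurable_fun setT (fun x : 'rV[R]_n.+1 => x *m block_mx (a%:M : 'M[R]_1) b 0 D).
  exact: measurable_rVM.
split => //; first by rewrite mulr_gt0// invr_gt0 normr_gt0.
move=> f mf f0; rewrite (@lebn_intS n f mf f0) (@lebn_intS n (fun x => f (x *m _))); last 2 first.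
- exact: measurableT_comp.
- by move=> x; exact: f0.
have mcons : measurable_fun setT (@rV_cons R n) := @measurable_rV_cons R n.
have msec x : measurable_fun setT (fun y => f (rV_cons (x : measurableTypeR R, y))).
  by apply: (measurableT_comp mf); apply: (measurableT_comp mcons).
transitivity (\int[lam]_x (d%:E * \int[lebn n]_y f (rV_cons ((a * x + 0)%R : measurableTypeR R, y))))%E.
  apply: eq_integral => x _.
  pose g z := f (rV_cons ((a * x + 0)%R : measurableTypeR R, z)).
  have [t1 t2 t3] := mscales_comp (lebn_translate (x *: b)) (And3 d0 mD hD).
  have := t3 g (msec _) (fun=> f0 _); rewrite mul1r -(hD g (msec _) (fun=> f0 _)) => <-.
  apply: eq_integral => y _; rewrite /g; congr f.
  by rewrite [LHS]mulmx_cons mulmx0 !mxE eqxx mulr1n [in LHS](addrC (x *: b)).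
have mF : measurable_fun setT (fun x : measurableTypeR R => \int[lebn n]_y f (rV_cons (x, y)))%E.
  apply: (@measurable_fun_fubini_tonelli_F _ _ _ _ _ (lebn n) (f \o @rV_cons R n)).
    exact: measurableT_comp.
  by move=> z; exact: f0.
have F0 (x : measurableTypeR R) : (0 <= \int[lebn n]_y f (rV_cons (x, y)))%E.
  exact: integral_ge0.
have [_ mm h] := @lam_affine a 0 a0.
have mG := measurableT_comp mF mm.
transitivity (d%:E * \int[lam]_x \int[lebn n]_y f (rV_cons ((a * x + 0)%R : measurableTypeR R, y)))%E.
  apply: (@ge0_integralZl _ _ _ lam setT measurableT _ mG d%:E).
    by move=> x _; exact: F0.
  by rewrite lee_fin ltW.
by rewrite (h _ mF F0) muleA -EFinM (mulrC d).
Qed.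

Lemma lebn_lblock n (c : 'cV[R]_n) :
  mscales (lebn n.+1) (fun x => x *m (block_mx (1%:M : 'M[R]_1) 0 c 1%:M)) 1.
Proof.
have mB : measurable_fun setT (fun x : 'rV[R]_n.+1 => x *m block_mx (1%:M : 'M[R]_1) 0 c 1%:M).
  exact: measurable_rVM.
split => //.
move=> f mf f0; rewrite mul1e (@lebn_intS' n f mf f0) (@lebn_intS' n (fun x => f (x *m _))); last 2 first.
- exact: measurableT_comp.
- by move=> x; exact: f0.
have mcons : measurable_fun setT (@rV_cons R n) := @measurable_rV_cons R n.
apply: eq_integral => y _.
have [_ _ h] := @lam_affine 1 ((y *m c) 0 0) (oner_neq0 _).
have := h (fun x => f (rV_cons (x, y))).
rewrite normr1 invr1 mul1e => <- //.
  by apply: eq_integral => x _; rewrite mulmx_cons mulmx1 scaler0 add0r mxE eqxx mulr1n.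
by apply: (measurableT_comp mf); apply: (measurableT_comp mcons).
Qed.

(** Gaussian elimination by induction on the dimension: with a non-zero corner entry, [A] is a lower
    unipotent block matrix times an upper triangular one, and each factor acts by affine maps on the
    fibres of one coordinate splitting. *)
Lemma lebn_mulmx n (A : 'M[R]_n) : A \in unitmx ->
  mscales (lebn n) (fun x => x *m A) (`|\det A|^-1).
Proof.
elim: n A => [|n IH] A uA.
  split; [by rewrite det_mx00 normr1 invr1|exact: measurable_rVM|].
  move=> f mf f0; rewrite !lebn_int0 det_mx00 normr1 invr1 mul1e.
  by rewrite (thinmx0 (0 *m A)).
(* If the corner vanishes, some other row has a non-zero first entry; adding it to the top row is a
   shear of determinant 1. *)
wlog A00 : A uA / A 0 0 != 0.
  move=> wl; have [A00|] := eqVneq (A 0 0) 0; last exact: wl.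
  have [i Ai] : exists i, A i 0 != 0.
    apply: contrapT => /forallNP h; move: uA; rewrite unitmxE unitfE => /eqP; apply.
    rewrite (expand_det_col A 0) big1// => i _.
    by have /negP := h i; rewrite negbK => /eqP ->; rewrite mul0r.
  have : exists j : 'I_n, i = lift 0 j.
    case: (unliftP 0 i) => [j ->|e]; first by exists j.
    by rewrite e A00 eqxx in Ai.
  move=> [j ij].
  pose E (s : R) : 'M[R]_n.+1 := block_mx (1%:M : 'M[R]_1) (s *: delta_mx 0 j) 0 1%:M.
  have dE s : \det (E s) = 1 by rewrite /E (@det_ublock _ 1 n) !det1 mulr1.
  have EE : E (-1) *m E 1 = 1%:M.
    rewrite /E (@mulmx_block _ 1 n 1 n 1 n) !(mul1mx, mulmx1, mul0mx, mulmx0, addr0, add0r).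
    by rewrite scale1r scaleN1r subrr -scalar_mx_block.
  have EA : A = E (-1) *m (E 1 *m A) by rewrite mulmxA EE mul1mx.
  have uE s : E s \in unitmx by rewrite unitmxE dE unitr1.
  have E00 : (E 1 *m A) 0 0 != 0.
    rewrite mxE big_ord_recl A00 mulr0 add0r (bigD1 j)//= big1 ?addr0.
      rewrite -ij (_ : E 1 0 i = 1) ?mul1r//.
      transitivity (E 1 (@lshift 1 n 0) (rshift 1 j)).
        by rewrite ij; congr (E 1 _ _); exact: val_inj.
      by rewrite (@block_mxEur _ 1 n 1 n) !mxE !eqxx mulr1.
    move=> k kj; rewrite (_ : E 1 0 (lift 0 k) = 0) ?mul0r//.
    transitivity (E 1 (@lshift 1 n 0) (rshift 1 k)).
      by congr (E 1 _ _); exact: val_inj.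
    by rewrite (@block_mxEur _ 1 n 1 n) !mxE (negbTE kj) andbF mulr0.
  have h1 := wl (E 1 *m A) (ltac:(by rewrite unitmx_mul uE uA)) E00.
  have [|] := @lebn_ublock n 1 (-1 *: delta_mx 0 j) 1%:M 1 (oner_neq0 _).
    split => //; first exact: measurable_rVM.
    by move=> f mf f0; rewrite mul1e; apply: eq_integral => x _; rewrite mulmx1.
  move=> e1 e2 e3.
  have := mscales_comp h1 (And3 e1 e2 e3).
  rewrite normr1 invr1 !mulr1 det_mulmx dE mul1r.
  rewrite (_ : (fun x => _) = fun x => x *m A)//.
  by apply/funext => x; rewrite -mulmxA; congr (_ *m _); exact/esym/EA.
have [a [b [c [D AE]]]] : exists a b c D, A = block_mx (a%:M : 'M[R]_1) b c D :> 'M[R]_(1 + n).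
  exists (A 0 0), (ursubmx (A : 'M[R]_(1 + n))), (dlsubmx (A : 'M[R]_(1 + n))), (drsubmx (A : 'M[R]_(1 + n))).
  rewrite -[LHS](@submxK _ 1 n 1 n); congr block_mx.
  by apply/matrixP => i j; rewrite !ord1 !mxE eqxx mulr1n; congr (A _ _); exact: val_inj.
have a0 : a != 0.
  move: A00; rewrite (_ : A 0 0 = A (@lshift 1 n 0) (@lshift 1 n 0)); last first.
    by congr (A _ _); exact: val_inj.
  by rewrite AE (@block_mxEul _ 1 n 1 n) mxE eqxx mulr1n.
pose D' := D - a^-1 *: (c *m b).
have fac : A = block_mx (1%:M : 'M[R]_1) 0 (a^-1 *: c) 1%:M *m block_mx (a%:M : 'M[R]_1) b 0 D'.
  rewrite (@mulmx_block _ 1 n 1 n 1 n) !(mul1mx, mulmx1, mul0mx, mulmx0, addr0, add0r) AE.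
  have -> : a^-1 *: c *m a%:M = c by rewrite mul_mx_scalar scalerA mulfV// scale1r.
  by have -> : a^-1 *: c *m b + D' = D by rewrite /D' -scalemxAl addrC subrK.
have dA : \det A = a * \det D'.
  by rewrite fac det_mulmx (@det_lblock _ 1 n) (@det_ublock _ 1 n) !det1 !mul1r det_scalar1.
have uD : D' \in unitmx.
  by move: uA; rewrite !unitmxE !unitfE dA mulf_eq0 negb_or => /andP[].
have := mscales_comp (lebn_ublock b a0 (IH D' uD)) (lebn_lblock (a^-1 *: c)).
rewrite mulr1 dA normrM invfM.
rewrite (_ : (fun x => _) = fun x => x *m A)//.
by apply/funext => x; rewrite -mulmxA -fac.
Qed.

End lebn.
Arguments lebn : clear implicits.

(** * The spaces L^1 and L^2 *)

Lemma ccvg_ev (I : Type) (F : set_system I) (FF : Filter F) (R : realType) (z : I -> R[i]) a :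
  (\forall k \near F, z k = a) -> ccvg F z a.
Proof.
move=> h; apply: cvg_near_cst; apply: filterS h => k ->.
by rewrite subrr normc0.
Qed.

Section L2_basics.
Context d (T : measurableType d) (R : realType) (mu : {measure set T -> \bar R}).
Implicit Types f g : T -> R[i].

Lemma nneg_int_le (h k : T -> R) : measurable_fun setT h -> measurable_fun setT k ->
  (forall x, 0 <= h x <= k x) -> (\int[mu]_x (h x)%:E <= \int[mu]_x (k x)%:E)%E.
Proof.
move=> mh mk hk; apply: ge0_le_integral => //.
- by move=> x _; rewrite lee_fin; case/andP: (hk x).
- exact/measurable_EFinP.
- exact/measurable_EFinP.
- by move=> x _; rewrite lee_fin; case/andP: (hk x).
Qed.

Lemma msq f : mc f -> measurable_fun setT (fun x => normc (f x) ^+ 2).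
Proof. by move=> mf; apply: measurable_funX; exact: mc_normc. Qed.

Lemma L2c_int f : L2c mu f -> mu.-integrable setT (EFin \o (fun x => normc (f x) ^+ 2)).
Proof.
move=> [mf f2]; apply: rint_fin => //; first exact: msq.
by move=> x; rewrite exprn_ge0// normc_ge0.
Qed.
Lemma L2c_dom f (h : T -> R) : mc f -> mu.-integrable setT (EFin \o h) ->
  (forall x, normc (f x) ^+ 2 <= h x) -> L2c mu f.
Proof.
move=> mf ih fh; split => //; apply: rint_lty => [|x]; last by rewrite exprn_ge0// normc_ge0.
apply: rint_le ih => [|x]; first exact: msq.
by rewrite ger0_norm ?exprn_ge0 ?normc_ge0.
Qed.
Lemma L2cZ c f : L2c mu f -> L2c mu (fun x => c * f x).
Proof.
move=> f2; apply: (@L2c_dom _ (fun x => normc c ^+ 2 * normc (f x) ^+ 2)).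
- by apply: mcM; [exact: mc_cst|case: f2].
- by apply: rintZ; exact: L2c_int.
- by move=> x; rewrite normcM exprMn.
Qed.
Lemma sqD_le (a b : R) : (a + b) ^+ 2 <= 2 * a ^+ 2 + 2 * b ^+ 2.
Proof. by have := sqr_ge0 (a - b); rewrite !expr2; lra. Qed.
Lemma normcD_sq (z w : R[i]) : normc (z + w) ^+ 2 <= 2 * normc z ^+ 2 + 2 * normc w ^+ 2.
Proof.
apply: le_trans (sqD_le _ _); rewrite ler_pXn2r ?nnegrE ?addr_ge0 ?normc_ge0//.
exact: normcD_le.
Qed.
Lemma L2cD f g : L2c mu f -> L2c mu g -> L2c mu (fun x => f x + g x).
Proof.
move=> f2 g2; apply: (@L2c_dom _ (fun x => 2 * normc (f x) ^+ 2 + 2 * normc (g x) ^+ 2)).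
- by apply: mcD; [case: f2|case: g2].
- by apply: rintD; apply: rintZ; exact: L2c_int.
- by move=> x; exact: normcD_sq.
Qed.
Lemma L2cN f : L2c mu f -> L2c mu (fun x => - f x).
Proof.
move=> f2; apply: (@L2c_dom _ (fun x => normc (f x) ^+ 2)).
- by apply: mcN; case: f2.
- exact: L2c_int.
- by move=> x; rewrite normcN.
Qed.
Lemma L2cB f g : L2c mu f -> L2c mu g -> L2c mu (fun x => f x - g x).
Proof. by move=> f2 g2; apply: L2cD => //; exact: L2cN. Qed.
Lemma L2c0 : L2c mu (fun=> 0).
Proof. by split; [exact: mc_cst|rewrite /L2n normc0 expr0n integral0]. Qed.
Lemma L2c_conj f : L2c mu f -> L2c mu (fun x => (f x)^*%C).
Proof.
move=> f2; apply: (@L2c_dom _ (fun x => normc (f x) ^+ 2)).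
- by apply: mc_conj; case: f2.
- exact: L2c_int.
- by move=> x; rewrite normc_conj.
Qed.
Lemma L2c_bound f g (M : R) : L2c mu f -> mc g -> (forall x, normc (g x) <= M) ->
  L2c mu (fun x => f x * g x).
Proof.
move=> f2 mg gM; apply: (@L2c_dom _ (fun x => M ^+ 2 * normc (f x) ^+ 2)).
- by apply: mcM => //; case: f2.
- by apply: rintZ; exact: L2c_int.
- move=> x; rewrite normcM exprMn mulrC ler_wpM2r ?exprn_ge0 ?normc_ge0//.
  by rewrite ler_pXn2r// ?nnegrE ?normc_ge0// (le_trans _ (gM x))// normc_ge0.
Qed.
Lemma L2cM f g : L2c mu f -> L2c mu g -> L1c mu (fun x => f x * g x).
Proof.
move=> f2 g2; apply: (@L1c_dom _ _ _ _ _ (fun x => normc (f x) ^+ 2 + normc (g x) ^+ 2)).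
- by apply: mcM; [case: f2|case: g2].
- by apply: rintD; exact: L2c_int.
- move=> x; rewrite normcM; have := sqr_ge0 (normc (f x) - normc (g x)).
  have := normc_ge0 (f x); have := normc_ge0 (g x).
  by rewrite !expr2; nra.
Qed.

Lemma L2n_ae f g : mc f -> mc g -> {ae mu, forall x, f x = g x} -> L2n mu f = L2n mu g.
Proof.
move=> mf mg fg; apply: ge0_ae_eq_integral => //.
- by apply/measurable_EFinP; exact: msq.
- by apply/measurable_EFinP; exact: msq.
- by move=> x _; rewrite lee_fin exprn_ge0// normc_ge0.
- by move=> x _; rewrite lee_fin exprn_ge0// normc_ge0.
- by apply: filterS fg => x ->.
Qed.
Lemma L1n_ae f g : mc f -> mc g -> {ae mu, forall x, f x = g x} -> L1n mu f = L1n mu g.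
Proof.
move=> mf mg fg; apply: ge0_ae_eq_integral => //.
- by apply/measurable_EFinP; exact: mc_normc.
- by apply/measurable_EFinP; exact: mc_normc.
- by move=> x _; rewrite lee_fin normc_ge0.
- by move=> x _; rewrite lee_fin normc_ge0.
- by apply: filterS fg => x ->.
Qed.
Lemma L2nD f g : mc f -> mc g ->
  (L2n mu (fun x => (f x + g x)%R) <= 2%:E * L2n mu f + 2%:E * L2n mu g)%E.
Proof.
move=> mf mg; have m1 := msq mf; have m2 := msq mg.
apply: (@le_trans _ _ (\int[mu]_x (2 * normc (f x) ^+ 2 + 2 * normc (g x) ^+ 2)%R%:E)%E).
  apply: nneg_int_le; first by apply: msq; exact: mcD.
    by apply: measurable_funD; exact: measurable_funM.
  by move=> x; rewrite exprn_ge0 ?normc_ge0//= normcD_sq.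
under eq_integral => x _ do rewrite EFinD (EFinM 2 (normc (f x) ^+ 2)) (EFinM 2 (normc (g x) ^+ 2)).
have e0 (h : T -> R[i]) x : (0 <= (normc (h x) ^+ 2)%:E)%E by rewrite lee_fin exprn_ge0// normc_ge0.
rewrite ge0_integralD//; last 4 first.
- by move=> x _; rewrite mule_ge0.
- by apply: measurable_funeM; exact/measurable_EFinP.
- by move=> x _; rewrite mule_ge0.
- by apply: measurable_funeM; exact/measurable_EFinP.
by rewrite !ge0_integralZl//; exact/measurable_EFinP.
Qed.
Lemma L2n_eq0 f : mc f -> L2n mu f = 0%E -> {ae mu, forall x, f x = 0}.
Proof.
move=> mf f0.
have mf2 : measurable_fun setT (fun x => (normc (f x) ^+ 2)%:E) by apply/measurable_EFinP; exact: msq.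
have : (\int[mu]_x `|(normc (f x) ^+ 2)%:E| = 0)%E.
  by rewrite -[RHS]f0; apply: eq_integral => x _; rewrite gee0_abs// lee_fin exprn_ge0// normc_ge0.
move/(ae_eq_integral_abs mu measurableT mf2).1.
apply: filterS => x /= /(_ I) [] /eqP; rewrite sqrf_eq0 => /eqP h.
exact: eq0_normc.
Qed.
Lemma L1n_eq0 f : mc f -> L1n mu f = 0%E -> {ae mu, forall x, f x = 0}.
Proof.
move=> mf f0.
have mf2 : measurable_fun setT (fun x => (normc (f x))%:E) by apply/measurable_EFinP; exact: mc_normc.
have : (\int[mu]_x `|(normc (f x))%:E| = 0)%E.
  by rewrite -[RHS]f0; apply: eq_integral => x _; rewrite gee0_abs// lee_fin normc_ge0.
move/(ae_eq_integral_abs mu measurableT mf2).1.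
by apply: filterS => x /= /(_ I) [] h; exact: eq0_normc.
Qed.
Lemma L1nD f g : mc f -> mc g ->
  (L1n mu (fun x => (f x + g x)%R) <= L1n mu f + L1n mu g)%E.
Proof.
move=> mf mg; have m1 := mc_normc mf; have m2 := mc_normc mg.
rewrite /L1n -ge0_integralD//; last 4 first.
- by move=> x _; rewrite lee_fin normc_ge0.
- exact/measurable_EFinP.
- by move=> x _; rewrite lee_fin normc_ge0.
- exact/measurable_EFinP.
under [leRHS]eq_integral do rewrite -EFinD.
apply: nneg_int_le; first by apply: mc_normc; exact: mcD.
  exact: measurable_funD.
by move=> x; rewrite normc_ge0/= normcD_le.
Qed.
Lemma ccvg_ReIm (z : nat -> R[i]) a : ccvg \oo z a <->
  (complex.Re (z k) @[k --> \oo] --> complex.Re a) /\ (complex.Im (z k) @[k --> \oo] --> complex.Im a).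
Proof.
split => [h|[h1 h2]]; first by split; [exact: ccvg_Re|exact: ccvg_Im].
by rewrite (_ : a = (complex.Re a +i* complex.Im a)%C); [exact: ccvgP|case: (a)].
Qed.
Lemma mc_cvg (f_ : nat -> T -> R[i]) f : (forall k, mc (f_ k)) ->
  (forall x, ccvg \oo (fun k => f_ k x) (f x)) -> mc f.
Proof.
move=> mf ff; split.
- apply: (@measurable_fun_cvg _ _ _ _ (fun k x => complex.Re (f_ k x))).
    by move=> k; case: (mf k).
  by move=> x _; case: ((ccvg_ReIm _ _).1 (ff x)).
- apply: (@measurable_fun_cvg _ _ _ _ (fun k x => complex.Im (f_ k x))).
    by move=> k; case: (mf k).
  by move=> x _; case: ((ccvg_ReIm _ _).1 (ff x)).
Qed.

Lemma real_dct0 (h : nat -> T -> R) (G : T -> R) : (forall k, measurable_fun setT (h k)) ->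
  mu.-integrable setT (EFin \o G) -> (forall k x, 0 <= h k x <= G x) ->
  {ae mu, forall x, h k x @[k --> \oo] --> (0 : R)} ->
  (\int[mu]_x (h k x)%:E)%E @[k --> \oo] --> (0 : \bar R).
Proof.
move=> mh iG hG h0.
have mh' k : measurable_fun setT (fun x => (h k x)%:E) by exact/measurable_EFinP.
have h0' : {ae mu, forall x, setT x -> (h k x)%:E @[k --> \oo] --> (0%E : \bar R)}.
  by apply: filterS h0 => x hx _; apply: cvg_EFin => //; exact: nearW.
have hG' : {ae mu, forall x k, setT x -> (`|(h k x)%:E| <= (EFin \o G) x)%E}.
  by apply: aeW => x k _ /=; rewrite lee_fin ger0_norm; case/andP: (hG k x).
have [_ _] := dominated_convergence measurableT mh' (measurable_cst _) h0' iG hG'.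
by rewrite integral0.
Qed.

Lemma dct_L1 (f_ : nat -> T -> R[i]) f (G : T -> R) : (forall k, mc (f_ k)) -> mc f ->
  mu.-integrable setT (EFin \o G) -> (forall k x, normc (f_ k x) <= G x) ->
  (forall x, normc (f x) <= G x) ->
  {ae mu, forall x, ccvg \oo (fun k => f_ k x) (f x)} ->
  L1n mu (fun x => f_ k x - f x) @[k --> \oo] --> (0 : \bar R).
Proof.
move=> mf_ mf iG fG f_G ff.
apply: (@real_dct0 (fun k x => normc (f_ k x - f x)) (fun x => 2 * G x)) => //.
- by move=> k; apply: mc_normc; exact: mcB.
- exact: rintZ.
- move=> k x; rewrite normc_ge0/= (le_trans (normcB_le _ _))//.
  by have := fG k x; have := f_G x; lra.
Qed.
Lemma dct_L2 (f_ : nat -> T -> R[i]) f (G : T -> R) : (forall k, mc (f_ k)) -> mc f ->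
  mu.-integrable setT (EFin \o G) -> (forall k x, normc (f_ k x) ^+ 2 <= G x) ->
  (forall x, normc (f x) ^+ 2 <= G x) ->
  {ae mu, forall x, ccvg \oo (fun k => f_ k x) (f x)} ->
  L2n mu (fun x => f_ k x - f x) @[k --> \oo] --> (0 : \bar R).
Proof.
move=> mf_ mf iG fG f_G ff.
apply: (@real_dct0 (fun k x => normc (f_ k x - f x) ^+ 2) (fun x => 4 * G x)) => //.
- by move=> k; apply: msq; exact: mcB.
- exact: rintZ.
- move=> k x; rewrite exprn_ge0 ?normc_ge0//=.
  have := normcD_sq (f_ k x) (- f x); rewrite normcN.
  by have := fG k x; have := f_G x; lra.
- apply: filterS ff => x fx; rewrite -(mulr0 0).
  by under eq_fun do rewrite expr2; exact: cvgM.
Qed.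
Lemma L1n_cvg_cint (f_ : nat -> T -> R[i]) f : (forall k, L1c mu (f_ k)) -> L1c mu f ->
  L1n mu (fun x => f_ k x - f x) @[k --> \oo] --> (0 : \bar R) ->
  ccvg \oo (fun k => cint mu (f_ k)) (cint mu f).
Proof.
move=> f_1 f1 h; have h1 : fine (L1n mu (fun x => f_ k x - f x)) @[k --> \oo] --> (0 : R).
  exact: (@fine_cvg _ _ _ _ _ 0 h).
apply: norm0_cvg h1 => k; apply/andP; split; first exact: normc_ge0.
by rewrite -cintB//; apply: cint_le; exact: L1cB.
Qed.
Lemma dct_cint (f_ : nat -> T -> R[i]) f (G : T -> R) : (forall k, mc (f_ k)) -> mc f ->
  mu.-integrable setT (EFin \o G) -> (forall k x, normc (f_ k x) <= G x) ->
  (forall x, normc (f x) <= G x) ->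
  {ae mu, forall x, ccvg \oo (fun k => f_ k x) (f x)} ->
  ccvg \oo (fun k => cint mu (f_ k)) (cint mu f).
Proof.
move=> mf_ mf iG fG f_G ff; apply: L1n_cvg_cint.
- by move=> k; exact: L1c_dom iG (fG k).
- exact: L1c_dom iG f_G.
- exact: dct_L1 iG fG f_G ff.
Qed.

Lemma L1c_null f : L1c mu f ->
  (forall E, measurable E -> cint mu (fun x => f x * ((\1_E x : R)%:C)%C) = 0) ->
  {ae mu, forall x, f x = 0}.
Proof.
move=> f1 h.
have [mR mI] := f1.1.
have key (g : T -> R) : mu.-integrable setT (EFin \o g) ->
    (forall E, measurable E -> \int[mu]_x (g x * \1_E x) = 0) -> {ae mu, forall x, g x = 0}.
  move=> ig hg.
  have := @integral_ae_eq _ _ _ mu setT measurableT (fun=> 0%E) (EFin \o g) ig.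
  move=> /(_ (measurable_cst _)) H.
  have : ae_eq mu setT (EFin \o g) (fun=> 0%E).
    apply: H => E _ mE; rewrite integral0 integral_mkcond.
    have := hg E mE; rewrite /Rintegral.
    rewrite (_ : (fun x => (g x * \1_E x)%:E) = (EFin \o g) \_ E); last first.
      apply/funext => x; rewrite /patch indicE; case: (x \in E); rewrite ?mulr1 ?mulr0//.
    move=> e; rewrite -[LHS]fineK ?e//.
    rewrite -integral_mkcond; apply: integrable_fin_num => //.
    exact: integrableS ig.
  by apply: filterS => x /= /(_ I) [].
have hR : {ae mu, forall x, complex.Re (f x) = 0}.
  apply: key => [|E mE]; first exact: L1c_Re.
  have := congr1 (@complex.Re R) (h E mE); rewrite /= => <-.
  by apply: eq_Rintegral => x _; rewrite cReM/= mulr0 subr0.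
have hI : {ae mu, forall x, complex.Im (f x) = 0}.
  apply: key => [|E mE]; first exact: L1c_Im.
  have := congr1 (@complex.Im R) (h E mE); rewrite /= => <-.
  by apply: eq_Rintegral => x _; rewrite cImM/= mulr0 add0r.
by apply: filterS2 hR hI => x e1 e2; exact: eqcP.
Qed.

End L2_basics.

(** * Completeness of L^2 *)

Section riesz_fischer.
Context (R : realType).

Lemma cvg_half : (2^-1 : R) ^+ k @[k --> \oo] --> (0 : R).
Proof. by apply: cvg_expr; rewrite ger0_norm ?invf_lt1 ?ltr1n. Qed.

(** Adding the tail [2 c / 2 ^ k] of the dominating geometric series makes the sequence
    non-increasing, and monotone convergence applies. *)
Lemma cauchy_geom (r : nat -> R) (c : R) :
  (forall k, `|r k.+1 - r k| <= c * 2^-1 ^+ k) -> cvgn r.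
Proof.
move=> rc.
pose s k := r k + 2 * c * 2^-1 ^+ k.
have c0 : 0 <= c by have := rc 0%N; rewrite expr0 mulr1; exact: le_trans.
have hs : {homo s : n m / (n <= m)%N >-> m <= n}.
  apply/nonincreasing_seqP => k; rewrite /s exprS.
  have := rc k; rewrite ler_norml => /andP[_ h].
  rewrite (_ : 2 * c * (2^-1 * 2^-1 ^+ k) = c * 2^-1 ^+ k); last by field.
  by move: h; set q := c * _; rewrite -mulrA -/q; lra.
have lb k : r 0%N - 2 * c + 2 * c * 2^-1 ^+ k <= r k.
  elim: k => [|k IH]; first by rewrite expr0 mulr1 subrK.
  have := rc k; rewrite ler_norml => /andP[h _]; move: IH h; rewrite exprS.
  rewrite (_ : 2 * c * (2^-1 * 2^-1 ^+ k) = c * 2^-1 ^+ k); last by field.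
  by rewrite -[2 * c * 2^-1 ^+ k]mulrA; set q := c * _; lra.
have cs : cvgn s.
  apply: (nonincreasing_is_cvgn hs); exists (r 0%N - 2 * c) => _ [k _ <-].
  have := lb k; rewrite /s => h.
  have : 0 <= c * 2^-1 ^+ k by rewrite mulr_ge0// exprn_ge0.
  by move: h; rewrite -mulrA; set q := c * _; lra.
have -> : r = fun k => s k - 2 * c * 2^-1 ^+ k by apply/funext => k; rewrite /s addrK.
apply: is_cvgB => //; apply/cvg_ex; exists (2 * c * 0).
by apply: cvgM; [exact: cvg_cst|exact: cvg_half].
Qed.

Context d (T : measurableType d) (mu : {measure set T -> \bar R}).

Lemma fatou_L2 (F : nat -> T -> R[i]) (f : T -> R[i]) (e : R) :
  (forall m, mc (F m)) -> (forall x, ccvg \oo (fun m => F m x) (f x)) ->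
  (forall m, (L2n mu (F m) <= e%:E)%E) -> (L2n mu f <= e%:E)%E.
Proof.
move=> mF Ff Fe.
have mF2 m : measurable_fun setT (fun x => (normc (F m x) ^+ 2)%:E).
  by apply/measurable_EFinP; exact: msq.
have F0 m x : setT x -> (0 <= (normc (F m x) ^+ 2)%:E)%E.
  by move=> _; rewrite lee_fin exprn_ge0// normc_ge0.
have := fatou mu measurableT mF2 F0.
rewrite (eq_integral (fun x => (normc (f x) ^+ 2)%:E)); last first.
  move=> x _; apply: (cvg_limn_einf_sup _).1; apply: cvg_EFin; first exact: nearW.
  have h := ccvg_normc (Ff x) _; rewrite /comp /=.
  by under eq_fun do rewrite expr2; rewrite expr2; apply: cvgM; exact: h.
move=> /le_trans; apply; rewrite limn_einf_lim.
apply: lime_le; first exact: is_cvg_einfs.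
apply: nearW => n; apply: le_trans (Fe n).
by apply: ereal_inf_lbound; exists n => //=.
Qed.

Lemma L2n_if (A : set T) (f : T -> R[i]) : measurable A -> mc f ->
  (L2n mu (fun x => (f x * ((\1_A x)%:C)%C)%R) <= L2n mu f)%E.
Proof.
move=> mA mf; apply: nneg_int_le; [by apply: msq; exact: mc_if|exact: msq|].
move=> x; rewrite exprn_ge0 ?normc_ge0//= normcM normc_real indicE.
by case: (x \in A); rewrite ?normr1 ?mulr1// normr0 mulr0 expr0n exprn_ge0// normc_ge0.
Qed.

Theorem riesz_fischer (u : nat -> T -> R[i]) : (forall k, L2c mu (u k)) ->
  (forall e : R, 0 < e -> exists N, forall m n, (N <= m)%N -> (N <= n)%N ->
    (L2n mu (fun x => u m x - u n x)%R < e%:E)%E) ->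
  exists f, L2c mu f /\ L2n mu (fun x => u n x - f x)%R @[n --> \oo] --> (0 : \bar R).
Proof.
move=> u2 uC.
(* The rate 8^-k on squared norms leaves room for weights 4^k: the weighted squares still have total
   integral at most 2, and finiteness of their sum [S] at a point gives increments of size
   [sqrt S / 2 ^ k] there. *)
have e8 k : 0 < 8^-1 ^+ k :> R by rewrite exprn_gt0.
pose N k := projT1 (cid (uC _ (e8 k))).
have NP k m n : (N k <= m)%N -> (N k <= n)%N ->
    (L2n mu (fun x => u m x - u n x)%R < (8^-1 ^+ k)%:E)%E by rewrite /N; case: cid => /= ? h; exact: h.
(* The sum dominates every [N i] with [i <= k], and the summand [k] makes the extraction go to
   infinity. *)
pose phi k := (\sum_(i < k.+1) N i + k)%N.
have phiN k m : (k <= m)%N -> (N k <= phi m)%N.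
  move=> km; rewrite /phi (bigD1 (Ordinal (km : (k < m.+1)%N)))//= -!addnA leq_addr//.
have phik k : (k <= phi k)%N by rewrite /phi leq_addl.
pose v k := u (phi k).
have mv k : mc (v k) by case: (u2 (phi k)).
pose g k x := 4 ^+ k * normc (v k.+1 x - v k x) ^+ 2.
have mg k : measurable_fun setT (fun x => (g k x)%:E).
  by apply/measurable_EFinP; apply: measurable_funM => //; apply: msq; exact: mcB.
have g0 k x : (0 <= (g k x)%:E)%E.
  by rewrite lee_fin mulr_ge0 ?exprn_ge0 ?normc_ge0.
have ig k : (\int[mu]_x (g k x)%:E <= (2^-1 ^+ k)%:E)%E.
  under eq_integral do rewrite EFinM.
  rewrite ge0_integralZl//; first last.
  - by move=> x _; rewrite lee_fin exprn_ge0// normc_ge0.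
  - by apply/measurable_EFinP; apply: msq; exact: mcB.
  have h := ltW (NP k (phi k.+1) (phi k) (phiN _ _ (leqnSn _)) (phiN _ _ (leqnn _))).
  apply: (@le_trans _ _ ((4 ^+ k)%:E * (8^-1 ^+ k)%:E)%E).
    by apply: lee_wpmul2l => //; rewrite lee_fin exprn_ge0.
  rewrite -EFinM lee_fin -exprMn.
  by rewrite (_ : 4 * 8^-1 = 2^-1 :> R)//; field.
pose S x := (\sum_(0 <= k <oo) (g k x)%:E)%E.
have mS : measurable_fun setT S by apply: ge0_emeasurable_sum => // k x _ _; exact: g0.
have iS : (\int[mu]_x S x <= 2%:E)%E.
  rewrite /S integral_nneseries//.
  apply: lime_le; first by apply: is_cvg_nneseries => n _ _; apply: integral_ge0 => x _; exact: g0.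
  apply: nearW => n; apply: (@le_trans _ _ (\sum_(0 <= k < n) (2^-1 ^+ k)%:E)%E).
    by apply: lee_sum.
  rewrite sumEFin lee_fin.
  have -> : \sum_(0 <= k < n) (2^-1 : R) ^+ k = 2 - 2 * 2^-1 ^+ n.
    elim: n => [|n IH]; first by rewrite big_nil expr0; ring.
    by rewrite big_nat_recr//= IH exprS; field.
  by rewrite gerBl mulr_ge0 ?exprn_ge0.
have S0 x : (0 <= S x)%E by apply: nneseries_ge0 => n _ _; exact: g0.
pose A := [set x | S x \is a fin_num].
have mA : measurable A.
  have := emeasurable_fin_num measurableT mS; rewrite setTI; exact.
have aeA : {ae mu, forall x, A x}.
  have iS' : mu.-integrable setT S.
    apply/integrableP; split => //.
    under eq_integral => x _ do rewrite gee0_abs//.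
    by rewrite (le_lt_trans iS)// ltry.
  by have := integrable_ae measurableT iS'; apply: filterS => x; apply.
have gS k x : A x -> g k x <= fine (S x).
  move=> Ax; rewrite -lee_fin fineK//.
  apply: le_trans (nneseries_lim_ge k.+1 _) => //.
  by rewrite big_nat_recr//= leeDr// sume_ge0// => i _; exact: g0.
have dv k x : A x -> normc (v k.+1 x - v k x) <= Num.sqrt (fine (S x)) * 2^-1 ^+ k.
  move=> Ax; have h := gS k x Ax.
  have S1 : 0 <= fine (S x) by rewrite fine_ge0.
  rewrite -(ler_pXn2r (n:=2))// ?nnegrE ?normc_ge0// ?mulr_ge0 ?sqrtr_ge0 ?exprn_ge0//.
  rewrite exprMn sqr_sqrtr// -exprM mulnC exprM.
  rewrite (_ : 2^-1 ^+ 2 = 4^-1 :> R); last by field.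
  by rewrite exprVn ler_pdivlMr ?exprn_gt0// mulrC.
(* Cutting off the null set where [S] is infinite makes the sequence converge everywhere, so that
   the limit is a measurable function. *)
pose v' k x := v k x * ((\1_A x : R)%:C)%C.
have mv' k : mc (v' k) by exact: mc_if.
have v'A k x : A x -> v' k x = v k x by move=> Ax; rewrite /v' indicE mem_set// mulr1.
have v'nA k x : ~ A x -> v' k x = 0 by move=> Ax; rewrite /v' indicE memNset// mulr0.
have [f ff] : exists f : T -> R[i], forall x, ccvg \oo (fun k => v' k x) (f x).
  suff h : forall x, exists l, ccvg \oo (fun k => v' k x) l.
    by have [f hf] := boolp.choice h; exists f.
  move=> x; have [Ax|nAx] := pselect (A x); last first.
    by exists 0; apply: ccvg_ext (ccvg_cst _) => k; rewrite v'nA.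
  have /cvg_ex[a ha] : cvgn (fun k => complex.Re (v' k x)).
    apply: (@cauchy_geom _ (Num.sqrt (fine (S x)))) => k.
    by rewrite !v'A// -cReB (le_trans (Re_le_normc _))// dv.
  have /cvg_ex[b hb] : cvgn (fun k => complex.Im (v' k x)).
    apply: (@cauchy_geom _ (Num.sqrt (fine (S x)))) => k.
    by rewrite !v'A// -cImB (le_trans (Im_le_normc _))// dv.
  by exists (a +i* b)%C; exact: ccvgP.
have mf : mc f by exact: mc_cvg mv' ff.
have aev k : {ae mu, forall x, v' k x = v k x} by apply: filterS aeA => x; exact: v'A.
have bound k e : (forall m, (k <= m)%N -> (L2n mu (fun x => v m x - v k x)%R <= e%:E)%E) ->
    (L2n mu (fun x => f x - v k x)%R <= e%:E)%E.
  move=> h; rewrite -(@L2n_ae _ _ _ mu (fun x => f x - v' k x)); first last.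
  - by apply: filterS (aev k) => x ->.
  - exact: mcB.
  - exact: mcB.
  apply: (@fatou_L2 (fun m x => v' (m + k)%N x - v' k x)).
  - by move=> m; exact: mcB.
  - move=> x; apply: ccvgB; last exact: ccvg_cst.
    by have := ff x; rewrite /ccvg => hx; apply: (cvg_comp (fun m => m + k)%N _ _ hx); exact: cvg_addnr.
  - move=> m; apply: le_trans (h (m + k)%N (leq_addl _ _)).
    rewrite (_ : (fun x => _) = fun x => (v (m + k)%N x - v k x) * ((\1_A x)%:C)%C).
      by apply: L2n_if => //; exact: mcB.
    by apply/funext => x; rewrite /v' mulrBl.
have f2 : L2c mu f.
  have h0 : (L2n mu (fun x => f x - v 0%N x)%R <= 1%:E)%E.
    apply: bound => m _; have := NP 0%N (phi m) (phi 0%N) (phiN _ _ (leq0n _)) (phiN _ _ (leqnn _)).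
    by rewrite expr0 => /ltW.
  rewrite (_ : f = fun x => (f x - v 0%N x) + v 0%N x); last by apply/funext => x; rewrite subrK.
  apply: L2cD; last exact: u2.
  by split; [exact: mcB|exact: le_lt_trans h0 (ltry _)].
exists f; split => //.
apply/fine_cvgP; split.
  by apply: nearW => n; apply: L2n_fin; exact: L2cB.
apply/cvgrPdist_le => e e0.
have e8' : 0 < e / 8 by rewrite divr_gt0.
have [M MP] := uC _ e8'.
exists M => // n Mn /=.
rewrite sub0r normrN ger0_norm ?fine_ge0 ?L2n_ge0//.
rewrite -lee_fin fineK; last by apply: L2n_fin; exact: L2cB.
have -> : (fun x => u n x - f x) = fun x => (u n x - v M x) + (- (f x - v M x)).
  by apply/funext => x; rewrite opprB addrA subrK.
have mun : mc (u n) by case: (u2 n).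
apply: le_trans (L2nD _ _ _) _; [exact: mcB|by apply: mcN; exact: mcB|].
have h1 : (L2n mu (fun x => u n x - v M x)%R <= (e / 8)%:E)%E by apply: ltW; apply: MP.
have h2 : (L2n mu (fun x => - (f x - v M x))%R <= (e / 8)%:E)%E.
  rewrite (_ : L2n mu _ = L2n mu (fun x => f x - v M x)%R).
    apply: bound => m Mm; apply: ltW; apply: MP => //.
    exact: leq_trans Mm (phik _).
  by apply: eq_integral => x _; rewrite normcN.
apply: le_trans (leeD (lee_wpmul2l _ h1) (lee_wpmul2l _ h2)) _; rewrite ?lee_fin//.
suff : forall r : R, 0 < r -> (2%:E * (r / 8)%:E + 2%:E * (r / 8)%:E <= r%:E)%E by apply.
move=> r r0; rewrite -!EFinM -EFinD lee_fin; move: r0; lra.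
Qed.

End riesz_fischer.

(** * L^2 as a Hilbert space *)

Section L2_hilbert.
Context d (T : measurableType d) (R : realType) (mu : {measure set T -> \bar R}).

Definition L2car := {f : T -> R[i] | L2c mu f}.
Implicit Types f g h : L2car.
Definition L2add f g : L2car := exist _ _ (L2cD (projT2 f) (projT2 g)).
Definition L2scl c f : L2car := exist _ _ (L2cZ c (projT2 f)).
Definition L2zero : L2car := exist _ _ (L2c0 mu).
Definition L2ip f g : R[i] := cint mu (fun x => projT1 f x * (projT1 g x)^*%C).

Lemma L2ip_L1 f g : L1c mu (fun x => projT1 f x * (projT1 g x)^*%C).
Proof. by apply: L2cM; [exact: projT2|apply: L2c_conj; exact: projT2]. Qed.
Lemma L2ip0l f : L2ip L2zero f = 0.
Proof. by rewrite /L2ip; under eq_fun do rewrite /= mul0r; rewrite cint0. Qed.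
Lemma L2ipDl f g h : L2ip (L2add f g) h = L2ip f h + L2ip g h.
Proof.
rewrite /L2ip -cintD; [|exact: L2ip_L1|exact: L2ip_L1].
by apply: eq_cint => x /=; rewrite mulrDl.
Qed.
Lemma L2ipZl c f g : L2ip (L2scl c f) g = c * L2ip f g.
Proof.
rewrite /L2ip -cintZ; last exact: L2ip_L1.
by apply: eq_cint => x /=; rewrite mulrA.
Qed.
Lemma L2ipJ f g : L2ip g f = ((L2ip f g)^*)%C.
Proof.
rewrite /L2ip -cint_conj; last exact: L2ip_L1.
by apply: eq_cint => x /=; rewrite conjcM conjcK mulrC.
Qed.
Lemma L2ipE f : L2ip f f = ((fine (L2n mu (projT1 f)))%:C)%C.
Proof.
rewrite /L2ip; under eq_fun do rewrite mul_conj.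
by rewrite cint_real.
Qed.
Lemma L2ip_ge0 f : 0 <= complex.Re (L2ip f f).
Proof. by rewrite L2ipE/= fine_ge0// L2n_ge0. Qed.
Lemma L2n_sub f g : complex.Re (L2ip (L2add f (L2scl (-1) g)) (L2add f (L2scl (-1) g))) =
  fine (L2n mu (fun x => projT1 f x - projT1 g x)).
Proof. by rewrite L2ipE/=; congr (fine (L2n _ _)); apply/funext => x; rewrite mulN1r. Qed.
Lemma L2complete (u : nat -> L2car) :
  (forall e : R, 0 < e -> exists N, forall m n, (N <= m)%N -> (N <= n)%N ->
      complex.Re (L2ip (L2add (u m) (L2scl (-1) (u n))) (L2add (u m) (L2scl (-1) (u n)))) < e) ->
    exists x, complex.Re (L2ip (L2add (u n) (L2scl (-1) x))
                     (L2add (u n) (L2scl (-1) x))) @[n --> \oo] --> (0 : R).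
Proof.
move=> uC; have [|f [f2 uf]] := @riesz_fischer _ _ _ mu (fun k => projT1 (u k)) (fun k => projT2 (u k)).
  move=> e e0; have [N h] := uC e e0; exists N => m n Nm Nn.
  have := h m n Nm Nn; rewrite L2n_sub => h'.
  rewrite -[X in (X < _)%E]fineK ?lte_fin//; apply: L2n_fin.
  by apply: L2cB; exact: projT2.
exists (exist _ f f2); under eq_fun do rewrite L2n_sub.
by move/fine_cvgP : uf => [].
Qed.

Definition L2H : preHilb R := PreHilb L2ip0l L2ipDl L2ipZl L2ipJ L2ip_ge0 L2complete.

Definition toL2 (f : T -> R[i]) (f2 : L2c mu f) : L2H := exist _ f f2.
Lemma n2_L2 (f : L2H) : n2 f = fine (L2n mu (projT1 f)).
Proof. exact: (congr1 (@complex.Re R) (L2ipE f)). Qed.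
Lemma ip_L2 (f g : L2H) : ip f g = cint mu (fun x => projT1 f x * (projT1 g x)^*%C).
Proof. by []. Qed.

End L2_hilbert.

Lemma mc_indic d (T : measurableType d) (R : realType) (A : set T) : measurable A ->
  mc (fun z => ((\1_A z : R)%:C)%C).
Proof. by move=> mA; apply: mc_real. Qed.

Lemma L1c_if d (T : measurableType d) (R : realType) (mu : {measure set T -> \bar R})
  (f : T -> R[i]) (A : set T) : measurable A -> L1c mu f ->
  L1c mu (fun z => f z * ((\1_A z : R)%:C)%C).
Proof.
move=> mA f1; apply: (@L1c_bound _ _ _ _ _ _ 1) => //; first exact: mc_indic.
by move=> z; rewrite normc_real indicE; case: (_ \in _); rewrite ?normr1 ?normr0.
Qed.

(** Sets over which [f] integrates to zero form a Dynkin system, so testing on a generating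
    pi-system is enough; the disjoint unions are handled by dominated convergence. *)
Lemma dynkin_null d (T : measurableType d) (R : realType) (mu : {measure set T -> \bar R})
  (G : set (set T)) (f : T -> R[i]) :
  @measurable _ T = <<s G >> -> setI_closed G -> L1c mu f -> cint mu f = 0 ->
  (forall A, G A -> cint mu (fun z => f z * ((\1_A z : R)%:C)%C) = 0) ->
  {ae mu, forall z, f z = 0}.
Proof.
move=> mG GI f1 hT h; apply: L1c_null => // E mE.
have fE E' : measurable E' -> L1c mu (fun z => f z * ((\1_E' z : R)%:C)%C).
  by move=> mE'; exact: L1c_if.
move: E mE; rewrite mG.
apply: dynkin_induction => //=.
- rewrite -[RHS]hT; apply: eq_cint => z; by rewrite indicE mem_set ?mulr1.
- move=> S mS hS.
  rewrite -[RHS](subrr (0 : R[i])) -{1}hT -hS -cintB//; last exact: fE.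
  apply: eq_cint => z; rewrite indicC !indicE /=.
  by case: (_ \in _); rewrite /= ?mulr1 ?mulr0 ?subr0 ?subrr.
move=> F mF tF hF.
pose U n := \big[setU/set0]_(i < n) F i.
have mU n : measurable (U n) by apply: bigsetU_measurable => i _; exact: mF.
have hU n : cint mu (fun z => f z * ((\1_(U n) z : R)%:C)%C) = 0.
  elim: n => [|n IH].
    by rewrite /U big_ord0 -[RHS](cint0 mu); apply: eq_cint => z; rewrite indicE in_set0 mulr0.
  rewrite /U big_ord_recr/= -/(U n) -[RHS](addr0 (0 : R[i])) -{1}IH -(hF n) -cintD; [|exact: fE|exact: fE].
  apply: eq_cint => z; rewrite -mulrDr -rcD; congr (_ * (_%:C)%C).
  rewrite !indicE in_setU; have [zU|zU] := boolP (z \in U n); have [zF|zF] := boolP (z \in F n); rewrite ?addr0 ?add0r//=.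
  exfalso; move: zU zF; rewrite !inE /U -bigcup_mkord => -[j /= jn Fj] Fn.
  have := tF j n I I; have jnn : j <> n by move=> e; rewrite e ltnn in jn.
  by move=> H; apply: jnn; apply: H; exists z.
have : ccvg \oo (fun n => cint mu (fun z => f z * ((\1_(U n) z : R)%:C)%C))
    (cint mu (fun z => f z * ((\1_(\bigcup_k F k) z : R)%:C)%C)).
  have le1 (S : set T) z : normc (f z * ((\1_S z : R)%:C)%C) <= normc (f z).
    rewrite normcM normc_real indicE; case: (_ \in _); rewrite ?normr1 ?mulr1//.
    by rewrite normr0 mulr0 normc_ge0.
  apply: (@dct_cint _ _ _ _ _ _ (fun z => normc (f z))).
  - by move=> k; exact: (fE _ (mU k)).1.
  - by apply: (fE _ _).1; exact: bigcupT_measurable.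
  - exact: L1c_int.
  - by move=> k z; exact: le1.
  - by move=> z; exact: le1.
  apply: nearW => z.
  have [[k _ Fk]|nF] := pselect ((\bigcup_k F k) z).
    apply: ccvg_ev; exists k.+1 => // n /= kn; congr (_ * (_%:C)%C).
    rewrite !indicE !mem_set//; first by exists k.
    by rewrite /U -bigcup_mkord; exists k.
  apply: ccvg_ev; apply: nearW => n; congr (_ * (_%:C)%C).
  rewrite !indicE !memNset// /U -bigcup_mkord => -[i _ Fi].
  by apply: nF; exists i.
move=> /ccvg_uniq; apply; apply: ccvg_ext (ccvg_cst _) => n; exact/esym/hU.
Qed.

(** * Fubini's theorem for complex functions *)

Section complex_fubini.
Context d1 d2 (T1 : measurableType d1) (T2 : measurableType d2) (R : realType).
Variables (m1 : {sigma_finite_measure set T1 -> \bar R}) (m2 : {sigma_finite_measure set T2 -> \bar R}).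
Implicit Types F : T1 * T2 -> R[i].

Lemma measurable_pairl (x : T1) : measurable_fun setT (fun y : T2 => (x, y)).
Proof. exact: measurable_fun_pair. Qed.
Lemma measurable_pairr (y : T2) : measurable_fun setT (fun x : T1 => (x, y)).
Proof. exact: measurable_fun_pair. Qed.

Lemma mc_slice1 F x : mc F -> mc (fun y => F (x, y)).
Proof. by move=> mF; exact: mc_comp (measurable_pairl x) mF. Qed.
Lemma mc_slice2 F y : mc F -> mc (fun x => F (x, y)).
Proof. by move=> mF; exact: mc_comp (measurable_pairr y) mF. Qed.

Lemma L1n_prod1 F : mc F -> L1n (m1 \x m2)%E F = (\int[m1]_x L1n m2 (fun y => F (x, y)))%E.
Proof.
move=> mF; apply: fubini_tonelli1 => [|x]; last by rewrite lee_fin normc_ge0.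
by apply/measurable_EFinP; exact: mc_normc.
Qed.
Lemma L1n_prod2 F : mc F -> L1n (m1 \x m2)%E F = (\int[m2]_y L1n m1 (fun x => F (x, y)))%E.
Proof.
move=> mF; apply: fubini_tonelli2 => [|x]; last by rewrite lee_fin normc_ge0.
by apply/measurable_EFinP; exact: mc_normc.
Qed.

Lemma L1c_slice1 F : L1c (m1 \x m2)%E F -> {ae m1, forall x, L1c m2 (fun y => F (x, y))}.
Proof.
move=> iF; have := ae_integrable1 (L1c_int iF); apply: filterS => x /= h.
split; first by apply: mc_slice1; case: iF.
by apply: rint_lty h _ => y; exact: normc_ge0.
Qed.
Lemma L1c_slice2 F : L1c (m1 \x m2)%E F -> {ae m2, forall y, L1c m1 (fun x => F (x, y))}.
Proof.
move=> iF; have := ae_integrable2 (L1c_int iF); apply: filterS => x /= h.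
split; first by apply: mc_slice2; case: iF.
by apply: rint_lty h _ => y; exact: normc_ge0.
Qed.

(** Holds for merely measurable [h]: Tonelli applies to the positive and negative parts, and [fine]
    assigns a value even where the integral diverges. *)
Let mRint1 (h : T1 * T2 -> R) : measurable_fun setT h ->
  measurable_fun setT (fun x => \int[m2]_y h (x, y)).
Proof.
move=> mh; rewrite (_ : (fun x => _) = fun x => fine (\int[m2]_y (EFin \o h)^\+ (x, y) -
    \int[m2]_y (EFin \o h)^\- (x, y))); last first.
  apply/funext => x; rewrite /Rintegral integralE.
  by congr (fine (_ - _)%E); apply: eq_integral => y _; rewrite ?funeposE ?funenegE.
apply: measurableT_comp => //; apply: emeasurable_funB.
  apply: (@measurable_fun_fubini_tonelli_F _ _ _ _ _ m2 ((EFin \o h)^\+%E)) => //.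
  by apply: measurable_funepos; exact/measurable_EFinP.
apply: (@measurable_fun_fubini_tonelli_F _ _ _ _ _ m2 ((EFin \o h)^\-%E)) => //.
by apply: measurable_funeneg; exact/measurable_EFinP.
Qed.
Let mRint2 (h : T1 * T2 -> R) : measurable_fun setT h ->
  measurable_fun setT (fun y => \int[m1]_x h (x, y)).
Proof.
move=> mh; rewrite (_ : (fun x => _) = fun y => fine (\int[m1]_x (EFin \o h)^\+ (x, y) -
    \int[m1]_x (EFin \o h)^\- (x, y))); last first.
  apply/funext => x; rewrite /Rintegral integralE.
  by congr (fine (_ - _)%E); apply: eq_integral => y _; rewrite ?funeposE ?funenegE.
apply: measurableT_comp => //; apply: emeasurable_funB.
  apply: (@measurable_fun_fubini_tonelli_G _ _ _ _ _ m1 ((EFin \o h)^\+%E)) => //.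
  by apply: measurable_funepos; exact/measurable_EFinP.
apply: (@measurable_fun_fubini_tonelli_G _ _ _ _ _ m1 ((EFin \o h)^\-%E)) => //.
by apply: measurable_funeneg; exact/measurable_EFinP.
Qed.

Lemma mc_cint1 F : mc F -> mc (fun x => cint m2 (fun y => F (x, y))).
Proof. by move=> [mr mi]; split; [exact: (mRint1 mr)|exact: (mRint1 mi)]. Qed.
Lemma mc_cint2 F : mc F -> mc (fun y => cint m1 (fun x => F (x, y))).
Proof. by move=> [mr mi]; split; [exact: (mRint2 mr)|exact: (mRint2 mi)]. Qed.

Let Rfub1 (h : T1 * T2 -> R) : (m1 \x m2)%E.-integrable setT (EFin \o h) ->
  \int[(m1 \x m2)%E]_z h z = \int[m1]_x \int[m2]_y h (x, y).
Proof.
move=> ih; rewrite /Rintegral -(integral12_prod_meas1 ih); congr fine.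
apply: ae_eq_integral => //.
- exact: (measurable_fubini_F ih).
- by apply/measurable_EFinP/mRint1/measurable_EFinP; exact: measurable_int ih.
have := ae_integrable1 ih; apply: filterS => x h1 _ /=.
by rewrite fineK//; exact: integrable_fin_num.
Qed.
Let Rfub2 (h : T1 * T2 -> R) : (m1 \x m2)%E.-integrable setT (EFin \o h) ->
  \int[(m1 \x m2)%E]_z h z = \int[m2]_y \int[m1]_x h (x, y).
Proof.
move=> ih; rewrite /Rintegral -(integral21_prod_meas1 ih); congr fine.
apply: ae_eq_integral => //.
- exact: (measurable_fubini_G ih).
- by apply/measurable_EFinP/mRint2/measurable_EFinP; exact: measurable_int ih.
have := ae_integrable2 ih; apply: filterS => x h1 _ /=.
by rewrite fineK//; exact: integrable_fin_num.
Qed.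

Lemma cint_fubini1 F : L1c (m1 \x m2)%E F ->
  cint (m1 \x m2)%E F = cint m1 (fun x => cint m2 (fun y => F (x, y))).
Proof.
move=> iF; apply: eqcP => /=; first exact: (Rfub1 (L1c_Re iF)).
exact: (Rfub1 (L1c_Im iF)).
Qed.
Lemma cint_fubini2 F : L1c (m1 \x m2)%E F ->
  cint (m1 \x m2)%E F = cint m2 (fun y => cint m1 (fun x => F (x, y))).
Proof.
move=> iF; apply: eqcP => /=; first exact: (Rfub2 (L1c_Re iF)).
exact: (Rfub2 (L1c_Im iF)).
Qed.

Lemma cint_swap F : L1c (m1 \x m2)%E F ->
  cint m1 (fun x => cint m2 (fun y => F (x, y))) = cint m2 (fun y => cint m1 (fun x => F (x, y))).
Proof. by move=> iF; rewrite -cint_fubini1// cint_fubini2. Qed.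

Lemma L1n_cint1 F : L1c (m1 \x m2)%E F ->
  (L1n m1 (fun x => cint m2 (fun y => F (x, y))) <= L1n (m1 \x m2)%E F)%E.
Proof.
move=> iF; have mF := iF.1; rewrite L1n_prod1//; apply: ae_ge0_le_integral => //.
- by move=> x _; rewrite lee_fin normc_ge0.
- by apply/measurable_EFinP/mc_normc; exact: mc_cint1.
- by move=> x _; exact: L1n_ge0.
- apply: (@measurable_fun_fubini_tonelli_F _ _ _ _ _ m2 (fun z => (normc (F z))%:E)) => [|x].
    by apply/measurable_EFinP; exact: mc_normc.
  by rewrite lee_fin normc_ge0.
have := L1c_slice1 iF; apply: filterS => x h _.
by rewrite -(fineK (L1n_fin h)) lee_fin; exact: cint_le.
Qed.
Lemma L1n_cint2 F : L1c (m1 \x m2)%E F ->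
  (L1n m2 (fun y => cint m1 (fun x => F (x, y))) <= L1n (m1 \x m2)%E F)%E.
Proof.
move=> iF; have mF := iF.1; rewrite L1n_prod2//; apply: ae_ge0_le_integral => //.
- by move=> x _; rewrite lee_fin normc_ge0.
- by apply/measurable_EFinP/mc_normc; exact: mc_cint2.
- by move=> x _; exact: L1n_ge0.
- apply: (@measurable_fun_fubini_tonelli_G _ _ _ _ _ m1 (fun z => (normc (F z))%:E)) => [|x].
    by apply/measurable_EFinP; exact: mc_normc.
  by rewrite lee_fin normc_ge0.
have := L1c_slice2 iF; apply: filterS => x h _.
by rewrite -(fineK (L1n_fin h)) lee_fin; exact: cint_le.
Qed.
Lemma L1c_cint1 F : L1c (m1 \x m2)%E F -> L1c m1 (fun x => cint m2 (fun y => F (x, y))).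
Proof.
move=> iF; split; first by apply: mc_cint1; case: iF.
by apply: le_lt_trans (L1n_cint1 iF) _; case: iF.
Qed.

Lemma L1n_tens (a : T1 -> R[i]) (b : T2 -> R[i]) : mc a -> mc b ->
  L1n (m1 \x m2)%E (fun z => a z.1 * b z.2) = (L1n m1 a * L1n m2 b)%E.
Proof.
move=> ma mb; rewrite L1n_prod1/=; last first.
  by apply: mcM; [exact: (mc_comp measurable_fst ma)|exact: mc_comp measurable_snd mb].
transitivity (\int[m1]_x ((normc (a x))%:E * L1n m2 b))%E.
  apply: eq_integral => x _; rewrite /L1n -ge0_integralZl//.
  - by apply: eq_integral => y _; rewrite normcM EFinM.
  - by apply/measurable_EFinP; exact: mc_normc.
  - by move=> y _; rewrite lee_fin normc_ge0.
  - by rewrite lee_fin normc_ge0.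
rewrite ge0_integralZr//.
- by apply/measurable_EFinP; exact: mc_normc.
- by move=> y _; rewrite lee_fin normc_ge0.
- exact: L1n_ge0.
Qed.
Lemma L1c_tens (a : T1 -> R[i]) (b : T2 -> R[i]) : L1c m1 a -> L1c m2 b ->
  L1c (m1 \x m2)%E (fun z => a z.1 * b z.2).
Proof.
move=> ia ib; split.
  by apply: mcM; [exact: mc_comp measurable_fst ia.1|exact: mc_comp measurable_snd ib.1].
rewrite L1n_tens; [|exact: ia.1|exact: ib.1].
by rewrite -(fineK (L1n_fin ia)) -(fineK (L1n_fin ib)) -EFinM ltry.
Qed.
Lemma cint_tens (a : T1 -> R[i]) (b : T2 -> R[i]) : L1c m1 a -> L1c m2 b ->
  cint (m1 \x m2)%E (fun z => a z.1 * b z.2) = cint m1 a * cint m2 b.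
Proof.
move=> ia ib; rewrite cint_fubini1; last exact: L1c_tens.
rewrite -cintZr//; apply: eq_cint => x /=; exact: cintZ.
Qed.
Lemma L2c_tens (a : T1 -> R[i]) (b : T2 -> R[i]) : L2c m1 a -> L2c m2 b ->
  L2c (m1 \x m2)%E (fun z => a z.1 * b z.2).
Proof.
move=> ia ib; split.
  by apply: mcM; [exact: mc_comp measurable_fst ia.1|exact: mc_comp measurable_snd ib.1].
have sq1 d (T : measurableType d) (m : {measure set T -> \bar R}) (f : T -> R[i]) :
    L2n m f = L1n m (fun x => f x * f x).
  by apply: eq_integral => x _; rewrite normcM expr2.
have sq d (T : measurableType d) (m : {measure set T -> \bar R}) (f : T -> R[i]) :
    L2c m f -> L1c m (fun x => f x * f x).
  by move=> h; exact: (L2cM h h).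
rewrite sq1 (_ : (fun x => _) = fun z => (a z.1 * a z.1) * (b z.2 * b z.2)).
  exact: (L1c_tens (sq _ _ _ _ ia) (sq _ _ _ _ ib)).2.
by apply/funext => z; ring.
Qed.

Lemma L2n_prod1 F : mc F -> L2n (m1 \x m2)%E F = (\int[m1]_x L2n m2 (fun y => F (x, y)))%E.
Proof.
move=> mF; apply: fubini_tonelli1 => [|x]; last by rewrite lee_fin exprn_ge0 ?normc_ge0.
by apply/measurable_EFinP; exact: msq.
Qed.

Lemma L1n_indic d (T : measurableType d) (m : {measure set T -> \bar R}) (A : set T) :
  measurable A -> L1n m (fun z => ((\1_A z : R)%:C)%C) = m A.
Proof.
move=> mA; transitivity (\int[m]_z (\1_A z : R)%:E)%E; last by rewrite integral_indic// setIT.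
by apply: eq_integral => z _; rewrite normc_real ger0_norm.
Qed.

Lemma ae_prod (A : set (T1 * T2)) : measurable A ->
  {ae m1, forall x, {ae m2, forall y, A (x, y)}} -> {ae (m1 \x m2)%E, forall z, A z}.
Proof.
move=> mA h; have mB := measurableC mA; apply/negligibleP => //.
rewrite -[LHS]/((m1 \x m2)%E (~` A)) -[LHS](@L1n_indic _ _ (m1 \x m2)%E _ mB) L1n_prod1; last exact: mc_indic.
transitivity (\int[m1]_x (0%E : \bar R))%E; last exact: integral0.
apply: ge0_ae_eq_integral => //.
- apply: (@measurable_fun_fubini_tonelli_F _ _ _ _ _ m2 (fun z => (normc ((\1_(~` A) z : R)%:C)%C)%:E)) => [|x].
    by apply/measurable_EFinP/mc_normc; exact: mc_indic.
  by rewrite lee_fin normc_ge0.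
- by move=> x _; exact: L1n_ge0.
apply: filterS h => x hx _.
transitivity (L1n m2 (fun _ => 0 : R[i])); last by rewrite /L1n; under eq_integral do rewrite normc0; rewrite integral0.
apply: L1n_ae; [exact: (mc_slice1 x (mc_indic R mB))|exact: mc_cst|].
by apply: filterS hx => y hy; rewrite indicE memNset//= => -/(_ hy).
Qed.

Lemma ge0_int_eq0 d (T : measurableType d) (m : {measure set T -> \bar R}) (f : T -> \bar R) :
  measurable_fun setT f -> (forall x, (0 <= f x)%E) -> (\int[m]_x f x = 0)%E ->
  {ae m, forall x, f x = 0%E}.
Proof.
move=> mf f0 h; have /(ae_eq_integral_abs m measurableT mf) : (\int[m]_x `|f x| = 0)%E.
  by rewrite -[RHS]h; apply: eq_integral => x _; rewrite gee0_abs.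
by apply: filterS => x /(_ I).
Qed.

Lemma ae_slice1 (A : set (T1 * T2)) : {ae (m1 \x m2)%E, forall z, A z} ->
  {ae m1, forall x, {ae m2, forall y, A (x, y)}}.
Proof.
move=> [B [mB B0 AB]].
have mi := mc_indic R mB; have := B0; rewrite -[LHS](@L1n_indic _ _ (m1 \x m2)%E _ mB) L1n_prod1//.
move=> /ge0_int_eq0 h; have {h} : {ae m1, forall x, L1n m2 (fun y => ((\1_B (x, y) : R)%:C)%C) = 0%E}.
  apply: h => [|x]; last exact: L1n_ge0.
  apply: (@measurable_fun_fubini_tonelli_F _ _ _ _ _ m2 (fun z => (normc ((\1_B z : R)%:C)%C)%:E)) => [|x].
    by apply/measurable_EFinP/mc_normc.
  by rewrite lee_fin normc_ge0.
apply: filterS => x /L1n_eq0 h; have {h} := h (mc_slice1 x mi).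
apply: filterS => y /eqP; rewrite rc_eq0 indicE; apply: contra_eqP => nA.
by rewrite (mem_set (AB (x, y) nA)) oner_eq0.
Qed.
Lemma ae_slice2 (A : set (T1 * T2)) : {ae (m1 \x m2)%E, forall z, A z} ->
  {ae m2, forall y, {ae m1, forall x, A (x, y)}}.
Proof.
move=> [B [mB B0 AB]].
have mi := mc_indic R mB; have := B0; rewrite -[LHS](@L1n_indic _ _ (m1 \x m2)%E _ mB) L1n_prod2//.
move=> /ge0_int_eq0 h; have {h} : {ae m2, forall y, L1n m1 (fun x => ((\1_B (x, y) : R)%:C)%C) = 0%E}.
  apply: h => [|x]; last exact: L1n_ge0.
  apply: (@measurable_fun_fubini_tonelli_G _ _ _ _ _ m1 (fun z => (normc ((\1_B z : R)%:C)%C)%:E)) => [|x].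
    by apply/measurable_EFinP/mc_normc.
  by rewrite lee_fin normc_ge0.
apply: filterS => y /L1n_eq0 h; have {h} := h (mc_slice2 y mi).
apply: filterS => x /eqP; rewrite rc_eq0 indicE; apply: contra_eqP => nA.
by rewrite (mem_set (AB (x, y) nA)) oner_eq0.
Qed.

Lemma L2c_indic d (T : measurableType d) (m : {measure set T -> \bar R}) (A : set T) :
  measurable A -> (m A < +oo)%E -> L2c m (fun z => ((\1_A z : R)%:C)%C).
Proof.
move=> mA fA; split; first exact: mc_indic.
suff -> : L2n m (fun z => ((\1_A z : R)%:C)%C) = L1n m (fun z => ((\1_A z : R)%:C)%C) by rewrite L1n_indic.
apply: eq_integral => z _; rewrite normc_real indicE.
by case: (z \in A); rewrite ?normr1 ?expr1n// normr0 expr0n.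
Qed.

Lemma prod_null (f : T1 * T2 -> R[i]) : L1c (m1 \x m2)%E f ->
  (forall A B, measurable A -> measurable B ->
    cint (m1 \x m2)%E (fun z => f z * ((\1_(A `*` B) z : R)%:C)%C) = 0) ->
  {ae (m1 \x m2)%E, forall z, f z = 0}.
Proof.
move=> f1 h; apply: (dynkin_null (measurable_prod_measurableType _ _)) => //.
- move=> _ _ [A1 mA1 [A2 mA2 <-]] [B1 mB1 [B2 mB2 <-]].
  exists (A1 `&` B1); first exact: measurableI.
  exists (A2 `&` B2); first exact: measurableI.
  by rewrite setXI.
- rewrite -[RHS](h setT setT)//; apply: eq_cint => z.
  by rewrite indicE mem_set ?mulr1.
- by move=> _ [A mA [B mB <-]]; exact: h.
Qed.

(** Indicators of rectangles inside an exhaustion by sets of finite measure are tensors of L^2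
    functions, and rectangles generate the product sigma-algebra. *)
Lemma tens_dense (K : T1 * T2 -> R[i]) : L2c (m1 \x m2)%E K ->
  (forall a b, L2c m1 a -> L2c m2 b ->
     cint (m1 \x m2)%E (fun z => K z * ((a z.1 * b z.2)^*)%C) = 0) ->
  {ae (m1 \x m2)%E, forall z, K z = 0}.
Proof.
move=> K2 h.
have /sigma_finiteP[F [F_T F_nd F_oo]] := sigma_finiteT m1.
have /sigma_finiteP[G [G_T G_nd G_oo]] := sigma_finiteT m2.
have mF k : measurable (F k) by case: (F_oo k).
have mG k : measurable (G k) by case: (G_oo k).
have indM (A : set T1) (B : set T2) z : \1_(A `*` B) z = \1_A z.1 * \1_B z.2 :> R.
  by rewrite !indicE in_setX; case: (_ \in _); rewrite ?mul1r ?mul0r.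
have indI d (T : measurableType d) (A B : set T) z : \1_(A `&` B) z = \1_A z * \1_B z :> R.
  by rewrite !indicE in_setI; case: (_ \in _); rewrite ?mul1r ?mul0r.
have fin1 k (A : set T1) : measurable A -> L2c m1 (fun z => ((\1_(F k `&` A) z : R)%:C)%C).
  move=> mA; apply: L2c_indic; first exact: measurableI.
  by apply: le_lt_trans (F_oo k).2; apply: le_measure; rewrite ?inE//; exact: measurableI.
have fin2 k (A : set T2) : measurable A -> L2c m2 (fun z => ((\1_(G k `&` A) z : R)%:C)%C).
  move=> mA; apply: L2c_indic; first exact: measurableI.
  by apply: le_lt_trans (G_oo k).2; apply: le_measure; rewrite ?inE//; exact: measurableI.
have hk k : {ae (m1 \x m2)%E, forall z, K z * ((\1_(F k `*` G k) z : R)%:C)%C = 0}.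
  apply: prod_null.
    apply: L2cM => //.
    rewrite (_ : (fun z => _) = fun z => ((\1_(F k `&` setT) z.1 : R)%:C)%C * ((\1_(G k `&` setT) z.2 : R)%:C)%C).
      exact: (L2c_tens (fin1 k _ measurableT) (fin2 k _ measurableT)).
    by apply/funext => z; rewrite -rcM indM !setIT.
  move=> A B mA mB; rewrite -[RHS](h _ _ (fin1 k A mA) (fin2 k B mB)).
  apply: eq_cint => z; rewrite conjcM !conjc_real -!rcM -mulrA -rcM; congr (_ * (_%:C)%C).
  by rewrite (indM (F k)) (indM A) !indI; ring.
have := ae_foralln hk; apply: filterS => z hz.
have [k1 _ zF] : (\bigcup_i F i) z.1 by rewrite -F_T.
have [k2 _ zG] : (\bigcup_i G i) z.2 by rewrite -G_T.
have := hz (maxn k1 k2); rewrite indicE mem_set ?mulr1//; split.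
  by move: zF; apply/subsetPset; apply: F_nd; exact: leq_maxl.
by move: zG; apply/subsetPset; apply: G_nd; exact: leq_maxr.
Qed.

End complex_fubini.

Section L2_tensor.
Context d1 d2 (T1 : measurableType d1) (T2 : measurableType d2) (R : realType).
Variables (m1 : {sigma_finite_measure set T1 -> \bar R}) (m2 : {sigma_finite_measure set T2 -> \bar R}).

End L2_tensor.

(** * Change of variables for complex integrals *)

Section scaling.
Context d (T : measurableType d) (R : realType) (m : {measure set T -> \bar R}).
Variables (phi : T -> T) (c : R).
Hypothesis sc : mscales m phi c.

Lemma mscales_L1n f : mc f -> L1n m (fun x => f (phi x)) = (c%:E * L1n m f)%E.
Proof.
move=> mf; have [_ _ h] := sc; apply: (h (fun x => (normc (f x))%:E)) => [|x].
  by apply/measurable_EFinP; exact: mc_normc.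
by rewrite lee_fin normc_ge0.
Qed.
Lemma mscales_L2n f : mc f -> L2n m (fun x => f (phi x)) = (c%:E * L2n m f)%E.
Proof.
move=> mf; have [_ _ h] := sc; apply: (h (fun x => (normc (f x) ^+ 2)%:E)) => [|x].
  by apply/measurable_EFinP; exact: msq.
by rewrite lee_fin exprn_ge0// normc_ge0.
Qed.
Lemma mscales_L1c f : L1c m f -> L1c m (fun x => f (phi x)).
Proof.
move=> f1; have [_ mphi _] := sc; split; first exact: mc_comp mphi f1.1.
by rewrite (mscales_L1n f1.1) -(fineK (L1n_fin f1)) -EFinM ltry.
Qed.
Lemma mscales_L2c f : L2c m f -> L2c m (fun x => f (phi x)).
Proof.
move=> f1; have [_ mphi _] := sc; split; first exact: mc_comp mphi f1.1.
by rewrite (mscales_L2n f1.1) -(fineK (L2n_fin f1)) -EFinM ltry.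
Qed.
Lemma mscales_Rint (h : T -> R) : m.-integrable setT (EFin \o h) ->
  \int[m]_x h (phi x) = c * \int[m]_x h x.
Proof.
move=> ih; have mh := rint_meas ih; have [c0 _ H] := sc.
have e1 : (\int[m]_x (fun x => (h (phi x))%:E)^\+ x = c%:E * \int[m]_x (EFin \o h)^\+ x)%E.
  rewrite -H//; first by apply: eq_integral => y _; rewrite !funeposE.
  by apply: measurable_funepos; exact/measurable_EFinP.
have e2 : (\int[m]_x (fun x => (h (phi x))%:E)^\- x = c%:E * \int[m]_x (EFin \o h)^\- x)%E.
  rewrite -H//; first by apply: eq_integral => y _; rewrite !funenegE.
  by apply: measurable_funeneg; exact/measurable_EFinP.
have f1 := integrable_pos_fin_num measurableT ih.
have f2 := integrable_neg_fin_num measurableT ih.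
rewrite /Rintegral integralE [in RHS]integralE e1 e2 -(fineK f1) -(fineK f2).
by rewrite -!EFinM -!EFinB /= mulrBr.
Qed.
Lemma mscales_cint f : L1c m f -> cint m (fun x => f (phi x)) = (c%:C)%C * cint m f.
Proof.
move=> f1; apply: eqcP; rewrite ?cReM ?cImM /=.
  by rewrite (mscales_Rint (L1c_Re f1)) mul0r subr0.
by rewrite (mscales_Rint (L1c_Im f1)) mul0r addr0.
Qed.
End scaling.

(** * Continuity of dilations and the Poisson kernel *)

Section ereal_cvg.
Context (R : realType).
Implicit Types a b : nat -> \bar R.

Lemma e0_le a b : (forall k, (0 <= a k <= b k)%E) -> b k @[k --> \oo] --> (0 : \bar R) ->
  a k @[k --> \oo] --> (0 : \bar R).
Proof.
move=> ab b0; apply: (@squeeze_cvge _ _ _ _ (fun=> 0%E) a b) => //; last exact: cvg_cst.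
by apply: nearW.
Qed.
Lemma e0_D a b : a k @[k --> \oo] --> (0 : \bar R) -> b k @[k --> \oo] --> (0 : \bar R) ->
  (a k + b k)%E @[k --> \oo] --> (0 : \bar R).
Proof. by move=> a0 b0; rewrite -[X in _ --> X](adde0 (0%E : \bar R)); exact: cvgeD. Qed.
Lemma e0_Z (c : R) a : a k @[k --> \oo] --> (0 : \bar R) ->
  (c%:E * a k)%E @[k --> \oo] --> (0 : \bar R).
Proof. by move=> a0; rewrite -[X in _ --> X](mule0 c%:E); exact: cvgeZl. Qed.
Lemma e0_eps a : (forall k, (0 <= a k)%E) ->
  (forall e : R, 0 < e -> \forall k \near \oo, (a k <= e%:E)%E) ->
  a k @[k --> \oo] --> (0 : \bar R).
Proof.
move=> a0 h; apply/fine_cvgP; split.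
  apply: filterS (h 1 ltr01) => k hk; rewrite ge0_fin_numE//.
  by apply: le_lt_trans hk _; exact: ltry.
apply/cvgrPdist_le => e e0; apply: filterS (h e e0) => k hk.
have fk : a k \is a fin_num by rewrite ge0_fin_numE// (le_lt_trans hk) ?ltry.
by rewrite /= sub0r normrN ger0_norm ?fine_ge0// -lee_fin fineK.
Qed.
Lemma e0_near a (e : R) : (forall k, (0 <= a k)%E) -> a k @[k --> \oo] --> (0 : \bar R) ->
  0 < e -> \forall k \near \oo, (a k <= e%:E)%E.
Proof.
move=> a0 /fine_cvgP[fa /cvgrPdist_le h] e0; apply: filterS2 fa (h e e0) => k fk.
by rewrite /= sub0r normrN ger0_norm ?fine_ge0// -lee_fin fineK.
Qed.

Lemma e0_fin (r : nat -> R) : r k @[k --> \oo] --> (0 : R) -> (r k)%:E @[k --> \oo] --> (0 : \bar R).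
Proof. by move=> r0; apply: cvg_EFin => //; exact: nearW. Qed.

End ereal_cvg.

Section rV_open.
Context (R : realType) (n : nat).
Local Notation V := 'rV[R]_n.

Lemma coord_continuous_rV (i : 'I_n) : continuous (fun x : V => x 0 i).
Proof. exact: coord_continuous. Qed.

Lemma measurable_rV_open : @measurable _ V = <<s open >>.
Proof.
apply/seteqP; split; last first.
  by apply: smallest_sub; [exact: sigma_algebra_measurable|exact: open_measurable_rV].
apply: smallest_sub; first exact: smallest_sigma_algebra.
move=> A; rewrite -bigcup_seq => -[i _ [B mB <-]]; rewrite setTI.
have mi : measurable_fun setT ((fun x => x 0 i) : g_sigma_algebraType (@open V) -> measurableTypeR R).
  apply: (measurability _ (RGenOpens.measurableE R)).
  move=> _ [_ [a [b ->]] <-]; rewrite setTI; apply: sub_gen_smallest.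
  have := @coord_continuous_rV i; rewrite continuousP; apply.
  exact: interval_open.
by have := mi measurableT B mB; rewrite setTI.
Qed.

Lemma open_null (mu : {measure set V -> \bar R}) (f : V -> R[i]) : L1c mu f ->
  (forall O : set V, open O -> cint mu (fun z => f z * ((\1_O z : R)%:C)%C) = 0) ->
  {ae mu, forall z, f z = 0}.
Proof.
move=> f1 h; apply: (dynkin_null measurable_rV_open) => //.
  by move=> A B oA oB; exact: openI.
rewrite -[RHS](h setT); last exact: openT.
by apply: eq_cint => z; rewrite indicE mem_set ?mulr1.
Qed.

Local Notation mu := (lebn R n).

Lemma open_null2 (f : V -> R[i]) : L2c mu f ->
  (forall O : set V, open O -> (mu O < +oo)%E ->
    cint mu (fun z => f z * ((\1_O z : R)%:C)%C) = 0) ->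
  {ae mu, forall z, f z = 0}.
Proof.
move=> f2 h; pose Q k : set V := ball 0 k.+1%:R.
have oQ k : open (Q k) by exact: ball_open.
have fQ k : (mu (Q k) < +oo)%E.
  apply: (@le_lt_trans _ _ (mu (cube k.+1%:R))); last by rewrite [mu _]lebesgue_cube ?ltry.
  apply: le_measure; rewrite ?inE; [exact: open_measurable_rV|exact: measurable_cube|].
  move=> x /ball_rVE => /(_ (ltr0Sn _ _)) hx i; apply: ltW; rewrite -normrN.
  by have := hx i; rewrite mxE sub0r.
have mQ k : measurable (Q k) by exact: open_measurable_rV.
have hk k : {ae mu, forall z, f z * ((\1_(Q k) z : R)%:C)%C = 0}.
  apply: open_null => [|O oO].
    by apply: (L2cM f2); apply: L2c_indic => //; exact: fQ.
  have oOQ : open (Q k `&` O) by exact: openI.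
  rewrite -[RHS](h _ oOQ); last first.
    apply: le_lt_trans (fQ k); apply: le_measure; rewrite ?inE//.
    exact: open_measurable_rV.
  apply: eq_cint => z; rewrite -mulrA -rcM; congr (_ * (_%:C)%C).
  by rewrite !indicE in_setI; case: (_ \in _); rewrite ?mul1r ?mul0r.
have := ae_foralln hk; apply: filterS => z hz.
pose k := (\sum_(i < n) (Num.truncn `|z 0%R i|).+1)%N.
have := hz k; rewrite indicE mem_set ?mulr1//.
apply/ball_rVE => // i; rewrite mxE sub0r normrN.
apply: (@lt_le_trans _ _ ((Num.truncn `|z 0 i|).+1%:R)); first exact: truncnS_gt.
by rewrite ler_nat (leq_trans _ (leqnSn _))// /k (bigD1 i)//= leq_addr.
Qed.

End rV_open.

Lemma measurable_inv_ge0 d (T : measurableType d) (R : realType) (f : T -> R) :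
  measurable_fun setT f -> (forall x, 0 <= f x) -> measurable_fun setT (fun x => (f x)^-1).
Proof.
move=> mf f0; under eq_fun do rewrite -powR_inv1//.
exact: measurableT_comp (measurable_powR _) mf.
Qed.

Lemma L1n_CS d (T : measurableType d) (R : realType) (mu : {measure set T -> \bar R}) (f g : T -> R[i]) :
  L2c mu f -> L2c mu g ->
  (L1n mu (fun x => (f x * g x)%R) <= (Num.sqrt (fine (L2n mu f)) * Num.sqrt (fine (L2n mu g)))%:E)%E.
Proof.
move=> f2 g2.
have nrm h : L2c mu h -> L2c mu (fun x => ((normc (h x))%:C)%C).
  move=> [mh h2]; split; first by apply: mc_real; exact: mc_normc.
  rewrite (_ : L2n mu _ = L2n mu h)//; apply: eq_integral => x _.
  by rewrite normc_real ger0_norm ?normc_ge0.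
have nn h (h2 : L2c mu h) : n2 (toL2 (nrm h h2)) = fine (L2n mu h).
  rewrite n2_L2; congr fine; apply: eq_integral => x _.
  by rewrite normc_real ger0_norm ?normc_ge0.
have := ip_le (toL2 (nrm f f2)) (toL2 (nrm g g2)); rewrite !nn ip_L2.
rewrite (_ : cint _ _ = ((fine (L1n mu (fun x => f x * g x)))%:C)%C).
  rewrite normc_real ger0_norm ?fine_ge0 ?L1n_ge0// => h.
  by rewrite -[leLHS]fineK ?lee_fin//; apply: L1n_fin; exact: L2cM.
rewrite -[RHS]/(((\int[mu]_x (normc (f x * g x)))%:C)%C) -cint_real; apply: eq_cint => x.
by rewrite conjc_real -rcM normcM.
Qed.

(** * Strong continuity of maps tending to the identity *)

Section shrink.
Context (R : realType) (n : nat).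
Local Notation V := 'rV[R]_n.
Local Notation mu := (lebn R n).
(** Covers translations by vectors tending to zero as well as dilations whose ratio tends to one. *)
Variables (phi : nat -> V -> V) (c : nat -> R).
Hypothesis sc : forall k, mscales mu (phi k) (c k).
Hypothesis c1 : c k @[k --> \oo] --> (1 : R).
Hypothesis phi1 : forall x, phi k x @[k --> \oo] --> x.

Let mphi k : measurable_fun setT (phi k). Proof. by case: (sc k). Qed.

Let shr (f : V -> R[i]) := L2n mu (fun x => f (phi k x) - f x) @[k --> \oo] --> (0 : \bar R).

(** Openness controls one side: each point of [O] is eventually mapped into [O], so the part [d k]
    of [O] that is lost has vanishing measure. The part gained is then controlled by the convergence
    of the volumes [c k * m]. *)
Let shr_open (O : set V) : open O -> (mu O < +oo)%E -> shr (fun z => ((\1_O z : R)%:C)%C).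
Proof.
move=> oO fO; have mO := open_measurable_rV oO.
pose m := fine (mu O).
have mE : mu O = m%:E by rewrite fineK// ge0_fin_numE.
have mOk k : measurable (phi k @^-1` O) by rewrite -[X in measurable X]setTI; exact: mphi.
have iO : (\int[mu]_x (\1_O x : R)%:E = m%:E)%E by rewrite integral_indic// setIT.
have ik k : (\int[mu]_x (\1_O (phi k x) : R)%:E = (c k * m)%:E)%E.
  have [_ _ h] := sc k; rewrite (h (fun x => (\1_O x)%:E)) ?iO -?EFinM//.
  by apply/measurable_EFinP.
pose d k x : R := \1_O x - \1_(phi k @^-1` O `&` O) x.
have md k : measurable_fun setT (d k) by apply: measurable_funB => //; apply: measurable_indic; exact: measurableI.
have d01 k x : 0 <= d k x <= \1_O x.
  rewrite /d !indicE in_setI; case: (_ \in phi k @^-1` O); case: (_ \in O); rewrite /= ?subrr ?subr0 ?lexx ?ler01//.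
have d0 : (\int[mu]_x (d k x)%:E)%E @[k --> \oo] --> (0 : \bar R).
  apply: real_dct0 md _ d01 _ => //.
    apply: rint_fin => //.
      by rewrite iO ltry.
  apply: nearW => x; apply: cvg_near_cst.
  have [Ox|nOx] := pselect (O x).
    have : \forall k \near \oo, O (phi k x) by apply: phi1; exact: open_nbhs_nbhs.
    by apply: filterS => k Ok; rewrite /d !indicE !mem_set ?subrr.
  by apply: nearW => k; rewrite /d !indicE !memNset ?subrr// => -[].
have e (k : nat) : L2n mu (fun x => ((\1_O (phi k x) : R)%:C)%C - ((\1_O x : R)%:C)%C) =
    ((c k * m - m)%:E + 2%:E * \int[mu]_x (d k x)%:E)%E.
  have mOp : measurable_fun setT (fun x => \1_O (phi k x) : R).
    by apply: (measurableT_comp _ (mphi k)).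
  have : (L2n mu (fun x => (((\1_O (phi k x) : R)%:C)%C - ((\1_O x : R)%:C)%C)%R) + m%:E =
     (c k * m)%:E + 2%:E * \int[mu]_x (d k x)%:E)%E.
    rewrite -ik -iO /L2n -ge0_integralD//; first last.
    - by apply/measurable_EFinP.
    - by apply/measurable_EFinP/msq; apply: mcB; exact: mc_real.
    - by move=> x _; rewrite lee_fin exprn_ge0 ?normc_ge0.
    rewrite -ge0_integralZl//; first last.
    - by move=> x _; rewrite lee_fin; case/andP: (d01 k x).
    - by apply/measurable_EFinP.
    rewrite -ge0_integralD//; first last.
    - by apply/measurable_EFinP; apply: measurable_funM.
    - by move=> x _; rewrite lee_fin mulr_ge0//; case/andP: (d01 k x).
    - by apply/measurable_EFinP.
    apply: eq_integral => x _; rewrite -EFinM -!EFinD; congr (_%:E).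
    rewrite -rcB normc_real /d !indicE in_setI.
    have -> : (x \in phi k @^-1` O) = (phi k x \in O).
      by apply/idP/idP; rewrite !inE.
    case: (phi k x \in O); case: (x \in O); rewrite /= ?subrr ?subr0 ?sub0r ?normrN ?normr1 ?normr0; ring.
  move=> h; rewrite EFinB -addeA [X in (_ + X)%E]addeC addeA -h -addeA -EFinB subrr adde0//.
rewrite /shr; under eq_fun do rewrite e.
apply: e0_D; last exact: e0_Z.
apply: cvg_EFin; first exact: nearW.
rewrite -(subrr m); apply: cvgB; last exact: cvg_cst.
by rewrite -[X in _ --> X](mul1r m); apply: cvgM => //; exact: cvg_cst.
Qed.

Lemma c_bounded : exists M, 0 < M /\ forall k, c k <= M.
Proof.
have /cvg_seq_bounded/pinfty_ex_gt0[M M0 hM] : cvgn c by apply/cvg_ex; exists 1.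
exists M; split => // k; have := hM k I; rewrite /= => /(le_trans (ler_norm _)); exact.
Qed.

(** The functions with this property form a subspace containing the indicators of open sets of
    finite measure, which is therefore dense; boundedness of the [c k] makes the approximation
    uniform in [k]. *)
Lemma shrink_L2 (f : V -> R[i]) : L2c mu f ->
  L2n mu (fun x => f (phi k x) - f x) @[k --> \oo] --> (0 : \bar R).
Proof.
move=> f2; have [M [M0 cM]] := c_bounded.
have mS (g : V -> R[i]) k : mc g -> mc (fun x => g (phi k x) - g x).
  by move=> mg; apply: mcB => //; exact: mc_comp (mphi k) mg.
pose S (g : L2H mu) := shr (projT1 g).
have SS : hsubspace S.
  split.
  - rewrite /S /shr /=; under eq_fun do under eq_fun do rewrite subrr.
    by rewrite (_ : (fun _ => _) = fun=> 0%E);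
      [exact: cvg_cst|apply/funext => _; rewrite /L2n; under eq_integral do rewrite normc0 expr0n; rewrite integral0].
  - move=> x y Sx Sy; apply: e0_le (e0_D (e0_Z 2 Sx) (e0_Z 2 Sy)) => k.
    rewrite L2n_ge0/=.
    rewrite (_ : (fun z => _) = fun z => (projT1 x (phi k z) - projT1 x z) + (projT1 y (phi k z) - projT1 y z)); last first.
      by apply/funext => z; rewrite addrACA opprD.
    by apply: L2nD; apply: mS; [case: (projT2 x)|case: (projT2 y)].
  - move=> a x Sx; apply: e0_le (e0_Z (normc a ^+ 2) Sx) => k.
    rewrite L2n_ge0/=.
    have mx := mS _ k (projT2 x).1.
    rewrite /L2n -ge0_integralZl//; first last.
    - by rewrite lee_fin exprn_ge0 ?normc_ge0.
    - by move=> z _; rewrite lee_fin exprn_ge0 ?normc_ge0.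
    - by apply/measurable_EFinP; exact: msq.
    rewrite (eq_integral (fun z => ((normc a ^+ 2)%:E * (normc (projT1 x (phi k z) - projT1 x z) ^+ 2)%:E)%E))// => z _.
    by rewrite -EFinM -exprMn -normcM mulrBr.
have [s [Ss sf]] : exists s : nat -> L2H mu, (forall k, S (s k)) /\ hcvg s (toL2 f2).
  apply: hsubspace_dense => // h hS.
  have h0 : {ae mu, forall z, projT1 h z = 0}.
    apply: open_null2 => [|O oO fO]; first exact: projT2.
    have o2 : L2c mu (fun z => ((\1_O z : R)%:C)%C) by apply: L2c_indic => //; exact: open_measurable_rV.
    rewrite -[RHS](hS (toL2 o2)); last exact: shr_open.
    by rewrite ip_L2; apply: eq_cint => z; rewrite conjc_real.
  rewrite n2_L2 (L2n_ae (projT2 h).1 (@mc_cst _ _ R 0) h0).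
  by rewrite /L2n; under eq_integral do rewrite normc0 expr0n; rewrite integral0.
apply: e0_eps => [k|e e0]; first exact: L2n_ge0.
pose eta := e / (8 * (M + 1)).
have eta0 : 0 < eta by rewrite divr_gt0// mulr_gt0// addr_gt0.
have /cvgrPdist_lt/(_ _ eta0)[N _ hN] := sf.
have := hN N (leqnn N); rewrite /= sub0r normrN ger0_norm ?n2_ge0// => hs.
have g2 := projT2 (s N); set g := projT1 (s N) in g2.
have hg : (L2n mu (fun x => (g x - f x)%R) <= eta%:E)%E.
  move: hs; rewrite n2_L2 => hs; rewrite -[leLHS]fineK; last by apply: L2n_fin; exact: L2cB.
  rewrite lee_fin; apply: ltW; move: hs; congr (fine (L2n _ _) < _).
  by apply/funext => x; rewrite /= mulN1r.
have e4 : 0 < e / 4 by rewrite divr_gt0.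
apply: filterS (e0_near _ (Ss N) e4) => [k hk|k]; last exact: L2n_ge0.
have mg := g2.1; have mf := f2.1.
have mD : mc (fun x => g x - f x) by exact: mcB.
rewrite (_ : (fun x => _) = fun x => ((g (phi k x) - g x) + ((- 1) * (g (phi k x) - f (phi k x)) + (g x - f x)))); last first.
  by apply/funext => x; ring.
have mDk : mc (fun x => -1 * (g (phi k x) - f (phi k x))).
  by apply: mcM; [exact: mc_cst|exact: (mc_comp (mphi k) mD)].
apply: le_trans (L2nD _ _ _) _; [exact: mS|exact: mcD|].
have h1 : (L2n mu (fun x => (-1 * (g (phi k x) - f (phi k x)))%R) <= (M * eta)%:E)%E.
  rewrite (_ : L2n _ _ = L2n mu (fun x => (fun y => (g y - f y)%R) (phi k x))); last first.
    by apply: eq_integral => x _; rewrite mulN1r normcN.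
  have ee := mscales_L2n (sc k) mD; rewrite /= in ee; rewrite ee EFinM; apply: lee_pmul => //.
  - by have [/ltW c0 _ _] := sc k; rewrite lee_fin.
  - exact: L2n_ge0.
  - by rewrite lee_fin.
apply: (@le_trans _ _ (2%:E * (e / 4)%:E + 2%:E * (2%:E * (M * eta)%:E + 2%:E * eta%:E))%E).
  apply: leeD; first exact: lee_wpmul2l.
  apply: lee_wpmul2l; first by rewrite lee_fin.
  apply: le_trans (L2nD _ mDk mD) _.
  by apply: leeD; exact: lee_wpmul2l.
have key (x y z w : R) : 2 * x + 2 * (2 * y + 2 * z) <= w ->
    (2%:E * x%:E + 2%:E * (2%:E * y%:E + 2%:E * z%:E) <= w%:E)%E.
  by rewrite -[X in (X <= _)%E]/((2 * x + 2 * (2 * y + 2 * z))%:E) lee_fin.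
apply: key.
have -> : 2 * (e / 4) + 2 * (2 * (M * eta) + 2 * eta) = e / 2 + 4 * (M + 1) * eta by field.
have -> : 4 * (M + 1) * eta = e / 2 by rewrite /eta; field; rewrite gt_eqF// addr_gt0.
by rewrite -splitr.
Qed.

(** Writing [f = a b] with [|a|^2 = |b|^2 = |f|] and applying Cauchy-Schwarz reduces the claim to
    the L^2 case for [a] and [b]. *)
Lemma shrink_L1 (f : V -> R[i]) : L1c mu f ->
  L1n mu (fun x => f (phi k x) - f x) @[k --> \oo] --> (0 : \bar R).
Proof.
move=> f1; have [mf _] := f1; have [M [M0 cM]] := c_bounded.
pose a x : R[i] := ((Num.sqrt (normc (f x)))%:C)%C.
pose b x : R[i] := f x * (((Num.sqrt (normc (f x)))^-1)%:C)%C.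
have ms : measurable_fun setT (fun x => Num.sqrt (normc (f x))).
  apply: (measurableT_comp _ (mc_normc mf)).
  by apply: continuous_measurable_fun; exact: sqrt_continuous.
have ma : mc a by exact: mc_real.
have mb : mc b by apply: mcM => //; apply: mc_real; apply: measurable_inv_ge0 => // x; exact: sqrtr_ge0.
have na x : normc (a x) ^+ 2 = normc (f x) by rewrite normc_real ger0_norm ?sqr_sqrtr ?sqrtr_ge0 ?normc_ge0.
have nb x : normc (b x) ^+ 2 = normc (f x).
  rewrite normcM normc_real ger0_norm ?invr_ge0 ?sqrtr_ge0// exprMn exprVn sqr_sqrtr ?normc_ge0// expr2.
  have [->|n0] := eqVneq (normc (f x)) 0; first by rewrite !mul0r.
  by rewrite mulfK.
have ab x : f x = a x * b x.
  rewrite /a /b mulrCA -rcM; have [f0|n0] := eqVneq (normc (f x)) 0.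
    by rewrite f0 sqrtr0 mul0r mulr0; apply/eq0_normc/eqP; rewrite f0.
  by rewrite divff ?mulr1// sqrtr_eq0 -ltNge lt_neqAle eq_sym n0 normc_ge0.
have a2 : L2c mu a by split => //; rewrite (_ : L2n mu a = L1n mu f) ?f1.2//; apply: eq_integral => x _; rewrite na.
have b2 : L2c mu b by split => //; rewrite (_ : L2n mu b = L1n mu f) ?f1.2//; apply: eq_integral => x _; rewrite nb.
have ak k : L2c mu (fun x => a (phi k x)) by exact: mscales_L2c (sc k) _ a2.
have bk k : L2c mu (fun x => b (phi k x)) by exact: mscales_L2c (sc k) _ b2.
pose B := M * fine (L2n mu b).
have fz (g : nat -> V -> R[i]) : (forall k, L2c mu (g k)) -> L2n mu (g k) @[k --> \oo] --> (0 : \bar R) ->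
    Num.sqrt (fine (L2n mu (g k))) @[k --> \oo] --> (0 : R).
  by move=> g2 /fine_cvgP[_ h]; exact: cvg_sqrt0.
have h1 := fz _ (fun k => L2cB (ak k) a2) (shrink_L2 a2).
have h2 := fz _ (fun k => L2cB (bk k) b2) (shrink_L2 b2).
have h3 : (Num.sqrt (fine (L2n mu (fun x => a (phi k x) - a x))) * Num.sqrt B +
   Num.sqrt (fine (L2n mu a)) * Num.sqrt (fine (L2n mu (fun x => b (phi k x) - b x)))) @[k --> \oo] --> (0 : R).
  rewrite -[X in _ --> X](addr0 (0 : R)) -{1}(mul0r (Num.sqrt B)) -{2}(mulr0 (Num.sqrt (fine (L2n mu a)))).
  by apply: cvgD; apply: cvgM => //; exact: cvg_cst.
apply: e0_le (e0_fin h3) => k; rewrite L1n_ge0/=.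
rewrite (_ : (fun x => _) = fun x => ((a (phi k x) - a x) * b (phi k x) + a x * (b (phi k x) - b x))); last first.
  by apply/funext => x; rewrite !ab; ring.
apply: le_trans (L1nD _ _ _) _.
- by apply: mcM; [exact: mcB (ak k).1 ma|exact: (bk k).1].
- by apply: mcM => //; exact: mcB (bk k).1 mb.
rewrite EFinD; apply: leeD.
  apply: le_trans (L1n_CS (L2cB (ak k) a2) (bk k)) _.
  rewrite lee_fin ler_wpM2l ?sqrtr_ge0// ler_wsqrtr//.
  rewrite (mscales_L2n (sc k))// -(fineK (L2n_fin b2)) -EFinM /= /B.
  by rewrite ler_wpM2r// fine_ge0 ?L2n_ge0.
exact: L1n_CS a2 (L2cB (bk k) b2).
Qed.

End shrink.

(** * The Poisson kernel on the line *)

Section poisson.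
Context (R : realType).
Local Notation lam := (@lebesgue_measure R).
Local Notation T1 := (measurableTypeR R).

Lemma lam_opp : mscales lam (fun x : T1 => - x : T1) 1.
Proof.
have := @lam_affine R (-1) 0 (ltac:(by rewrite oppr_eq0 oner_eq0)).
rewrite normrN1 invr1 (_ : (fun x => -1 * x + 0) = (fun x => - x))//.
by apply/funext => x; rewrite mulN1r addr0.
Qed.

(** With the factor 2 pi, [lap] and the Cauchy density [cauchyd] form a Fourier pair of positive
    functions, the damping factor and the approximate identity of the whole theory. *)
Definition lap (x : R) : R := expR (- (2 * pi * `|x|)).
Definition cauchyd (x : R) : R := (pi * (1 + x ^+ 2))^-1.

Lemma lap_continuous : continuous lap.
Proof.
move=> x; rewrite /lap; apply: continuous_comp; last exact: continuous_expR.
apply: cvgN; apply: cvgM; first exact: cvg_cst.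
exact: norm_continuous.
Qed.

Lemma lap_even x : lap (- x) = lap x. Proof. by rewrite /lap normrN. Qed.

(** The summand 1 keeps the integrand non-negative, as the fundamental theorem of calculus on a
    half-line requires. The phase [p] yields cosine and sine transforms at once, through [p = 0] and
    [p = pi / 2]. *)
Lemma exp_cos_half (a b p : R) : 0 < a ->
  (\int[lam]_(x in `[0%R, +oo[) (expR (- (a * x)) * (1 + cos (b * x + p)))%:E =
  (a^-1 + (a * cos p - b * sin p) / (a ^+ 2 + b ^+ 2))%:E)%E.
Proof.
move=> a0; have D0 : 0 < a ^+ 2 + b ^+ 2 by rewrite ltr_wpDr ?sqr_ge0// exprn_gt0.
pose F (x : R) := expR (- (a * x)) * ((b * sin (b * x + p) - a * cos (b * x + p)) / (a ^+ 2 + b ^+ 2) - a^-1).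
have dF (x : R) : is_derive x 1 F (expR (- (a * x)) * (1 + cos (b * x + p))).
  apply: is_derive_eq; rewrite /GRing.scale /=.
  by field; rewrite !gt_eqF.
have -> : ((a^-1 + (a * cos p - b * sin p) / (a ^+ 2 + b ^+ 2))%:E = 0%:E - (F 0)%:E)%E.
  by rewrite -EFinB /F !mulr0 oppr0 expR0 !add0r; congr (_%:E); field; rewrite !gt_eqF.
rewrite -(@ge0_continuous_FTC2y _ (fun x => expR (- (a * x)) * (1 + cos (b * x + p))) F).
- by [].
- by move=> x _; rewrite mulr_ge0 ?expR_ge0// -lerBlDl sub0r cos_geN1.
- apply: continuous_subspaceT => x.
  apply: cvgM; [apply: continuous_comp; last exact: continuous_expR; apply: cvgN; apply: cvgM; [exact: cvg_cst|exact: cvg_id]|].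
  apply: cvgD; first exact: cvg_cst.
  apply: continuous_comp; last exact: continuous_cos.
  by apply: cvgD; [apply: cvgM; [exact: cvg_cst|exact: cvg_id]|exact: cvg_cst].
- have h : expR (- (a * x)) @[x --> +oo] --> (0 : R).
    apply: (cvg_comp (fun x => a * x) (fun y => expR (- y))); last exact: cvgr_expR.
    by apply: gt0_cvgMry => //; exact: cvg_id.
  pose M := (`|b| + a) / (a ^+ 2 + b ^+ 2) + a^-1.
  apply: cvg_dist0; apply: norm0_cvg (cvgZ0 M h) => x; rewrite normr_ge0/= subr0 normrM.
  rewrite (ger0_norm (expR_ge0 _)) mulrC ler_wpM2r ?expR_ge0//.
  apply: le_trans (ler_normB _ _) _; rewrite /M normfV (gtr0_norm a0) lerD2r.
  rewrite normrM normfV (gtr0_norm D0) ler_wpM2r ?invr_ge0 ?(ltW D0)//.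
  apply: le_trans (ler_normB _ _) _; rewrite (normrM b) (normrM a) (gtr0_norm a0); apply: lerD.
    by rewrite ler_piMr// ler_norml sin_geN1 sin_le1.
  by rewrite ler_piMr ?(ltW a0)// ler_norml cos_geN1 cos_le1.
- by move=> x _; have [] := dF x.
- apply: cvg_at_right_filter; apply: differentiable_continuous.
  by apply/derivable1_diffP; have [] := dF 0.
- by move=> x _; rewrite derive1E; have [_] := dF x.
Qed.

Lemma lap_half (b : R) : (\int[lam]_(x in `[0%R, +oo[) (lap x * (1 + cos (b * x)))%:E =
  ((2 * pi)^-1 + 2 * pi / ((2 * pi) ^+ 2 + b ^+ 2))%:E)%E.
Proof.
have a0 : 0 < 2 * pi :> R by rewrite mulr_gt0 ?pi_gt0.
have := exp_cos_half b 0 a0; rewrite cos0 sin0 mulr1 mulr0 subr0 => <-.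
apply: eq_integral => x; rewrite inE/= in_itv/= andbT => x0.
by rewrite addr0 /lap ger0_norm.
Qed.

Lemma lap_sym (b : R) : (\int[lam]_x (lap x * (1 + cos (b * x)))%:E =
  (2 * ((2 * pi)^-1 + 2 * pi / ((2 * pi) ^+ 2 + b ^+ 2)))%:E)%E.
Proof.
rewrite ge0_symfun_integralT.
- by rewrite -set_itvcy lap_half EFinM.
- by move=> x; rewrite mulr_ge0 ?expR_ge0// -lerBlDl sub0r cos_geN1.
- move=> x; apply: cvgM; first exact: lap_continuous.
  apply: cvgD; first exact: cvg_cst.
  apply: continuous_comp; last exact: continuous_cos.
  by apply: cvgM; [exact: cvg_cst|exact: cvg_id].
- by move=> x /=; rewrite lap_even mulrN cosN.
Qed.

Lemma measurable_lap : measurable_fun setT (lap : T1 -> R).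
Proof. by apply: continuous_measurable_fun; exact: lap_continuous. Qed.
Lemma lap_ge0 x : 0 <= lap x. Proof. exact: expR_ge0. Qed.

Lemma lap_int : (\int[lam]_x (lap x)%:E = (pi^-1)%:E)%E.
Proof.
have := lap_sym 0; under eq_integral do rewrite mul0r cos0.
under eq_integral => x _ do rewrite (_ : (lap x * (1 + 1))%:E = (2%:E * (lap x)%:E)%E) ?(mulrC (lap x))//.
rewrite ge0_integralZl//; first last.
- by move=> x _; rewrite lee_fin lap_ge0.
- by apply/measurable_EFinP; exact: measurable_lap.
have p0 : pi != 0 :> R by rewrite gt_eqF ?pi_gt0.
move=> h; rewrite -[LHS]mul1e -(mulVf (lt0r_neq0 (ltr0n R 2))) EFinM -muleA h -EFinM.
by congr (_%:E); rewrite expr0n addr0; move: p0; generalize (pi : R) => p p0; field.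
Qed.

Lemma lap_rint : lam.-integrable setT (EFin \o lap).
Proof.
apply: rint_fin => //; [exact: measurable_lap|exact: lap_ge0|].
by rewrite lap_int ltry.
Qed.
Lemma lap_L1 : L1c lam (fun x => ((lap x)%:C)%C).
Proof.
apply: (L1c_dom _ lap_rint) => [|x]; first by apply: mc_real; exact: measurable_lap.
by rewrite normc_real ger0_norm ?lap_ge0.
Qed.

Lemma lap_FT (xi : R) :
  cint lam (fun x => ((lap x)%:C)%C * cis (- (2 * pi * (x * xi)))) = ((cauchyd xi)%:C)%C.
Proof.
have mcs (f : R -> R) : continuous f -> measurable_fun setT f by exact: continuous_measurable_fun.
have mlin : measurable_fun setT (fun x : T1 => - (2 * pi * (x * xi))).
  by apply: measurable_funN; apply: measurable_funM => //; exact: measurable_funM.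
have L : L1c lam (fun x => ((lap x)%:C)%C * cis (- (2 * pi * (x * xi)))).
  apply: (@L1c_bound _ _ _ _ _ _ 1 lap_L1); first exact: mc_cis.
  by move=> x; rewrite normc_cis.
set I := cint _ _.
have Ii : complex.Im I = 0.
  have : I = (I^*)%C.
    rewrite /I -[LHS]mul1r -(mscales_cint lam_opp L) -cint_conj//; apply: eq_cint => x.
    by rewrite lap_even conjcM conjc_real conj_cis mulNr mulrN.
  by move=> /(congr1 (@complex.Im R)); rewrite cImJ; lra.
have Ir : complex.Re I = cauchyd xi.
  have : \int[lam]_x (lap x * (1 + cos (2 * pi * xi * x))) = pi^-1 + complex.Re I.
    rewrite -[pi^-1]/(fine (pi^-1)%:E) -lap_int -RintegralD//; [|exact: lap_rint|exact: L1c_Re L].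
    apply: eq_Rintegral => x _; rewrite cReM/= mul0r subr0 mulrDr mulr1 cosN.
    by congr (_ + _ * cos _); ring.
  rewrite /Rintegral lap_sym => h.
  have e1 : 2 * ((2 * pi)^-1 + 2 * pi / ((2 * pi) ^+ 2 + (2 * pi * xi) ^+ 2)) = pi^-1 + complex.Re I by exact: h.
  have -> : complex.Re I = 2 * ((2 * pi)^-1 + 2 * pi / ((2 * pi) ^+ 2 + (2 * pi * xi) ^+ 2)) - pi^-1.
    by rewrite e1 addrC addKr.
  have p0 : pi != 0 :> R by rewrite gt_eqF ?pi_gt0.
  have x0 : 1 + xi ^+ 2 != 0 by rewrite gt_eqF// ltr_wpDr ?sqr_ge0.
  have x1 : (2 * pi) ^+ 2 + (2 * pi * xi) ^+ 2 = (2 * pi) ^+ 2 * (1 + xi ^+ 2).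
    by rewrite exprMn; ring.
  rewrite /cauchyd x1; move: p0 x0; generalize (pi : R) => p p0 x0; field.
  by rewrite p0 x0.
by apply: eqcP.
Qed.

Lemma cauchyd_ge0 x : 0 <= cauchyd x.
Proof. by rewrite invr_ge0 mulr_ge0 ?pi_ge0// addr_ge0 ?sqr_ge0. Qed.
Lemma cauchyd_continuous : continuous cauchyd.
Proof.
move=> x; apply: cvgV.
  by rewrite gt_eqF// mulr_gt0 ?pi_gt0// ltr_wpDr ?sqr_ge0.
apply: cvgM; first exact: cvg_cst.
by apply: cvgD; [exact: cvg_cst|exact: exprn_continuous].
Qed.
Lemma measurable_cauchyd : measurable_fun setT (cauchyd : T1 -> R).
Proof. by apply: continuous_measurable_fun; exact: cauchyd_continuous. Qed.
Lemma cauchyd_even x : cauchyd (- x) = cauchyd x. Proof. by rewrite /cauchyd sqrrN. Qed.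

Lemma cauchyd_int : (\int[lam]_x (cauchyd x)%:E = 1)%E.
Proof.
have p0 := pi_gt0 R.
rewrite ge0_symfun_integralT.
- rewrite -set_itvcy.
  under eq_integral => x _ do rewrite (_ : (cauchyd x)%:E = ((pi^-1)%:E * ((oneDsqr x)^-1)%:E)%E) ?/cauchyd ?invfM//.
  rewrite ge0_integralZl//; first last.
  + by rewrite lee_fin invr_ge0 ltW.
  + apply/measurable_EFinP; apply: measurable_funTS; apply: continuous_measurable_fun.
    exact: continuous_oneDsqrV.
  rewrite integral0y_oneDsqr -!EFinM; congr (_%:E).
  by move: p0; generalize (pi : R) => p p0; field; rewrite gt_eqF.
- exact: cauchyd_ge0.
- exact: cauchyd_continuous.
- by move=> x /=; rewrite cauchyd_even.
Qed.

End poisson.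

(** * The Poisson kernel in dimension n *)

Section poisson_n.
Context (R : realType).
Local Notation lam := (@lebesgue_measure R).

Lemma lebn_int_cons n (f : 'rV[R]_n.+1 -> \bar R) : measurable_fun setT f ->
  (forall x, (0 <= f x)%E) ->
  (\int[lebn R n.+1]_x f x = \int[(lam \x lebn R n)%E]_z f (rV_cons z))%E.
Proof.
move=> mf f0; rewrite lebn_intS// fubini_tonelli1//.
exact: measurableT_comp mf (@measurable_rV_cons R n).
Qed.

Lemma lebn_cint_cons n (f : 'rV[R]_n.+1 -> R[i]) : mc f ->
  cint (lebn R n.+1) f = cint (lam \x lebn R n)%E (fun z => f (rV_cons z)).
Proof.
have h (g : 'rV[R]_n.+1 -> R) : measurable_fun setT g ->
    \int[lebn R n.+1]_x g x = \int[(lam \x lebn R n)%E]_z g (rV_cons z).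
  move=> mg; rewrite /Rintegral integralE [in RHS]integralE.
  congr (fine (_ - _)%E).
    rewrite lebn_int_cons//; first by apply: eq_integral => z _; rewrite !funeposE.
    by apply: measurable_funepos; exact/measurable_EFinP.
  rewrite lebn_int_cons//; first by apply: eq_integral => z _; rewrite !funenegE.
  by apply: measurable_funeneg; exact/measurable_EFinP.
by move=> [m1 m2]; apply: eqcP; [exact: h m1|exact: h m2].
Qed.

Lemma lebn_L1n_cons n (f : 'rV[R]_n.+1 -> R[i]) : mc f ->
  L1n (lebn R n.+1) f = L1n (lam \x lebn R n)%E (fun z => f (rV_cons z)).
Proof.
move=> mf; rewrite /L1n lebn_int_cons// => [|x]; last by rewrite lee_fin normc_ge0.
by apply/measurable_EFinP; exact: mc_normc.
Qed.

(** Products of one-dimensional kernels instead of the rotation-invariant ones, so that integrals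
    and transforms factor along [rV_cons]. *)
Definition theta n (x : 'rV[R]_n) : R := expR (- (2 * pi * \sum_(i < n) `|x 0 i|)).
Definition pois n (x : 'rV[R]_n) : R := \prod_(i < n) cauchyd (x 0 i).

Lemma measurable_theta n : measurable_fun setT (@theta n).
Proof.
apply: measurableT_comp; first exact: measurable_expR.
apply: measurable_funN; apply: measurable_funM => //; apply: measurable_sum => i.
by apply: measurableT_comp => //; exact: measurable_coord.
Qed.
Lemma measurable_pois n : measurable_fun setT (@pois n).
Proof.
apply: measurable_prod => i _.
by apply: measurableT_comp (@measurable_cauchyd R) _; exact: measurable_coord.
Qed.
Lemma theta_ge0 n (x : 'rV[R]_n) : 0 <= theta x. Proof. exact: expR_ge0. Qed.
Lemma theta_le1 n (x : 'rV[R]_n) : theta x <= 1.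
Proof. by rewrite -expR0 ler_expR lerNl oppr0 !mulr_ge0 ?pi_ge0 ?sumr_ge0. Qed.
Lemma pois_ge0 n (x : 'rV[R]_n) : 0 <= pois x.
Proof. by apply: prodr_ge0 => i _; exact: cauchyd_ge0. Qed.

Lemma theta_cons n z : @theta n.+1 (rV_cons z) = lap z.1 * theta z.2.
Proof.
rewrite /theta /lap -expRD; congr expR.
rewrite big_ord_recl rV_cons0 mulrDr opprD; congr (- (_ * _) - _ * _).
by apply: eq_bigr => i _; rewrite rV_consS.
Qed.
Lemma pois_cons n z : @pois n.+1 (rV_cons z) = cauchyd z.1 * pois z.2.
Proof.
rewrite /pois big_ord_recl rV_cons0; congr (_ * _).
by apply: eq_bigr => i _; rewrite rV_consS.
Qed.

Lemma theta_L1 n : L1c (lebn R n) (fun x => ((theta x)%:C)%C).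
Proof.
have mt k := mc_real (@measurable_theta k).
elim: n => [|n IH]; first by split => //; rewrite /L1n lebn_int0 ltry.
split; first exact: mt.
rewrite lebn_L1n_cons// (_ : (fun z => _) = fun z => ((lap z.1)%:C)%C * ((theta z.2)%:C)%C).
  by have [] := L1c_tens (@lap_L1 R) IH.
by apply/funext => z; rewrite theta_cons rcM.
Qed.

Lemma theta_FT n (xi : 'rV[R]_n) :
  cint (lebn R n) (fun x => ((theta x)%:C)%C * cis (- (2 * pi * dotrV x xi))) = ((pois xi)%:C)%C.
Proof.
have mt k := mc_real (@measurable_theta k).
have md k (v : 'rV[R]_k) : mc (fun x : 'rV[R]_k => cis (- (2 * pi * dotrV x v))).
  apply: mc_cis; apply: measurable_funN; apply: measurable_funM => //.
  exact: measurable_dotrV.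
have L k (v : 'rV[R]_k) : L1c (lebn R k) (fun x => ((theta x)%:C)%C * cis (- (2 * pi * dotrV x v))).
  by apply: (L1c_bound (@theta_L1 k) (md k v)) => x; rewrite normc_cis.
elim: n xi => [|n IH] xi.
  rewrite /cint /Rintegral !lebn_int0 /theta /pois /dotrV !big_ord0 !mulr0 oppr0 expR0 cis0 mulr1.
  by [].
rewrite lebn_cint_cons; last exact: (L _ _).1.
rewrite -{2}(rV_cons_eta xi) pois_cons rcM -lap_FT -IH -cint_tens; first last.
- exact: L.
- apply: (L1c_bound (@lap_L1 R)); last by move=> x; rewrite normc_cis.
  by apply: mc_cis; apply: measurable_funN; apply: measurable_funM => //; exact: measurable_funM.
apply: eq_cint => z; rewrite theta_cons rcM -{1}(rV_cons_eta xi) dotrV_cons.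
by rewrite mulrDr opprD cisD /=; ring.
Qed.

Lemma pois_int n : (\int[lebn R n]_x (pois x)%:E = 1)%E.
Proof.
elim: n => [|n IH]; first by rewrite lebn_int0 /pois big_ord0.
rewrite lebn_intS; last 2 first.
- by apply/measurable_EFinP; exact: measurable_pois.
- by move=> x; rewrite lee_fin pois_ge0.
transitivity (\int[lam]_x (cauchyd x)%:E)%E; last exact: cauchyd_int.
apply: eq_integral => x _; transitivity (\int[lebn R n]_y ((cauchyd x)%:E * (pois y)%:E))%E.
  by apply: eq_integral => y _; rewrite pois_cons EFinM.
rewrite ge0_integralZl//; first last.
- by rewrite lee_fin cauchyd_ge0.
- by move=> y _; rewrite lee_fin pois_ge0.
- by apply/measurable_EFinP; exact: measurable_pois.
by rewrite IH mule1.
Qed.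
Lemma pois_rint n : (lebn R n).-integrable setT (EFin \o @pois n).
Proof.
apply: rint_fin; [exact: measurable_pois|exact: pois_ge0|].
by rewrite pois_int ltry.
Qed.

End poisson_n.

(** * The Fourier transform on L^1 *)

Section dot.
Context (R : realType) (n : nat).
Implicit Types x y z : 'rV[R]_n.
Lemma dotrVC x y : dotrV x y = dotrV y x.
Proof. by apply: eq_bigr => i _; rewrite mulrC. Qed.
Lemma dotrVDl x y z : dotrV (x + y) z = dotrV x z + dotrV y z.
Proof. by rewrite /dotrV -big_split; apply: eq_bigr => i _; rewrite mxE mulrDl. Qed.
Lemma dotrVDr x y z : dotrV x (y + z) = dotrV x y + dotrV x z.
Proof. by rewrite dotrVC dotrVDl !(dotrVC x). Qed.
Lemma dotrVZl a x y : dotrV (a *: x) y = a * dotrV x y.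
Proof. by rewrite /dotrV mulr_sumr; apply: eq_bigr => i _; rewrite mxE mulrA. Qed.
Lemma dotrVZr a x y : dotrV x (a *: y) = a * dotrV x y.
Proof. by rewrite dotrVC dotrVZl dotrVC. Qed.
Lemma dotrVNl x y : dotrV (- x) y = - dotrV x y.
Proof. by rewrite -scaleN1r dotrVZl mulN1r. Qed.
Lemma dotrVNr x y : dotrV x (- y) = - dotrV x y.
Proof. by rewrite dotrVC dotrVNl dotrVC. Qed.
Lemma dotrVBl x y z : dotrV (x - y) z = dotrV x z - dotrV y z.
Proof. by rewrite dotrVDl dotrVNl. Qed.
Lemma dotrVBr x y z : dotrV x (y - z) = dotrV x y - dotrV x z.
Proof. by rewrite dotrVDr dotrVNr. Qed.
Lemma dotrV0l x : dotrV 0 x = 0.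
Proof. by rewrite -(scale0r 0) dotrVZl mul0r. Qed.
Lemma dotrV0r x : dotrV x 0 = 0.
Proof. by rewrite dotrVC dotrV0l. Qed.
End dot.

Section fourier_L1.
Context (R : realType) (n : nat).
Local Notation V := 'rV[R]_n.
Local Notation mu := (lebn R n).
Implicit Types f g : V -> R[i].

Definition ec (x y : V) : R[i] := cis (2 * pi * dotrV x y).

Lemma ecN x y : cis (- (2 * pi * dotrV x y)) = ec x (- y).
Proof. by rewrite /ec dotrVNr mulrN. Qed.
Lemma normc_ec x y : normc (ec x y) = 1. Proof. exact: normc_cis. Qed.
Lemma ecDl x y z : ec (x + y) z = ec x z * ec y z.
Proof. by rewrite /ec dotrVDl mulrDr cisD. Qed.
Lemma ecDr x y z : ec x (y + z) = ec x y * ec x z.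
Proof. by rewrite /ec dotrVDr mulrDr cisD. Qed.
Lemma ecC x y : ec x y = ec y x. Proof. by rewrite /ec dotrVC. Qed.
Lemma ec_conj x y : ((ec x y)^*)%C = ec x (- y).
Proof. by rewrite /ec conj_cis dotrVNr mulrN. Qed.
Lemma ec0 x : ec x 0 = 1. Proof. by rewrite /ec dotrV0r mulr0 cis0. Qed.
Lemma ecNN x y : ec (- x) (- y) = ec x y.
Proof. by rewrite /ec dotrVNl dotrVNr opprK. Qed.
Lemma ecNl x y : ec (- x) y = ec x (- y).
Proof. by rewrite /ec dotrVNl dotrVNr. Qed.
Lemma mc_ec d (T : measurableType d) (a b : T -> V) : measurable_fun setT a ->
  measurable_fun setT b -> mc (fun x => ec (a x) (b x)).
Proof.
by move=> ma mb; apply: mc_cis; apply: measurable_funM => //; exact: measurable_dotrV.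
Qed.
Lemma mc_ecr v : mc (fun x : V => ec v x). Proof. exact: mc_ec. Qed.
Lemma mc_ecl v : mc (fun x : V => ec x v). Proof. exact: mc_ec. Qed.
Lemma mc_ecNr v : mc (fun x : V => ec v (- x)).
Proof. by apply: mc_ec => //; exact: measurable_rVN. Qed.

Lemma fourierE f x : fourier f x = cint mu (fun y => f y * ec x (- y)).
Proof. by rewrite /fourier; congr (cint _ _); apply/funext => y; rewrite ecN. Qed.

Lemma ft_L1 f x : L1c mu f -> L1c mu (fun y => f y * ec x (- y)).
Proof. by move=> f1; apply: (L1c_bound f1 (mc_ecNr x)) => y; rewrite normc_ec. Qed.
Lemma mod_L1 f x : L1c mu f -> L1c mu (fun y => f y * ec x y).
Proof. by move=> f1; apply: (L1c_bound f1 (mc_ecr x)) => y; rewrite normc_ec. Qed.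
Lemma mod_L2 f x : L2c mu f -> L2c mu (fun y => f y * ec x y).
Proof. by move=> f1; apply: (L2c_bound f1 (mc_ecr x)) => y; rewrite normc_ec. Qed.

Lemma fourier_bound f x : L1c mu f -> normc (fourier f x) <= fine (L1n mu f).
Proof.
move=> f1; rewrite fourierE; apply: le_trans (cint_le (ft_L1 x f1)) _.
rewrite (_ : L1n _ _ = L1n mu f)//; apply: eq_integral => y _.
by rewrite normcM normc_ec mulr1.
Qed.

Lemma mc_ftk f : mc f -> mc (fun z : V * V => f z.2 * ec z.1 (- z.2)).
Proof.
move=> mf; apply: mcM; first exact: (mc_comp measurable_snd mf).
by apply: mc_ec; [exact: measurable_fst|apply: measurable_rVN; exact: measurable_snd].
Qed.
Lemma mc_fourier f : mc f -> mc (fourier f).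
Proof.
move=> mf; rewrite (_ : fourier f = fun x => cint mu (fun y => f y * ec x (- y))); last first.
  by apply/funext => x; rewrite fourierE.
exact: (mc_cint1 mu (mc_ftk mf)).
Qed.

Lemma fourierD f g x : L1c mu f -> L1c mu g -> fourier (fun y => f y + g y) x = fourier f x + fourier g x.
Proof.
move=> f1 g1; rewrite !fourierE -cintD; [|exact: ft_L1|exact: ft_L1].
by apply: eq_cint => y; rewrite mulrDl.
Qed.
Lemma fourierB f g x : L1c mu f -> L1c mu g -> fourier (fun y => f y - g y) x = fourier f x - fourier g x.
Proof.
move=> f1 g1; rewrite !fourierE -cintB; [|exact: ft_L1|exact: ft_L1].
by apply: eq_cint => y; rewrite mulrBl.
Qed.
Lemma fourierZ c f x : L1c mu f -> fourier (fun y => c * f y) x = c * fourier f x.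
Proof.
move=> f1; rewrite !fourierE -cintZ; last exact: ft_L1.
by apply: eq_cint => y; rewrite mulrA.
Qed.
Lemma fourier_mod f v x : fourier (fun y => f y * ec v y) x = fourier f (x - v).
Proof.
rewrite !fourierE; apply: eq_cint => y.
by rewrite -mulrA ecDl ecNl opprK [ec v y * _]mulrC.
Qed.
Lemma fourier_conj f x : L1c mu f -> fourier (fun y => (f y)^*%C) x = ((fourier f (- x))^*)%C.
Proof.
move=> f1; rewrite !fourierE -cint_conj; last exact: ft_L1.
by apply: eq_cint => y; rewrite conjcM ec_conj ecNN.
Qed.
Lemma fourier_sum (I : Type) (r : seq I) (F : I -> V -> R[i]) x :
  (forall i, L1c mu (F i)) -> fourier (fun y => \sum_(i <- r) F i y) x = \sum_(i <- r) fourier (F i) x.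
Proof.
move=> F1; under [RHS]eq_bigr do rewrite fourierE.
rewrite fourierE -cint_sum; last by move=> i; exact: ft_L1.
by apply: eq_cint => y; rewrite mulr_suml.
Qed.

Lemma lebn_dilate (s : R) : 0 < s -> mscales mu (fun x => s *: x) ((s ^+ n)^-1).
Proof.
move=> s0; have := @lebn_mulmx R n (s%:M); rewrite det_scalar ger0_norm ?exprn_ge0 ?ltW//.
rewrite (_ : (fun x => x *m s%:M) = (fun x => s *: x)); last first.
  by apply/funext => x; rewrite mul_mx_scalar.
by apply; rewrite unitmxE det_scalar unitfE expf_neq0// gt_eqF.
Qed.
Lemma lebn_affine (s : R) (v : V) : 0 < s -> mscales mu (fun x => v + s *: x) ((s ^+ n)^-1).
Proof.
move=> s0; have := mscales_comp (lebn_translate v) (lebn_dilate s0); rewrite mul1r.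
by rewrite (_ : (fun x => s *: x + v) = (fun x => v + s *: x))//; apply/funext => x; rewrite addrC.
Qed.
Lemma lebn_opp : mscales mu (fun x => - x) 1.
Proof.
have := @lebn_mulmx R n ((-1)%:M); rewrite det_scalar normrX normrN1 expr1n invr1.
rewrite (_ : (fun x => x *m (-1)%:M) = (fun x => - x)); last first.
  by apply/funext => x; rewrite mul_mx_scalar scaleN1r.
by apply; rewrite unitmxE det_scalar unitfE expf_neq0// oppr_eq0 oner_eq0.
Qed.

Lemma fourier_translate f v x : L1c mu f ->
  fourier (fun y => f (y + v)) x = ec x v * fourier f x.
Proof.
move=> f1; rewrite !fourierE -cintZ; last exact: ft_L1.
rewrite -[RHS]mul1r -(mscales_cint (lebn_translate v)); last first.
  by apply: L1cZ; exact: ft_L1.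
by apply: eq_cint => y; rewrite mulrCA -ecDr opprD addrCA subrr addr0.
Qed.
Lemma fourier_dilate f s x : 0 < s -> L1c mu f ->
  fourier (fun y => f (s *: y)) x = (((s ^+ n)^-1)%:C)%C * fourier f (s^-1 *: x).
Proof.
move=> s0 f1; rewrite !fourierE -(mscales_cint (lebn_dilate s0)); last exact: ft_L1.
apply: eq_cint => y; congr (_ * _); rewrite /ec !dotrVNr dotrVZl dotrVZr mulrA mulVf ?mul1r//.
by rewrite gt_eqF.
Qed.

Lemma fourier_mul f g : L1c mu f -> L1c mu g ->
  cint mu (fun x => fourier f x * g x) = cint mu (fun y => f y * fourier g y).
Proof.
move=> f1 g1.
have L : L1c (mu \x mu)%E (fun z : V * V => g z.1 * f z.2 * ec z.1 (- z.2)).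
  apply: (L1c_bound (L1c_tens g1 f1)) => [|z]; last by rewrite normc_ec.
  by apply: mc_ec; [exact: measurable_fst|apply: measurable_rVN; exact: measurable_snd].
transitivity (cint mu (fun x => cint mu (fun y => g x * f y * ec x (- y)))).
  apply: eq_cint => x; rewrite fourierE mulrC -cintZ; last exact: ft_L1.
  by apply: eq_cint => y; rewrite mulrA.
rewrite (cint_swap L); apply: eq_cint => y /=.
rewrite fourierE -cintZ; last exact: ft_L1.
by apply: eq_cint => x; rewrite (ecC x) ecNl; ring.
Qed.

End fourier_L1.

Lemma ccvg_real (I : Type) (F : set_system I) (FF : ProperFilter F) (R : realType) (r : I -> R) (a : R) :
  r k @[k --> F] --> a -> ccvg F (fun k => ((r k)%:C)%C) ((a%:C)%C).
Proof.
move=> h; rewrite /ccvg; under eq_fun do rewrite -rcB normc_real.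
exact: dist0_cvg.
Qed.

(** * Approximate identities and injectivity of the transform *)

Section smoothing.
Context (R : realType) (n : nat).
Local Notation V := 'rV[R]_n.
Local Notation mu := (lebn R n).
Implicit Types f g : V -> R[i].

Definition smooth (s : R) f (z : V) := cint mu (fun u => f (z + s *: u) * ((pois u)%:C)%C).

Lemma pois_le1 (x : V) : pois x <= 1.
Proof.
rewrite /pois; apply: prodr_ile1 => i _; rewrite cauchyd_ge0/= invf_le1.
  rewrite -[X in X <= _]mulr1 ler_pM// ?lerDl ?sqr_ge0//.
  by apply: le_trans (pi_ge2 R); rewrite ler1n.
by rewrite mulr_gt0 ?pi_gt0// ltr_wpDr ?sqr_ge0.
Qed.

Lemma pois_L1 : L1c mu (fun x : V => ((pois x)%:C)%C).
Proof.
apply: (L1c_dom _ (@pois_rint R n)) => [|x]; first by apply: mc_real; exact: measurable_pois.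
by rewrite normc_real ger0_norm ?pois_ge0.
Qed.

Lemma theta_dil (s : R) : 0 < s -> L1c mu (fun x : V => ((theta (s *: x))%:C)%C).
Proof. by move=> s0; exact: (mscales_L1c (lebn_dilate n s0) (@theta_L1 R n)). Qed.

Lemma measurable_theta_dil (s : R) : measurable_fun setT (fun x : V => theta (s *: x)).
Proof.
by apply: measurableT_comp; [exact: measurable_theta|exact: measurable_rVZ].
Qed.

Lemma thetaM_FT (s : R) (z y : V) : 0 < s ->
  fourier (fun x => ((theta (s *: x))%:C)%C * ec x z) y =
  (((s ^+ n)^-1 * pois (s^-1 *: (y - z)))%:C)%C.
Proof.
move=> s0; under eq_fun do rewrite ecC; rewrite fourier_mod.
rewrite (@fourier_dilate _ _ (fun x : V => ((theta x)%:C)%C))//; last exact: theta_L1.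
rewrite rcM -theta_FT; congr (_ * _); apply: eq_cint => x.
by rewrite dotrVC.
Qed.

(** Fourier inversion with damping: the multiplication formula moves the transform onto the damped
    character, where it becomes a dilated and translated Poisson kernel. *)
Lemma smoothE (s : R) f z : 0 < s -> L1c mu f ->
  cint mu (fun x => fourier f x * (((theta (s *: x))%:C)%C * ec x z)) = smooth s f z.
Proof.
move=> s0 f1; have sn0 : s != 0 by rewrite gt_eqF.
rewrite fourier_mul//; last by apply: (L1c_bound (theta_dil s0) (mc_ecl z)) => x; rewrite normc_ec.
under eq_fun do rewrite thetaM_FT//.
pose F y := f y * ((pois (s^-1 *: (y - z)))%:C)%C.
have F1 : L1c mu F.
  apply: (@L1c_bound _ _ _ _ _ _ 1 f1).
    apply: mc_real; apply: measurableT_comp; first exact: measurable_pois.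
    by apply: measurable_rVZ; apply: measurable_rVB.
  by move=> x; rewrite normc_real ger0_norm ?pois_ge0// pois_le1.
transitivity ((((s ^+ n)^-1)%:C)%C * cint mu F).
  by rewrite -cintZ//; apply: eq_cint => y; rewrite rcM /F; ring.
rewrite -(mscales_cint (lebn_affine z s0) F1); apply: eq_cint => u.
by rewrite /F [z + _]addrC addrK scalerA mulVf ?scale1r.
Qed.

Lemma mc_shift (s : R) f : mc f -> mc (fun p : V * V => f (p.1 + s *: p.2)).
Proof.
move=> mf; apply: (mc_comp _ mf); apply: measurable_rVD; first exact: measurable_fst.
by apply: measurable_rVZ; exact: measurable_snd.
Qed.

Lemma shift_L1n (s : R) f u : mc f -> L1n mu (fun z => f (z + s *: u)) = L1n mu f.
Proof. by move=> mf; rewrite (mscales_L1n (lebn_translate (s *: u)) mf) mul1e. Qed.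

Lemma cvg_shift (sk : nat -> R) (u z : V) : sk k @[k --> \oo] --> (0 : R) ->
  z + sk k *: u @[k --> \oo] --> z.
Proof.
move=> s0; rewrite -[X in _ --> X]addr0 -(scale0r u).
apply: cvgD; first exact: cvg_cst.
exact: cvgZr_tmp.
Qed.

Section convolution_kernel.
Variable k : V -> R[i].
Hypothesis k1 : L1c mu k.

(** A correlation, with [z + s u] rather than [z - s u]; the transform of [k] is consequently
    evaluated at [- (s *: x)] in [fourier_convk]. *)
Definition convk (s : R) f (z : V) := cint mu (fun u => f (z + s *: u) * k u).

Lemma mc_convk (s : R) f : mc f -> mc (fun p : V * V => f (p.1 + s *: p.2) * k p.2).
Proof. by move=> mf; apply: mcM; [exact: mc_shift|exact: mc_comp measurable_snd k1.1]. Qed.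

Lemma convk_L1 (s : R) f : L1c mu f ->
  L1c (mu \x mu)%E (fun p : V * V => f (p.1 + s *: p.2) * k p.2).
Proof.
move=> f1; split; first exact: mc_convk f1.1.
rewrite L1n_prod2; last exact: mc_convk f1.1.
rewrite (eq_integral (fun u : V => (L1n mu f * (normc (k u))%:E)%E)); last first.
  move=> u _ /=; rewrite -(@shift_L1n s f u f1.1) /L1n -ge0_integralZr//.
  - by apply: eq_integral => z _; rewrite normcM.
  - apply/measurable_EFinP; apply: mc_normc; apply: (mc_comp _ f1.1).
    exact: measurable_rVD.
  - by move=> z _; rewrite lee_fin normc_ge0.
  - by rewrite lee_fin normc_ge0.
rewrite ge0_integralZl//; first last.
- exact: L1n_ge0.
- by move=> u _; rewrite lee_fin normc_ge0.
- by apply/measurable_EFinP; apply: mc_normc; exact: k1.1.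
by rewrite -(fineK (L1n_fin f1)) -/(L1n mu k) -(fineK (L1n_fin k1)) -EFinM ltry.
Qed.

(** Since [k] has integral 1, the error is an average over [u] of differences of translates. Its L^1
    norm is at most the average of their norms, which tend to zero and are dominated by twice the
    norm of [f]. *)
Lemma convk_cvg (sk : nat -> R) f : cint mu k = 1 -> sk k @[k --> \oo] --> (0 : R) ->
  L1c mu f -> L1n mu (fun z => convk (sk k) f z - f z) @[k --> \oo] --> (0 : \bar R).
Proof.
move=> kone s0 f1; have mf := f1.1.
pose D l (p : V * V) := f (p.1 + sk l *: p.2) * k p.2 - f p.1 * k p.2.
have fp1 : L1c (mu \x mu)%E (fun p : V * V => f p.1 * k p.2) by exact: (L1c_tens f1 k1).
have D1 l : L1c (mu \x mu)%E (D l) by apply: L1cB => //; exact: convk_L1.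
pose h l (u : V) := fine (L1n mu (fun z => f (z + sk l *: u) - f z)) * normc (k u).
have du1 l (u : V) : L1c mu (fun z => f (z + sk l *: u) - f z).
  by apply: L1cB => //; exact: (mscales_L1c (lebn_translate (sk l *: u)) f1).
have hE l : L1n (mu \x mu)%E (D l) = (\int[mu]_u (h l u)%:E)%E.
  rewrite L1n_prod2; last exact: (D1 l).1.
  apply: eq_integral => u _; rewrite /h EFinM fineK; last exact: L1n_fin.
  rewrite /L1n -ge0_integralZr//; first last.
  - by rewrite lee_fin normc_ge0.
  - by move=> z _; rewrite lee_fin normc_ge0.
  - by apply/measurable_EFinP; apply: mc_normc; exact: (du1 l u).1.
  by apply: eq_integral => z _; rewrite /D /= -mulrBl normcM.
have mh l : measurable_fun setT (h l).
  apply: measurable_funM; last exact: mc_normc k1.1.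
  apply: measurableT_comp => //.
  apply: (@measurable_fun_fubini_tonelli_G _ _ _ _ _ mu (fun p : V * V => (normc (f (p.1 + sk l *: p.2) - f p.1))%:E)).
    apply/measurable_EFinP; apply: mc_normc; apply: mcB; first exact: mc_shift.
    exact: (mc_comp measurable_fst mf).
  by move=> p; rewrite lee_fin normc_ge0.
apply: (@e0_le _ _ (fun l => (\int[mu]_u (h l u)%:E)%E)) => [l|].
  rewrite L1n_ge0 -hE/= (@L1n_ae _ _ _ mu _ (fun z => cint mu (fun u => D l (z, u)))).
  - exact: L1n_cint1 (D1 l).
  - by apply: mcB => //; exact: (mc_cint1 mu (mc_convk (sk l) mf)).
  - exact: (mc_cint1 mu (D1 l).1).
  apply: filterS2 (L1c_slice1 (convk_L1 (sk l) f1)) (L1c_slice1 fp1) => z h1 h2.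
  by rewrite /D /= cintB//= cintZ// kone mulr1.
pose G (u : V) := 2 * fine (L1n mu f) * normc (k u).
apply: (@real_dct0 _ _ _ _ _ G mh).
- by apply: rintZ; exact: L1c_int.
- move=> l u; rewrite mulr_ge0 ?fine_ge0 ?L1n_ge0 ?normc_ge0//=.
  rewrite ler_wpM2r ?normc_ge0// -lee_fin fineK; last exact: L1n_fin.
  apply: le_trans (L1nD _ _ _) _.
  - by apply: (mscales_L1c (lebn_translate (sk l *: u)) f1).1.
  - exact: mcN.
  rewrite (shift_L1n (sk l) u mf) (_ : L1n mu (fun z => - f z) = L1n mu f); last first.
    by apply: eq_integral => z _; rewrite normcN.
  by rewrite EFinM fineK ?L1n_fin// mule_natl mule2n.
- apply: nearW => u.
  have := @shrink_L1 R n (fun l z => z + sk l *: u) (fun=> 1) (fun l => lebn_translate (sk l *: u)) (cvg_cst _) (cvg_shift u ^~ s0) f f1.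
  move=> /(_ _)/fine_cvgP[_ /= hh].
  by rewrite -[X in _ --> X](mul0r (normc (k u))); apply: cvgM; [exact: hh|exact: cvg_cst].
Qed.

End convolution_kernel.

Lemma smooth_ker_L1 (s : R) f : L1c mu f ->
  L1c (mu \x mu)%E (fun p : V * V => f (p.1 + s *: p.2) * ((pois p.2)%:C)%C).
Proof. exact: convk_L1 pois_L1 s f. Qed.

Lemma smooth_cvg (sk : nat -> R) f : sk k @[k --> \oo] --> (0 : R) ->
  L1c mu f -> L1n mu (fun z => smooth (sk k) f z - f z) @[k --> \oo] --> (0 : \bar R).
Proof.
apply: (convk_cvg pois_L1); rewrite cint_real (_ : \int[mu]_x pois x = 1)//.
by rewrite /Rintegral pois_int.
Qed.

Lemma invS_cvg0 : (k.+1%:R^-1 : R) @[k --> \oo] --> (0 : R).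
Proof. exact: cvg_harmonic. Qed.

(** The Poisson smoothings of [f] are damped integrals of its transform, hence zero, and they
    converge to [f] in L^1. *)
Theorem fourier_inj f : L1c mu f -> {ae mu, forall x, fourier f x = 0} -> {ae mu, forall x, f x = 0}.
Proof.
move=> f1 ff0.
have sp k : 0 < (k.+1%:R^-1 : R) by rewrite invr_gt0.
have sm0 k z : smooth (k.+1%:R^-1) f z = 0.
  rewrite -smoothE// -[RHS](cint0 mu); apply: ae_eq_cint.
  - apply: mcM; first exact: mc_fourier f1.1.
    by apply: mcM; [exact: (theta_dil (sp k)).1|exact: mc_ecl].
  - exact: mc_cst.
  - by apply: filterS ff0 => x ->; rewrite mul0r.
apply: L1n_eq0; first exact: f1.1.
have := smooth_cvg invS_cvg0 f1.
rewrite (_ : (fun k => _) = fun=> L1n mu f) => [h|].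
  by apply: (cvg_unique _ (cvg_cst _) h); exact: ereal_hausdorff.
apply/funext => k; apply: eq_integral => z _.
by rewrite sm0 sub0r normcN.
Qed.

End smoothing.

(** * Plancherel's theorem for functions in L^1 and L^2 *)

Section plancherel_L1.
Context (R : realType) (n : nat).
Local Notation V := 'rV[R]_n.
Local Notation mu := (lebn R n).
Implicit Types f g : V -> R[i].

Definition autocorr f (v : V) := cint mu (fun z => (f z)^*%C * f (z + v)).

Lemma shift_L2 f v : L2c mu f -> L2c mu (fun z => f (z + v)).
Proof. exact: (mscales_L2c (lebn_translate v)). Qed.

Lemma cint_CS d (T : measurableType d) (m : {measure set T -> \bar R}) (f g : T -> R[i]) :
  L2c m f -> L2c m g ->
  normc (cint m (fun x => f x * g x)) <= Num.sqrt (fine (L2n m f)) * Num.sqrt (fine (L2n m g)).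
Proof.
move=> f2 g2; apply: le_trans (cint_le (L2cM f2 g2)) _.
rewrite -lee_fin fineK; first exact: L1n_CS.
by apply: L1n_fin; exact: L2cM.
Qed.
Lemma L2n_conj d (T : measurableType d) (m : {measure set T -> \bar R}) (f : T -> R[i]) :
  L2n m (fun x => (f x)^*%C) = L2n m f.
Proof. by apply: eq_integral => x _; rewrite normc_conj. Qed.

Lemma L2n_shift f v : mc f -> L2n mu (fun z => f (z + v)) = L2n mu f.
Proof. by move=> mf; rewrite (mscales_L2n (lebn_translate v) mf) mul1e. Qed.

Lemma autocorr_le f v : L2c mu f -> normc (autocorr f v) <= fine (L2n mu f).
Proof.
move=> f2; apply: le_trans (cint_CS (L2c_conj f2) (shift_L2 v f2)) _.
by rewrite L2n_conj (L2n_shift v f2.1) -expr2 sqr_sqrtr// fine_ge0// L2n_ge0.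
Qed.

Lemma autocorr0 f : L2c mu f -> autocorr f 0 = ((fine (L2n mu f))%:C)%C.
Proof.
move=> f2; rewrite /autocorr; under eq_fun do rewrite addr0 conj_mul.
by rewrite cint_real.
Qed.

Lemma autocorr_cvg f (sk : nat -> R) u : sk k @[k --> \oo] --> (0 : R) -> L2c mu f ->
  ccvg \oo (fun k => autocorr f (sk k *: u)) (autocorr f 0).
Proof.
move=> s0 f2.
have := @shrink_L2 R n (fun k z => z + sk k *: u) (fun=> 1) (fun k => lebn_translate (sk k *: u)) (cvg_cst _) (cvg_shift u ^~ s0) f f2.
move=> /(_ _)/fine_cvgP[_ /cvg_sqrt0 hh].
apply: norm0_cvg (cvgZ0 (Num.sqrt (fine (L2n mu f))) hh) => k.
have fs v : L1c mu (fun z => (f z)^*%C * f (z + v)) by apply: L2cM; [exact: L2c_conj|exact: shift_L2].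
have -> : autocorr f (sk k *: u) - autocorr f 0 = cint mu (fun z => (f z)^*%C * (f (z + sk k *: u) - f z)).
  have := cintB (fs (sk k *: u)) (fs 0); rewrite /autocorr => <-.
  by apply: eq_cint => z; rewrite -mulrBr addr0.
rewrite normc_ge0 /=.
apply: le_trans (cint_CS (L2c_conj f2) (L2cB (shift_L2 _ f2) f2)) _.
by rewrite L2n_conj.
Qed.

Lemma mc_autocorr f (s : R) : mc f -> mc (fun u : V => autocorr f (s *: u)).
Proof.
move=> mf; apply: (@mc_cint2 _ _ _ _ _ mu (fun p : V * V => (f p.1)^*%C * f (p.1 + s *: p.2))).
by apply: mcM; [apply: mc_conj; exact: (mc_comp measurable_fst mf)|exact: mc_shift].
Qed.

(** The damped energy of the spectrum is a Poisson average of the autocorrelation near the origin;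
    letting [s] tend to 0 turns this into Plancherel's identity. *)
Lemma plancherel_theta f (s : R) : 0 < s -> L1c mu f -> L2c mu f ->
  cint mu (fun x => ((normc (fourier f x) ^+ 2 * theta (s *: x))%:C)%C) =
  cint mu (fun u => ((pois u)%:C)%C * autocorr f (s *: u)).
Proof.
move=> s0 f1 f2; have mf := f1.1.
have mF := mc_fourier mf.
have L1 : L1c mu (fun x => fourier f x * ((theta (s *: x))%:C)%C).
  have := L1c_bound (theta_dil n s0) mF (fun x => fourier_bound x f1).
  by under eq_fun do rewrite mulrC.
have c1 : L1c mu (fun z => (f z)^*%C) by exact: L1c_conj.
have L2 : L1c (mu \x mu)%E (fun p : V * V => fourier f p.1 * ((theta (s *: p.1))%:C)%C * (f p.2)^*%C * ec p.1 p.2).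
  apply: (L1c_bound (L1c_tens L1 c1)) => [|p]; last by rewrite normc_ec.
  by apply: mc_ec; [exact: measurable_fst|exact: measurable_snd].
transitivity (cint mu (fun x => cint mu (fun z => fourier f x * ((theta (s *: x))%:C)%C * (f z)^*%C * ec x z))).
  apply: eq_cint => x; rewrite rcM -mul_conj fourierE -cint_conj; last exact: ft_L1.
  rewrite -fourierE mulrAC -cintZ; last by apply: L1c_conj; exact: ft_L1.
  by apply: eq_cint => z; rewrite conjcM ec_conj opprK !mulrA.
rewrite (cint_swap L2) /=.
transitivity (cint mu (fun z => (f z)^*%C * smooth s f z)).
  apply: eq_cint => z; rewrite -smoothE// -cintZ.
    by apply: eq_cint => x; ring.
  have := L1c_bound L1 (mc_ecl z) (fun x => ltac:(by rewrite normc_ec) : normc (ec x z) <= 1).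
  by under eq_fun do rewrite -mulrA.
have L3 : L1c (mu \x mu)%E (fun p : V * V => (f p.1)^*%C * f (p.1 + s *: p.2) * ((pois p.2)%:C)%C).
  have m1 : mc (fun p : V * V => (f p.1)^*%C * f (p.1 + s *: p.2)).
    by apply: mcM; [apply: mc_conj; exact: (mc_comp measurable_fst mf)|exact: mc_shift].
  have m2 : mc (fun p : V * V => (f p.1)^*%C * f (p.1 + s *: p.2) * ((pois p.2)%:C)%C).
    by apply: mcM => //; apply: mc_real; apply: measurableT_comp; [exact: measurable_pois|exact: measurable_snd].
  split => //; rewrite L1n_prod2//.
  apply: (@le_lt_trans _ _ (\int[mu]_u ((fine (L2n mu f))%:E * (pois u)%:E))%E); last first.
    rewrite ge0_integralZl//; first last.
    - by rewrite lee_fin fine_ge0 ?L2n_ge0.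
    - by move=> u _; rewrite lee_fin pois_ge0.
    - by apply/measurable_EFinP; exact: measurable_pois.
    by rewrite pois_int mule1 ltry.
  apply: ge0_le_integral => //.
  - by move=> u _; exact: L1n_ge0.
  - apply: (@measurable_fun_fubini_tonelli_G _ _ _ _ _ mu (fun p : V * V => (normc ((f p.1)^*%C * f (p.1 + s *: p.2) * ((pois p.2)%:C)%C))%:E)).
      by apply/measurable_EFinP; exact: mc_normc.
    by move=> p; rewrite lee_fin normc_ge0.
  - by apply/measurable_EFinP; apply: measurable_funM => //; exact: measurable_pois.
  move=> u _ /=.
  have h := L1n_CS (L2c_conj f2) (shift_L2 (s *: u) f2).
  rewrite L2n_conj (L2n_shift _ mf) -expr2 sqr_sqrtr ?fine_ge0 ?L2n_ge0// in h.
  apply: le_trans (lee_wpmul2r _ h); last by rewrite lee_fin pois_ge0.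
  rewrite /L1n -ge0_integralZr//; first last.
  - by rewrite lee_fin pois_ge0.
  - by move=> z _; rewrite lee_fin normc_ge0.
  - apply/measurable_EFinP; apply: mc_normc; apply: mcM; first exact: mc_conj.
    exact: (shift_L2 (s *: u) f2).1.
  rewrite le_eqVlt; apply/orP; left; apply/eqP; apply: eq_integral => z _.
  by rewrite normcM normc_real ger0_norm ?pois_ge0.
transitivity (cint mu (fun z => cint mu (fun u => (f z)^*%C * f (z + s *: u) * ((pois u)%:C)%C))).
  apply: ae_eq_cint.
  - by apply: mcM; [exact: mc_conj|exact: (mc_cint1 mu (@mc_convk R n _ (@pois_L1 R n) s f mf))].
  - exact: (mc_cint1 mu L3.1).
  apply: filterS (L1c_slice1 (smooth_ker_L1 s f1)) => z hz.
  by rewrite /smooth -cintZ//; apply: eq_cint => u; rewrite mulrA.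
rewrite (cint_swap L3); apply: eq_cint => u /=.
rewrite mulrC -cintZr//; apply: L2cM; [exact: L2c_conj|exact: shift_L2].
Qed.

Lemma thetaM (s : R) (x : V) : 0 < s -> theta (s *: x) ^+ 2 = theta ((2 * s) *: x).
Proof.
move=> s0; rewrite /theta -expRM_natl; congr expR.
rewrite mulrN; congr (- _); rewrite mulrCA; congr (_ * _); rewrite mulr_sumr; apply: eq_bigr => i _.
by rewrite !mxE -mulrA (normrM 2) ger0_norm.
Qed.

Lemma theta_cvg (sk : nat -> R) (x : V) : sk k @[k --> \oo] --> (0 : R) ->
  theta (sk k *: x) @[k --> \oo] --> (1 : R).
Proof.
move=> s0; rewrite /theta -[X in _ --> X]expR0.
apply: (continuous_cvg _ (@continuous_expR R 0)).
rewrite -[X in _ --> X]oppr0; apply: cvgN.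
rewrite -[X in _ --> X](mulr0 (2 * pi)); apply: cvgM; first exact: cvg_cst.
under eq_fun do under eq_bigr do rewrite mxE normrM.
under eq_fun do rewrite -mulr_sumr.
under eq_fun do rewrite mulrC; apply: cvgZ0.
by rewrite -(normr0 R); exact: cvg_norm.
Qed.

Theorem plancherel_L12 f : L1c mu f -> L2c mu f ->
  L2c mu (fourier f) /\ L2n mu (fourier f) = L2n mu f.
Proof.
move=> f1 f2; have mF := mc_fourier f1.1.
have sp k : 0 < (k.+1%:R^-1 : R) by rewrite invr_gt0.
(* The square of [theta] at scale [s] is [theta] at scale [2 s], so these norms fall under
   [plancherel_theta]. They are bounded uniformly in [s], and Fatou's lemma puts the transform in
   L^2. *)
have th2 (s : R) : 0 < s -> L2n mu (fun x => fourier f x * ((theta (s *: x))%:C)%C) =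
   (complex.Re (cint mu (fun u => ((pois u)%:C)%C * autocorr f ((2 * s) *: u))))%:E.
  move=> s0; have s2 : 0 < 2 * s by rewrite mulr_gt0.
  rewrite -plancherel_theta//.
  transitivity ((\int[mu]_x (normc (fourier f x) ^+ 2 * theta ((2 * s) *: x)))%:E); last by rewrite cint_real.
  rewrite /Rintegral fineK.
    apply: eq_integral => x _; rewrite normcM exprMn normc_real ger0_norm ?theta_ge0//.
    by rewrite thetaM.
  apply: integrable_fin_num => //.
  apply: (@rint_le _ _ _ mu (fun x : V => normc (fourier f x) ^+ 2 * theta ((2 * s) *: x))
    (fun x => fine (L1n mu f) ^+ 2 * theta ((2 * s) *: x))).
  - by apply: measurable_funM; [exact: msq|exact: measurable_theta_dil].
  - move=> x; rewrite ger0_norm ?mulr_ge0 ?theta_ge0 ?exprn_ge0 ?normc_ge0//.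
    rewrite ler_wpM2r ?theta_ge0// ler_pXn2r ?nnegrE ?normc_ge0 ?fine_ge0 ?L1n_ge0//.
    exact: fourier_bound.
  - by apply: rintZ; exact: (L1c_Re (theta_dil n s2)).
have pA (s : R) : L1c mu (fun u : V => ((pois u)%:C)%C * autocorr f (s *: u)).
  apply: (L1c_bound (@pois_L1 R n) (mc_autocorr s f2.1)) => u; exact: autocorr_le.
have key (s : R) : normc (cint mu (fun u => ((pois u)%:C)%C * autocorr f (s *: u))) <= fine (L2n mu f).
  apply: le_trans (cint_le (pA s)) _; rewrite -lee_fin fineK; last exact: L1n_fin.
  apply: (@le_trans _ _ (\int[mu]_u ((fine (L2n mu f))%:E * (pois u)%:E))%E).
    apply: ge0_le_integral => //.
    - by move=> u _; rewrite lee_fin normc_ge0.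
    - by apply/measurable_EFinP; apply: mc_normc; exact: (pA s).1.
    - by apply/measurable_EFinP; apply: measurable_funM => //; exact: measurable_pois.
    move=> u _; rewrite -EFinM lee_fin normcM normc_real ger0_norm ?pois_ge0// mulrC.
    by rewrite ler_wpM2r ?pois_ge0 ?autocorr_le.
  rewrite ge0_integralZl//; first last.
  - by rewrite lee_fin fine_ge0 ?L2n_ge0.
  - by move=> u _; rewrite lee_fin pois_ge0.
  - by apply/measurable_EFinP; exact: measurable_pois.
  by rewrite pois_int mule1.
have F2 : L2c mu (fourier f).
  split => //; apply: (@le_lt_trans _ _ (fine (L2n mu f))%:E); last exact: ltry.
  apply: (@fatou_L2 _ _ _ mu (fun k x => fourier f x * ((theta (k.+1%:R^-1 *: x))%:C)%C)).
  - by move=> k; apply: mcM => //; exact: (theta_dil n (sp k)).1.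
  - move=> x; rewrite -[X in ccvg _ _ X]mulr1; apply: ccvgM; first exact: ccvg_cst.
    exact: ccvg_real (theta_cvg x (@invS_cvg0 R)).
  by move=> k; rewrite th2// lee_fin (le_trans (ler_norm _))// (le_trans (Re_le_normc _)).
split => //.
have c1 : ccvg \oo (fun k : nat => cint mu (fun x => ((normc (fourier f x) ^+ 2 * theta (k.+1%:R^-1 *: x))%:C)%C))
    (cint mu (fun x => ((normc (fourier f x) ^+ 2)%:C)%C)).
  apply: (@dct_cint _ _ _ _ _ _ (fun x => normc (fourier f x) ^+ 2)).
  - by move=> k; apply: mc_real; apply: measurable_funM; [exact: msq|exact: measurable_theta_dil].
  - by apply: mc_real; exact: msq.
  - exact: L2c_int.
  - move=> k x; rewrite normc_real ger0_norm ?mulr_ge0 ?theta_ge0 ?exprn_ge0 ?normc_ge0//.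
    by rewrite ler_piMr ?theta_le1 ?exprn_ge0 ?normc_ge0.
  - by move=> x; rewrite normc_real ger0_norm ?exprn_ge0 ?normc_ge0.
  apply: nearW => x; apply: ccvg_real; rewrite -[X in _ --> X]mulr1.
  by apply: cvgM; [exact: cvg_cst|exact: theta_cvg (@invS_cvg0 R)].
have c2 : ccvg \oo (fun k : nat => cint mu (fun u => ((pois u)%:C)%C * autocorr f (k.+1%:R^-1 *: u)))
    (cint mu (fun u => ((pois u)%:C)%C * autocorr f 0)).
  apply: (@dct_cint _ _ _ _ _ _ (fun u => fine (L2n mu f) * pois u)).
  - by move=> k; exact: (pA _).1.
  - by apply: mcM; [exact: (@pois_L1 R n).1|exact: mc_cst].
  - by apply: rintZ; exact: pois_rint.
  - move=> k u; rewrite normcM normc_real ger0_norm ?pois_ge0// mulrC.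
    by rewrite ler_wpM2r ?pois_ge0 ?autocorr_le.
  - move=> u; rewrite normcM normc_real ger0_norm ?pois_ge0// mulrC.
    by rewrite ler_wpM2r ?pois_ge0 ?autocorr_le.
  apply: nearW => u; apply: ccvgM; first exact: ccvg_cst.
  exact: autocorr_cvg (@invS_cvg0 R) f2.
have : cint mu (fun x => ((normc (fourier f x) ^+ 2)%:C)%C) = cint mu (fun u => ((pois u)%:C)%C * autocorr f 0).
  apply: ccvg_uniq c1 _; apply: ccvg_ext c2 => k; exact/esym/plancherel_theta.
rewrite cint_real cintZr; last exact: pois_L1.
rewrite cint_real autocorr0// (_ : \int[mu]_x pois x = 1); last by rewrite /Rintegral pois_int.
rewrite mul1r => /(congr1 (@complex.Re R)) /= h.
rewrite -(fineK (L2n_fin F2)) -(fineK (L2n_fin f2)); congr (_%:E); exact: h.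
Qed.

End plancherel_L1.

(** * The Fourier transform on L^2 *)

Section Lp_bridge.
Context (R : realType) (n : nat).
Local Notation V := 'rV[R]_n.
Local Notation mu := (lebn R n).
Implicit Types f g : V -> R[i].

Lemma eLp1E f : eLpnorm 1%:E f = L1n mu f.
Proof.
rewrite /eLpnorm Lnorm1; apply: eq_integral => x _.
by rewrite gee0_abs// lee_fin normc_ge0.
Qed.

Lemma eLp2E f : ((eLpnorm 2%:E f) `^ 2)%E = L2n mu f.
Proof.
rewrite /eLpnorm poweR_Lnorm//; apply: eq_integral => x _.
by rewrite gee0_abs ?lee_fin ?normc_ge0// poweR_EFin powR_mulrn ?normc_ge0.
Qed.

Lemma eLp2_le f (r : R) : 0 <= r -> (eLpnorm 2%:E f <= r%:E)%E = (L2n mu f <= (r ^+ 2)%:E)%E.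
Proof.
move=> r0; have := eLp2E f; have : (0 <= eLpnorm 2%:E f)%E by exact: Lnorm_ge0.
case: (eLpnorm 2%:E f) => [s|_|//].
  rewrite lee_fin => s0 <-; rewrite poweR_EFin powR_mulrn// !lee_fin.
  by rewrite ler_pXn2r ?nnegrE.
by rewrite poweRyr ?pnatr_eq0// => <-; rewrite !leye_eq.
Qed.

Lemma eLp2_lty f : (eLpnorm 2%:E f < +oo)%E = (L2n mu f < +oo)%E.
Proof.
apply/idP/idP => h; first by rewrite -eLp2E poweR_lty.
have f0 : L2n mu f \is a fin_num by rewrite ge0_fin_numE ?L2n_ge0.
apply: le_lt_trans (ltry (Num.sqrt (fine (L2n mu f)))).
by rewrite eLp2_le ?sqrtr_ge0// sqr_sqrtr ?fine_ge0 ?L2n_ge0// fineK.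
Qed.

Lemma Lp2E f : (L2n mu f < +oo)%E -> Lpnorm 2%:E f ^+ 2 = fine (L2n mu f).
Proof.
rewrite -eLp2_lty /Lpnorm => h; rewrite -eLp2E.
have := h; have : (0 <= eLpnorm 2%:E f)%E by exact: Lnorm_ge0.
case: (eLpnorm 2%:E f) => [s|//|//].
by rewrite lee_fin => s0 _ /=; rewrite powR_mulrn.
Qed.
Lemma Lp1E f : Lpnorm 1%:E f = fine (L1n mu f).
Proof. by rewrite /Lpnorm eLp1E. Qed.

Lemma in_Lp1 f : in_Lp 1%:E f <-> L1c mu f.
Proof. by rewrite /in_Lp eLp1E. Qed.
Lemma in_Lp2 f : in_Lp 2%:E f <-> L2c mu f.
Proof. by rewrite /in_Lp eLp2_lty. Qed.

Lemma cvg_Lp1 (u : nat -> V -> R[i]) f :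
  cvg_Lp 1%:E u f <-> L1n mu (fun x => u k x - f x) @[k --> \oo] --> (0 : \bar R).
Proof. by rewrite /cvg_Lp; under eq_fun do rewrite eLp1E. Qed.
Lemma cvg_Lp2 (u : nat -> V -> R[i]) f :
  cvg_Lp 2%:E u f <-> L2n mu (fun x => u k x - f x) @[k --> \oo] --> (0 : \bar R).
Proof.
rewrite /cvg_Lp; split => h.
  apply: e0_eps => [k|e e0]; first exact: L2n_ge0.
  have e1 : 0 < Num.sqrt e by rewrite sqrtr_gt0.
  apply: filterS (e0_near _ h e1) => [k|k]; last exact: Lnorm_ge0.
  by rewrite eLp2_le ?sqrtr_ge0// sqr_sqrtr// ltW.
apply: e0_eps => [k|e e0]; first exact: Lnorm_ge0.
have e1 : 0 < e ^+ 2 by rewrite exprn_gt0.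
apply: filterS (e0_near _ h e1) => [k|k]; last exact: L2n_ge0.
by rewrite eLp2_le// ltW.
Qed.

End Lp_bridge.

Section fourier_L2.
Context (R : realType) (n : nat).
Local Notation V := 'rV[R]_n.
Local Notation mu := (lebn R n).
Implicit Types f g F G : V -> R[i].

Definition L2to (u : nat -> V -> R[i]) f :=
  L2n mu (fun x => u k x - f x) @[k --> \oo] --> (0 : \bar R).
Definition ft2 f F := exists u : nat -> V -> R[i],
  [/\ forall k, L1c mu (u k) /\ L2c mu (u k), L2to u f & L2to (fun k => fourier (u k)) F].

Lemma is_fourier2E f F : is_fourier2 f F <-> ft2 f F.
Proof.
split => -[u [h1 h2 h3]]; exists u; split; try exact/cvg_Lp2.
  by move=> k; have [/in_Lp1 ? /in_Lp2 ?] := h1 k.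
by move=> k; have [? ?] := h1 k; split; [exact/in_Lp1|exact/in_Lp2].
Qed.

Lemma L2to_eq (u v : nat -> V -> R[i]) f g :
  (forall k, L2n mu (fun x => v k x - g x) = L2n mu (fun x => u k x - f x)) -> L2to u f -> L2to v g.
Proof. by move=> /funext e; rewrite /L2to e. Qed.

Lemma L2toD (u v : nat -> V -> R[i]) f g : (forall k, mc (u k)) -> (forall k, mc (v k)) ->
  mc f -> mc g -> L2to u f -> L2to v g -> L2to (fun k x => u k x + v k x) (fun x => f x + g x).
Proof.
move=> mu_ mv mf mg uf vg; apply: e0_le (e0_D (e0_Z 2 uf) (e0_Z 2 vg)) => k.
rewrite L2n_ge0/=.
rewrite (_ : (fun z => _) = fun z => (u k z - f z) + (v k z - g z)); last first.
  by apply/funext => z; rewrite addrACA opprD.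
by apply: L2nD; exact: mcB.
Qed.
Lemma L2nZ d (T : measurableType d) (m : {measure set T -> \bar R}) c (h : T -> R[i]) : mc h ->
  L2n m (fun x => c * h x) = ((normc c ^+ 2)%:E * L2n m h)%E.
Proof.
move=> mh; rewrite /L2n -ge0_integralZl//; first last.
- by rewrite lee_fin exprn_ge0 ?normc_ge0.
- by move=> z _; rewrite lee_fin exprn_ge0 ?normc_ge0.
- by apply/measurable_EFinP; exact: msq.
by apply: eq_integral => x _; rewrite -EFinM -exprMn normcM.
Qed.
Lemma L2toZ c (u : nat -> V -> R[i]) f : (forall k, mc (u k)) -> mc f ->
  L2to u f -> L2to (fun k x => c * u k x) (fun x => c * f x).
Proof.
move=> mu_ mf uf; apply: e0_le (e0_Z (normc c ^+ 2) uf) => k; rewrite L2n_ge0/=.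
by under eq_fun do rewrite -mulrBr; rewrite L2nZ//; exact: mcB.
Qed.
Lemma L2to_norm (u : nat -> V -> R[i]) f : (forall k, L2c mu (u k)) -> L2c mu f ->
  L2to u f -> fine (L2n mu (u k)) @[k --> \oo] --> fine (L2n mu f).
Proof.
move=> u2 f2 uf.
have h : hcvg (fun k => toL2 (u2 k)) (toL2 f2).
  move/fine_cvgP : uf => [_]; rewrite /hcvg => h.
  rewrite (_ : (fun k => _) = fun k => fine (L2n mu (fun x => u k x - f x)))//.
  apply/funext => k; rewrite n2_L2 /=; congr (fine (L2n _ _)).
  by apply/funext => x; rewrite /= mulN1r.
have := hcvg_n2 h; rewrite n2_L2.
by under eq_fun do rewrite n2_L2.
Qed.
Lemma L2to_cauchy (u : nat -> V -> R[i]) f : (forall k, mc (u k)) -> mc f -> L2to u f ->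
  forall e : R, 0 < e -> exists N, forall m k, (N <= m)%N -> (N <= k)%N ->
    (L2n mu (fun x => u m x - u k x)%R < e%:E)%E.
Proof.
move=> mu_ mf uf e e0; have e8 : 0 < e / 8 by rewrite divr_gt0.
have [N _ hN] := e0_near (fun k => L2n_ge0 _ _) uf e8; exists N => m k Nm Nk.
rewrite (_ : (fun x => _) = fun x => (u m x - f x) + (-1) * (u k x - f x)); last first.
  by apply/funext => x; ring.
apply: le_lt_trans (L2nD _ _ _) _; [exact: mcB|apply: mcM; [exact: mc_cst|exact: mcB]|].
rewrite L2nZ; last exact: mcB.
rewrite normcN normc1 expr1n mul1e.
have h1 := hN m Nm; have h2 := hN k Nk; rewrite /= in h1 h2.
apply: (@le_lt_trans _ _ (2%:E * (e / 8)%:E + 2%:E * (e / 8)%:E)%E).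
  by apply: leeD; exact: lee_wpmul2l.
by rewrite -EFinM -EFinD lte_fin; lra.
Qed.

Lemma ft2_L12 f : L1c mu f -> L2c mu f -> ft2 f (fourier f).
Proof.
move=> f1 f2; exists (fun=> f); split => //; rewrite /L2to.
  under eq_fun do under eq_fun do rewrite subrr; rewrite /L2n; under eq_fun do under eq_integral do rewrite normc0 expr0n.
  by rewrite integral0; exact: cvg_cst.
under eq_fun do under eq_fun do rewrite subrr; rewrite /L2n; under eq_fun do under eq_integral do rewrite normc0 expr0n.
by rewrite integral0; exact: cvg_cst.
Qed.

Lemma ft2D f g F G : mc f -> mc g -> mc F -> mc G -> ft2 f F -> ft2 g G ->
  ft2 (fun x => f x + g x) (fun x => F x + G x).
Proof.
move=> mf mg mF mG [u [u12 uf uF]] [v [v12 vg vG]].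
have mu_ k : mc (u k) by case: (u12 k) => -[].
have mv k : mc (v k) by case: (v12 k) => -[].
exists (fun k x => u k x + v k x); split.
- by move=> k; have [? ?] := u12 k; have [? ?] := v12 k; split; [exact: L1cD|exact: L2cD].
- exact: L2toD.
rewrite (_ : (fun k => _) = fun k x => fourier (u k) x + fourier (v k) x); last first.
  by apply/funext => k; apply/funext => x; apply: fourierD; [case: (u12 k)|case: (v12 k)].
by apply: L2toD => // k; exact: mc_fourier.
Qed.
Lemma ft2Z c f F : mc f -> mc F -> ft2 f F -> ft2 (fun x => c * f x) (fun x => c * F x).
Proof.
move=> mf mF [u [u12 uf uF]].
have mu_ k : mc (u k) by case: (u12 k) => -[].
exists (fun k x => c * u k x); split.
- by move=> k; have [? ?] := u12 k; split; [exact: L1cZ|exact: L2cZ].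
- exact: L2toZ.
rewrite (_ : (fun k => _) = fun k x => c * fourier (u k) x); last first.
  by apply/funext => k; apply/funext => x; apply: fourierZ; case: (u12 k).
by apply: L2toZ => // k; exact: mc_fourier.
Qed.

Lemma ft2_norm f F : L2c mu f -> L2c mu F -> ft2 f F -> L2n mu F = L2n mu f.
Proof.
move=> f2 F2 [u [u12 uf uF]].
have h1 := L2to_norm (fun k => (u12 k).2) f2 uf.
have P k := plancherel_L12 (u12 k).1 (u12 k).2.
have h2 := L2to_norm (fun k => (P k).1) F2 uF.
rewrite -(fineK (L2n_fin f2)) -(fineK (L2n_fin F2)); congr (_%:E).
move: h2; under eq_fun do rewrite (P _).2; move=> h2.
by apply: (cvg_unique _ h2 h1); exact: norm_hausdorff.
Qed.

Lemma L2_cube_cvg f : L2c mu f ->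
  L2to (fun k x => f x * ((\1_(cube k%:R) x : R)%:C)%C) f.
Proof.
move=> f2; have mf := f2.1.
apply: (@dct_L2 _ _ _ mu _ _ (fun x => normc (f x) ^+ 2)) => //.
- by move=> k; apply: mc_if => //; exact: measurable_cube.
- exact: L2c_int.
- move=> k x; rewrite ler_pXn2r ?nnegrE ?normc_ge0// normcM normc_real indicE.
  by case: (_ \in _); rewrite ?normr1 ?mulr1// normr0 mulr0 normc_ge0.
apply: nearW => x; apply: ccvg_ev.
exists (\sum_(i < n) (Num.truncn `|x 0%R i|).+1)%N => // k /= hk.
rewrite indicE mem_set ?mulr1// => i.
apply: le_trans (ltW (truncnS_gt _)) _.
by rewrite ler_nat (leq_trans _ hk)// (bigD1 i)//= leq_addr.
Qed.

Lemma cube_fin k : (mu (cube k%:R) < +oo)%E.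
Proof. by rewrite [mu _]lebesgue_cube ?ltry. Qed.

Lemma L2_cube_L12 f k : L2c mu f ->
  L1c mu (fun x => f x * ((\1_(cube k%:R) x : R)%:C)%C) /\
  L2c mu (fun x => f x * ((\1_(cube k%:R) x : R)%:C)%C).
Proof.
move=> f2; have mk := @measurable_cube R n k%:R; split.
  by apply: (L2cM f2); apply: L2c_indic => //; exact: cube_fin.
apply: (L2c_bound f2 (mc_indic R mk)) => x; rewrite normc_real.
by rewrite indicE; case: (_ \in _); rewrite ?normr1 ?normr0.
Qed.

Lemma ft2_exists f : L2c mu f -> exists F, L2c mu F /\ ft2 f F.
Proof.
move=> f2; pose u k x := f x * ((\1_(cube k%:R) x : R)%:C)%C.
have u12 k := L2_cube_L12 k f2.
have uf := L2_cube_cvg f2.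
have P k := plancherel_L12 (u12 k).1 (u12 k).2.
have [|F [F2 uF]] := riesz_fischer (fun k => (P k).1).
  move=> e e0; have [N hN] := L2to_cauchy (fun k => (u12 k).1.1) f2.1 uf e0.
  exists N => m k Nm Nk.
  rewrite (_ : (fun x => _) = fourier (fun x => u m x - u k x)); last first.
    by apply/funext => x; rewrite fourierB//; [exact: (u12 m).1|exact: (u12 k).1].
  rewrite (plancherel_L12 _ _).2; first exact: hN.
    by apply: L1cB; [exact: (u12 m).1|exact: (u12 k).1].
  by apply: L2cB; [exact: (u12 m).2|exact: (u12 k).2].
by exists F; split => //; exists u; split.
Qed.

(** Polarisation of [ft2_norm]: sums give the real parts, and replacing [g] by [i g] gives the
    imaginary parts. *)
Lemma ft2_ip f g F G : L2c mu f -> L2c mu g -> L2c mu F -> L2c mu G -> ft2 f F -> ft2 g G ->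
  cint mu (fun x => F x * (G x)^*%C) = cint mu (fun x => f x * (g x)^*%C).
Proof.
have Repart f' g' F' G' : L2c mu f' -> L2c mu g' -> L2c mu F' -> L2c mu G' -> ft2 f' F' -> ft2 g' G' ->
  complex.Re (cint mu (fun x => F' x * (G' x)^*%C)) = complex.Re (cint mu (fun x => f' x * (g' x)^*%C)).
  move=> f2 g2 F2 G2 fF gG.
  have e1 := ft2_norm (L2cD f2 g2) (L2cD F2 G2) (ft2D f2.1 g2.1 F2.1 G2.1 fF gG).
  have := n2D (toL2 f2) (toL2 g2); have := n2D (toL2 F2) (toL2 G2).
  rewrite !n2_L2 !ip_L2 /= e1 (ft2_norm f2 F2 fF) (ft2_norm g2 G2 gG) => -> h.
  move/addrI : h => h.
  by have /(mulfI _) := h; apply; rewrite pnatr_eq0.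
move=> f2 g2 F2 G2 fF gG.
have L1 (a b : V -> R[i]) : L2c mu a -> L2c mu b -> L1c mu (fun x => a x * (b x)^*%C).
  by move=> a2 b2; apply: L2cM => //; exact: L2c_conj.
apply: eqcP; first exact: Repart.
have := Repart _ _ _ _ f2 (L2cZ 'i%C g2) F2 (L2cZ 'i%C G2) fF (ft2Z 'i%C g2.1 G2.1 gG).
have e (a b : V -> R[i]) : L2c mu a -> L2c mu b ->
    complex.Re (cint mu (fun x => a x * ('i%C * b x)^*%C)) = complex.Im (cint mu (fun x => a x * (b x)^*%C)).
  move=> a2 b2; under eq_fun do rewrite conjcM mulrCA.
  by rewrite cintZ ?cReM/=; [rewrite mul0r sub0r mulN1r opprK|exact: L1].
by rewrite !e.
Qed.

Lemma L2n0_ae f g : L2c mu f -> L2c mu g -> L2n mu (fun x => f x - g x) = 0%E ->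
  {ae mu, forall x, f x = g x}.
Proof.
move=> f2 g2 /L2n_eq0 h; have := h (mcB f2.1 g2.1).
by apply: filterS => x /eqP; rewrite subr_eq0 => /eqP.
Qed.

Lemma L2n_cst0 d (T : measurableType d) (m : {measure set T -> \bar R}) : L2n m (fun=> 0 : R[i]) = 0%E.
Proof. by rewrite /L2n; under eq_integral do rewrite normc0 expr0n; rewrite integral0. Qed.

Lemma ft2_ext f g F G : mc f -> mc g -> mc F -> mc G ->
  {ae mu, forall x, f x = g x} -> {ae mu, forall x, F x = G x} -> ft2 f F -> ft2 g G.
Proof.
move=> mf mg mF mG fg FG [u [u12 uf uF]]; exists u; split => //.
  apply: L2to_eq uf => k; have mk : mc (u k) by case: (u12 k) => -[].
  by apply: L2n_ae; [exact: mcB|exact: mcB|apply: filterS fg => x ->].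
apply: L2to_eq uF => k; have mk : mc (fourier (u k)) by apply: mc_fourier; case: (u12 k) => -[].
by apply: L2n_ae; [exact: mcB|exact: mcB|apply: filterS FG => x ->].
Qed.

Lemma ft2_conj f F : mc f -> mc F -> ft2 f F ->
  ft2 (fun x => (f x)^*%C) (fun x => (F (- x))^*%C).
Proof.
move=> mf mF [u [u12 uf uF]]; exists (fun k x => (u k x)^*%C); split.
- by move=> k; have [? ?] := u12 k; split; [exact: L1c_conj|exact: L2c_conj].
- by apply: L2to_eq uf => k; apply: eq_integral => x _; rewrite -conjcB normc_conj.
apply: L2to_eq uF => k; have mk : mc (fourier (u k)) by apply: mc_fourier; case: (u12 k) => -[].
rewrite -[RHS]mul1e -(mscales_L2n (lebn_opp R n)); last exact: mcB.
apply: eq_integral => x _; rewrite fourier_conj; last by case: (u12 k).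
by rewrite -conjcB normc_conj.
Qed.

Lemma ft2_mod f F v : mc f -> mc F -> ft2 f F -> ft2 (fun x => f x * ec v x) (fun x => F (x - v)).
Proof.
move=> mf mF [u [u12 uf uF]]; exists (fun k x => u k x * ec v x); split.
- by move=> k; have [? ?] := u12 k; split; [exact: mod_L1|exact: mod_L2].
- by apply: L2to_eq uf => k; apply: eq_integral => x _; rewrite -mulrBl normcM normc_ec mulr1.
apply: L2to_eq uF => k; have mk : mc (fourier (u k)) by apply: mc_fourier; case: (u12 k) => -[].
rewrite -[RHS]mul1e -(mscales_L2n (lebn_translate (- v))); last exact: mcB.
by apply: eq_integral => x _; rewrite fourier_mod.
Qed.

Lemma L2to_cint (u : nat -> V -> R[i]) f g : (forall k, L2c mu (u k)) -> L2c mu f -> L2c mu g ->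
  L2to u f -> ccvg \oo (fun k => cint mu (fun x => g x * u k x)) (cint mu (fun x => g x * f x)).
Proof.
move=> u2 f2 g2 /fine_cvgP[_ /cvg_sqrt0 h].
apply: norm0_cvg (cvgZ0 (Num.sqrt (fine (L2n mu g))) h) => k; apply/andP; split; first exact: normc_ge0.
have := cintB (L2cM g2 (u2 k)) (L2cM g2 f2) => <-.
under eq_fun do rewrite -mulrBr.
by apply: cint_CS => //; exact: L2cB.
Qed.

Lemma fourier_mul_L2 f g G : L1c mu f -> L2c mu f -> L2c mu g -> L2c mu G -> ft2 g G ->
  cint mu (fun x => fourier f x * g x) = cint mu (fun x => f x * G x).
Proof.
move=> f1 f2 g2 G2 [u [u12 ug uG]].
have u2 k : L2c mu (u k) by case: (u12 k).
have F2 : L2c mu (fourier f) by case: (plancherel_L12 f1 f2).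
have U2 k : L2c mu (fourier (u k)) by case: (u12 k) => a b; case: (plancherel_L12 a b).
have h1 := L2to_cint u2 g2 F2 ug; have h2 := L2to_cint U2 G2 f2 uG.
apply: ccvg_uniq h1 _; apply: ccvg_ext h2 => k; apply/esym/fourier_mul => //.
by case: (u12 k).
Qed.

(** Let [F'] be the transform of the conjugate of [H]. The multiplication formula gives equal
    pairings of [F] and [F'] with the transforms [fourier (u k)], hence with their limit [F']; as
    both have the same norm, their distance is zero. *)
Lemma ft2_inv F H : L2c mu F -> L2c mu H -> ft2 (fun x => (F x)^*%C) H -> ft2 (fun x => (H x)^*%C) F.
Proof.
move=> F2 H2 cFH; have cF2 := L2c_conj F2.
have f2 := L2c_conj H2; set f := fun x => (H x)^*%C in f2 *.
have [F' [F'2 fF']] := ft2_exists f2.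
suff : {ae mu, forall x, F' x = F x}.
  move=> h; apply: ft2_ext fF' => //; [exact: f2.1|exact: f2.1|exact: F'2.1|exact: F2.1|exact: nearW].
have [u [u12 uf uF]] := fF'.
have P k := plancherel_L12 (u12 k).1 (u12 k).2.
have e k : cint mu (fun x => F' x * (fourier (u k) x)^*%C) = cint mu (fun x => F x * (fourier (u k) x)^*%C).
  rewrite (ft2_ip f2 (u12 k).2 F'2 (P k).1 fF' (ft2_L12 (u12 k).1 (u12 k).2)).
  have h := fourier_mul_L2 (u12 k).1 (u12 k).2 cF2 H2 cFH.
  rewrite (_ : (fun x => f x * _) = fun x => (u k x * H x)^*%C); last first.
    by apply/funext => x; rewrite conjcM mulrC.
  rewrite cint_conj; last by apply: L2cM => //; case: (u12 k).
  rewrite -h -cint_conj; last by apply: L2cM => //; case: (P k).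
  by apply: eq_cint => x; rewrite conjcM conjcK mulrC.
have cU2 k := L2c_conj (P k).1.
have uFc : L2to (fun k x => (fourier (u k) x)^*%C) (fun x => (F' x)^*%C).
  by apply: L2to_eq uF => k; apply: eq_integral => x _; rewrite -conjcB normc_conj.
have h1 := L2to_cint cU2 (L2c_conj F'2) F'2 uFc.
have h2 := L2to_cint cU2 (L2c_conj F'2) F2 uFc.
have e2 : cint mu (fun x => F' x * (F' x)^*%C) = cint mu (fun x => F x * (F' x)^*%C).
  by apply: ccvg_uniq h1 _; apply: ccvg_ext h2 => k; rewrite e.
have nn : L2n mu F' = L2n mu F.
  by rewrite (ft2_norm f2 F'2 fF') L2n_conj (ft2_norm cF2 H2 cFH) L2n_conj.
have := n2B (toL2 F2) (toL2 F'2).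
rewrite ip_L2 -e2 -(ip_L2 (toL2 F'2) (toL2 F'2)) -/(n2 (toL2 F'2)) !n2_L2 /= nn => h.
have h0 : fine (L2n mu (fun x => F x + -1 * F' x)) = 0 by rewrite h; ring.
have h3 : L2n mu (fun x => F x - F' x) = 0%E.
  rewrite -(fineK (L2n_fin (L2cB F2 F'2))); congr (_%:E); rewrite -h0; congr (fine (L2n _ _)).
  by apply/funext => x; rewrite mulN1r.
by apply: filterS (L2n0_ae F2 F'2 h3) => x ->.
Qed.

Theorem ft2_surj F : L2c mu F -> exists f, L2c mu f /\ ft2 f F.
Proof.
move=> F2; have [H [H2 cFH]] := ft2_exists (L2c_conj F2).
by exists (fun x => (H x)^*%C); split; [exact: L2c_conj|exact: ft2_inv].
Qed.

(** Plancherel for [f] against the conjugate of [g] modulated by [x]. This identity, valid at every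
    [x], turns a product of functions into the push-forward of the tensor of their transforms. *)
Theorem fourier_prod f g F G x : L2c mu f -> L2c mu g -> L2c mu F -> L2c mu G ->
  ft2 f F -> ft2 g G ->
  fourier (fun y => f y * g y) x = cint mu (fun y => F y * G (x - y)).
Proof.
move=> f2 g2 F2 G2 fF gG.
have h := ft2_mod x (mc_conj g2.1) _ (ft2_conj g2.1 G2.1 gG).
have g'2 := mod_L2 x (L2c_conj g2).
have G0 := mscales_L2c (lebn_opp R n) G2.
have G'2 := shift_L2 (- x) (L2c_conj G0).
have e := ft2_ip f2 g'2 F2 G'2 fF (h (mc_conj G0.1)).
rewrite fourierE; transitivity (cint mu (fun y => f y * ((g y)^*%C * ec x y)^*%C)).
  by apply: eq_cint => y; rewrite conjcM conjcK ec_conj mulrA.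
by rewrite -e; apply: eq_cint => y; rewrite conjcK opprB.
Qed.

End fourier_L2.

(** * Laplace transforms of homogeneous densities *)

Section laplace.
Context (R : realType).
Local Notation lam := (@lebesgue_measure R).
Local Notation T1 := (measurableTypeR R).
Implicit Types z w : R[i].

(** The exponential e^(- z r) with complex [z]. *)
Definition ce z (r : R) : R[i] :=
  ((expR (- (complex.Re z * r)))%:C)%C * cis (- (complex.Im z * r)).

Lemma ceD z r s : ce z (r + s) = ce z r * ce z s.
Proof. by rewrite /ce !mulrDr !opprD expRD cisD rcM; ring. Qed.
Lemma ce_add z w r : ce (z + w) r = ce z r * ce w r.
Proof. by rewrite /ce cReD cImD !mulrDl !opprD expRD cisD rcM; ring. Qed.
Lemma normc_ce z r : normc (ce z r) = expR (- (complex.Re z * r)).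
Proof. by rewrite normcM normc_real normc_cis mulr1 ger0_norm ?expR_ge0. Qed.
Lemma ce_scale z (a r : R) : ce z (a * r) = ce ((a%:C)%C * z) r.
Proof.
by rewrite /ce cReM cImM /= !mul0r subr0 addr0 !mulrA !(mulrC a).
Qed.
Lemma ce0 z : ce z 0 = 1.
Proof. by rewrite /ce !mulr0 !oppr0 expR0 cis0 mulr1. Qed.
Lemma mc_ce d (T : measurableType d) z (f : T -> R) : measurable_fun setT f -> mc (fun x => ce z (f x)).
Proof.
move=> mf; apply: mcM.
  apply: mc_real; apply: measurableT_comp; first exact: measurable_expR.
  by apply: measurable_funN; exact: measurable_funM.
by apply: mc_cis; apply: measurable_funN; exact: measurable_funM.
Qed.

Definition pos1 (r : R) : R := \1_(`[0, +oo[%classic) r.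
Lemma pos1E r : pos1 r = if 0 <= r then 1 else 0.
Proof. by rewrite /pos1 indicE mem_setE in_itv/= andbT; case: (0 <= r). Qed.
Lemma measurable_pos1 : measurable_fun setT (pos1 : T1 -> R).
Proof. exact: measurable_indic. Qed.
Lemma pos1_ge0 r : 0 <= pos1 r. Proof. by rewrite pos1E; case: ifP. Qed.
Lemma pos1_le1 r : pos1 r <= 1. Proof. by rewrite pos1E; case: ifP. Qed.

Lemma pos1_int (f : R -> R) :
  (\int[lam]_r (pos1 r * f r)%:E = \int[lam]_(r in `[0%R, +oo[) (f r)%:E)%E.
Proof.
rewrite [RHS]integral_mkcond; apply: eq_integral => r _.
rewrite /patch pos1E mem_setE in_itv/= andbT.
by case: (0 <= r); rewrite ?mul1r ?mul0r.
Qed.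

Lemma exp_cos_L1 (a b p : R) : 0 < a ->
  lam.-integrable setT (EFin \o (fun r => pos1 r * expR (- (a * r)) * cos (b * r + p))) /\
  \int[lam]_r (pos1 r * expR (- (a * r)) * cos (b * r + p)) = (a * cos p - b * sin p) / (a ^+ 2 + b ^+ 2).
Proof.
move=> a0.
have me : measurable_fun setT (fun r : T1 => expR (- (a * r))).
  apply: measurableT_comp; first exact: measurable_expR.
  by apply: measurable_funN; exact: measurable_funM.
have mcb (q c : R) : measurable_fun setT (fun r : T1 => cos (q * r + c)).
  apply: measurableT_comp; first by apply: continuous_measurable_fun; exact: continuous_cos.
  by apply: measurable_funD => //; exact: measurable_funM.
have h q c : (\int[lam]_r (pos1 r * (expR (- (a * r)) * (1 + cos (q * r + c))))%:E =
  (a^-1 + (a * cos c - q * sin c) / (a ^+ 2 + q ^+ 2))%:E)%E.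
  by rewrite pos1_int exp_cos_half.
have i1 q c : lam.-integrable setT (EFin \o (fun r => pos1 r * (expR (- (a * r)) * (1 + cos (q * r + c))))).
  apply: rint_fin.
  - apply: measurable_funM; first exact: measurable_pos1.
    by apply: measurable_funM => //; exact: measurable_funD.
  - by move=> r; rewrite mulr_ge0 ?pos1_ge0// mulr_ge0 ?expR_ge0// -lerBlDl sub0r cos_geN1.
  - by rewrite h ltry.
have i0 : lam.-integrable setT (EFin \o (fun r => 2^-1 * (pos1 r * (expR (- (a * r)) * (1 + cos (0 * r + 0)))))).
  by apply: rintZ; exact: i1.
have e r : pos1 r * expR (- (a * r)) * cos (b * r + p) =
    pos1 r * (expR (- (a * r)) * (1 + cos (b * r + p))) - 2^-1 * (pos1 r * (expR (- (a * r)) * (1 + cos (0 * r + 0)))).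
  by rewrite mul0r addr0 cos0; field.
split.
  rewrite (_ : (fun r => _) = fun r => pos1 r * (expR (- (a * r)) * (1 + cos (b * r + p))) - 2^-1 * (pos1 r * (expR (- (a * r)) * (1 + cos (0 * r + 0))))); last by apply/funext => r; exact: e.
  by apply: rintB => //; exact: i1.
under eq_Rintegral do rewrite e.
rewrite RintegralB// RintegralZl//.
rewrite /Rintegral !h /= cos0 sin0 expr0n addr0 mulr0 subr0 mulr1.
by field; rewrite !gt_eqF// ltr_wpDr ?sqr_ge0// exprn_gt0.
Qed.

Lemma laplace1 z : 0 < complex.Re z ->
  L1c lam (fun r => ((pos1 r)%:C)%C * ce z r) /\ cint lam (fun r => ((pos1 r)%:C)%C * ce z r) = z^-1.
Proof.
move=> z0; have [i1 e1] := exp_cos_L1 (complex.Im z) 0 z0.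
have [i2 e2] := exp_cos_L1 (complex.Im z) (pi / 2) z0.
have Re_e r : complex.Re (((pos1 r)%:C)%C * ce z r) = pos1 r * expR (- (complex.Re z * r)) * cos (complex.Im z * r + 0).
  by rewrite mulrA -rcM cReM /= mul0r subr0 cosN addr0.
have Im_e r : complex.Im (((pos1 r)%:C)%C * ce z r) = pos1 r * expR (- (complex.Re z * r)) * cos (complex.Im z * r + pi / 2).
  by rewrite mulrA -rcM cImM /= mul0r addr0 sinN cosDpihalf.
have L : L1c lam (fun r => ((pos1 r)%:C)%C * ce z r).
  apply: L1cP; [under eq_fun do rewrite Re_e; exact: i1|under eq_fun do rewrite Im_e; exact: i2].
split => //; apply: eqcP.
  transitivity (\int[lam]_r (pos1 r * expR (- (complex.Re z * r)) * cos (complex.Im z * r + 0))).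
    by apply: eq_Rintegral => r _; exact: Re_e.
  by rewrite e1; case: (z) => u v /=; rewrite cos0 sin0 mulr1 mulr0 subr0.
transitivity (\int[lam]_r (pos1 r * expR (- (complex.Re z * r)) * cos (complex.Im z * r + pi / 2))).
  by apply: eq_Rintegral => r _; exact: Im_e.
rewrite e2; case: (z) => u v /=.
by rewrite cos_pihalf sin_pihalf mulr1 mulr0 sub0r mulNr.
Qed.

Lemma lam_shift (b : R) : mscales lam (fun r : T1 => r - b : T1) 1.
Proof.
have := @lam_affine R 1 (- b) (oner_neq0 _); rewrite normr1 invr1.
by rewrite (_ : (fun x => 1 * x - b) = (fun x => x - b))//; apply/funext => x; rewrite mul1r.
Qed.

(** Writing e^(- z b) as an integral over the half-line [r >= b] is what turns a Laplace transform
    into an integral of sublevel volumes. *)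
Lemma laplace_tail z (b : R) : 0 < complex.Re z ->
  L1c lam (fun r => ((pos1 (r - b))%:C)%C * (z * ce z r)) /\
  cint lam (fun r => ((pos1 (r - b))%:C)%C * (z * ce z r)) = ce z b.
Proof.
move=> z0; have [L e] := laplace1 z0.
have zn0 : z != 0 by apply: contraTneq z0 => ->; rewrite ltxx.
have E : (fun r => ((pos1 (r - b))%:C)%C * (z * ce z r)) =
    (fun r => z * ce z b * (((pos1 (r - b))%:C)%C * ce z (r - b))).
  by apply/funext => r; rewrite -{2}(subrK b r) ceD; ring.
have L' := mscales_L1c (lam_shift b) L.
rewrite E; split; first exact: L1cZ.
rewrite cintZ// (mscales_cint (lam_shift b) L) e mul1r.
by rewrite mulrAC mulfV ?mul1r.
Qed.

End laplace.

(** * The layer-cake formula for Laplace transforms *)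

Section layer_cake.
Context d (T : measurableType d) (R : realType) (m : {sigma_finite_measure set T -> \bar R}).
Local Notation lam := (@lebesgue_measure R).
Local Notation T1 := (measurableTypeR R).
Variables (w b : T -> R).
Hypotheses (mw : measurable_fun setT w) (mb : measurable_fun setT b).
Hypotheses (w0 : forall t, 0 <= w t) (b0 : forall t, 0 <= b t).

(** The volume, weighted by [w], of the sublevel set [b <= r]. *)
Definition lvl (r : R) : \bar R := (\int[m]_t (w t * pos1 (r - b t))%:E)%E.

Let ker z (p : T * T1) : R[i] := ((w p.1 * pos1 (p.2 - b p.1))%:C)%C * (z * ce z p.2).

Let mpos : measurable_fun setT (fun p : T * T1 => pos1 (p.2 - b p.1)).
Proof.
apply: measurableT_comp; first exact: measurable_pos1.
apply: measurable_funB; first exact: measurable_snd.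
exact: measurableT_comp mb measurable_fst.
Qed.
Let mker z : mc (ker z).
Proof.
apply: mcM.
  apply: mc_real; apply: measurable_funM => //.
  exact: measurableT_comp mw measurable_fst.
by apply: mcM; [exact: mc_cst|apply: mc_ce; exact: measurable_snd].
Qed.

Let Lker1 z : 0 < complex.Re z -> L1n (m \x lam)%E (ker z) =
  ((normc z / complex.Re z)%:E * L1n m (fun t => (((w t)%:C)%C * ce z (b t))%R))%E.
Proof.
move=> z0; have mwb : mc (fun t => ((w t)%:C)%C * ce z (b t)).
  by apply: mcM; [exact: mc_real|exact: mc_ce].
rewrite L1n_prod1// /L1n -ge0_integralZl//; first last.
- by rewrite lee_fin divr_ge0 ?normc_ge0 ?ltW.
- by move=> t _; rewrite lee_fin normc_ge0.
- by apply/measurable_EFinP; exact: mc_normc.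
apply: eq_integral => t _.
pose x : R[i] := ((complex.Re z)%:C)%C.
have x0 : 0 < complex.Re x by [].
have [L e] := laplace_tail (b t) x0.
transitivity (\int[lam]_r ((w t * normc z / complex.Re z)%:E *
    (complex.Re (((pos1 (r - b t))%:C)%C * (x * ce x r))%R)%:E))%E.
  apply: eq_integral => r _; rewrite -EFinM; congr (_%:E).
  rewrite /ker /= 2!normcM normc_real ger0_norm ?mulr_ge0 ?pos1_ge0// normc_ce.
  rewrite /ce /= mul0r oppr0 cos0 sin0 !(mulr0,mul0r,subr0,addr0,mulr1).
  by field; rewrite gt_eqF.
have i1 := L1c_Re L.
have nn (r : T1) : 0 <= complex.Re (((pos1 (r - b t))%:C)%C * (x * ce x r)).
  rewrite /ce /= mul0r oppr0 cos0 sin0 !(mulr0,mul0r,subr0,addr0,mulr1).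
  by rewrite !mulr_ge0 ?pos1_ge0 ?expR_ge0 ?ltW.
rewrite ge0_integralZl//; first last.
- by rewrite lee_fin mulr_ge0 ?invr_ge0 ?(ltW z0)// mulr_ge0 ?normc_ge0.
- by move=> r _; rewrite lee_fin nn.
- by apply/measurable_EFinP; exact: rint_meas i1.
rewrite -(fineK (integrable_fin_num measurableT i1)).
have -> : fine (\int[lam]_r (EFin \o (fun r => complex.Re (((pos1 (r - b t))%:C)%C * (x * ce x r))%R)) r)%E = expR (- (complex.Re z * b t)).
  transitivity (complex.Re (cint lam (fun r => ((pos1 (r - b t))%:C)%C * (x * ce x r)))); first by [].
  by rewrite e /ce /= mul0r oppr0 cos0 sin0 !(mulr0,mul0r,subr0,addr0,mulr1).
rewrite -!EFinM; congr (_%:E); rewrite normcM normc_real ger0_norm// normc_ce.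
by field; rewrite gt_eqF.
Qed.

Let Lker2 z : L1n (m \x lam)%E (ker z) =
  (\int[lam]_r ((normc z * expR (- (complex.Re z * r)))%:E * lvl r))%E.
Proof.
rewrite L1n_prod2//; apply: eq_integral => r _.
rewrite /lvl -ge0_integralZl//; first last.
- by rewrite lee_fin mulr_ge0 ?normc_ge0 ?expR_ge0.
- by move=> t _; rewrite lee_fin mulr_ge0 ?pos1_ge0.
- apply/measurable_EFinP; apply: measurable_funM => //.
  apply: measurableT_comp; first exact: measurable_pos1.
  by apply: measurable_funB.
apply: eq_integral => t _; rewrite -EFinM; congr (_%:E).
by rewrite /ker /= 2!normcM normc_real ger0_norm ?mulr_ge0 ?pos1_ge0// normc_ce mulrC.
Qed.

Let mlvl : measurable_fun setT (lvl : T1 -> \bar R).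
Proof.
apply: (@measurable_fun_fubini_tonelli_G _ _ _ _ _ m (fun p : T * T1 => (w p.1 * pos1 (p.2 - b p.1))%:E)).
  apply/measurable_EFinP; apply: measurable_funM => //.
  exact: measurableT_comp mw measurable_fst.
by move=> p; rewrite lee_fin mulr_ge0 ?pos1_ge0.
Qed.

Lemma lvl_neg r : r < 0 -> lvl r = 0%E.
Proof.
move=> r0; rewrite /lvl -[RHS](integral0 m setT); apply: eq_integral => t _.
by rewrite pos1E ifF ?mulr0//; apply/negbTE; rewrite -ltNge subr_lt0 (lt_le_trans r0).
Qed.

Variables (n : nat) (c : R).
Hypothesis lvlE : forall r, 0 < r -> lvl r = (c * r ^+ n)%:E.

Let lvlE' : {ae lam, forall r : T1, lvl r = (c * (pos1 r * r ^+ n))%:E}.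
Proof.
exists [set 0]; split => //; first exact: lebesgue_measure_set1.
move=> r /= h; apply: contrapT => r0; apply: h.
have [rn|rp|e] := ltrgtP r 0; last by exfalso; exact: r0.
  by rewrite lvl_neg// pos1E ifF ?mul0r ?mulr0//; apply/negbTE; rewrite -ltNge.
by rewrite lvlE// pos1E ifT ?mul1r// ltW.
Qed.

Lemma c_ge0 : 0 <= c.
Proof.
have := lvlE ltr01; rewrite expr1n mulr1 => h.
by rewrite -lee_fin -h; apply: integral_ge0 => t _; rewrite lee_fin mulr_ge0 ?pos1_ge0.
Qed.

(** Its integral is n! / z^n; that value is eliminated in [homog_laplace] by comparison with the
    simplex instead of being computed. *)
Definition gam z (r : R) : R[i] := ((pos1 r * r ^+ n)%:C)%C * (z * ce z r).
Let mpr : measurable_fun setT (fun r : T1 => pos1 r * r ^+ n).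
Proof. by apply: measurable_funM; [exact: measurable_pos1|exact: exprn_measurable]. Qed.
Let prn_ge0 (r : R) : 0 <= pos1 r * r ^+ n.
Proof. by rewrite pos1E; case: ifP => [r0|_]; rewrite ?mul0r// mul1r exprn_ge0. Qed.
Let mgam z : mc (gam z : T1 -> R[i]).
Proof.
apply: mcM; first exact: mc_real mpr.
by apply: mcM; [exact: mc_cst|exact: mc_ce].
Qed.

Let Lker3 z : L1n (m \x lam)%E (ker z) = (c%:E * L1n lam (gam z))%E.
Proof.
rewrite Lker2 /L1n -ge0_integralZl//; first last.
- by rewrite lee_fin c_ge0.
- by move=> r _; rewrite lee_fin normc_ge0.
- by apply/measurable_EFinP; exact: (mc_normc (mgam z)).
apply: ge0_ae_eq_integral => //.
- apply: emeasurable_funM; last exact: mlvl.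
  apply/measurable_EFinP; apply: measurable_funM => //.
  apply: measurableT_comp; first exact: measurable_expR.
  by apply: measurable_funN; exact: measurable_funM.
- by apply/measurable_EFinP; apply: measurable_funM => //; exact: (mc_normc (mgam z)).
- move=> r _; rewrite mule_ge0// ?lee_fin ?mulr_ge0 ?normc_ge0 ?expR_ge0//.
  by apply: integral_ge0 => t _; rewrite lee_fin mulr_ge0 ?pos1_ge0.
- by move=> r _; rewrite -EFinM lee_fin mulr_ge0 ?normc_ge0 ?c_ge0.
apply: filterS lvlE' => r -> _; rewrite -!EFinM; congr (_%:E).
by rewrite /gam 2!normcM normc_real ger0_norm// normc_ce; ring.
Qed.

Lemma layer_cake z : 0 < complex.Re z -> (L1n lam (gam z) < +oo)%E ->
  L1c m (fun t => ((w t)%:C)%C * ce z (b t)) /\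
  cint m (fun t => ((w t)%:C)%C * ce z (b t)) = (c%:C)%C * cint lam (gam z).
Proof.
move=> z0 gfin.
have Lg : L1c lam (gam z) by split => //; exact: mgam.
have L : L1c (m \x lam)%E (ker z).
  by split => //; rewrite Lker3 -(fineK (L1n_fin Lg)) -EFinM ltry.
have e1 t : cint lam (fun r => ker z (t, r)) = ((w t)%:C)%C * ce z (b t).
  have [L1 <-] := laplace_tail (b t) z0; rewrite -cintZ//.
  by apply: eq_cint => r; rewrite /ker /= rcM -mulrA.
split.
  have := L1c_cint1 L; rewrite (_ : (fun x => _) = fun t => ((w t)%:C)%C * ce z (b t))//.
  by apply/funext => t; exact: e1.
transitivity (cint m (fun t => cint lam (fun r => ker z (t, r)))).
  by apply: eq_cint => t; rewrite e1.
rewrite (cint_swap L) -cintZ//; apply: ae_eq_cint.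
- exact: (mc_cint2 m (mker z)).
- by apply: mcM; [exact: mc_cst|exact: mgam].
apply: filterS lvlE' => r hr.
have mr : measurable_fun setT (fun t => w t * pos1 (r - b t)).
  apply: measurable_funM => //.
  apply: measurableT_comp; first exact: measurable_pos1.
  by apply: measurable_funB.
have i : L1c m (fun t => ((w t * pos1 (r - b t))%:C)%C).
  split; first exact: mc_real.
  suff -> : L1n m (fun t => ((w t * pos1 (r - b t))%:C)%C) = lvl r by rewrite hr ltry.
  apply: eq_integral => t _.
  by rewrite normc_real ger0_norm// mulr_ge0 ?pos1_ge0.
rewrite /ker /= cintZr// cint_real /Rintegral -/(lvl r) hr /= /gam rcM; ring.
Qed.

Lemma layer_cake_fin z : 0 < complex.Re z -> 0 < c ->
  L1c m (fun t => ((w t)%:C)%C * ce z (b t)) -> (L1n lam (gam z) < +oo)%E.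
Proof.
move=> z0 c0 L.
have : (L1n (m \x lam)%E (ker z) < +oo)%E.
  by rewrite Lker1// -(fineK (L1n_fin L)) -EFinM ltry.
rewrite Lker3; case: (L1n lam (gam z)) (L1n_ge0 lam (gam z)) => [x _ _|_|//]; first exact: ltry.
by rewrite gt0_muley ?lte_fin.
Qed.

End layer_cake.

(** * Homogeneous densities and the standard simplex *)

Section homogeneous.
Context (R : realType).
Local Notation lam := (@lebesgue_measure R).

Lemma pos1_scale (r s : R) : 0 < r -> pos1 (r * s) = pos1 s.
Proof. by move=> r0; rewrite !pos1E pmulr_rge0. Qed.

Lemma lvl_homog d (T : measurableType d) (m : {sigma_finite_measure set T -> \bar R}) (w b : T -> R)
  (n : nat) (phi : R -> T -> T) : measurable_fun setT w -> measurable_fun setT b ->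
  (forall t, 0 <= w t) ->
  (forall r, 0 < r -> mscales m (phi r) ((r ^+ n)^-1)) ->
  (forall r t, 0 < r -> w (phi r t) = w t) -> (forall r t, 0 < r -> b (phi r t) = r * b t) ->
  (lvl m w b 1 < +oo)%E ->
  forall r, 0 < r -> lvl m w b r = (fine (lvl m w b 1) * r ^+ n)%:E.
Proof.
move=> mw mb w0 ms hw hb fin1 r r0.
have rn0 : 0 < r ^+ n by rewrite exprn_gt0.
have [_ _ h] := ms r r0.
have e := h (fun t => (w t * pos1 (r - b t))%:E) _ _.
rewrite EFinM fineK; last first.
  by rewrite ge0_fin_numE//; apply: integral_ge0 => t _; rewrite lee_fin mulr_ge0 ?pos1_ge0.
have -> : lvl m w b 1 = (((r ^+ n)^-1)%:E * lvl m w b r)%E.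
  rewrite /lvl -e; last 2 first.
  - apply/measurable_EFinP; apply: measurable_funM => //.
    apply: measurableT_comp; first exact: measurable_pos1.
    by apply: measurable_funB.
  - by move=> t; rewrite lee_fin mulr_ge0 ?pos1_ge0.
  apply: eq_integral => t _; rewrite hw// hb//.
  by rewrite (_ : r - r * b t = r * (1 - b t)) ?pos1_scale//; ring.
by rewrite muleAC -EFinM mulVf ?mul1e// gt_eqF.
Qed.

(** The indicator of the positive orthant; on it the sublevel sets of [smpb] are the standard
    simplices, and the Laplace transform factors over the coordinates. *)
Definition smpw n (u : 'rV[R]_n) : R := \prod_(i < n) pos1 (u 0 i).
Definition smpb n (u : 'rV[R]_n) : R := \sum_(i < n) `|u 0 i|.
Lemma measurable_smpw n : measurable_fun setT (@smpw n).
Proof.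
apply: measurable_prod => i _; apply: measurableT_comp; first exact: measurable_pos1.
exact: measurable_coord.
Qed.
Lemma measurable_smpb n : measurable_fun setT (@smpb n).
Proof.
apply: measurable_sum => i; apply: measurableT_comp; first exact: normr_measurable.
exact: measurable_coord.
Qed.
Lemma smpw_ge0 n (u : 'rV[R]_n) : 0 <= smpw u.
Proof. by apply: prodr_ge0 => i _; exact: pos1_ge0. Qed.
Lemma smpw_le1 n (u : 'rV[R]_n) : smpw u <= 1.
Proof. by apply: prodr_ile1 => i _; rewrite pos1_ge0 pos1_le1. Qed.
Lemma smpb_ge0 n (u : 'rV[R]_n) : 0 <= smpb u. Proof. exact: sumr_ge0. Qed.

Lemma smp_laplace n (z : R[i]) : 0 < complex.Re z ->
  L1c (lebn R n) (fun u => ((smpw u)%:C)%C * ce z (smpb u)) /\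
  cint (lebn R n) (fun u => ((smpw u)%:C)%C * ce z (smpb u)) = z^-1 ^+ n.
Proof.
move=> z0; have [L1 e1] := laplace1 z0.
have mF k : mc (fun u : 'rV[R]_k => ((smpw u)%:C)%C * ce z (smpb u)).
  by apply: mcM; [apply: mc_real; exact: measurable_smpw|apply: mc_ce; exact: measurable_smpb].
elim: n => [|n [L e]].
  split.
    by split => //; rewrite /L1n lebn_int0 ltry.
  by rewrite /cint /Rintegral !lebn_int0 /smpw /smpb !big_ord0 ce0 mulr1 expr0.
have E : (fun p => ((smpw (@rV_cons R n p))%:C)%C * ce z (smpb (rV_cons p))) =
    fun p => ((pos1 p.1)%:C)%C * ce z p.1 * (((smpw p.2)%:C)%C * ce z (smpb p.2)).
  apply/funext => p; rewrite /smpw /smpb !big_ord_recl rV_cons0.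
  under eq_bigr do rewrite rV_consS; under [X in ce _ (_ + X)]eq_bigr do rewrite rV_consS.
  rewrite rcM ceD pos1E; case: ifP => p0; last by rewrite !mul0r.
  by rewrite (ger0_norm p0); ring.
split.
  split => //; rewrite lebn_L1n_cons// E.
  by have [] := L1c_tens L1 L.
by rewrite lebn_cint_cons// E (cint_tens L1 L) e1 e exprS.
Qed.

(** The volume 1 / n! of the standard simplex, kept symbolic. *)
Definition smpvol n : R := fine (lvl (lebn R n) (@smpw n) (@smpb n) 1).

Lemma smp_fin n : (lvl (lebn R n) (@smpw n) (@smpb n) 1 < +oo)%E.
Proof.
apply: (@le_lt_trans _ _ (lebn R n (cube 1))); last by rewrite [X in (X < _)%E]lebesgue_cube ?ltry.
rewrite -(setIT (cube 1)) -integral_indic//; last exact: measurable_cube.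
apply: ge0_le_integral => //.
- by move=> t _; rewrite lee_fin mulr_ge0 ?pos1_ge0 ?smpw_ge0.
- apply/measurable_EFinP; apply: measurable_funM; first exact: measurable_smpw.
  apply: measurableT_comp; first exact: measurable_pos1.
  by apply: measurable_funB => //; exact: measurable_smpb.
- by apply/measurable_EFinP; apply: measurable_indic; exact: measurable_cube.
move=> u _; rewrite lee_fin pos1E; case: ifP => [h|_]; last by rewrite mulr0.
rewrite mulr1 indicE mem_set ?smpw_le1// => i.
apply: le_trans (_ : smpb u <= 1); last by rewrite -subr_ge0.
by rewrite /smpb (bigD1 i)//= lerDl sumr_ge0.
Qed.

Lemma smp_lvl n r : 0 < r -> lvl (lebn R n) (@smpw n) (@smpb n) r = (smpvol n * r ^+ n)%:E.
Proof.
move=> r0; rewrite /smpvol; move: r r0.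
apply: (@lvl_homog _ _ (lebn R n) _ _ n (fun r u => r *: u)).
- exact: measurable_smpw.
- exact: measurable_smpb.
- exact: smpw_ge0.
- by move=> s s0; exact: lebn_dilate.
- by move=> s u s0; apply: eq_bigr => i _; rewrite mxE pos1_scale.
- move=> s u s0; rewrite /smpb mulr_sumr; apply: eq_bigr => i _.
  by rewrite mxE normrM gtr0_norm.
- exact: smp_fin.
Qed.

(** Zero volume would by scaling make [smpw] vanish almost everywhere, against the value 1 of its
    Laplace transform at [z = 1]. *)
Lemma smpvol_gt0 n : 0 < smpvol n.
Proof.
rewrite lt_neqAle fine_ge0 ?andbT; last first.
  by apply: integral_ge0 => t _; rewrite lee_fin mulr_ge0 ?pos1_ge0 ?smpw_ge0.
apply/eqP => c0; have := @smp_lvl n; rewrite -c0 => lv.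
have w0 : {ae lebn R n, forall u : 'rV[R]_n, smpw u = 0}.
  have h k : {ae lebn R n, forall u : 'rV[R]_n, (smpw u * pos1 (k.+1%:R - smpb u))%:E = 0%E}.
    apply: ge0_int_eq0.
    - apply/measurable_EFinP; apply: measurable_funM; first exact: measurable_smpw.
      apply: measurableT_comp; first exact: measurable_pos1.
      by apply: measurable_funB => //; exact: measurable_smpb.
    - by move=> t; rewrite lee_fin mulr_ge0 ?pos1_ge0 ?smpw_ge0.
    - by have := lv k.+1%:R; rewrite mul0r; apply; rewrite ltr0n.
  have := ae_foralln h; apply: filterS => u /(_ (Num.truncn (smpb u))) [].
  by rewrite pos1E ifT ?mulr1// subr_ge0 ltW// truncnS_gt.
have o0 : 0 < complex.Re (1 : R[i]) by exact: ltr01.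
have [L] := @smp_laplace n 1 o0; rewrite invr1 expr1n => e.
have : (1 : R[i]) = 0.
  rewrite -e -[RHS](cint0 (lebn R n)); apply: ae_eq_cint; [exact: L.1|exact: mc_cst|].
  by apply: filterS w0 => u ->; rewrite mul0r.
by move/eqP; rewrite oner_eq0.
Qed.

(** The sublevel volumes of [b] and those of the simplex are both multiples of [r ^+ n], so the two
    Laplace transforms are the same multiples of the integral of [gam z]; the one of the simplex is
    [z ^- n]. The simplex also supplies the integrability of [gam z]. *)
Theorem homog_laplace d (T : measurableType d) (m : {sigma_finite_measure set T -> \bar R}) (w b : T -> R)
  (n : nat) (c : R) z : measurable_fun setT w -> measurable_fun setT b ->
  (forall t, 0 <= w t) -> (forall t, 0 <= b t) ->
  (forall r, 0 < r -> lvl m w b r = (c * r ^+ n)%:E) -> 0 < complex.Re z ->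
  L1c m (fun t => ((w t)%:C)%C * ce z (b t)) /\
  cint m (fun t => ((w t)%:C)%C * ce z (b t)) = ((c / smpvol n)%:C)%C * z^-1 ^+ n.
Proof.
move=> mw mb w0 b0 hl z0.
have [L e] := @smp_laplace n z z0.
have v0 := smpvol_gt0 n.
have gf := layer_cake_fin (@measurable_smpw n) (@measurable_smpb n) (@smpw_ge0 n) (@smpb_ge0 n) (@smp_lvl n) z0 v0 L.
have [_ e2] := layer_cake (@measurable_smpw n) (@measurable_smpb n) (@smpw_ge0 n) (@smpb_ge0 n) (@smp_lvl n) z0 gf.
have [L3 e3] := layer_cake mw mb w0 b0 hl z0 gf.
split => //; rewrite e3 -e e2 rcM rcV -!mulrA mulKf//.
by rewrite rc_eq0 gt_eqF.
Qed.

End homogeneous.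

(** * A Carleman-type inequality *)

Lemma sum_continuous (R : realType) n (I : Type) (s : seq I) (F : I -> 'rV[R]_n -> R) :
  (forall i, continuous (F i)) -> continuous (fun u => \sum_(i <- s) F i u : R).
Proof.
move=> h; elim: s => [|i s IH] u.
  rewrite (_ : (fun u : 'rV[R]_n => _) = fun=> 0 : R); first exact: cst_continuous.
  by apply/funext => w; rewrite big_nil.
rewrite (_ : (fun u : 'rV[R]_n => _) = fun u : 'rV[R]_n => F i u + \sum_(j <- s) F j u : R).
  by apply: cvgD; [exact: nbhs_filter|exact: h|exact: IH].
by apply/funext => w; rewrite big_cons.
Qed.

Lemma dotrV_continuous (R : realType) n (v : 'rV[R]_n) : continuous (fun t => dotrV v t).
Proof.
apply: sum_continuous => i u.
by apply: cvgM; [exact: nbhs_filter|exact: cst_continuous|exact: coord_continuous].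
Qed.

(** * Support functions and the barrier cone *)

Section support_function.
Context (R : realType) (n : nat).
Local Notation V := 'rV[R]_n.
Variables (Omega : set V) (x0 : V).
Hypotheses (Omega_open : open Omega) (Omega0 : Omega x0).

(** For [r > 0] this is [r] times the polar body of [Omega - x0]. *)
Definition slab (r : R) : set V := [set t | forall y, Omega y -> dotrV (y - x0) t <= r].
Definition bcone : set V := \bigcup_k slab k%:R.
(** Outside the barrier cone [bcone] the supremum takes the default value 0; this is why the weights
    below carry the indicator of the cone. *)
Definition supp (t : V) : R := sup [set dotrV (y - x0) t | y in Omega].

Lemma measurable_slab r : measurable (slab r).
Proof.
rewrite -[slab r]setCK; apply: measurableC; apply: open_measurable_rV.
rewrite (_ : ~` _ = \bigcup_(y in Omega) [set t | r < dotrV (y - x0) t]).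
  apply: bigcup_open => y _.
  apply: (@open_comp _ _ (fun t => dotrV (y - x0) t) [set z | z > r]); last exact: open_gt.
  by move=> t _; exact: dotrV_continuous.
apply/seteqP; split => [t /existsNP[y /not_implyP[Oy /negP]]|t [y Oy /= h] /(_ y Oy)].
  by rewrite -ltNge => h; exists y.
by rewrite leNgt h.
Qed.
Lemma measurable_bcone : measurable bcone.
Proof. by apply: bigcupT_measurable => k; exact: measurable_slab. Qed.

Lemma slab_bcone r t : slab r t -> bcone t.
Proof.
move=> h; exists (Num.truncn `|r|).+1 => // y Oy; apply: le_trans (h y Oy) _.
by apply: le_trans (ler_norm _) _; rewrite ltW// truncnS_gt.
Qed.

Lemma supp_has t : bcone t -> has_sup [set dotrV (y - x0) t | y in Omega].
Proof.
move=> [k _ h]; split; first by exists (dotrV (x0 - x0) t); exists x0.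
by exists k%:R => _ [y Oy <-]; exact: h.
Qed.
Lemma supp_ub t y : bcone t -> Omega y -> dotrV (y - x0) t <= supp t.
Proof. by move=> /supp_has[_ hu] Oy; apply: ub_le_sup => //; exists y. Qed.
Lemma supp_le t r : slab r t -> supp t <= r.
Proof.
move=> h; have [h0 _] := supp_has (slab_bcone h).
by apply: ge_sup => // _ [y Oy <-]; exact: h.
Qed.
Lemma supp_slab t r : bcone t -> supp t <= r -> slab r t.
Proof. by move=> Ct h y Oy; apply: le_trans (supp_ub Ct Oy) h. Qed.
Lemma supp_out t : ~ bcone t -> supp t = 0.
Proof.
move=> h; apply: sup_out => -[_ [M hM]]; apply: h; apply: (@slab_bcone M) => y Oy.
by apply: hM; exists y.
Qed.
Lemma supp_ge0 t : 0 <= supp t.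
Proof.
have [Ct|nC] := pselect (bcone t); last by rewrite supp_out.
by have := supp_ub Ct Omega0; rewrite subrr dotrV0l.
Qed.

Lemma slabZ r s t : 0 < s -> slab (s * r) (s *: t) <-> slab r t.
Proof.
move=> s0; split => h y Oy; have := h y Oy; rewrite dotrVZr.
  by rewrite ler_pM2l.
by rewrite -(ler_pM2l s0).
Qed.
Lemma bconeZ s t : 0 < s -> bcone (s *: t) <-> bcone t.
Proof.
move=> s0; split => -[k _ h].
  apply: (@slab_bcone (s^-1 * k%:R)); apply/(slabZ _ _ s0).
  by rewrite mulrA mulfV ?mul1r// gt_eqF.
by apply: (@slab_bcone (s * k%:R)); apply/(slabZ _ _ s0).
Qed.
Lemma suppZ s t : 0 < s -> supp (s *: t) = s * supp t.
Proof.
move=> s0; have [Ct|nC] := pselect (bcone t); last first.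
  by rewrite !supp_out ?mulr0//; apply/(contra_not _ nC) => /(bconeZ _ s0).
have le a u : 0 < a -> bcone u -> supp (a *: u) <= a * supp u.
  by move=> a0 Cu; apply: supp_le; apply/(slabZ _ _ a0); exact: supp_slab.
apply/eqP; rewrite eq_le le//=.
rewrite -ler_pdivlMl//; have := le s^-1 (s *: t).
by rewrite scalerA mulVf ?gt_eqF// scale1r; apply; [rewrite invr_gt0|apply/bconeZ].
Qed.

Lemma measurable_supp : measurable_fun setT supp.
Proof.
apply: (measurability _ (RGenOInfty.measurableE R)) => _ [_ [r ->] <-]; rewrite setTI.
have [r0|r0] := ltP r 0.
  rewrite (_ : _ @^-1` _ = setT)//; apply/seteqP; split => // t _ /=.
  by rewrite in_itv/= andbT (lt_le_trans r0)// supp_ge0.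
rewrite (_ : _ @^-1` _ = bcone `&` ~` slab r).
  by apply: measurableI; [exact: measurable_bcone|apply: measurableC; exact: measurable_slab].
apply/seteqP; split => t /=; rewrite in_itv/= andbT.
  move=> h; split; last by move=> /supp_le; rewrite leNgt h.
  by apply: contrapT => /supp_out e; move: h; rewrite e ltNge r0.
by move=> [Ct h]; rewrite ltNge; apply/negP => /(supp_slab Ct).
Qed.

(* Test the supremum on the points of a sup-norm ball around [x]. *)
Lemma supp_coord x : Omega x -> exists rho : R, 0 < rho /\
  forall t i, bcone t -> rho * `|t 0 i| <= supp t - dotrV (x - x0) t.
Proof.
move=> Ox; have /nbhs_ballP[e /= e0 he] : nbhs x Omega by exact: open_nbhs_nbhs.
exists (e / 2); split; first by rewrite divr_gt0.
move=> t i Ct; pose v : V := \row_j (if j == i then (e / 2) * Num.sg (t 0 i) else 0).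
have Oy : Omega (x + v).
  apply: he; apply/ball_rVE => // j; rewrite !mxE opprD addrA subrr sub0r normrN.
  case: ifP => _; last by rewrite normr0.
  rewrite normrM (gtr0_norm (divr_gt0 e0 _))//.
  apply: (@le_lt_trans _ _ (e / 2)); last by rewrite ltr_pdivrMr// ltr_pMr// ltr1n.
  rewrite ler_piMr//; first by rewrite ltW// divr_gt0.
  by rewrite normr_sg; case: (t 0 i != 0).
have := supp_ub Ct Oy; rewrite (addrAC x) (dotrVDl (x - x0)).
have -> : dotrV v t = e / 2 * `|t 0 i|.
  rewrite /dotrV (bigD1 i)//= big1 ?addr0.
    by rewrite /v mxE eqxx [in RHS]normrEsg mulrA.
  by move=> j ji; rewrite mxE (negbTE ji) mul0r.
by move=> h; rewrite lerBrDr addrC.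
Qed.

End support_function.

Section fatou_convolution.
Context d (T : measurableType d) (R : realType) (mu : {measure set T -> \bar R}).

(** Square roots of the functions bring the statement under [fatou_L2]. *)
Lemma fatou_cvg (h : nat -> T -> R) (g : T -> R) (e : R) :
  (forall k, measurable_fun setT (h k)) -> (forall k x, 0 <= h k x) ->
  (forall x, h k x @[k --> \oo] --> g x) ->
  (forall k, (\int[mu]_x (h k x)%:E <= e%:E)%E) -> (\int[mu]_x (g x)%:E <= e%:E)%E.
Proof.
move=> mh h0 hg he.
have s0 k x : Num.sqrt (h k x) ^+ 2 = h k x by rewrite sqr_sqrtr.
have g0 x : 0 <= g x by rewrite -(cvg_lim (@norm_hausdorff _ _) (hg x)); apply: limr_ge; [apply/cvg_ex; exists (g x); exact: hg|exact: nearW].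
have e1 (r : R) : 0 <= r -> normc (((Num.sqrt r)%:C)%C) ^+ 2 = r.
  by move=> r0; rewrite normc_real ger0_norm ?sqrtr_ge0// sqr_sqrtr.
have := @fatou_L2 _ _ _ mu (fun k x => ((Num.sqrt (h k x))%:C)%C) (fun x => ((Num.sqrt (g x))%:C)%C) e.
rewrite /L2n; under eq_integral do rewrite e1//; apply.
- move=> k; apply: mc_real; apply: (measurableT_comp _ (mh k)).
  by apply: continuous_measurable_fun; exact: sqrt_continuous.
- move=> x; apply: ccvg_real.
  exact: (continuous_cvg _ (@sqrt_continuous R (g x)) (hg x)).
- by move=> k; under eq_integral do rewrite e1//; exact: he.
Qed.

End fatou_convolution.

(** * Correlations and the damped power spectrum *)

Section convolution.
Context (R : realType) (n : nat).
Local Notation V := 'rV[R]_n.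
Local Notation mu := (lebn R n).

Lemma conv_ker_L1 (f g : V -> R[i]) : L1c mu f -> L1c mu g ->
  L1c (mu \x mu)%E (fun p : V * V => f p.1 * g (p.1 + p.2)) /\
  L1n (mu \x mu)%E (fun p : V * V => f p.1 * g (p.1 + p.2)) = (L1n mu f * L1n mu g)%E.
Proof.
move=> f1 g1.
have mk : mc (fun p : V * V => f p.1 * g (p.1 + p.2)).
  apply: mcM; first exact: (mc_comp measurable_fst f1.1).
  apply: (mc_comp _ g1.1); apply: measurable_rVD; [exact: measurable_fst|exact: measurable_snd].
have e : L1n (mu \x mu)%E (fun p : V * V => f p.1 * g (p.1 + p.2)) = (L1n mu f * L1n mu g)%E.
  rewrite L1n_prod1// /L1n -ge0_integralZr//; first last.
  - exact: L1n_ge0.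
  - by move=> x _; rewrite lee_fin normc_ge0.
  - by apply/measurable_EFinP; exact: mc_normc f1.1.
  apply: eq_integral => z _ /=.
  rewrite -[X in (_ * X)%E]mul1e -[X in (_ * X)%E](mscales_L1n (lebn_translate z) g1.1).
  rewrite /L1n -ge0_integralZl//; first last.
  - by rewrite lee_fin normc_ge0.
  - by move=> x _; rewrite lee_fin normc_ge0.
  - by apply/measurable_EFinP; apply: mc_normc; exact: (mscales_L1c (lebn_translate z) g1).1.
  by apply: eq_integral => t _; rewrite normcM EFinM [z + t]addrC.
by split => //; split => //; rewrite e -(fineK (L1n_fin f1)) -(fineK (L1n_fin g1)) -EFinM ltry.
Qed.

Lemma smooth_L1 (s : R) (f : V -> R[i]) : L1c mu f ->
  L1c mu (smooth s f) /\ (L1n mu (smooth s f) <= L1n mu f)%E.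
Proof.
move=> f1; have L := smooth_ker_L1 s f1; split; first exact: (L1c_cint1 L).
apply: le_trans (L1n_cint1 L) _.
rewrite L1n_prod2; last exact: L.1.
rewrite (eq_integral (fun u : V => (L1n mu f * (pois u)%:E)%E)); last first.
  move=> u _ /=; rewrite -(@shift_L1n R n s f u f1.1) /L1n -ge0_integralZr//.
  - by apply: eq_integral => z _; rewrite normcM normc_real ger0_norm ?pois_ge0.
  - apply/measurable_EFinP; apply: mc_normc; apply: (mc_comp _ f1.1).
    exact: measurable_rVD.
  - by move=> z _; rewrite lee_fin normc_ge0.
  - by rewrite lee_fin pois_ge0.
rewrite ge0_integralZl//; first last.
- exact: L1n_ge0.
- by move=> u _; rewrite lee_fin pois_ge0.
- by apply/measurable_EFinP; exact: measurable_pois.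
by rewrite pois_int mule1.
Qed.

(** For [f] in L^1 the transform is merely bounded, so its square is damped by [theta] to become
    integrable. *)
Definition dsq (f : V -> R[i]) (s : R) x : R[i] := ((normc (fourier f x) ^+ 2 * theta (s *: x))%:C)%C.

Lemma sq_L1 (f : V -> R[i]) (s : R) : 0 < s -> L1c mu f -> L1c mu (dsq f s).
Proof.
move=> s0 f1; have mF := mc_fourier f1.1.
apply: (@L1c_dom _ _ _ mu (dsq f s) (fun x => fine (L1n mu f) ^+ 2 * theta (s *: x))).
- by apply: mc_real; apply: measurable_funM; [exact: msq|exact: measurable_theta_dil].
- by apply: rintZ; exact: (L1c_Re (theta_dil n s0)).
move=> x; rewrite normc_real ger0_norm ?mulr_ge0 ?theta_ge0 ?exprn_ge0 ?normc_ge0//.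
rewrite ler_wpM2r ?theta_ge0// ler_pXn2r ?nnegrE ?normc_ge0 ?fine_ge0 ?L1n_ge0//.
exact: fourier_bound.
Qed.

(* The Fourier coefficients of the damped spectrum form an L^1 function because they are
   the cross-correlation of [f] with its Poisson smoothing. *)
Lemma spectrum_corr (f : V -> R[i]) (s : R) : 0 < s -> L1c mu f ->
  mc (fun t => cint mu (fun x => dsq f s x * ec x t)) /\
  (L1n mu (fun t => cint mu (fun x => (dsq f s x * ec x t)%R)) <= L1n mu f * L1n mu f)%E.
Proof.
move=> s0 f1; have mf := f1.1; have mF := mc_fourier mf.
have [S1 Sle] := smooth_L1 s f1.
have L1 : L1c mu (fun x => fourier f x * ((theta (s *: x))%:C)%C).
  have := L1c_bound (theta_dil n s0) mF (fun x => fourier_bound x f1).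
  by under eq_fun do rewrite mulrC.
have c1 : L1c mu (fun z => (f z)^*%C) by exact: L1c_conj.
have [K1 Ke] := conv_ker_L1 c1 S1.
have E t : cint mu (fun x => dsq f s x * ec x t) = cint mu (fun z => (f z)^*%C * smooth s f (z + t)).
  have L2 : L1c (mu \x mu)%E (fun p : V * V => fourier f p.1 * ((theta (s *: p.1))%:C)%C * (f p.2)^*%C * ec p.1 (p.2 + t)).
    apply: (L1c_bound (L1c_tens L1 c1)) => [|p]; last by rewrite normc_ec.
    apply: mc_ec; first exact: measurable_fst.
    by apply: measurable_rVD => //; exact: measurable_snd.
  transitivity (cint mu (fun x => cint mu (fun z => fourier f x * ((theta (s *: x))%:C)%C * (f z)^*%C * ec x (z + t)))).
    apply: eq_cint => x; rewrite /dsq rcM -mul_conj {2}fourierE -cint_conj; last exact: ft_L1.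
    set I := cint _ _; rewrite (_ : fourier f x * I * _ * _ = fourier f x * ((theta (s *: x))%:C)%C * ec x t * I); last by ring.
    rewrite /I -cintZ; last by apply: L1c_conj; exact: ft_L1.
    by apply: eq_cint => z; rewrite conjcM ec_conj opprK ecDr; ring.
  rewrite (cint_swap L2); apply: eq_cint => z /=.
  rewrite -smoothE// -cintZ.
    by apply: eq_cint => x; ring.
  have := L1c_bound L1 (mc_ecl (z + t)) (fun x => ltac:(by rewrite normc_ec) : normc (ec x (z + t)) <= 1).
  by under eq_fun do rewrite -mulrA.
rewrite (_ : (fun t => cint mu (fun x => dsq f s x * ec x t)) = fun t => cint mu (fun z => (f z)^*%C * smooth s f (z + t))); last first.
  by apply/funext => t; exact: E.
split; first exact: (mc_cint2 mu K1.1).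
apply: le_trans (L1n_cint2 K1) _; rewrite Ke.
rewrite (_ : L1n mu (fun z => (f z)^*%C) = L1n mu f); last by apply: eq_integral => z _; rewrite normc_conj.
by apply: lee_wpmul2l => //; exact: L1n_ge0.
Qed.

End convolution.

Lemma normcV (R : realType) (z : R[i]) : normc z^-1 = (normc z)^-1.
Proof.
have [->|z0] := eqVneq z 0; first by rewrite invr0 normc0 invr0.
apply: (mulIf (x := normc z)); first by rewrite gt_eqF ?normc_gt0.
by rewrite -normcM mulVf// normc1 mulVf// gt_eqF ?normc_gt0.
Qed.
Lemma mcV d (T : measurableType d) (R : realType) (f : T -> R[i]) : mc f -> mc (fun x => (f x)^-1).
Proof.
move=> mf; rewrite (_ : (fun x => _) = fun x => (f x)^*%C * (((normc (f x) ^+ 2)^-1)%:C)%C).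
  apply: mcM; first exact: mc_conj.
  apply: mc_real; apply: measurable_inv_ge0; first exact: msq.
  by move=> x; rewrite exprn_ge0 ?normc_ge0.
apply/funext => x; have [->|z0] := eqVneq (f x) 0; first by rewrite invr0 conjc0 mul0r.
have n0 : (((normc (f x) ^+ 2)%:C)%C : R[i]) != 0 by rewrite rc_eq0 expf_neq0// gt_eqF ?normc_gt0.
by rewrite rcV; apply: (mulIf n0); rewrite mulfVK// -mul_conj mulKf.
Qed.
Lemma ccvgV1 (I : Type) (F : set_system I) (FF : ProperFilter F) (R : realType) (z : I -> R[i]) a :
  (forall k, 1 <= normc (z k)) -> 1 <= normc a -> ccvg F z a -> ccvg F (fun k => (z k)^-1) a^-1.
Proof.
move=> z1 a1; have nz w : 1 <= normc w -> w != 0 :> R[i].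
  by move=> w1; rewrite -normc_gt0 (lt_le_trans ltr01).
apply: norm0_cvg => k; rewrite normc_ge0/=.
have -> : (z k)^-1 - a^-1 = (a - z k) * ((z k)^-1 * a^-1) by field; rewrite !nz.
rewrite normcM normcBC ler_piMr ?normc_ge0// normcM !normcV.
by rewrite mulr_ile1 ?invr_ge0 ?normc_ge0// invf_le1// (lt_le_trans ltr01).
Qed.
Lemma ccvgX (I : Type) (F : set_system I) (FF : ProperFilter F) (R : realType) (z : I -> R[i]) a n :
  ccvg F z a -> ccvg F (fun k => z k ^+ n) (a ^+ n).
Proof.
move=> za; elim: n => [|n IH]; first exact: ccvg_cst.
by under eq_fun do rewrite exprS; rewrite exprS; exact: ccvgM.
Qed.

(* The product measure of the library carries no usable sigma-finite instance. *)
Section prodm.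
Context (R : realType) d1 d2 (T1 : measurableType d1) (T2 : measurableType d2).
Variables (m1 : {sigma_finite_measure set T1 -> \bar R}) (m2 : {sigma_finite_measure set T2 -> \bar R}).

Lemma prod_sigma_finite : sigma_finite setT (m1 \x m2)%E.
Proof.
have /sigma_finiteP[F [TF ndF Foo]] := sigma_finiteT m1.
have /sigma_finiteP[G [TG ndG Goo]] := sigma_finiteT m2.
exists (fun n => F n `*` G n).
  apply/seteqP; split => // -[x y] _.
  have [n _ Fnx] : (\bigcup_i F i) x by rewrite -TF.
  have [k _ Gky] : (\bigcup_i G i) y by rewrite -TG.
  exists (maxn n k) => //; split.
  - by move: x Fnx; exact/subsetPset/ndF/leq_maxl.
  - by move: y Gky; exact/subsetPset/ndG/leq_maxr.
move=> k; have [? ?] := Foo k; have [? ?] := Goo k.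
split; first exact: measurableX.
by rewrite product_measure1E// lte_mul_pinfty// ge0_fin_numE.
Qed.

Definition prodm : set (T1 * T2) -> \bar R := (m1 \x m2)%E.
Let prodm0 : prodm set0 = 0%E. Proof. exact: measure0. Qed.
Let prodm_ge0 A : (0 <= prodm A)%E. Proof. exact: measure_ge0. Qed.
Let prodm_sa : semi_sigma_additive prodm. Proof. exact: measure_semi_sigma_additive. Qed.
HB.instance Definition _ := isMeasure.Build _ _ _ prodm prodm0 prodm_ge0 prodm_sa.
HB.instance Definition _ := @Measure_isSigmaFinite.Build _ _ _ prodm prod_sigma_finite.

Lemma prodm_tonelli1 (f : T1 * T2 -> \bar R) : measurable_fun setT f -> (forall p, (0 <= f p)%E) ->
  (\int[prodm]_p f p = \int[m1]_x \int[m2]_y f (x, y))%E.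
Proof. exact: fubini_tonelli1. Qed.
Lemma prodm_tonelli2 (f : T1 * T2 -> \bar R) : measurable_fun setT f -> (forall p, (0 <= f p)%E) ->
  (\int[prodm]_p f p = \int[m2]_y \int[m1]_x f (x, y))%E.
Proof. exact: fubini_tonelli2. Qed.

End prodm.
Arguments prodm {R d1 d2 T1 T2} m1 m2.

(** Splitting the threshold 1 into two halves decouples the gauge from the regularising term; this
    is the origin of the level [2^-1] of the slab in [carleman]. *)
Lemma pos1_mul_le (R : realType) (a b : R) :
  pos1 (2^-1 - a) * pos1 (2^-1 - b) <= pos1 (1 - (a + b)).
Proof.
rewrite !pos1E; have [h1|h1] := leP 0 (2^-1 - a); last by rewrite mul0r; case: ifP.
have [h2|h2] := leP 0 (2^-1 - b); last by rewrite mulr0; case: ifP.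
by rewrite mulr1 (_ : 0 <= 1 - (a + b))//; lra.
Qed.

(** * Rotation of the Laplace transform to the imaginary axis *)

Section carleman.
Context (R : realType) (n : nat).
Local Notation V := 'rV[R]_n.
Local Notation K := (2 * n)%N.
Local Notation U := 'rV[R]_(2 * n).
Local Notation mu := (lebn R n).
Local Notation m2 := (prodm (lebn R n) (lebn R (2 * n))).
Variables (Omega : set V) (x0 : V).
Hypotheses (Omega_open : open Omega) (Omega0 : Omega x0).
Local Notation sh := (supp Omega x0).
Local Notation bc := (bcone Omega x0).

Let mC := measurable_bcone Omega x0.
Let msh := measurable_supp Omega0.
Let indC (t : V) : R := \1_bc t.
Let mindC : measurable_fun setT indC. Proof. exact: measurable_indic. Qed.
Let indC_ge0 t : 0 <= indC t. Proof. by rewrite /indC. Qed.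

(** On the barrier cone, the support function of [Omega] taken from the base point [x] instead of
    [x0]. *)
Definition gauge (x t : V) : R := supp Omega x0 t - dotrV (x - x0) t.

Lemma gauge_ge0 x t : Omega x -> bc t -> 0 <= gauge x t.
Proof. by move=> Ox Ct; rewrite subr_ge0 supp_ub. Qed.
Lemma gaugeZ x r t : 0 < r -> gauge x (r *: t) = r * gauge x t.
Proof. by move=> r0; rewrite /gauge suppZ// dotrVZr mulrBr. Qed.
Lemma measurable_gauge d (T : measurableType d) (a b : T -> V) :
  measurable_fun setT a -> measurable_fun setT b -> measurable_fun setT (fun p => gauge (a p) (b p)).
Proof.
move=> ma mb; apply: measurable_funB; first exact: measurableT_comp msh mb.
by apply: measurable_dotrV => //; exact: measurable_rVB.
Qed.

(* [w] is a product weight in the direction [t] and in an auxiliary simplex variable [u] whose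
   Laplace transform produces the damping factor [(1 + z eps h)^-K]. *)
Let w (p : V * U) : R := indC p.1 * (smpw p.2 * expR (- smpb p.2)).
(** [layer_cake] asks for non-negativity everywhere, hence the absolute value off the barrier cone;
    on the cone, for [x] in [Omega], the gauge is already non-negative. *)
Let b x (eps : R) (p : V * U) : R := `|gauge x p.1| + eps * (sh p.1 * smpb p.2).

Let mw : measurable_fun setT w.
Proof.
apply: measurable_funM; first exact: measurableT_comp mindC measurable_fst.
apply: measurable_funM; first exact: measurableT_comp (@measurable_smpw R _) measurable_snd.
apply: measurableT_comp; first exact: measurable_expR.
by apply: measurable_funN; exact: measurableT_comp (@measurable_smpb R _) measurable_snd.
Qed.
Let mb x eps : measurable_fun setT (b x eps).
Proof.
apply: measurable_funD.
  by apply: measurableT_comp => //; apply: measurable_gauge => //; exact: measurable_fst.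
apply: measurable_funM => //; apply: measurable_funM; first exact: measurableT_comp msh measurable_fst.
exact: measurableT_comp (@measurable_smpb R _) measurable_snd.
Qed.
Let w_ge0 p : 0 <= w p.
Proof. by rewrite !mulr_ge0 ?smpw_ge0 ?expR_ge0. Qed.
Let b_ge0 x eps p : 0 <= eps -> 0 <= b x eps p.
Proof. by move=> e0; rewrite addr_ge0// !mulr_ge0 ?smpb_ge0 ?supp_ge0. Qed.

Let smp1 : L1c (lebn R K) (fun u : U => ((smpw u * expR (- smpb u))%:C)%C) /\
  (\int[lebn R K]_u (smpw u * expR (- smpb u))%:E = 1)%E.
Proof.
have o0 : 0 < complex.Re (1 : R[i]) by exact: ltr01.
have [L e] := @smp_laplace R K 1 o0.
have E : (fun u : U => ((smpw u)%:C)%C * ce 1 (smpb u)) = fun u => ((smpw u * expR (- smpb u))%:C)%C.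
  by apply/funext => u; rewrite /ce /= mul0r oppr0 cis0 mulr1 mul1r -rcM.
rewrite E in L e; split => //.
have := congr1 (@complex.Re R) e; rewrite invr1 expr1n /= => h.
have := L1c_Re L => /(integrable_fin_num measurableT) /= fin.
by rewrite -(fineK fin); congr (_%:E).
Qed.

Let mdens : measurable_fun setT (fun u : U => smpw u * expR (- smpb u)).
Proof.
apply: measurable_funM; first exact: measurable_smpw.
by apply: measurableT_comp; [exact: measurable_expR|apply: measurable_funN; exact: measurable_smpb].
Qed.

(** By [supp_coord] the gauge dominates every coordinate, so the sublevel set lies over a cube in
    [t], and the weight in [u] has total mass 1. *)
Let lvl1 x eps : Omega x -> 0 < eps -> (lvl m2 w (b x eps) 1 < +oo)%E.
Proof.
move=> Ox eps0; have [rho [rho0 hrho]] := supp_coord Omega_open Omega0 Ox.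
pose Q : set V := cube (rho^-1).
have mQ : measurable Q by exact: measurable_cube.
apply: (@le_lt_trans _ _ (\int[m2]_p ((\1_Q p.1 : R)%:E * (smpw p.2 * expR (- smpb p.2))%:E))%E).
  apply: ge0_le_integral => //.
  - by move=> p _; rewrite lee_fin mulr_ge0 ?pos1_ge0.
  - apply/measurable_EFinP; apply: measurable_funM => //.
    apply: measurableT_comp; first exact: measurable_pos1.
    by apply: measurable_funB.
  - apply: emeasurable_funM; apply/measurable_EFinP.
      by apply: measurableT_comp; [exact: measurable_indic|exact: measurable_fst].
    exact: (measurableT_comp mdens measurable_snd).
  move=> p _; rewrite -EFinM lee_fin /w pos1E; case: ifP => [h|_]; last first.
    by rewrite mulr0 !mulr_ge0 ?smpw_ge0 ?expR_ge0.
  rewrite mulr1 ler_wpM2r ?mulr_ge0 ?smpw_ge0 ?expR_ge0// /indC !indicE.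
  case: (boolP (p.1 \in bc)) => [/set_mem Ct|_]; last by [].
  rewrite mem_set// => i; rewrite -(ler_pM2l rho0) mulfV ?gt_eqF//.
  apply: le_trans (hrho _ i Ct) _; rewrite subr_ge0 in h.
  apply: le_trans h; apply: le_trans (ler_norm _) _.
  by rewrite lerDl !mulr_ge0 ?smpb_ge0 ?supp_ge0 ?ltW.
have nQ : (0 <= rho^-1) by rewrite invr_ge0 ltW.
rewrite prodm_tonelli1; first last.
- by move=> p; rewrite mule_ge0// lee_fin mulr_ge0 ?smpw_ge0 ?expR_ge0.
- apply: emeasurable_funM; apply/measurable_EFinP.
    by apply: measurableT_comp; [exact: measurable_indic|exact: measurable_fst].
  exact: (measurableT_comp mdens measurable_snd).
rewrite (eq_integral (fun t : V => (\1_Q t : R)%:E)); last first.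
  move=> t _; rewrite /= ge0_integralZl//.
  - by rewrite smp1.2 mule1.
  - apply/measurable_EFinP; apply: measurable_funM; first exact: measurable_smpw.
    by apply: measurableT_comp; [exact: measurable_expR|apply: measurable_funN; exact: measurable_smpb].
  - by move=> u _; rewrite lee_fin mulr_ge0 ?smpw_ge0 ?expR_ge0.
rewrite integral_indic// setIT [X in (X < _)%E](lebesgue_cube n nQ).
by rewrite ltry.
Qed.

Lemma mscales_fst (r : R) : 0 < r ->
  mscales m2 (fun p : V * U => (r *: p.1, p.2)) ((r ^+ n)^-1).
Proof.
move=> r0; have [c0 mphi h] := lebn_dilate n r0.
have mp : measurable_fun setT (fun p : V * U => (r *: p.1, p.2)).
  apply: measurable_fun_pair; last exact: measurable_snd.
  by apply: measurable_rVZ; exact: measurable_fst.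
split => // f mf f0.
rewrite (@prodm_tonelli2 _ _ _ _ _ (lebn R n) (lebn R K) (fun p => f (r *: p.1, p.2)))//; last exact: measurableT_comp mf mp.
rewrite prodm_tonelli2// -ge0_integralZl//; first last.
- by rewrite lee_fin ltW.
- by move=> u _; apply: integral_ge0 => t _.
- exact: (@measurable_fun_fubini_tonelli_G _ _ _ _ _ (lebn R n) f).
apply: eq_integral => u _; rewrite /= (h (fun t => f (t, u)))//.
exact: measurableT_comp mf (measurable_pairr u).
Qed.

Let wlap x eps z : Omega x -> 0 < eps -> 0 < complex.Re z ->
  L1c m2 (fun p => ((w p)%:C)%C * ce z (b x eps p)) /\
  cint m2 (fun p => ((w p)%:C)%C * ce z (b x eps p)) =
    ((fine (lvl m2 w (b x eps) 1) / smpvol R n)%:C)%C * z^-1 ^+ n.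
Proof.
move=> Ox eps0 z0; apply: homog_laplace => //; first by move=> p; exact/b_ge0/ltW.
(* Only [t] is scaled: the degree of homogeneity is [n], whatever the dimension of the auxiliary
   variable [u]. *)
apply: (@lvl_homog _ _ _ m2 _ _ n (fun r p => (r *: p.1, p.2))) => //.
- by move=> r r0; exact: mscales_fst.
- move=> r p r0; rewrite /w /= /indC !indicE; congr (_ * _); congr (_%:R); congr nat_of_bool.
  by apply/idP/idP; rewrite !inE => /bconeZ; apply.
- by move=> r p r0; rewrite /b /= gaugeZ// suppZ// normrM gtr0_norm//; ring.
- exact: lvl1.
Qed.

(* For [Re z > 0] the integral of [G] over [t] is a constant times [z ^- n] by homogeneity; both sides
   extend continuously to [z = 2 pi i], where [G] becomes a modulation of a function bounded by [1]. *)
Let G x eps z (t : V) : R[i] :=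
  ((indC t)%:C)%C * ce z `|gauge x t| * (1 + ((eps * sh t)%:C)%C * z)^-1 ^+ K.

Let GE x eps z : Omega x -> 0 < eps -> 0 < complex.Re z ->
  cint mu (G x eps z) = ((fine (lvl m2 w (b x eps) 1) / smpvol R n)%:C)%C * z^-1 ^+ n.
Proof.
move=> Ox eps0 z0; have [L <-] := wlap Ox eps0 z0.
rewrite [RHS](cint_fubini1 L); apply: eq_cint => t.
set a := eps * sh t.
have a0 : 0 <= a by rewrite mulr_ge0 ?supp_ge0 ?ltW.
have z'0 : 0 < complex.Re (1 + (a%:C)%C * z).
  by rewrite cReD cReM /= mul0r subr0 ltr_wpDr// mulr_ge0// ltW.
rewrite /G -/a; have [L' e'] := @smp_laplace R K _ z'0; rewrite -e' -cintZ//.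
apply: eq_cint => u; rewrite /w /b /= ceD ce_add !rcM.
have -> : ce z (eps * (sh t * smpb u)) = ce ((a%:C)%C * z) (smpb u) by rewrite mulrA -/a ce_scale.
have -> : ce 1 (smpb u) = ((expR (- smpb u))%:C)%C by rewrite /ce /= mul0r oppr0 cis0 mulr1 mul1r.
by rewrite /a rcM; ring.
Qed.

(** The point 2 pi i on the boundary of the half-plane of convergence, approached from inside by the
    [zk]. *)
Let z0 : R[i] := (0 +i* (2 * pi))%C.
Let zk (k : nat) : R[i] := ((k.+1%:R^-1)%:C)%C + z0.

Let pi1 : 1 <= 2 * pi :> R.
Proof. have := pi_ge2 R; lra. Qed.

Lemma Im_le_normc' (z : R[i]) : complex.Im z <= normc z.
Proof. exact: le_trans (ler_norm _) (Im_le_normc _). Qed.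

Let normc_den (eta a : R) : 0 <= eta -> 0 <= a ->
  1 + (2 * pi * a) ^+ 2 <= normc (1 + (a%:C)%C * ((eta%:C)%C + z0)) ^+ 2.
Proof.
move=> e0 a0; rewrite normcSq /z0 /=.
rewrite !(addr0, mul0r, subr0, add0r) (mulrC a (2 * pi)) lerD2r.
rewrite -{1}(expr1n _ 2) ler_pXn2r ?nnegrE ?lerDl ?mulr_ge0//.
by rewrite addr_ge0 ?mulr_ge0.
Qed.

(** The majorant must be uniform up to the imaginary axis, where the exponential no longer decays,
    so it comes from the damping factor alone. By [supp_coord] at [x0] the support function
    dominates each coordinate; the exponent [2 n] provides [n] factors [(1 + (2 pi a)^2)^-1], one
    for the Cauchy density of each coordinate. *)
Let dom_bound eps : 0 < eps -> exists D : V -> R, mu.-integrable setT (EFin \o D) /\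
  forall x eta t, 0 <= eta -> normc (G x eps ((eta%:C)%C + z0) t) <= D t.
Proof.
move=> eps0; have [rho [rho0 hrho]] := supp_coord Omega_open Omega0 Omega0.
pose kap := 2 * pi * (eps * rho).
have kap0 : 0 < kap by rewrite !mulr_gt0 ?pi_gt0.
exists (fun t => pi ^+ n * pois (kap *: t)); split.
  apply: rintZ; have := mscales_L1c (lebn_dilate n kap0) (@pois_L1 R n).
  by move=> /L1c_Re.
move=> x eta t e0.
rewrite 2!normcM normc_ce normc_real ger0_norm// normcX normcV.
have D0 : 0 <= pi ^+ n * pois (kap *: t) by rewrite mulr_ge0 ?pois_ge0 ?exprn_ge0 ?pi_ge0.
rewrite /indC indicE; case: (boolP (t \in bc)) => [/set_mem Ct|_]; last by rewrite !mul0r.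
rewrite mul1r; set a := eps * sh t.
have a0 : 0 <= a by rewrite mulr_ge0 ?supp_ge0 ?ltW.
have nd := normc_den e0 a0; set N := normc _ in nd *.
have N1 : 0 < N ^+ 2 by apply: lt_le_trans nd; rewrite ltr_wpDr ?sqr_ge0.
apply: (@le_trans _ _ (N^-1 ^+ K)).
  rewrite ler_piMl ?exprn_ge0 ?invr_ge0 ?normc_ge0// -expR0 ler_expR oppr_le0.
  by rewrite mulr_ge0// /z0 /= addr0.
rewrite exprM exprVn.
have -> : pi ^+ n * pois (kap *: t) = \prod_(i < n) (1 + (kap * t 0 i) ^+ 2)^-1.
  rewrite -[n in pi ^+ n]card_ord -prodr_const -big_split; apply: eq_bigr => i _ /=.
  by rewrite mxE /cauchyd invfM mulrA mulfV ?mul1r// gt_eqF ?pi_gt0.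
rewrite -[n in _ ^+ n]card_ord -prodr_const; apply: ler_prod => i _.
rewrite invr_ge0 ltW//= lef_pV2 ?posrE ?ltr_wpDr ?sqr_ge0//.
apply: le_trans nd; rewrite lerD2l -(real_normK (num_real (kap * t 0 i))).
rewrite ler_pXn2r ?nnegrE ?normr_ge0 ?mulr_ge0 ?pi_ge0 ?supp_ge0 ?(ltW eps0)//.
have := hrho t i Ct; rewrite subrr dotrV0l subr0 => h.
rewrite normrM (gtr0_norm kap0) /kap /a -(mulrA (2 * pi)) -(mulrA eps).
by rewrite !ler_wpM2l ?mulr_ge0 ?pi_ge0 ?(ltW eps0).
Qed.

Let mG x eps z : mc (G x eps z).
Proof.
apply: mcM; last first.
  apply: mcX; apply: mcV; apply: mcD; first exact: mc_cst.
  by apply: mcM; [apply: mc_real; apply: measurable_funM|exact: mc_cst].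
apply: mcM; first exact: mc_real.
by apply: mc_ce; apply: measurableT_comp => //; exact: measurable_gauge.
Qed.

Lemma ce_cvg (r : R) : ccvg \oo (fun k => ce (zk k) r) (ce z0 r).
Proof.
rewrite -[X in ccvg _ _ X]mul1r /zk; under eq_fun do rewrite ce_add; apply: ccvgM; last exact: ccvg_cst.
rewrite (_ : (fun k => _) = fun k : nat => ((expR (- (k.+1%:R^-1 * r)))%:C)%C); last first.
  by apply/funext => k; rewrite /ce /= mul0r oppr0 cis0 mulr1.
apply: ccvg_real; rewrite -[X in _ --> X]expR0; apply: (continuous_cvg _ (@continuous_expR R 0)).
rewrite -[X in _ --> X]oppr0; apply: cvgN; rewrite -[X in _ --> X](mul0r r).
by apply: cvgM; [exact: invS_cvg0|exact: cvg_cst].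
Qed.

Let zk_cvg : ccvg \oo zk z0.
Proof.
rewrite -[X in ccvg _ _ X]add0r; apply: ccvgD; last exact: ccvg_cst.
by apply: ccvg_real; exact: invS_cvg0.
Qed.

Let G_lim x eps : Omega x -> 0 < eps ->
  cint mu (G x eps z0) = ((fine (lvl m2 w (b x eps) 1) / smpvol R n)%:C)%C * z0^-1 ^+ n.
Proof.
move=> Ox eps0; have [D [iD hD]] := dom_bound eps0.
have zE : z0 = ((0 : R)%:C)%C + z0 by rewrite add0r.
have hk (k : nat) : 0 <= (k.+1%:R^-1 : R) by rewrite invr_ge0.
have c1 : ccvg \oo (fun k => cint mu (G x eps (zk k))) (cint mu (G x eps z0)).
  apply: (@dct_cint _ _ _ _ _ _ D).
  - by move=> k; exact: mG.
  - exact: mG.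
  - exact: iD.
  - by move=> k t; exact: hD.
  - by move=> t; rewrite zE; exact: hD.
  apply: nearW => t; apply: ccvgM.
    by apply: ccvgM; [exact: ccvg_cst|exact: ce_cvg].
  have a0 : 0 <= eps * sh t by rewrite mulr_ge0 ?supp_ge0 ?ltW.
  have n1 eta : 0 <= eta -> 1 <= normc (1 + ((eps * sh t)%:C)%C * ((eta%:C)%C + z0)).
    move=> e0; rewrite -(ler_pXn2r (n:=2))// ?nnegrE ?normc_ge0// expr1n.
    by apply: le_trans (normc_den e0 a0); rewrite lerDl sqr_ge0.
  apply: ccvgX; apply: ccvgV1.
  - by move=> k; exact: n1.
  - by rewrite zE; exact: n1.
  - by apply: ccvgD; [exact: ccvg_cst|apply: ccvgM; [exact: ccvg_cst|exact: zk_cvg]].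
have c2 : ccvg \oo (fun k => cint mu (G x eps (zk k))) (((fine (lvl m2 w (b x eps) 1) / smpvol R n)%:C)%C * z0^-1 ^+ n).
  rewrite (_ : (fun k => _) = fun k => ((fine (lvl m2 w (b x eps) 1) / smpvol R n)%:C)%C * (zk k)^-1 ^+ n); last first.
    by apply/funext => k; rewrite GE// /zk /z0 /= addr0 invr_gt0.
  apply: ccvgM; first exact: ccvg_cst.
  apply: ccvgX; apply: ccvgV1 => //.
    by move=> k; apply: le_trans (Im_le_normc' _); rewrite /zk /z0 /= add0r.
  by apply: le_trans (Im_le_normc' _).
exact: ccvg_uniq c1 c2.
Qed.

Let Gm eps := G x0 eps z0.

Let ce_z0 r : ce z0 r = cis (- (2 * pi * r)).
Proof. by rewrite /ce /= mul0r oppr0 expR0 mul1r. Qed.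

Let GmE x eps t : Omega x -> G x eps z0 t = Gm eps t * ec (x - x0) t.
Proof.
move=> Ox; rewrite /Gm /G /indC indicE; case: (boolP (t \in bc)) => [/set_mem Ct|_]; last by rewrite !mul0r.
rewrite !ger0_norm ?gauge_ge0// /gauge subrr dotrV0l subr0 (ceD _ (sh t)).
rewrite [ce z0 (- _)]ce_z0 mulrN opprK -/(ec _ _); ring.
Qed.

Let G_L1 x eps : 0 < eps -> L1c mu (G x eps z0).
Proof.
move=> eps0; have [D [iD hD]] := dom_bound eps0.
apply: L1c_dom iD _; first exact: mG.
have zE : z0 = ((0 : R)%:C)%C + z0 by rewrite add0r.
by move=> t; rewrite zE; exact: hD.
Qed.

Let Gm1 eps t : 0 < eps -> normc (Gm eps t) <= 1.
Proof.
move=> eps0; rewrite /Gm /G 2!normcM normc_ce normc_real ger0_norm// normcX normcV.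
rewrite /z0 mul0r oppr0 expR0 mulr1.
have i1 : indC t <= 1 by rewrite /indC indicE; case: (_ \in _).
suff h' : (normc (1 + ((eps * sh t)%:C)%C * z0))^-1 <= 1.
  by rewrite mulr_ile1 ?exprn_ge0 ?exprn_ile1 ?invr_ge0 ?normc_ge0.
have a0 : 0 <= eps * sh t by rewrite mulr_ge0 ?supp_ge0 ?ltW.
have h : 1 <= normc (1 + ((eps * sh t)%:C)%C * z0).
  rewrite -(ler_pXn2r (n:=2))// ?nnegrE ?normc_ge0// expr1n.
  have := normc_den (lexx 0) a0; rewrite (_ : (0%:C)%C + z0 = z0) ?add0r//.
  by apply: le_trans; rewrite lerDl sqr_ge0.
by rewrite invf_le1 ?(lt_le_trans ltr01).
Qed.

(** * Pairing with the power spectrum *)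

Section pairing.
Variable f : V -> R[i].
Hypotheses (f1 : L1c mu f) (f0 : {ae mu, forall x, ~ Omega x -> fourier f x = 0}).

Let F2 x : R := \1_Omega x * normc (fourier f x) ^+ 2.
Let mF2 : measurable_fun setT F2.
Proof.
apply: measurable_funM; last exact: msq (mc_fourier f1.1).
by apply: measurable_indic; exact: open_measurable_rV.
Qed.
Let F2_ge0 x : 0 <= F2 x.
Proof. by rewrite mulr_ge0// exprn_ge0// normc_ge0. Qed.

Let Phi eps s (x : V) (p : V * U) : R := F2 x * theta (s *: x) * (w p * pos1 (1 - b x eps p)).

Let mPhi eps s : measurable_fun setT (fun q : V * (V * U) => Phi eps s q.1 q.2).
Proof.
have m1 := measurable_fst : measurable_fun setT (@fst V (V * U)).
have m2' := measurable_snd : measurable_fun setT (@snd V (V * U)).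
apply: measurable_funM; apply: measurable_funM.
- exact: measurableT_comp mF2 m1.
- exact: measurableT_comp (measurable_theta_dil s) m1.
- exact: measurableT_comp mw m2'.
apply: measurableT_comp; first exact: measurable_pos1.
apply: measurable_funB => //; apply: measurable_funD.
  apply: measurableT_comp => //; apply: measurable_gauge => //.
  exact: measurableT_comp measurable_fst m2'.
apply: measurable_funM => //; apply: measurable_funM.
  by apply: measurableT_comp msh _; exact: measurableT_comp measurable_fst m2'.
by apply: measurableT_comp (@measurable_smpb R _) _; exact: measurableT_comp measurable_snd m2'.
Qed.

Let Phi_ge0 eps s x p : 0 <= Phi eps s x p.
Proof.
apply: mulr_ge0; first by apply: mulr_ge0; [exact: F2_ge0|exact: theta_ge0].
by apply: mulr_ge0; [exact: w_ge0|exact: pos1_ge0].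
Qed.

(** One double integral in two orders. Integrating [t] first gives the sublevel volumes by [G_lim];
    integrating [x] first gives the correlation of the spectrum, of L^1 norm at most [|f|_1^2],
    against a function bounded by 1. The prefactor of [H] inverts the constant of [G_lim]. *)
Let pairing eps s : 0 < eps -> 0 < s ->
  (\int[mu]_x \int[m2]_p (Phi eps s x p)%:E <=
    (smpvol R n * (2 * pi) ^+ n * fine (L1n mu f) ^+ 2)%:E)%E.
Proof.
move=> eps0 s0; have S1 := sq_L1 s0 f1; have [mQ Q1] := spectrum_corr s0 f1.
pose k (q : V * V) := dsq f s q.1 * Gm eps q.2 * ec (q.1 - x0) q.2.
have Lk : L1c (mu \x mu)%E k.
  apply: (L1c_bound (L1c_tens S1 (@G_L1 x0 _ eps0)) _ (M := 1)) => [|q]; last by rewrite normc_ec.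
  by apply: mc_ec; [apply: measurable_rVB; [exact: measurable_fst|exact: measurable_cst]|exact: measurable_snd].
have c0 := smpvol_gt0 R n.
pose H x := ((smpvol R n)%:C)%C * z0 ^+ n * cint mu (fun t => k (x, t)).
have LH : L1c mu H by apply: L1cZ; exact: L1c_cint1.
suff -> : (\int[mu]_x \int[m2]_p (Phi eps s x p)%:E = (complex.Re (cint mu H))%:E)%E.
  rewrite lee_fin; apply: le_trans (ler_norm _) _; apply: le_trans (Re_le_normc _) _.
  rewrite cintZ; last exact: L1c_cint1.
  rewrite !normcM normc_real (ger0_norm (ltW c0)) normcX.
  have -> : normc z0 = 2 * pi by rewrite /z0 normcE' expr0n add0r sqrtr_sqr ger0_norm// mulr_ge0// pi_ge0.
  apply: ler_wpM2l; first by rewrite mulr_ge0 ?(ltW c0) ?exprn_ge0 ?mulr_ge0 ?pi_ge0.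
  rewrite (cint_swap Lk).
  have Q1' : L1c mu (fun t => cint mu (fun x => dsq f s x * ec x t)).
    split => //; apply: le_lt_trans Q1 _.
    by rewrite -(fineK (L1n_fin f1)) -EFinM ltry.
  have e t : cint mu (fun x => k (x, t)) = cint mu (fun x => dsq f s x * ec x t) * (Gm eps t * ec (- x0) t).
    rewrite mulrC -cintZ; last by apply: (L1c_bound S1 (mc_ecl t) (M := 1)) => x; rewrite normc_ec.
    by apply: eq_cint => x; rewrite /k /= ecDl; ring.
  rewrite (eq_cint mu e).
  have b1 t : normc (Gm eps t * ec (- x0) t) <= 1 by rewrite normcM normc_ec mulr1 Gm1.
  have mm : mc (fun t => Gm eps t * ec (- x0) t) by apply: mcM; [exact: mG|exact: mc_ecr].
  apply: le_trans (cint_le (L1c_bound Q1' mm b1)) _.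
  rewrite -lee_fin fineK ?L1n_fin//; last exact: L1c_bound Q1' mm b1.
  rewrite EFin_expe fineK ?L1n_fin// expe2; apply: le_trans Q1.
  apply: ge0_le_integral => //.
  - by move=> t _; rewrite lee_fin normc_ge0.
  - by apply/measurable_EFinP; apply: mc_normc; apply: mcM mm.
  - by apply/measurable_EFinP; exact: mc_normc.
  - by move=> t _; rewrite lee_fin normcM ler_piMr ?normc_ge0.
transitivity (\int[mu]_x (complex.Re (H x))%:E)%E; last first.
  rewrite /cint /= fineK//; exact: integrable_fin_num (L1c_Re LH).
apply: ae_eq_integral => //.
- apply: (@measurable_fun_fubini_tonelli_F _ _ _ _ _ m2 (fun q => (Phi eps s q.1 q.2)%:E)).
    by apply/measurable_EFinP; exact: mPhi.
  by move=> q; rewrite lee_fin; exact: Phi_ge0.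
- by apply/measurable_EFinP; exact: LH.1.1.
apply: filterS f0 => x x_0 _.
have -> : (\int[m2]_p (Phi eps s x p)%:E = (F2 x * theta (s *: x))%:E * lvl m2 w (b x eps) 1)%E.
  rewrite /lvl -ge0_integralZl//.
  - apply/measurable_EFinP; apply: measurable_funM => //.
    apply: measurableT_comp; first exact: measurable_pos1.
    by apply: measurable_funB.
  - by move=> p _; rewrite lee_fin mulr_ge0 ?pos1_ge0.
  - by rewrite lee_fin; apply: mulr_ge0; [exact: F2_ge0|exact: theta_ge0].
have [Ox|nOx] := pselect (Omega x); last first.
  rewrite /F2 x_0// normc0 expr0n /= mulr0 !mul0r mul0e /H /k.
  rewrite (_ : (fun t => _) = fun=> 0); first by rewrite cint0 mulr0.
  by apply/funext => t; rewrite /= /dsq x_0// normc0 expr0n /= mul0r (_ : (0%:C)%C = 0 :> R[i])// !mul0r.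
have -> : H x = ((F2 x * theta (s *: x) * fine (lvl m2 w (b x eps) 1))%:C)%C.
  rewrite /H; transitivity (((smpvol R n)%:C)%C * z0 ^+ n * (dsq f s x * cint mu (G x eps z0))).
    congr (_ * _); rewrite -cintZ; last exact: G_L1.
    by apply: eq_cint => t; rewrite /k GmE//; ring.
  rewrite G_lim// /F2 indicE mem_set// mul1r /dsq !rcM rcV exprVn.
  have z1 : z0 != 0 by rewrite /z0 eq_complex/= negb_and (gt_eqF (mulr_gt0 _ _)) ?orbT ?pi_gt0.
  have c1 : ((smpvol R n)%:C)%C != 0 :> R[i] by rewrite rc_eq0 gt_eqF.
  by field; rewrite c1 expf_neq0.
by rewrite [in RHS]EFinM fineK// ge0_fin_numE ?lvl1// integral_ge0// => p _; rewrite lee_fin mulr_ge0 ?pos1_ge0.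
Qed.

Let half x t := pos1 (2^-1 - `|gauge x t|).
Let mhalf : measurable_fun setT (fun q : V * V => half q.1 q.2).
Proof.
apply: measurableT_comp; first exact: measurable_pos1.
apply: measurable_funB => //; apply: measurableT_comp => //.
by apply: measurable_gauge; [exact: measurable_fst|exact: measurable_snd].
Qed.

Let invS0 (k : nat) : 0 < (k.+1%:R^-1 : R).
Proof. by rewrite invr_gt0 ltr0n. Qed.

(** The spectral damping and the parameter [eps] are both set to [1 / (k + 1)]. In the split form
    the regularising factor tends to 1 pointwise, so the limit keeps the gauge condition only and
    Fatou's lemma applies. *)
Let h k (q : V * (V * U)) : R := F2 q.1 * theta (k.+1%:R^-1 *: q.1) *
  (w q.2 * (half q.1 q.2.1 * pos1 (2^-1 - k.+1%:R^-1 * (sh q.2.1 * smpb q.2.2)))).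

Let mh k : measurable_fun setT (h k).
Proof.
have m1 := measurable_fst : measurable_fun setT (@fst V (V * U)).
have m2' := measurable_snd : measurable_fun setT (@snd V (V * U)).
have m3 : measurable_fun setT (fun q : V * (V * U) => q.2.1) := measurableT_comp measurable_fst m2'.
apply: measurable_funM; apply: measurable_funM.
- exact: measurableT_comp mF2 m1.
- exact: measurableT_comp (measurable_theta_dil _) m1.
- exact: measurableT_comp mw m2'.
apply: measurable_funM; first exact: (measurableT_comp mhalf (measurable_fun_pair m1 m3)).
apply: measurableT_comp; first exact: measurable_pos1.
apply: measurable_funB => //; apply: measurable_funM => //; apply: measurable_funM.
  exact: measurableT_comp msh m3.
by apply: measurableT_comp (@measurable_smpb R _) _; exact: measurableT_comp measurable_snd m2'.
Qed.

Let h_ge0 k q : 0 <= h k q.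
Proof.
apply: mulr_ge0; first by apply: mulr_ge0; [exact: F2_ge0|exact: theta_ge0].
by apply: mulr_ge0; [exact: w_ge0|apply: mulr_ge0; exact: pos1_ge0].
Qed.

Let h_int k : (\int[prodm mu m2]_q (h k q)%:E <=
    (smpvol R n * (2 * pi) ^+ n * fine (L1n mu f) ^+ 2)%:E)%E.
Proof.
apply: le_trans (pairing (invS0 k) (invS0 k)).
rewrite prodm_tonelli1; first last.
- by move=> q; rewrite lee_fin; exact: h_ge0.
- by apply/measurable_EFinP; exact: mh.
apply: ge0_le_integral => //.
- by move=> x _; apply: integral_ge0 => p _; rewrite lee_fin; exact: h_ge0.
- apply: (@measurable_fun_fubini_tonelli_F _ _ _ _ _ m2 (fun q => (h k q)%:E)).
    by apply/measurable_EFinP.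
  by move=> q; rewrite lee_fin; exact: h_ge0.
- apply: (@measurable_fun_fubini_tonelli_F _ _ _ _ _ m2 (fun q => (Phi k.+1%:R^-1 k.+1%:R^-1 q.1 q.2)%:E)).
    by apply/measurable_EFinP; exact: mPhi.
  by move=> q; rewrite lee_fin; exact: Phi_ge0.
move=> x _; apply: ge0_le_integral => //.
- by move=> p _; rewrite lee_fin; exact: h_ge0.
- by apply/measurable_EFinP; exact: (measurableT_comp (mh k) (measurable_pairl x)).
- by apply/measurable_EFinP; exact: (measurableT_comp (mPhi _ _) (measurable_pairl x)).
move=> p _; rewrite lee_fin; apply: ler_wpM2l.
  by apply: mulr_ge0; [exact: F2_ge0|exact: theta_ge0].
apply: ler_wpM2l; first exact: w_ge0.
exact: pos1_mul_le.
Qed.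

Let h_cvg q : h k q @[k --> \oo] --> F2 q.1 * (w q.2 * half q.1 q.2.1).
Proof.
rewrite -(mulr1 (half _ _)) -[X in X * _](mulr1 (F2 _)).
apply: cvgM; apply: cvgM; try exact: cvg_cst; last first.
  apply: cvgM; first exact: cvg_cst.
  apply: cvg_near_cst; have s0 : 0 <= sh q.2.1 * smpb q.2.2 by rewrite mulr_ge0 ?smpb_ge0 ?supp_ge0.
  set a := sh _ * _ in s0 *.
  have h2 : (k.+1%:R^-1 * a : R) @[k --> \oo] --> (0 : R).
    by rewrite -[X in _ --> X](mul0r a); apply: cvgM; [exact: invS_cvg0|exact: cvg_cst].
  have h3 : \forall k \near \oo, k.+1%:R^-1 * a < 2^-1.
    by apply: (cvgr_lt _ h2); rewrite invr_gt0.
  by apply: filterS h3 => k hk; rewrite pos1E subr_ge0 (ltW hk).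
exact: (theta_cvg _ (@invS_cvg0 R)).
Qed.

Lemma carleman_pairing : (\int[mu]_x ((F2 x)%:E * \int[mu]_t (indC t * half x t)%:E) <=
  (smpvol R n * (2 * pi) ^+ n * fine (L1n mu f) ^+ 2)%:E)%E.
Proof.
apply: le_trans (fatou_cvg mh h_ge0 h_cvg h_int).
rewrite le_eqVlt; apply/orP; left; apply/eqP.
have mg : measurable_fun setT (fun q : V * (V * U) => F2 q.1 * (w q.2 * half q.1 q.2.1)).
  have m1 := measurable_fst : measurable_fun setT (@fst V (V * U)).
  have m2' := measurable_snd : measurable_fun setT (@snd V (V * U)).
  apply: measurable_funM; first exact: measurableT_comp mF2 m1.
  apply: measurable_funM; first exact: measurableT_comp mw m2'.
  exact: (measurableT_comp mhalf (measurable_fun_pair m1 (measurableT_comp measurable_fst m2'))).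
have g0 q : 0 <= F2 q.1 * (w q.2 * half q.1 q.2.1).
  by apply: mulr_ge0; [exact: F2_ge0|apply: mulr_ge0; [exact: w_ge0|exact: pos1_ge0]].
rewrite prodm_tonelli1; first last.
- by move=> q; rewrite lee_fin; exact: g0.
- by apply/measurable_EFinP; exact: mg.
apply: eq_integral => x _.
have mwx : measurable_fun setT (fun p : V * U => w p * half x p.1).
  apply: measurable_funM => //.
  exact: (measurableT_comp (measurableT_comp mhalf (measurable_pairl x)) measurable_fst).
have wx0 p : (0 <= (w p * half x p.1)%:E)%E.
  by rewrite lee_fin; apply: mulr_ge0; [exact: w_ge0|exact: pos1_ge0].
transitivity ((F2 x)%:E * \int[m2]_p (w p * half x p.1)%:E)%E; last first.
  rewrite -ge0_integralZl//.
  - by apply/measurable_EFinP.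
  - by rewrite lee_fin; exact: F2_ge0.
congr (_ * _)%E; rewrite prodm_tonelli1//; last by apply/measurable_EFinP.
apply: eq_integral => t _.
transitivity (\int[lebn R K]_u ((indC t * half x t)%:E * (smpw u * expR (- smpb u))%:E))%E.
  rewrite ge0_integralZl//.
  - by rewrite smp1.2 mule1.
  - by apply/measurable_EFinP.
  - by move=> u _; rewrite lee_fin mulr_ge0 ?smpw_ge0 ?expR_ge0.
  - by rewrite lee_fin; apply: mulr_ge0; [exact: indC_ge0|exact: pos1_ge0].
by apply: eq_integral => u _; rewrite -EFinM /w /=; congr (_%:E); ring.
Qed.
End pairing.

(** [q] is given by an integral with parameter, hence measurable on the whole space; it is
    identified with the volume of half the polar body of [Omega - x] for [x] in [Omega]. *)
Theorem carleman : exists q : V -> \bar R, [/\ measurable_fun setT q, (forall x, 0 <= q x)%E,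
    (forall x, Omega x -> q x = mu (slab Omega x 2^-1)) &
  forall f, L1c mu f -> {ae mu, forall x, ~ Omega x -> fourier f x = 0} ->
  (\int[mu]_x ((\1_Omega x * normc (fourier f x) ^+ 2)%:E * q x) <=
    (smpvol R n * (2 * pi) ^+ n * fine (L1n mu f) ^+ 2)%:E)%E].
Proof.
have mq : measurable_fun setT (fun q : V * V => indC q.2 * pos1 (2^-1 - `|gauge q.1 q.2|)).
  apply: measurable_funM; first exact: measurableT_comp mindC measurable_snd.
  apply: measurableT_comp; first exact: measurable_pos1.
  apply: measurable_funB => //; apply: measurableT_comp => //.
  by apply: measurable_gauge; [exact: measurable_fst|exact: measurable_snd].
have q0 q : 0 <= indC q.2 * pos1 (2^-1 - `|gauge q.1 q.2|).
  by apply: mulr_ge0; [exact: indC_ge0|exact: pos1_ge0].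
exists (fun x => \int[mu]_t (indC t * pos1 (2^-1 - `|gauge x t|))%:E)%E; split.
- apply: (@measurable_fun_fubini_tonelli_F _ _ _ _ _ mu (fun q => (indC q.2 * pos1 (2^-1 - `|gauge q.1 q.2|))%:E)).
    by apply/measurable_EFinP; exact: mq.
  by move=> q; rewrite lee_fin; exact: q0.
- by move=> x; apply: integral_ge0 => t _; rewrite lee_fin; exact: (q0 (x, t)).
- move=> x Ox; rewrite -(setIT (slab _ _ _)) -integral_indic//; last exact: measurable_slab.
  apply: eq_integral => t _; congr (_%:E); rewrite /indC !indicE pos1E.
  have gy y : dotrV (y - x) t = dotrV (y - x0) t - dotrV (x - x0) t.
    by rewrite -dotrVBl opprB addrA subrK.
  have [Ct|nC] := boolP (t \in bc); last first.
    rewrite mul0r (_ : t \in _ = false)//; apply/negbTE; apply: contra nC => /set_mem h.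
    apply/mem_set/(@slab_bcone _ _ _ _ (2^-1 + dotrV (x - x0) t)) => y Oy.
    by rewrite -lerBlDr -gy; exact: h.
  move/set_mem in Ct; rewrite mul1r ger0_norm ?gauge_ge0// subr_ge0.
  have [h|h] := leP (gauge x t) 2^-1.
    rewrite mem_set// => y Oy; rewrite gy; apply: le_trans h.
    by rewrite lerB// supp_ub.
  rewrite (_ : t \in _ = false)//; apply/negbTE/negP => /set_mem h'.
  move: h; apply/negP; rewrite -leNgt lerBlDr; apply: (supp_le Omega0) => y Oy.
  by rewrite -lerBlDr -gy; exact: h'.
by move=> f f1 f0; exact: carleman_pairing.
Qed.

End carleman.

(** * Polar bodies *)

Lemma mscales_set (R : realType) d (T : measurableType d) (m : {measure set T -> \bar R}) phi c A :
  mscales m phi c -> measurable A -> m (phi @^-1` A) = (c%:E * m A)%E.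
Proof.
move=> [c0 mp h] mA.
have mpA : measurable (phi @^-1` A) by rewrite -[_ @^-1` _]setTI; exact: mp.
rewrite -(setIT (phi @^-1` A)) -integral_indic// -(setIT A) -integral_indic// setIT -h//.
by apply/measurable_EFinP; exact: measurable_indic.
Qed.

Section bipolar.
Context (R : realType) (n : nat).
Local Notation V := 'rV[R]_n.
Local Notation mu := (lebn R n).

Definition cvx (K : set V) := forall x y s, K x -> K y -> 0 <= s -> s <= 1 -> K (s *: x + (1 - s) *: y).

Lemma dotrV_ge0 (t : V) : 0 <= dotrV t t.
Proof. by apply: sumr_ge0 => i _; rewrite -expr2 sqr_ge0. Qed.
Lemma dotrV_gt0 (t : V) : t != 0 -> 0 < dotrV t t.
Proof.
move=> t0; rewrite lt_neqAle dotrV_ge0 andbT eq_sym; apply: contra t0.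
rewrite psumr_eq0 => [/allP h|i _]; last by rewrite -expr2 sqr_ge0.
apply/eqP/rowP => i; rewrite mxE; apply/eqP.
by have := h i (mem_index_enum i); rewrite mulf_eq0 orbb.
Qed.
Lemma dotrV_coord (t : V) i : `|t 0 i| ^+ 2 <= dotrV t t.
Proof.
rewrite real_normK ?num_real// /dotrV (bigD1 i)//= expr2 lerDl.
by apply: sumr_ge0 => j _; rewrite -expr2 sqr_ge0.
Qed.

Lemma dotrV_sq (s : R) (z t : V) :
  dotrV (s *: z - t) (s *: z - t) = dotrV t t - 2 * s * dotrV z t + s ^+ 2 * dotrV z z.
Proof.
by rewrite dotrVBl !dotrVBr !dotrVZl !dotrVZr (dotrVC t z); ring.
Qed.

Section polar.
Variables (K : set V) (rho : R).
Hypotheses (K_cvx : cvx K) (rho0 : 0 < rho) (K_ball : forall v : V, (forall i, `|v 0 i| < rho) -> K v).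

Let K0 : K 0. Proof. by apply: K_ball => i; rewrite mxE normr0. Qed.

Let closure_seg c y s : closure K c -> K y -> 0 <= s -> s <= 1 -> closure K (s *: y + (1 - s) *: c).
Proof.
move=> Kc Ky s0 s1 B hB.
have hc : {for c, continuous (fun z : V => s *: y + (1 - s) *: z)}.
  apply: cvgD; first exact: nbhs_filter.
    exact: cst_continuous.
  apply: cvgZ; [exact: nbhs_filter|exact: cst_continuous|exact: cvg_id].
have [z [Kz Bz]] := Kc _ (hc _ hB).
by exists (s *: y + (1 - s) *: z); split => //; exact: K_cvx.
Qed.

Let dist_continuous (p : V) : continuous (fun y : V => dotrV (y - p) (y - p)).
Proof.
apply: sum_continuous => i u.
have h : continuous (fun y : V => (y - p) 0 i : R).
  move=> y; rewrite (_ : (fun y : V => _) = fun y : V => y 0 i - p 0 i :> R).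
    by apply: cvgB; [exact: nbhs_filter|exact: coord_continuous|exact: cst_continuous].
  by apply/funext => w; rewrite !mxE.
by apply: cvgM; [exact: nbhs_filter|exact: h|exact: h].
Qed.

(* Nearest-point separation of [2 v] from [closure K]; the slack of a factor 2 avoids
   supporting hyperplanes at boundary points. *)
Lemma bipolar v : (forall t, slab K 0 1 t -> dotrV v t < 2^-1) -> K v.
Proof.
move=> h; apply: contrapT => nKv; pose p : V := 2 *: v.
have far y : K y -> ~ forall i, `|p 0 i - y 0 i| < rho.
  move=> Ky hy; apply: nKv; have Kz : K (p - y) by apply: K_ball => i; have := hy i; rewrite !mxE.
  have := K_cvx Ky Kz (ltac:(by rewrite invr_ge0) : 0 <= 2^-1 :> R) (ltac:(lra) : 2^-1 <= 1 :> R).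
  rewrite (_ : 2^-1 *: y + _ = v)//.
  by apply/rowP => i; rewrite !mxE; field.
pose N y := dotrV (y - p) (y - p).
(* Only points at least as close to [p] as the origin compete, which makes the minimisation
   compact. *)
pose A := closure K `&` [set y | N y <= N 0].
have A0 : A 0 by split => //; [exact: subset_closure|rewrite /=].
have cA : compact A.
  apply: bounded_closed_compact.
    exists (Num.sqrt (N 0) + `|p|); split; first exact: num_real.
    move=> M hM y [_ /= hy].
    have -> : y = (y - p) + p by rewrite subrK.
    apply: le_trans (ler_normD _ _) _; apply: le_trans (ltW hM); rewrite lerD2r.
    rewrite [leLHS]/Num.norm /= mx_normrE; apply: bigmax_le => [|[j i] _]; first exact: sqrtr_ge0.
    rewrite (ord1 j) /= -sqrtr_sqr ler_sqrt; last exact: dotrV_ge0.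
    by rewrite -real_normK ?num_real//; apply: le_trans (dotrV_coord _ _) hy.
  apply: closedI; first exact: closed_closure.
  rewrite (_ : [set y | _] = N @^-1` [set r | r <= N 0])//.
  by apply: closed_comp => [y _|]; [exact: dist_continuous|exact: closed_le].
have [c /set_mem[Kc /= Nc] hmin'] : exists2 c, c \in A & forall t, t \in A -> N c <= N t.
  apply: EVT_min_rV => //; first by exists 0.
  exact/continuous_subspaceT/dist_continuous.
have hmin y : closure K y -> N c <= N y.
  move=> Ky; have [hy|/ltW hy] := leP (N y) (N 0); last exact: le_trans hy.
  by apply: hmin'; rewrite inE.
pose t0 := p - c.
have t00 : t0 != 0.
  apply/eqP => /eqP; rewrite subr_eq0 => /eqP pc.
  have hB : nbhs c (ball c rho) by exact: nbhsx_ballx.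
  have [y [Ky /(ball_rVE _ _ rho0) By]] := Kc _ hB.
  by apply: (far y Ky) => i; rewrite pc; exact: By.
have sup y : K y -> dotrV y t0 <= dotrV c t0.
  move=> Ky; rewrite -subr_le0 -dotrVBl leNgt; apply/negP => a0.
  set a := dotrV _ _ in a0; set e := dotrV (y - c) (y - c).
  have e0 : 0 <= e by exact: dotrV_ge0.
  have key s : 0 < s -> s <= 1 -> 2 * a <= s * e.
    move=> s0 s1; have := hmin _ (closure_seg Kc Ky (ltW s0) s1).
    have -> : N (s *: y + (1 - s) *: c) = N c - 2 * s * a + s ^+ 2 * e.
      have cp : c - p = - t0 by rewrite /t0 opprB.
      rewrite /N cp (_ : _ - p = s *: (y - c) - t0); last first.
        by apply/rowP => i; rewrite !mxE; ring.
      by rewrite dotrV_sq dotrVNl dotrVNr opprK.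
    rewrite -subr_ge0 => hh; rewrite -(ler_pM2l s0); nra.
  (* With this step length [s * e] is at most [a], against the lower bound [2 * a] of [key]. *)
  have s1 : 0 < a / (a + e) <= 1.
    by rewrite divr_gt0 ?ltr_wpDr//= ler_pdivrMr ?ltr_wpDr// mul1r lerDl.
  case/andP: s1 => s0 s1; have := key _ s0 s1.
  have : a / (a + e) * e <= a.
    by rewrite mulrAC ler_pdivrMr ?ltr_wpDr// ler_pM2l// lerDr ltW.
  by move: a0; lra.
have b0 : 0 < dotrV c t0.
  pose r := rho / (1 + `|t0|).
  have r0 : 0 < r by rewrite divr_gt0// ltr_pwDl.
  apply: lt_le_trans (sup (r *: t0) _); first by rewrite dotrVZl mulr_gt0// dotrV_gt0.
  apply: K_ball => i; rewrite mxE normrM gtr0_norm// /r mulrAC ltr_pdivrMr ?ltr_pwDl//.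
  rewrite ltr_pM2l//; apply: le_lt_trans (_ : `|t0| < _); last by rewrite ltrDr.
  rewrite [leRHS]/Num.norm /= mx_normrE; exact: (le_bigmax _ (fun j : 'I_1 * 'I_n => `|t0 j.1 j.2|) (0, i)).
have Ht : slab K 0 1 ((dotrV c t0)^-1 *: t0).
  by move=> y Ky; rewrite subr0 dotrVZr ler_pdivrMl// mulr1; exact: sup.
(* The normalised direction is in the polar body, yet [v] is the midpoint of [c] and [t0], so its
   pairing with that direction exceeds 1/2 by a positive multiple of [dotrV t0 t0]. *)
have := h _ Ht; rewrite dotrVZr ltr_pdivrMl//.
have -> : v = 2^-1 *: (c + t0) by rewrite /t0 addrC subrK /p scalerA mulVf ?scale1r.
rewrite dotrVZl dotrVDl; have := dotrV_gt0 t00; lra.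
Qed.

Hypothesis K_line : forall u : V, u != 0 -> exists s, ~ K (s *: u).

Let P := slab K 0 1.

Let P_bound t i : P t -> `|t 0 i| <= 2 / rho.
Proof.
move=> Pt; pose v : V := \row_j (if j == i then (rho / 2) * Num.sg (t 0 i) else 0).
have Kv : K v.
  apply: K_ball => j; rewrite mxE; case: ifP => _; last by rewrite normr0.
  rewrite normrM (gtr0_norm (divr_gt0 rho0 _))// normr_sg.
  apply: (@le_lt_trans _ _ (rho / 2)); last by rewrite ltr_pdivrMr// ltr_pMr// ltr1n.
  by rewrite ler_piMr ?divr_ge0 ?(ltW rho0)//; case: (_ != _).
have := Pt _ Kv; rewrite subr0 /dotrV (bigD1 i)//= big1 ?addr0; last first.
  by move=> j ji; rewrite mxE (negbTE ji) mul0r.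
rewrite mxE eqxx -mulrA -normrEsg.
by rewrite -ler_pdivlMl ?divr_gt0// invf_div mulr1.
Qed.

(** A vector [u] orthogonal to all polar points would satisfy the criterion of [bipolar] together
    with all its multiples, so [K] would contain a line. Hence the polar body spans, and independent
    rows can be chosen one by one. *)
Lemma polar_free m : (m <= n)%N -> exists B : 'M[R]_(m, n), row_free B /\ forall i, P (row i B).
Proof.
elim: m => [_|m IH mn]; first by exists 0; split; [rewrite /row_free mxrank0|case].
have [B [fB PB]] := IH (ltnW mn).
have : kermx B^T != 0.
  rewrite -mxrank_eq0 mxrank_ker mxrank_tr (eqP fB) subn_eq0 -ltnNge//.
move=> /rowV0Pn[u /sub_kermxP uB u0].
have [s ns] := K_line u0.
have [t [Pt tu]] : exists t, P t /\ dotrV u t != 0.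
  apply: contrapT => h; apply: ns; apply: bipolar => t Pt.
  rewrite dotrVZl (_ : dotrV u t = 0) ?mulr0 ?invr_gt0//.
  by apply/eqP/negPn/negP => tu; apply: h; exists t.
have dotE (a b : V) : a *m b^T = (dotrV a b)%:M.
  apply/matrixP => i j; rewrite !ord1 !mxE eqxx mulr1n /dotrV.
  by apply: eq_bigr => k _; rewrite mxE.
rewrite -addn1; exists (col_mx B t); split.
  apply: inj_row_free => v; rewrite -[v]hsubmxK mul_row_col => h.
  have r0 : rsubmx v = 0.
    have := congr1 (mulmx^~ u^T) h; rewrite mulmxDl mul0mx -!mulmxA.
    have -> : B *m u^T = 0 by rewrite -[LHS]trmxK trmx_mul trmxK uB trmx0.
    rewrite mulmx0 add0r dotE mul_mx_scalar => /eqP.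
    by rewrite scaler_eq0 dotrVC (negbTE tu) => /eqP.
  move: h; rewrite r0 mul0mx addr0 => /eqP; rewrite mulmx_free_eq0// => /eqP ->.
  by rewrite row_mx0.
move=> i; case: (splitP i) => k ik.
  by rewrite (_ : i = lshift 1 k) ?rowKu//; exact: val_inj.
rewrite (_ : i = rshift m k) ?rowKd; last exact: val_inj.
by rewrite (ord1 k) row_id.
Qed.

(** Cramer's rule: replacing the i-th row by [t] multiplies the determinant by the i-th coordinate
    of [t]. A determinant above half the supremum over the polar body therefore leaves coordinates
    of size at most 2. *)
Lemma polar_det : exists A : 'M[R]_n, [/\ A \in unitmx, (forall i, P (row i A)) &
  forall t, P t -> exists l : V, t = l *m A /\ forall i, `|l 0 i| <= 2].
Proof.
have [B [fB PB]] := polar_free (leqnn n).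
pose D := [set `|\det A| | A in [set A : 'M[R]_n | forall i, P (row i A)]].
have hD : has_sup D.
  split; first by exists `|\det B|; exists B.
  exists (\sum_(s : {perm 'I_n}) (2 / rho) ^+ n) => _ [A PA <-].
  rewrite /determinant; apply: le_trans (ler_norm_sum _ _ _) _.
  apply: ler_sum => s _; rewrite normrM normrX normrN1 expr1n mul1r normr_prod.
  rewrite -[n in _ ^+ n]card_ord -prodr_const; apply: ler_prod => i _.
  by rewrite normr_ge0 /=; have := P_bound (s i) (PA i); rewrite mxE.
have uB : B \in unitmx by rewrite -row_free_unit.
have S0 : 0 < sup D.
  apply: lt_le_trans (ub_le_sup hD.2 _ : `|\det B| <= _); last by exists B.
  by rewrite normr_gt0 -unitfE -unitmxE.
have [_ [A PA <-] hA] := sup_adherent (divr_gt0 S0 (ltr0Sn R 1) : 0 < sup D / 2) hD.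
have dA : 0 < `|\det A| by lra.
have uA : A \in unitmx by rewrite unitmxE unitfE -normr_gt0.
exists A; split => // t Pt; exists (t *m invmx A); split; first by rewrite mulmxKV.
move=> i; pose A' : 'M[R]_n := \matrix_(j, k) (if j == i then t 0 k else A j k).
have PA' j : P (row j A').
  have [ji|ji] := eqVneq j i.
    by rewrite (_ : row j A' = t)//; apply/rowP => k; rewrite !mxE ji eqxx.
  by rewrite (_ : row j A' = row j A)//; apply/rowP => k; rewrite !mxE (negbTE ji).
have detA' : \det A' = (t *m \adj A) 0 i.
  rewrite (expand_det_row A' i) mxE; apply: eq_bigr => k _; rewrite !mxE eqxx; congr (_ * _).
  rewrite /cofactor; congr (_ * \det _); apply/matrixP => a c; rewrite !mxE.
  by rewrite eq_sym (negbTE (neq_lift _ _)).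
have le : `|\det A'| <= sup D by apply: ub_le_sup hD.2 _ _; exists A'.
rewrite /invmx uA -scalemxAr mxE -detA' normrM normfV mulrC ler_pdivrMr//; lra.
Qed.

Hypothesis K_meas : measurable K.

Let N : R := n.+1%:R.
Let N0 : 0 < N. Proof. by rewrite ltr0n. Qed.

Definition symcore : set V := [set v | K v /\ K (- v)].

Lemma measurable_symcore : measurable symcore.
Proof.
rewrite (_ : symcore = K `&` (fun v => - v) @^-1` K)//; apply: measurableI => //.
by rewrite -[_ @^-1` _]setTI; exact: measurable_rVN.
Qed.

Let sum_ord_le (F : 'I_n -> R) (c : R) : (forall i, F i <= c / N) -> 0 <= c -> \sum_i F i <= c.
Proof.
move=> h c0; apply: (@le_trans _ _ (\sum_(i < n) c / N)); first exact: ler_sum.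
rewrite sumr_const card_ord -mulr_natr mulrAC ler_pdivrMr// ler_wpM2l//.
by rewrite ler_nat.
Qed.

Let dot_mulr (A : 'M[R]_n) (l v : V) : dotrV v (l *m A) = \sum_i l 0 i * dotrV v (row i A).
Proof.
rewrite /dotrV; under eq_bigr do rewrite mxE mulr_sumr.
rewrite exchange_big; apply: eq_bigr => i _; rewrite mulr_sumr; apply: eq_bigr => j _.
by rewrite mxE mulrCA.
Qed.

(** In the coordinates given by [A], both [symcore] and the slab contain boxes of fixed size. The
    maps involved are inverse transposes of each other, so the determinants cancel in the product;
    finiteness comes from a larger box. *)
Lemma polar_volume : (0 < mu symcore < +oo)%E /\
  (((1 / (4 * N)) ^+ n * (1 / (2 * N)) ^+ n)%:E <= mu symcore * mu (slab K 0 2^-1))%E.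
Proof.
have [A [uA PA hA]] := polar_det.
have dA : 0 < `|\det A| by rewrite normr_gt0 -unitfE -unitmxE.
have uT : A^T \in unitmx by rewrite unitmx_tr.
have dotA v i : (v *m A^T) 0 i = dotrV v (row i A).
  by rewrite mxE; apply: eq_bigr => j _; rewrite !mxE.
have vol (r : R) : 0 <= r -> mu ((fun v => v *m A^T) @^-1` cube r) = (`|\det A|^-1 * (2 * r) ^+ n)%:E.
  move=> r0; rewrite (mscales_set (lebn_mulmx uT)); last exact: measurable_cube.
  by rewrite det_tr EFinM [X in (_ * X)%E](lebesgue_cube n r0).
have mpre r : measurable ((fun v : V => v *m A^T) @^-1` cube r).
  by rewrite -[_ @^-1` _]setTI; apply: measurable_rVM => //; exact: measurable_cube.
have mS := measurable_symcore.
(* Polar points have coordinates at most 2, so pairings are at most [2 r] per coordinate and 1/4 in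
   total, below the 1/2 asked by [bipolar]. The value [N = n + 1] also makes sense in dimension
   0. *)
pose r := 1 / (8 * N).
have r0 : 0 < r by rewrite divr_gt0// mulr_gt0.
have low : (fun v : V => v *m A^T) @^-1` cube r `<=` symcore.
  have small v : cube r (v *m A^T) -> K v.
    move=> hv; apply: bipolar => t /hA[l [-> l2]]; rewrite dot_mulr.
    apply: (@le_lt_trans _ _ 4^-1); last lra.
    apply: sum_ord_le => // i; apply: le_trans (ler_norm _) _; rewrite normrM -dotA.
    apply: (@le_trans _ _ (2 * r)); first by apply: ler_pM.
    by rewrite (_ : 4^-1 / N = 2 * r)// /r; field; rewrite gt_eqF.
  move=> v hv; split; first exact: small.
  by apply: small => i; rewrite mulNmx mxE normrN; exact: hv.
have up : symcore `<=` (fun v : V => v *m A^T) @^-1` cube 1.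
  move=> v [Kv KNv] i; rewrite dotA ler_norml.
  have := PA i _ Kv; have := PA i _ KNv; rewrite !subr0 dotrVNl.
  by move=> h1 h2; apply/andP; split => //; rewrite lerNl.
have L1 : ((`|\det A|^-1 * (2 * r) ^+ n)%:E <= mu symcore)%E.
  by rewrite -(vol _ (ltW r0)); apply: le_measure => //; rewrite inE.
have L2 : ((`|\det A| * (1 / (2 * N)) ^+ n)%:E <= mu (slab K 0 2^-1))%E.
  (* The cube of half-side [h] centred at [(h, ..., h)] consists of non-negative coordinates up to
     [1 / (2 N)], so combinations of the rows stay at level 1/2. Signs matter: polar inequalities of
     the rows are one-sided. *)
  pose h := 1 / (4 * N); have h0 : 0 < h by rewrite divr_gt0// mulr_gt0.
  pose c : V := \row_i - h.
  have uI : invmx A \in unitmx by rewrite unitmx_inv.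
  have M := mscales_comp (lebn_translate c) (lebn_mulmx uI).
  have e := mscales_set M (@measurable_cube R n h).
  rewrite [X in _ = (_ * X)%E](lebesgue_cube n (ltW h0)) -EFinM mul1r det_inv normfV invrK in e.
  rewrite (_ : (1 / (2 * N)) = 2 * h); last by rewrite /h; field; rewrite gt_eqF.
  rewrite -e; apply: le_measure; rewrite ?inE.
  - by rewrite -[_ @^-1` _]setTI; case: M => _ mM _; apply: mM => //; exact: measurable_cube.
  - exact: measurable_slab.
  move=> t /= ht y Ky; rewrite subr0; pose l := t *m invmx A.
  have tl : t = l *m A by rewrite mulmxKV.
  rewrite tl dot_mulr; apply: sum_ord_le => // i.
  have : `|(l + c) 0 i| <= h by exact: ht.
  rewrite (_ : (l + c) 0 i = l 0 i - h); last by rewrite [LHS]mxE [c 0 i]mxE.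
  rewrite ler_norml => /andP[g1 g2].
  have hd : dotrV y (row i A) <= 1 by have := PA i _ Ky; rewrite subr0.
  have li : 0 <= l 0 i by lra.
  have li2 : l 0 i <= 2^-1 / N.
    rewrite (_ : 2^-1 / N = 2 * h); first by lra.
    by rewrite /h; field; rewrite gt_eqF.
  by apply: le_trans li2; rewrite -[leRHS]mulr1; exact: ler_wpM2l.
split.
  apply/andP; split.
    by apply: lt_le_trans L1; rewrite lte_fin; apply: mulr_gt0; [rewrite invr_gt0|apply: exprn_gt0; exact: mulr_gt0].
  apply: (@le_lt_trans _ _ (mu ((fun v : V => v *m A^T) @^-1` cube 1))).
    by apply: le_measure => //; rewrite inE.
  by rewrite vol// ltry.
rewrite (_ : _%:E = ((`|\det A|^-1 * (2 * r) ^+ n)%:E * (`|\det A| * (1 / (2 * N)) ^+ n)%:E)%E).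
  apply: lee_pmul => //; rewrite lee_fin; apply: mulr_ge0; rewrite ?invr_ge0 ?normr_ge0//.
    by apply: exprn_ge0; rewrite ltW// mulr_gt0.
  by apply: exprn_ge0; rewrite divr_ge0// mulr_ge0// ltW.
rewrite -EFinM; congr (_%:E); rewrite (_ : 2 * r = 1 / (4 * N)); last by rewrite /r; field; rewrite gt_eqF.
by field; rewrite !gt_eqF.
Qed.

End polar.
End bipolar.

(** * The weight and its lower bound *)

Section weight.
Context (R : realType) (n : nat).
Local Notation V := 'rV[R]_n.
Local Notation mu := (lebn R n).
Variable Omega : set V.
Hypothesis Omega_open : open Omega.

Definition wset (x : V) : set V := [set y | half_set Omega y /\ half_set Omega (x - y)].
Definition wgt (x : V) : \bar R := mu (wset x).

Lemma half_setE (y : V) : half_set Omega y <-> Omega (2 *: y).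
Proof.
split => [[z Oz <-]|O2]; first by rewrite scalerA mulfV// scale1r.
by exists (2 *: y) => //; rewrite scalerA mulVf// scale1r.
Qed.

Lemma half_pre : half_set Omega = (fun y => 2 *: y) @^-1` Omega.
Proof. by apply/seteqP; split => y; move/half_setE. Qed.

Lemma open_half : open (half_set Omega).
Proof. by rewrite half_pre; apply: open_comp => // y _; exact: scaler_continuous. Qed.

Lemma measurable_half : measurable (half_set Omega).
Proof. by apply: open_measurable_rV; exact: open_half. Qed.

Let ker_meas : measurable_fun setT (fun q : V * V => (\1_(half_set Omega) q.2 * \1_(half_set Omega) (q.1 - q.2) : R)).
Proof.
have mI : measurable_fun setT (\1_(half_set Omega) : V -> R) by apply: measurable_indic; exact: measurable_half.
apply: measurable_funM; first exact: measurableT_comp mI measurable_snd.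
by apply: measurableT_comp mI _; apply: measurable_rVB; [exact: measurable_fst|exact: measurable_snd].
Qed.

Lemma measurable_wset x : measurable (wset x).
Proof.
have -> : wset x = half_set Omega `&` (fun y => x - y) @^-1` half_set Omega by [].
apply: measurableI; first exact: measurable_half.
rewrite -[_ @^-1` _]setTI; apply: measurable_rVB => //; exact: measurable_half.
Qed.

Lemma wgtE x : wgt x = (\int[mu]_y (\1_(half_set Omega) y * \1_(half_set Omega) (x - y))%:E)%E.
Proof.
rewrite /wgt -(setIT (wset x)) -integral_indic//; last exact: measurable_wset.
apply: eq_integral => y _; congr (_%:E); rewrite !indicE -natrM mulnb; congr (_%:R); congr nat_of_bool.
by apply/idP/andP; rewrite !inE.
Qed.

Lemma measurable_wgt : measurable_fun setT wgt.
Proof.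
rewrite (_ : wgt = fun x => \int[mu]_y (\1_(half_set Omega) y * \1_(half_set Omega) (x - y))%:E)%E; last first.
  by apply/funext => x; exact: wgtE.
apply: (@measurable_fun_fubini_tonelli_F _ _ _ _ _ mu (fun q : V * V => (\1_(half_set Omega) q.2 * \1_(half_set Omega) (q.1 - q.2))%:E)).
  by apply/measurable_EFinP; exact: ker_meas.
by move=> q; rewrite lee_fin mulr_ge0.
Qed.

Lemma wgt_out x : cvx Omega -> ~ Omega x -> wset x = set0.
Proof.
move=> cO nO; apply/seteqP; split => // y [/half_setE h1 /half_setE h2]; apply: nO.
have := cO _ _ 2^-1 h1 h2 (ltac:(by rewrite invr_ge0)) (ltac:(lra)).
by rewrite [X in Omega X -> _](_ : _ = x)//; apply/rowP => i; rewrite !mxE; field.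
Qed.

Lemma weight_bound : cvx Omega -> ~ has_affine_line Omega ->
  exists c : R, 0 < c /\ forall x, Omega x ->
    (0 < wgt x < +oo)%E /\ (c%:E <= wgt x * mu (slab Omega x 2^-1))%E.
Proof.
move=> cO lO; pose N : R := n.+1%:R.
have N0 : 0 < N by rewrite ltr0n.
pose C := (1 / (4 * N)) ^+ n * (1 / (2 * N)) ^+ n.
have C0 : 0 < C by rewrite mulr_gt0 ?exprn_gt0 ?divr_gt0 ?mulr_gt0.
exists ((2 ^+ n)^-1 * C); split; first by rewrite mulr_gt0 ?invr_gt0 ?exprn_gt0.
move=> x Ox; pose K : set V := [set v | Omega (x + v)].
have /nbhs_ballP[rho /= rho0 hrho] : nbhs x Omega by exact: open_nbhs_nbhs.
have Kc : cvx K.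
  move=> u v s Ku Kv s0 s1; rewrite /K /= (_ : x + _ = s *: (x + u) + (1 - s) *: (x + v)); first exact: cO.
  by apply/rowP => i; rewrite !mxE; ring.
have Kb (v : V) : (forall i, `|v 0 i| < rho) -> K v.
  move=> hv; apply: hrho; apply/ball_rVE => // i.
  by rewrite mxE opprD addrA subrr sub0r normrN.
have Kl (u : V) : u != 0 -> exists s, ~ K (s *: u).
  move=> u0; apply: contrapT => h; apply: lO; exists x, u; split => // t.
  by apply: contrapT => ht; apply: h; exists t.
have Km : measurable K.
  apply: open_measurable_rV; apply: (@open_comp _ _ (fun v => x + v)) => // v _.
  by apply: cvgD; [exact: nbhs_filter|exact: cst_continuous|exact: cvg_id].
have [/andP[S0 Soo] SC] := polar_volume Kc rho0 Kb Kl Km.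
have sE : slab K 0 2^-1 = slab Omega x 2^-1.
  apply/seteqP; split => t h y.
    by move=> Oy; have := h (y - x); rewrite subr0 /K /= addrC subrK; exact.
  by move=> Ky; have := h _ Ky; rewrite (addrC x) addrK subr0.
(* The map sending [y] to [2 y - x] takes [wset Omega x] onto the symmetric core of [Omega - x]. *)
have wE : wgt x = (((2 ^+ n)^-1)%:E * mu (symcore K))%E.
  have M := mscales_comp (lebn_translate (- x)) (lebn_dilate n (ltr0Sn R 1)).
  have e := mscales_set M (measurable_symcore Km).
  rewrite mul1r in e; rewrite -e /wgt; congr (mu _); apply/seteqP; split => y /=.
    move=> [/half_setE h1 /half_setE h2]; split; rewrite /K /= ?(addrC (2 *: y)) ?addNKr//.
    by rewrite -(_ : 2 *: (x - y) = x - (- x + 2 *: y))//; apply/rowP => i; rewrite !mxE; ring.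
  rewrite /symcore /K /= => -[h1 h2]; split; apply/half_setE.
    by rewrite addrC subrK in h1.
  by rewrite (_ : 2 *: (x - y) = x - (2 *: y - x))//; apply/rowP => i; rewrite !mxE; ring.
rewrite wE -sE; split.
  rewrite mule_gt0 ?lte_fin ?invr_gt0 ?exprn_gt0//=.
  by rewrite lte_mul_pinfty// lee_fin invr_ge0 exprn_ge0.
by rewrite EFinM -muleA lee_wpmul2l// lee_fin invr_ge0 exprn_ge0.
Qed.

End weight.

(** * Kernels annihilated by the convolution map *)

Lemma n2_addK (R : realType) (H : preHilb R) (x y : H) : n2 (hsub (hadd x y) x) = n2 y.
Proof.
apply: n2_eq; rewrite /n2; set v := hsub _ y.
suff -> : ip v v = 0 by [].
have h z : ip v z = 0 by rewrite /v /hsub !(ipDl, ipZl); ring.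
exact: h.
Qed.

(** * Closed subspaces and L^2 functions supported in a set *)

Section subspace_hilbert.
Context (R : realType) (H : preHilb R) (P : H -> Prop).
Hypothesis P_sub : hsubspace P.
(** Closedness holds up to null vectors, since an L^2 limit may be altered on a null set. *)
Hypothesis P_closed : forall (u : nat -> H) x, (forall k, P (u k)) -> hcvg u x ->
  exists y, P y /\ n2 (hsub x y) = 0.

Definition subcar := {x : H | P x}.
Let sub0 : P hz. Proof. by case: P_sub. Qed.
Let subD x y : P x -> P y -> P (hadd x y). Proof. by case: P_sub => _ + _; exact. Qed.
Let subZ a x : P x -> P (hscl a x). Proof. by case: P_sub => _ _; exact. Qed.
Definition subadd (x y : subcar) : subcar := exist _ _ (subD (projT2 x) (projT2 y)).
Definition subscl a (x : subcar) : subcar := exist _ _ (subZ a (projT2 x)).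

Let subcomplete (u : nat -> subcar) :
  (forall e : R, 0 < e -> exists N, forall m n, (N <= m)%N -> (N <= n)%N ->
    complex.Re (ip (projT1 (subadd (u m) (subscl (-1) (u n))))
                   (projT1 (subadd (u m) (subscl (-1) (u n))))) < e) ->
  exists x : subcar, complex.Re (ip (projT1 (subadd (u n) (subscl (-1) x)))
                   (projT1 (subadd (u n) (subscl (-1) x)))) @[n --> \oo] --> (0 : R).
Proof.
move=> /hcomplete[x ux]; have [y [Py xy]] := P_closed (fun k => projT2 (u k)) ux.
exists (exist _ y Py); rewrite (_ : (fun n => _) = fun n => n2 (hsub (projT1 (u n)) x))//.
apply/funext => n; rewrite -[LHS]/(n2 (hsub (projT1 (u n)) y)) !n2B (n2_eq xy).
by rewrite (ipJ x) (ipJ y) (ip_eql _ xy).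
Qed.

Definition subHilb : preHilb R := @PreHilb R subcar (exist _ hz sub0) subadd subscl
  (fun x y => ip (projT1 x) (projT1 y)) (fun x => ip0l (projT1 x))
  (fun x y z => ipDl (projT1 x) (projT1 y) (projT1 z))
  (fun a x y => ipZl a (projT1 x) (projT1 y)) (fun x y => ipJ (projT1 x) (projT1 y))
  (fun x => ip_ge0 (projT1 x)) subcomplete.

End subspace_hilbert.

Section supported.
Context d (T : measurableType d) (R : realType) (m : {measure set T -> \bar R}) (S : set T).
Hypothesis mS : measurable S.

(** Vanishing off [S] is required at every point: kernels are later restricted to the null sets
    [z.1 + z.2 = x], where an almost everywhere condition would say nothing. *)
Let P (f : L2H m) : Prop := forall x, ~ S x -> projT1 f x = 0.
Let P_sub : hsubspace P.
Proof.
split => [x //|f g Pf Pg x nS|a f Pf x nS].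
  by rewrite -[LHS]/(projT1 f x + projT1 g x) Pf// Pg// addr0.
by rewrite -[LHS]/(a * projT1 f x) Pf// mulr0.
Qed.

Lemma L2c_ind (f : T -> R[i]) : L2c m f -> L2c m (fun x => f x * ((\1_S x : R)%:C)%C).
Proof.
move=> f2; apply: (L2c_bound f2 (mc_indic R mS) (M := 1)) => x.
by rewrite normc_real indicE; case: (_ \in _); rewrite ?normr1 ?normr0.
Qed.

Let P_closed (u : nat -> L2H m) x : (forall k, P (u k)) -> hcvg u x ->
  exists y, P y /\ n2 (hsub x y) = 0.
Proof.
move=> Pu ux; exists (toL2 (L2c_ind (projT2 x))); split.
  by move=> t nS; rewrite /= indicE memNset// mulr0.
apply/eqP; rewrite eq_le n2_ge0 andbT; apply/ler_addgt0Pl => e e0; rewrite addr0.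
have [k hk] : exists k, n2 (hsub (u k) x) <= e.
  have /cvgrPdist_le/(_ _ e0)[N _ hN] := ux; exists N; have := hN N (leqnn _).
  by rewrite /= sub0r normrN ger0_norm ?n2_ge0.
apply: le_trans hk; rewrite (n2BC (u k)) !n2_L2 fine_le ?L2n_fin//; try exact: projT2.
apply: ge0_le_integral => //.
- by move=> t _; rewrite lee_fin exprn_ge0 ?normc_ge0.
- by apply/measurable_EFinP; apply: msq; exact: (projT2 (hsub x _)).1.
- by apply/measurable_EFinP; apply: msq; exact: (projT2 (hsub x _)).1.
move=> t _; rewrite lee_fin /= !mulN1r indicE.
have [St|nS] := boolP (t \in S); first by rewrite mulr1 subrr normc0 expr0n /= exprn_ge0 ?normc_ge0.
have uk : sval (u k) t = 0 by apply: Pu => /mem_set h; rewrite h in nS.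
by rewrite uk mulr0.
Qed.

Definition L2S : preHilb R := subHilb P_sub P_closed.

Definition fn (f : L2S) : T -> R[i] := projT1 (projT1 f).
Lemma fn_L2 f : L2c m (fn f). Proof. exact: (projT2 (projT1 f)). Qed.
Lemma fn_out f x : ~ S x -> fn f x = 0. Proof. exact: (projT2 f). Qed.
Definition toL2S f (f2 : L2c m f) (f0 : forall x, ~ S x -> f x = 0) : L2S := exist P (toL2 f2) f0.
Lemma n2_fn f : n2 f = fine (L2n m (fn f)). Proof. exact: n2_L2. Qed.
Lemma n2_fnE f : (n2 f)%:E = L2n m (fn f).
Proof. by rewrite n2_fn fineK// L2n_fin//; exact: fn_L2. Qed.
Lemma ip_fn f g : ip f g = cint m (fun x => fn f x * (fn g x)^*%C). Proof. by []. Qed.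

End supported.

(** * Measure-preserving maps of product spaces *)

Section measure_preserving.
Context (R : realType).

Lemma ae_pull d (T : measurableType d) (m : {measure set T -> \bar R}) (phi : T -> T) c (Q : set T) :
  mscales m phi c -> {ae m, forall x, Q x} -> {ae m, forall x, Q (phi x)}.
Proof.
move=> sc [B [mB B0 QB]]; have mp : measurable_fun setT phi by case: sc.
exists (phi @^-1` B); split.
- by rewrite -[_ @^-1` _]setTI; exact: mp.
- by rewrite (mscales_set sc mB) B0 mule0.
- by move=> x nQ; exact: QB.
Qed.

Context d1 d2 (T1 : measurableType d1) (T2 : measurableType d2).
Variables (m1 : {sigma_finite_measure set T1 -> \bar R}) (m2 : {sigma_finite_measure set T2 -> \bar R}).

Lemma mscales_fiber (phi : T1 * T2 -> T1) : measurable_fun setT phi ->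
  (forall y, mscales m1 (fun x => phi (x, y)) 1) ->
  mscales (m1 \x m2)%E (fun p => (phi p, p.2)) 1.
Proof.
move=> mp h; split => //; first by apply: measurable_fun_pair => //; exact: measurable_snd.
move=> f mf f0; rewrite mul1e.
have mq : measurable_fun setT (fun p : T1 * T2 => (phi p, p.2)).
  by apply: measurable_fun_pair => //; exact: measurable_snd.
rewrite (@fubini_tonelli2 _ _ _ _ _ m1 m2 (fun p => f (phi p, p.2)))//; last exact: measurableT_comp mf mq.
rewrite (@fubini_tonelli2 _ _ _ _ _ m1 m2 f mf f0); apply: eq_integral => y _.
have [_ _ /(_ (fun x => f (x, y)))] := h y; rewrite mul1e; apply => //.
exact: measurableT_comp mf (measurable_pairr y).
Qed.

Lemma mscales_prod_snd (psi : T2 -> T2) c : mscales m2 psi c ->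
  mscales (m1 \x m2)%E (fun p => (p.1, psi p.2)) c.
Proof.
move=> [c0 mp h]; split => //.
  by apply: measurable_fun_pair; [exact: measurable_fst|exact: measurableT_comp mp measurable_snd].
move=> f mf f0.
have mq : measurable_fun setT (fun p : T1 * T2 => (p.1, psi p.2)).
  by apply: measurable_fun_pair; [exact: measurable_fst|exact: measurableT_comp mp measurable_snd].
rewrite (@fubini_tonelli1 _ _ _ _ _ m1 m2 (fun p => f (p.1, psi p.2)))//; last exact: measurableT_comp mf mq.
rewrite (@fubini_tonelli1 _ _ _ _ _ m1 m2 f mf f0) -ge0_integralZl//; first last.
- by rewrite lee_fin ltW.
- by move=> x _; apply: integral_ge0 => y _.
- exact: (@measurable_fun_fubini_tonelli_F _ _ _ _ _ m2 f).
apply: eq_integral => x _; rewrite /fubini_F (h (fun y => f (x, y)))//.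
exact: measurableT_comp mf (measurable_pairl x).
Qed.

End measure_preserving.

Section measure_preserving_swap.
Context (R : realType) d (T : measurableType d) (m : {sigma_finite_measure set T -> \bar R}).

Lemma mscales_swap : mscales (m \x m)%E (fun p : T * T => (p.2, p.1)) 1.
Proof.
have mq : measurable_fun setT (fun p : T * T => (p.2, p.1)).
  by apply: measurable_fun_pair; [exact: measurable_snd|exact: measurable_fst].
split => // f mf f0; rewrite mul1e.
rewrite (@fubini_tonelli1 _ _ _ _ _ m m (fun p => f (p.2, p.1)))//; last exact: measurableT_comp mf mq.
by rewrite fubini_tonelli2.
Qed.

Lemma mscales_swap12 : mscales (m \x prodm m m)%E (fun p : T * (T * T) => (p.2.1, (p.1, p.2.2))) 1.
Proof.
have m21 : measurable_fun setT (fun p : T * (T * T) => p.2.1) by exact: measurableT_comp measurable_fst measurable_snd.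
have m22 : measurable_fun setT (fun p : T * (T * T) => p.2.2) by exact: measurableT_comp measurable_snd measurable_snd.
have mq : measurable_fun setT (fun p : T * (T * T) => (p.2.1, (p.1, p.2.2))).
  by apply: measurable_fun_pair => //; apply: measurable_fun_pair => //; exact: measurable_fst.
have mass : measurable_fun setT (fun q : (T * T) * T => (q.1.1, (q.1.2, q.2))).
  apply: measurable_fun_pair; first exact: measurableT_comp measurable_fst measurable_fst.
  by apply: measurable_fun_pair; [exact: measurableT_comp measurable_snd measurable_fst|exact: measurable_snd].
split => // f mf f0; rewrite mul1e.
pose F (p : T * T) := (\int[m]_c f (p.1, (p.2, c)))%E.
have mF : measurable_fun setT F.
  apply: (@measurable_fun_fubini_tonelli_F _ _ (T * T)%type T _ m (fun q => f (q.1.1, (q.1.2, q.2)))) => //.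
  exact: measurableT_comp mf mass.
have F0 p : (0 <= F p)%E by apply: integral_ge0.
have i1 g : measurable_fun setT g -> (forall p, (0 <= g p)%E) ->
    (\int[(m \x prodm m m)%E]_p g p = \int[m]_a \int[m]_b \int[m]_c g (a, (b, c)))%E.
  move=> mg g0; rewrite (@fubini_tonelli1 _ _ _ _ _ m (prodm m m))//; apply: eq_integral => a _.
  rewrite /fubini_F prodm_tonelli1//; exact: measurableT_comp mg (measurable_pairl a).
have e := i1 (fun p => f (p.2.1, (p.1, p.2.2))) (measurableT_comp mf mq) (fun p => f0 _).
rewrite (i1 f mf f0) e.
have mF' : measurable_fun setT (fun p : T * T => F (p.2, p.1)).
  by apply: measurableT_comp mF _; apply: measurable_fun_pair; [exact: measurable_snd|exact: measurable_fst].
exact: (@fubini_tonelli _ _ _ _ _ m m (fun p => F (p.2, p.1)) mF').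
Qed.

End measure_preserving_swap.

Lemma L2c_slice1 d1 d2 (T1 : measurableType d1) (T2 : measurableType d2) (R : realType)
    (m1 : {sigma_finite_measure set T1 -> \bar R}) (m2 : {sigma_finite_measure set T2 -> \bar R})
    (F : T1 * T2 -> R[i]) :
  L2c (m1 \x m2)%E F -> {ae m1, forall x, L2c m2 (fun y => F (x, y))}.
Proof.
move=> [mF F2].
have e (d : measure_display) (T : measurableType d) (m : {measure set T -> \bar R}) (f : T -> R[i]) :
    L1n m (fun z => ((normc (f z) ^+ 2)%:C)%C) = L2n m f.
  by apply: eq_integral => z _; rewrite normc_real ger0_norm// exprn_ge0// normc_ge0.
have : L1c (m1 \x m2)%E (fun z => ((normc (F z) ^+ 2)%:C)%C).
  by split; [apply: mc_real; exact: msq|rewrite e].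
move=> /L1c_slice1; apply: filterS => x [_ h]; split; first exact: mc_slice1.
by rewrite -e.
Qed.

(** * Kernels on U * U and their push-forward *)

Section tensor_kernels.
Context (R : realType) (n : nat).
Local Notation V := 'rV[R]_n.
Local Notation mu := (lebn R n).
Local Notation mm := (lebn R n \x lebn R n)%E.
Variable U : set V.
Hypothesis mU : measurable U.
Let mUU : measurable (U `*` U). Proof. exact: measurableX. Qed.

Definition HU := L2S mu mU.
Definition HUU := L2S mm mUU.
Implicit Types (a b : HU) (K : HUU) (r : seq (HU * HU)).

Let tens_out a b (z : V * V) : ~ (U `*` U) z -> fn a z.1 * fn b z.2 = 0.
Proof.
move=> nz; have [U1|/fn_out->] := pselect (U z.1); last by rewrite mul0r.
have [U2|/fn_out->] := pselect (U z.2); last by rewrite mulr0.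
by exfalso; apply: nz.
Qed.

Definition tensU a b : HUU := toL2S mUU (L2c_tens (fn_L2 a) (fn_L2 b)) (@tens_out a b).

Lemma tensU_ip a b a' b' : ip (tensU a b) (tensU a' b') = ip a a' * ip b b'.
Proof.
rewrite !ip_fn -cint_tens; [|exact: L2cM (fn_L2 _) (L2c_conj (fn_L2 _))|exact: L2cM (fn_L2 _) (L2c_conj (fn_L2 _))].
apply: eq_cint => z; rewrite -[fn (tensU a b) z]/(fn a z.1 * fn b z.2).
by rewrite -[fn (tensU a' b') z]/(fn a' z.1 * fn b' z.2) conjcM; ring.
Qed.

Lemma L2n_ae0 d (T : measurableType d) (m : {measure set T -> \bar R}) (f : T -> R[i]) : mc f ->
  {ae m, forall x, f x = 0} -> L2n m f = 0%E.
Proof. by move=> mf h; rewrite -(L2n_cst0 m); apply: L2n_ae => //; exact: mc_cst. Qed.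

Lemma n2_ae K : n2 K = 0 <-> {ae mm, forall z, fn K z = 0}.
Proof.
split => [h|h]; last by rewrite n2_fn L2n_ae0//; exact: (fn_L2 K).1.
by apply: L2n_eq0; [exact: (fn_L2 K).1|rewrite -n2_fnE h].
Qed.

Lemma toU (f : V -> R[i]) : L2c mu f -> exists a : HU, fn a = fun x => f x * ((\1_U x : R)%:C)%C.
Proof.
move=> f2; have h x : ~ U x -> f x * ((\1_U x : R)%:C)%C = 0.
  by move=> nU; rewrite indicE memNset// mulr0.
by exists (toL2S mU (L2c_ind mU f2) h).
Qed.

Lemma tensU_dense K : (forall a b, ip K (tensU a b) = 0) -> n2 K = 0.
Proof.
move=> h; apply/n2_ae; apply: tens_dense; first exact: fn_L2.
move=> f g /toU[a fa] /toU[b fb]; rewrite -[RHS](h a b) ip_fn; apply: eq_cint => z.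
have [[U1 U2]|/fn_out->] := pselect ((U `*` U) z); last by rewrite !mul0r.
by rewrite -[fn (tensU a b) z]/(fn a z.1 * fn b z.2) fa fb !indicE !mem_set// !mulr1.
Qed.

Lemma shear_pres : mscales mm (fun p : V * V => (p.2, p.1 - p.2)) 1.
Proof.
have M : mscales mm (fun p : V * V => (p.1 - p.2, p.2)) 1.
  apply: (@mscales_fiber _ _ _ _ _ mu mu (fun p => p.1 - p.2)).
    by apply: measurable_rVB; [exact: measurable_fst|exact: measurable_snd].
  by move=> y; exact: (lebn_translate (- y)).
by have := mscales_comp (mscales_swap mu) M; rewrite mulr1.
Qed.

Definition kerT K x := cint mu (fun y => fn K (y, x - y)).
Definition tsumf r (z : V * V) : R[i] := \sum_(ab <- r) fn ab.1 z.1 * fn ab.2 z.2.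
Definition rsum r x : R[i] := \sum_(ab <- r) cint mu (fun y => fn ab.1 y * fn ab.2 (x - y)).

Lemma fn_htsum r : fn (htsum tensU r) = tsumf r.
Proof.
apply/funext => z; rewrite /tsumf; elim: r => [|ab r IH]; first by rewrite big_nil.
by rewrite big_cons -IH.
Qed.

Lemma L2c_refl a x : L2c mu (fun y => fn a (x - y)).
Proof.
have M := mscales_comp (lebn_translate x) (lebn_opp R n); have := mscales_L2c M (fn_L2 a).
by under eq_fun do rewrite addrC.
Qed.
Lemma conv_L1 a b x : L1c mu (fun y => fn a y * fn b (x - y)).
Proof. exact: L2cM (fn_L2 a) (L2c_refl b x). Qed.

Lemma rsum_kerT r x : cint mu (fun y => tsumf r (y, x - y)) = rsum r x.
Proof. by rewrite /tsumf cint_sum// => ab; exact: conv_L1. Qed.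

(** The push-forward vanishes at every [x], so that adding such a kernel leaves [rsum] unchanged as
    a function and not merely almost everywhere. *)
Definition ker0 K := exists r, fn K = tsumf r /\ forall x, rsum r x = 0.

Lemma ker0_sub : hsubspace ker0.
Proof.
split.
- by exists [::]; split => [|x]; rewrite /tsumf /rsum ?big_nil//; apply/funext => z; rewrite big_nil.
- move=> K K' [r [e h]] [r' [e' h']]; exists (r ++ r'); split => [|x].
    apply/funext => z; transitivity (fn K z + fn K' z) => //.
    by rewrite e e' /tsumf big_cat.
  transitivity (rsum r x + rsum r' x); first by rewrite /rsum big_cat.
  by rewrite h h' addr0.
- move=> c K [r [e h]]; exists [seq (hscl c ab.1, ab.2) | ab <- r]; split => [|x].
    apply/funext => z; rewrite /tsumf big_map -[LHS]/(c * fn K z) e /tsumf mulr_sumr.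
    by apply: eq_bigr => ab _; rewrite mulrA.
  transitivity (c * rsum r x); last by rewrite h mulr0.
  rewrite /rsum big_map mulr_sumr; apply: eq_bigr => ab _.
  by rewrite -cintZ; [apply: eq_cint => y; rewrite mulrA|exact: conv_L1].
Qed.

Hypothesis finU : forall x, (mu [set y | U y /\ U (x - y)%R] < +oo)%E.

Let u (x : V) : R[i] := ((\1_U x : R)%:C)%C.
Let mu_ : mc u. Proof. exact: mc_indic. Qed.
Let u1 x : U x -> u x = 1. Proof. by move=> Ux; rewrite /u indicE mem_set. Qed.
Let u0 x : ~ U x -> u x = 0. Proof. by move=> Ux; rewrite /u indicE memNset. Qed.
Let u_le1 x : normc (u x) <= 1.
Proof. by rewrite normc_real indicE; case: (_ \in _); rewrite ?normr1 ?normr0. Qed.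
Let ms (s : V) : measurable_fun setT (fun x : V => x + s). Proof. exact: measurable_rVD. Qed.

Let L2c_u f (g : V -> V) : measurable_fun setT g -> L2c mu f -> L2c mu (fun x => f x * u (g x)).
Proof. by move=> mg f2; apply: (L2c_bound f2 (mc_comp mg mu_) (M := 1)). Qed.

Lemma kerT_L1 K : {ae mu, forall x, L1c mu (fun y => fn K (y, x - y))}.
Proof.
apply: filterS (L2c_slice1 (mscales_L2c shear_pres (fn_L2 K))) => x k2.
pose W := [set y | U y /\ U (x - y)].
have mW : measurable W.
  rewrite (_ : W = U `&` (fun y => x - y) @^-1` U)//; apply: measurableI => //.
  by rewrite -[_ @^-1` _]setTI; exact: measurable_rVB.
have kW y : ~ W y -> fn K (y, x - y) = 0.
  by move=> nW; apply: fn_out => -[U1 U2]; apply: nW.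
have := L2cM k2 (L2c_indic mW (finU x)); congr (L1c _ _); apply/funext => y /=.
rewrite indicE; have [/set_mem Wy|nW] := boolP (y \in W); first by rewrite mulr1.
by rewrite kW ?mul0r// => /mem_set h; rewrite h in nW.
Qed.

Section orth.
Variable phi : HUU.
Hypothesis phi_orth : forall K, ker0 K -> ip phi K = 0.

(** The defect of [phi (y + s, z) = phi (y, z + s)], cut off to the places where all the points
    involved lie in [U]. *)
Let Psi (s : V) (z : V * V) : R[i] :=
  (fn phi (z.1 + s, z.2) - fn phi (z.1, z.2 + s)) * (u z.1 * u (z.1 + s) * (u z.2 * u (z.2 + s))).

Let mPsi d (T : measurableType d) (f g h : T -> V) : measurable_fun setT f -> measurable_fun setT g ->
  measurable_fun setT h -> mc (fun t => Psi (f t) (g t, h t)).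
Proof.
move=> mf mg mh; have mphi := (fn_L2 phi).1.
have mgf : measurable_fun setT (fun t => g t + f t) by exact: measurable_rVD.
have mhf : measurable_fun setT (fun t => h t + f t) by exact: measurable_rVD.
apply: mcM.
  by apply: mcB; apply: (mc_comp _ mphi); exact: measurable_fun_pair.
by apply: mcM; apply: mcM; apply: mc_comp mu_.
Qed.

Let sh1 s : mscales mm (fun z : V * V => (z.1 + s, z.2)) 1.
Proof.
apply: (@mscales_fiber _ _ _ _ _ mu mu (fun p => p.1 + s)).
  by apply: measurable_rVD => //; exact: measurable_fst.
by move=> y; exact: lebn_translate.
Qed.
Let sh2 s : mscales mm (fun z : V * V => (z.1, z.2 + s)) 1.
Proof. exact: (mscales_prod_snd mu (lebn_translate s)). Qed.

Let Psi0 s : {ae mm, forall z, Psi s z = 0}.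
Proof.
have p1 := mscales_L2c (sh1 s) (fn_L2 phi); have p2 := mscales_L2c (sh2 s) (fn_L2 phi).
apply: tens_dense.
  apply: (L2c_bound (L2cB p1 p2) _ (M := 1)) => [|z].
    apply: mcM; apply: mcM; apply: (mc_comp _ mu_) => //; try exact: measurable_fst; try exact: measurable_snd.
      by apply: measurable_rVD => //; exact: measurable_fst.
    by apply: measurable_rVD => //; exact: measurable_snd.
  rewrite !normcM; have h1 := u_le1 z.1; have h2 := u_le1 (z.1 + s); have h3 := u_le1 z.2; have h4 := u_le1 (z.2 + s).
  by rewrite !mulr_ile1 ?mulr_ge0 ?normc_ge0.
move=> f g f2 g2.
have W h : L2c mu h -> L2c mu (fun x => h x * u x * u (x + s)) by move=> h2; apply: L2c_u => //; exact: L2c_u.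
have W' h : L2c mu h -> exists a, fn a = fun x => h (x - s) * u (x - s) * u x.
  move=> h2; have [a ea] := toU (mscales_L2c (lebn_translate (- s)) (L2c_u (@measurable_id _ _ _) h2)).
  by exists a; rewrite ea.
have W0 h : L2c mu h -> exists a, fn a = fun x => h x * u x * u (x + s).
  move=> h2; have [a ea] := toU (L2c_u (ms s) h2).
  by exists a; rewrite ea; apply/funext => x; rewrite mulrAC.
have [a ea] := W0 _ f2; have [as_ eas] := W' _ f2; have [b eb] := W0 _ g2; have [bs ebs] := W' _ g2.
pose K := hsub (tensU as_ b) (tensU a bs).
have K0 : ker0 K.
  exists [:: (as_, b); (hscl (-1) a, bs)]; split.
    apply/funext => z; rewrite /tsumf !big_cons big_nil addr0.
    by rewrite -[LHS]/(fn as_ z.1 * fn b z.2 + -1 * (fn a z.1 * fn bs z.2)) mulrA.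
  move=> x; rewrite /rsum !big_cons big_nil addr0 /=.
  have := mscales_cint (lebn_translate s) (conv_L1 as_ b x); rewrite mul1r => <-.
  have T1 := mscales_L1c (lebn_translate s) (conv_L1 as_ b x).
  rewrite -(cintD T1 (conv_L1 (hscl (-1) a) bs x)) -[RHS](cint0 mu); apply: eq_cint => y.
  rewrite -[fn (hscl _ _) y]/(-1 * fn a y) eas eb ea ebs addrK.
  rewrite (_ : x - (y + s) = x - y - s) ?subrK; last by rewrite opprD addrA.
  by ring.
have := phi_orth K0; rewrite ipBr => /eqP; rewrite subr_eq0 => /eqP.
rewrite !ip_fn => E.
pose q1 z := (fn a z.1 * fn b z.2)^*%C.
have Lab : L2c mm (fun z => fn a z.1 * fn b z.2) by exact: L2c_tens (fn_L2 a) (fn_L2 b).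
have := mscales_cint (sh1 s) (L2cM (fn_L2 phi) (L2c_conj (fn_L2 (tensU as_ b)))).
have := mscales_cint (sh2 s) (L2cM (fn_L2 phi) (L2c_conj (fn_L2 (tensU a bs)))).
rewrite !mul1r => e2 e1; rewrite -e1 -e2 in E.
rewrite -[RHS](subrr (cint mm (fun z => fn phi (z.1 + s, z.2) * ((fn (tensU as_ b)) (z.1 + s, z.2))^*%C))).
rewrite [X in _ - X]E -cintB; first last.
- exact: L2cM p2 (L2c_conj (mscales_L2c (sh2 s) (fn_L2 (tensU a bs)))).
- exact: L2cM p1 (L2c_conj (mscales_L2c (sh1 s) (fn_L2 (tensU as_ b)))).
apply: eq_cint => z.
rewrite -[fn (tensU as_ b) _]/(fn as_ (z.1 + s) * fn b z.2) -[fn (tensU a bs) _]/(fn a z.1 * fn bs (z.2 + s)).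
rewrite eas ebs ea eb !addrK /Psi !conjcM /u !conjc_real; ring.
Qed.

(** Sends [(x, (y, y'))] to the shift [y - y'] at the point [(y', x - y)], where [Psi] compares
    [phi] at two points of the line [z.1 + z.2 = x]. It preserves measure, so almost everywhere
    statements can be pulled back. *)
Let Theta (p : V * (V * V)) : V * (V * V) := (p.2.1 - p.2.2, (p.2.2, p.1 - p.2.1)).

Let Theta_pres : mscales (mu \x prodm mu mu)%E Theta 1.
Proof.
have S1 : mscales (mu \x prodm mu mu)%E (fun p : V * (V * V) => (p.1 - p.2.1, p.2)) 1.
  apply: (@mscales_fiber _ _ _ _ _ mu (prodm mu mu) (fun p => p.1 - p.2.1)).
    apply: measurable_rVB; first exact: measurable_fst.
    exact: measurableT_comp measurable_fst measurable_snd.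
  by move=> y; exact: (lebn_translate (- y.1)).
have S2 : mscales (mu \x prodm mu mu)%E (fun p : V * (V * V) => (p.1, (p.2.2, p.2.1))) 1.
  exact: (@mscales_prod_snd _ _ _ _ _ mu (prodm mu mu) (fun q : V * V => (q.2, q.1)) 1 (mscales_swap mu)).
have := mscales_comp S1 (mscales_comp S2 (mscales_comp (mscales_swap12 mu) S1)).
by rewrite !mulr1.
Qed.

(* Testing [phi] against [a(. - s) (x) b - a (x) b(. - s)], which lies in the kernel of [kerT], shows that
   [phi (y + s, z) = phi (y, z + s)]: [phi] only depends on [y + z]. *)
Lemma orth_const : {ae mu, forall x, {ae mu, forall y', {ae mu, forall y,
  U y -> U (x - y) -> U y' -> U (x - y') -> fn phi (y, x - y) = fn phi (y', x - y')}}}.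
Proof.
have m1 := measurable_fst : measurable_fun setT (@fst V (V * V)).
have m2 : measurable_fun setT (fun p : V * (V * V) => p.2.1) by exact: measurableT_comp measurable_fst measurable_snd.
have m3 : measurable_fun setT (fun p : V * (V * V) => p.2.2) by exact: measurableT_comp measurable_snd measurable_snd.
have mA : measurable [set p : V * (V * V) | Psi p.1 (p.2.1, p.2.2) = 0].
  have := mc_normc (mPsi m1 m2 m3) => /(_ measurableT [set 0] (measurable_set1 _)).
  rewrite setTI; congr (measurable _); apply/seteqP; split => p /=; last by move=> ->; rewrite normc0.
  by move/eq0_normc.
have h : {ae (mu \x prodm mu mu)%E, forall p, [set p : V * (V * V) | Psi p.1 (p.2.1, p.2.2) = 0] p}.
  apply: (@ae_prod _ _ _ _ _ mu (prodm mu mu) _ mA); apply: nearW => s.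
  by apply: filterS (Psi0 s) => -[y z].
have := ae_slice1 (ae_pull Theta_pres h); apply: filterS => x hx.
have := @ae_slice2 _ _ _ _ _ mu mu [set q : V * V | [set p : V * (V * V) | Psi p.1 (p.2.1, p.2.2) = 0] (Theta (x, q))] hx.
apply: filterS => y' hy'; apply: filterS hy' => y /= + Uy Uxy Uy' Uxy'.
rewrite /Psi /= (addrC y') subrK (_ : x - y + (y - y') = x - y'); last by rewrite addrA subrK.
by rewrite !u1// !mulr1 => /eqP; rewrite subr_eq0 => /eqP ->.
Qed.

(** On almost every line [z.1 + z.2 = x] the function [phi] is a constant, so the inner product on
    that line is a multiple of [kerT K x]. If no comparison point is available, the line meets
    [U * U] in a null set. *)
Lemma orth_kernel K : {ae mu, forall x, kerT K x = 0} -> ip K phi = 0.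
Proof.
move=> hK; rewrite ip_fn.
have L : L1c mm (fun z => fn K z * (fn phi z)^*%C) by exact: L2cM (fn_L2 K) (L2c_conj (fn_L2 phi)).
have := mscales_cint shear_pres L; rewrite mul1r => <-.
have L' := mscales_L1c shear_pres L; rewrite (cint_fubini1 L').
rewrite -[RHS](cint0 mu); apply: ae_eq_cint; [exact: (mc_cint1 mu L'.1)|exact: mc_cst|].
apply: filterS3 orth_const (kerT_L1 K) hK => x hx k1 k0.
pose W := [set y | U y /\ U (x - y)].
have kW y : ~ W y -> fn K (y, x - y) = 0.
  by move=> nW; apply: fn_out => -[U1 U2]; apply: nW.
have [[y' [[U1 U2] hy']]|nex] := pselect (exists y', W y' /\ {ae mu, forall y,
    U y -> U (x - y) -> U y' -> U (x - y') -> fn phi (y, x - y) = fn phi (y', x - y')}).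
  transitivity (cint mu (fun y => fn K (y, x - y) * (fn phi (y', x - y'))^*%C)); last first.
    by rewrite cintZr// -/(kerT K x) k0 mul0r.
  apply: ae_eq_cint.
  - exact: (mc_slice1 x L'.1).
  - by apply: mcM; [exact: k1.1|exact: mc_cst].
  apply: filterS hy' => y /= h; have [[W1 W2]|/kW->] := pselect (W y); last by rewrite !mul0r.
  by rewrite h.
rewrite -(cint0 mu); apply: ae_eq_cint; [exact: (mc_slice1 x L'.1)|exact: mc_cst|].
apply: filterS hx => y hy /=; rewrite kW ?mul0r// => Wy; apply: nex; exists y; split => //.
Qed.

End orth.

(** The difference [kap] of the two kernels has zero push-forward, so by [orth_kernel] it is
    orthogonal to its own component [phi] orthogonal to [ker0]. Hence [phi] is null, and elements of
    [ker0] added to the finite-rank kernel bring it as close to [K] as desired. *)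
Lemma kernel_reduce r K e : {ae mu, forall x, kerT K x = rsum r x} -> 0 < e ->
  exists r', (forall x, rsum r' x = rsum r x) /\ n2 (htsum tensU r') <= n2 K + e.
Proof.
move=> hK e0; pose kap := hsub (htsum tensU r) K.
have kap0 : {ae mu, forall x, kerT kap x = 0}.
  apply: filterS2 hK (kerT_L1 K) => x hx Lx.
  have Lr : L1c mu (fun y => tsumf r (y, x - y)) by apply: L1c_sum => ab; exact: conv_L1.
  transitivity (cint mu (fun y => tsumf r (y, x - y) - fn K (y, x - y))).
    by apply: eq_cint => y; rewrite -fn_htsum -mulN1r.
  by rewrite (cintB Lr Lx) rsum_kerT -/(kerT K x) hx subrr.
have [phi [s [s0 sphi ophi]]] := projection kap ker0_sub.
have kphi := orth_kernel ophi kap0.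
have phi0 : n2 phi = 0.
  have c1 := hcvg_ip phi sphi.
  have c2 : ccvg \oo (fun k => ip (hadd kap (s k)) phi) 0.
    rewrite (_ : (fun k => _) = fun=> 0); first exact: ccvg_cst.
    by apply/funext => k; rewrite ipDl kphi ipJ ophi// conjc0 addr0.
  have ip0 : ip phi phi = 0 by exact: ccvg_uniq c1 c2.
  by rewrite /n2 ip0.
pose u' k := hadd K (hadd kap (s k)).
have cu : hcvg u' K.
  have := hcvg_n2 sphi; rewrite phi0 /hcvg.
  suff -> : (fun k => n2 (hsub (u' k) K)) = fun k => n2 (hadd kap (s k)) by [].
  by apply/funext => k; exact: n2_addK.
have [k hk] : exists k, n2 (u' k) <= n2 K + e.
  have /cvgrPdist_le/(_ _ e0)[N _ hN] := hcvg_n2 cu; exists N; have := hN N (leqnn _).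
  by rewrite /= distrC => /(le_trans (ler_norm _)); rewrite lerBlDl.
have [rk [ek Tk]] := s0 k; exists (r ++ rk); split => [x|].
  transitivity (rsum r x + rsum rk x); first by rewrite /rsum big_cat.
  by rewrite Tk addr0.
suff -> : n2 (htsum tensU (r ++ rk)) = n2 (u' k) by [].
rewrite !n2_fn fn_htsum; congr (fine (L2n _ _)); apply/funext => z.
transitivity (fn K z + (fn (htsum tensU r) z + -1 * fn K z + fn (s k) z)) => //.
by rewrite fn_htsum ek /tsumf big_cat /=; ring.
Qed.

End tensor_kernels.

(** * The norm of W_2 and Hilbert-Schmidt kernels *)

Import HBNNSimple.
(** Stated for arbitrary functions because elements of [W_space] are only almost everywhere equal to
    measurable ones. A simple function below [f], set to zero on the exceptional null set, is below
    [g] and has the same integral. *)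
Lemma ge0_integral_ae_le d (T : measurableType d) (R : realType) (m : {measure set T -> \bar R})
    (f g : T -> \bar R) : (forall x, (0 <= f x)%E) -> (forall x, (0 <= g x)%E) ->
  {ae m, forall x, f x = g x} -> (\int[m]_x f x <= \int[m]_x g x)%E.
Proof.
move=> f0 g0 [B [mB B0 fg]]; rewrite !ge0_integralTE//.
apply: ge_ereal_sup => _ [s /= sf <-].
have mCB : measurable_fun setT (\1_(~` B) : T -> R) by apply: measurable_indic; exact: measurableC.
rewrite -integralT_nnsfun.
have -> : (\int[m]_x (s x)%:E = \int[m]_x (s x * \1_(~` B) x)%:E)%E.
  apply: ae_eq_integral => //.
  - exact/measurable_EFinP.
  - by apply/measurable_EFinP; apply: measurable_funM.
  exists B; split => // x; apply: contra_notP => nB _.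
  by rewrite indicE mem_set// mulr1.
rewrite ge0_integralTE; last by move=> x; rewrite lee_fin mulr_ge0.
apply: le_ereal_sup => _ [h hle <-]; exists h => // x.
apply: le_trans (hle x) _; rewrite indicE; have [/set_mem nB|_] := boolP (x \in _); last by rewrite mulr0.
rewrite mulr1 (_ : g x = f x)//; apply/esym; apply: contrapT => nfg; apply: nB; exact: fg.
Qed.

Lemma L1n_ae_any d (T : measurableType d) (R : realType) (m : {measure set T -> \bar R})
  (f g : T -> R[i]) : {ae m, forall x, f x = g x} -> L1n m f = L1n m g.
Proof.
move=> h; have h' : {ae m, forall x, g x = f x} by apply: filterS h.
apply/eqP; rewrite eq_le; apply/andP; split; apply: ge0_integral_ae_le.
- by move=> x; rewrite lee_fin normc_ge0.
- by move=> x; rewrite lee_fin normc_ge0.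
- by apply: filterS h => x ->.
- by move=> x; rewrite lee_fin normc_ge0.
- by move=> x; rewrite lee_fin normc_ge0.
- by apply: filterS h' => x ->.
Qed.

(** * W_2 as a quotient of finite-rank kernels *)

Section W_kernels.
Context (R : realType) (n : nat).
Local Notation V := 'rV[R]_n.
Local Notation mu := (lebn R n).
Local Notation mm := (lebn R n \x lebn R n)%E.
Variable U : set V.
Hypothesis mU : measurable U.
Local Notation HU := (HU mU).
Local Notation HUU := (HUU mU).
Local Notation rsum := (@rsum R n U mU).
Local Notation tens := (@tensU R n U mU).

Lemma PW2I f (a : HU) : L2c mu f -> ft2 f (fn a) -> PW2 U f.
Proof.
move=> f2 fa; split; first exact/in_Lp2.
exists (fn a); split; [apply/in_Lp2; exact: fn_L2|exact/is_fourier2E|].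
by apply: nearW => x; exact: fn_out.
Qed.

Lemma PW2E f : PW2 U f -> L2c mu f /\ exists a : HU, ft2 f (fn a).
Proof.
move=> [/in_Lp2 f2 [F [/in_Lp2 F2 /is_fourier2E fF F0]]]; split => //.
have [a ea] := toU mU F2; exists a.
apply: ft2_ext fF => //; [exact: f2.1|exact: f2.1|exact: F2.1|exact: (fn_L2 a).1|exact: nearW|].
apply: filterS F0 => x Fx; rewrite ea indicE; have [_|/negP nU] := boolP (x \in U); first by rewrite mulr1.
by rewrite mulr0 Fx// => /mem_set.
Qed.

Lemma ft2_n2 f (a : HU) : L2c mu f -> ft2 f (fn a) -> Lpnorm 2%:E f ^+ 2 = n2 a.
Proof.
move=> f2 fa; rewrite Lp2E ?f2.2// n2_fn; congr fine; symmetry.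
by apply: ft2_norm => //; exact: fn_L2.
Qed.

Lemma L2dot_ip f g (a b : HU) : L2c mu f -> L2c mu g -> ft2 f (fn a) -> ft2 g (fn b) ->
  L2dot f g = ip a b.
Proof. by move=> f2 g2 fa gb; rewrite ip_fn (ft2_ip f2 g2 (fn_L2 a) (fn_L2 b) fa gb). Qed.

Lemma choose_ft (A : nat -> HU) : exists f : nat -> V -> R[i], forall j, L2c mu (f j) /\ ft2 (f j) (fn (A j)).
Proof.
have h j : exists f, L2c mu f /\ ft2 f (fn (A j)) by exact: ft2_surj (fn_L2 (A j)).
by have [f hf] := choice h; exists f.
Qed.

Lemma fourier_tens (f g : V -> R[i]) (a b : HU) x : L2c mu f -> L2c mu g -> ft2 f (fn a) -> ft2 g (fn b) ->
  fourier (fun y => f y * g y) x = cint mu (fun y => fn a y * fn b (x - y)).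
Proof. by move=> f2 g2 fa gb; exact: fourier_prod f2 g2 (fn_L2 a) (fn_L2 b) fa gb. Qed.

Lemma fn_hrem (K : HUU) (A B : nat -> HU) N z :
  fn (hrem tens K A B N) z = fn K z - \sum_(j < N) fn (A j) z.1 * fn (B j) z.2.
Proof.
elim: N => [|N IH]; first by rewrite big_ord0 subr0.
by rewrite big_ord_recr opprD addrA -IH -mulN1r.
Qed.

Lemma ellp2 N (a : 'I_N -> R) : ellp_norm 2%:E a = Num.sqrt (\sum_(j < N) a j ^+ 2).
Proof.
rewrite /ellp_norm powR12_sqrt; last by apply: sumr_ge0 => j _; exact: powR_ge0.
congr Num.sqrt; apply: eq_bigr => j _.
by rewrite powR_mulrn// real_normK ?num_real.
Qed.

(** The finite singular value decomposition replaces an arbitrary finite sum of products by one with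
    orthogonal factors, whose l^2 norm is the Hilbert-Schmidt norm of the kernel. The difference of
    the two sums has zero transform and vanishes by [fourier_inj]. *)
Lemma W_repr_of_tsum r h : L1c mu h -> (forall x, fourier h x = rsum r x) ->
  exists N (f_ g_ : 'I_N -> V -> R[i]), W_repr U h f_ g_ /\
   ellp_norm 2%:E (fun j => Lpnorm 2%:E (f_ j) * Lpnorm 2%:E (g_ j)) = Num.sqrt (n2 (htsum tens r)).
Proof.
move=> h1 hr.
have [M [A [B [oA oB nz rem0 sumE]]]] := fin_svd (@tensU_ip _ _ _ mU) (@tensU_dense _ _ _ mU) r.
have [f hf] := choose_ft A; have [g hg] := choose_ft B.
exists M, (fun j : 'I_M => f j), (fun j : 'I_M => g j); split; last first.
  rewrite ellp2 -sumE; congr Num.sqrt; apply: eq_bigr => j _.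
  by rewrite exprMn (ft2_n2 (hf j).1 (hf j).2) (ft2_n2 (hg j).1 (hg j).2).
have ne (k : V -> R[i]) (a : HU) : L2c mu k -> ft2 k (fn a) -> n2 a != 0 -> ~ (k = cst 0 %[ae mu]).
  move=> k2 ka a0 kz; move/eqP: a0; apply; rewrite -(ft2_n2 k2 ka) Lp2E ?k2.2//.
  by rewrite (L2n_ae0 k2.1)//; apply: filterS kz => x; exact.
split.
- move=> j; split; first exact: PW2I (hf j).1 (hf j).2.
  exact: ne (hf j).1 (hf j).2 (nz j (ltn_ord j)).1.
- move=> j; split; first exact: PW2I (hg j).1 (hg j).2.
  exact: ne (hg j).1 (hg j).2 (nz j (ltn_ord j)).2.
- move=> i j ij; rewrite (L2dot_ip (hf i).1 (hf j).1 (hf i).2 (hf j).2); apply: oA.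
  by move=> /val_inj.
- move=> i j ij; rewrite (L2dot_ip (hg i).1 (hg j).1 (hg i).2 (hg j).2); apply: oB.
  by move=> /val_inj.
have Lfg j : L1c mu (fun x => f j x * g j x) by exact: L2cM (hf j).1 (hg j).1.
have Ls : L1c mu (fun x => \sum_(j < M) f j x * g j x) by apply: L1c_sum => j; exact: Lfg.
have : {ae mu, forall x, h x - \sum_(j < M) f j x * g j x = 0}.
  apply: fourier_inj; first exact: L1cB.
  have := (n2_ae _).1 rem0 => /(ae_pull (shear_pres R n)) /ae_slice1; apply: filterS => x hx.
  rewrite (fourierB x h1 Ls) hr fourier_sum; last by move=> j; exact: Lfg.
  rewrite -rsum_kerT; apply/eqP; rewrite subr_eq0; apply/eqP.
  rewrite (eq_bigr (fun j : 'I_M => cint mu (fun y => fn (A j) y * fn (B j) (x - y)))); last first.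
    by move=> j _; exact: fourier_tens (hf j).1 (hg j).1 (hf j).2 (hg j).2.
  rewrite -cint_sum; last by move=> j; exact: conv_L1.
  apply: ae_eq_cint.
  - by apply: mc_sum => ab; exact: (conv_L1 _ _ _).1.
  - by apply: mc_sum => ab; exact: (conv_L1 _ _ _).1.
  apply: filterS hx => y; rewrite fn_hrem fn_htsum => /eqP.
  by rewrite subr_eq0 => /eqP.
by apply: filterS => x /eqP; rewrite subr_eq0 => /eqP.
Qed.

(** The elements of [W_space] freed from orthogonality, which makes closure under subtraction
    immediate. By [W_spaceE] and [W_spaceI] the two notions agree up to null sets. *)
Definition tsum_fun h := L1c mu h /\ exists r, forall x, fourier h x = rsum r x.

Lemma tsum_fun_sum N (f_ g_ : 'I_N -> V -> R[i]) : (forall j, PW2 U (f_ j)) -> (forall j, PW2 U (g_ j)) ->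
  tsum_fun (fun x => \sum_(j < N) f_ j x * g_ j x).
Proof.
move=> hf hg.
have L j : L1c mu (fun x => f_ j x * g_ j x) by exact: L2cM (PW2E (hf j)).1 (PW2E (hg j)).1.
split; first exact: L1c_sum.
have [a ha] := choice (fun j => (PW2E (hf j)).2).
have [b hb] := choice (fun j => (PW2E (hg j)).2).
exists [seq (a j, b j) | j <- index_enum 'I_N] => x.
rewrite fourier_sum// /rsum big_map; apply: eq_bigr => j _.
exact: fourier_tens (PW2E (hf j)).1 (PW2E (hg j)).1 (ha j) (hb j).
Qed.

Lemma tsum_fun0 : tsum_fun (fun=> 0).
Proof.
split; first exact: L1c0.
exists [::] => x; rewrite /rsum big_nil fourierE.
by rewrite -[RHS](cint0 mu); apply: eq_cint => y; rewrite mul0r.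
Qed.

Lemma tsum_funB h k : tsum_fun h -> tsum_fun k -> tsum_fun (fun x => h x - k x).
Proof.
move=> [h1 [r hr]] [k1 [s ks]]; split; first exact: L1cB.
exists (r ++ [seq (hscl (-1) ab.1, ab.2) | ab <- s]) => x.
rewrite (fourierB x h1 k1) hr ks /rsum big_cat big_map /= -sumrN; congr (_ + _).
apply: eq_bigr => ab _; rewrite -cintN; last exact: conv_L1.
by apply: eq_cint => y; rewrite -mulNr; congr (_ * _); rewrite -mulN1r.
Qed.

Lemma W_spaceE h : W_space U h -> exists h', tsum_fun h' /\ {ae mu, forall x, h x = h' x}.
Proof.
move=> [N [f_ [g_ [hf hg _ _ hE]]]]; exists (fun x => \sum_(j < N) f_ j x * g_ j x); split; last first.
  by apply: filterS hE => x; exact.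
by apply: tsum_fun_sum => j; [exact: (hf j).1|exact: (hg j).1].
Qed.

Lemma W_spaceI h : tsum_fun h -> W_space U h.
Proof. by move=> [h1 [r hr]]; have [N [f [g [H _]]]] := W_repr_of_tsum h1 hr; exists N, f, g. Qed.

Lemma W_repr_ae h h' N (f_ g_ : 'I_N -> V -> R[i]) : {ae mu, forall x, h x = h' x} ->
  W_repr U h f_ g_ -> W_repr U h' f_ g_.
Proof.
by move=> hh [hf hg of_ og E]; split => //; apply: filterS2 hh E => x -> ->.
Qed.

Lemma W_norm_ae h h' : {ae mu, forall x, h x = h' x} -> W_norm 2%:E U h = W_norm 2%:E U h'.
Proof.
move=> hh; have hh' : {ae mu, forall x, h' x = h x} by apply: filterS hh.
rewrite /W_norm; congr ereal_inf; apply/seteqP; split => r [N [f [g [W ->]]]];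
  exists N, f, g; split => //; exact: W_repr_ae W.
Qed.

Lemma W_norm_ge0 h : (0 <= W_norm 2%:E U h)%E.
Proof.
apply: le_ereal_inf_tmp => _ [N [f [g [_ ->]]]].
by rewrite lee_fin ellp2 sqrtr_ge0.
Qed.

Hypothesis finU : forall x, (mu [set y | U y /\ U (x - y)%R] < +oo)%E.

Lemma W_norm_le h (K : HUU) : tsum_fun h -> {ae mu, forall x, kerT K x = fourier h x} ->
  (W_norm 2%:E U h <= (Num.sqrt (n2 K))%:E)%E.
Proof.
move=> [h1 [r hr]] hK; apply/lee_addgt0Pr => e e0.
have hK' : {ae mu, forall x, kerT K x = rsum r x} by apply: filterS hK => x ->.
have [r' [r'E r'n]] := kernel_reduce finU hK' (exprn_gt0 2 e0).
have [N [f [g [W Wn]]]] := W_repr_of_tsum h1 (fun x => etrans (hr x) (esym (r'E x))).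
apply: le_trans (ereal_inf_lbound _) _.
  by exists N, f, g; split; [exact: W|reflexivity].
rewrite Wn -EFinD lee_fin -(ler_pXn2r (n:=2))// ?nnegrE ?sqrtr_ge0 ?addr_ge0 ?sqrtr_ge0 ?(ltW e0)//.
rewrite sqrrD !sqr_sqrtr ?n2_ge0//; apply: le_trans r'n _.
by rewrite addrAC lerDl mulrn_wge0// mulr_ge0 ?sqrtr_ge0 ?(ltW e0).
Qed.

End W_kernels.

(** * The kernel attached to a function of PW^1 *)

Section spectral_kernel.
Context (R : realType) (n : nat).
Local Notation V := 'rV[R]_n.
Local Notation mu := (lebn R n).
Local Notation mm := (lebn R n \x lebn R n)%E.
Variable Omega : set V.
Hypotheses (Omega_open : open Omega) (Omega_cvx : cvx Omega) (Omega_lines : ~ has_affine_line Omega).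
Local Notation U := (half_set Omega).
Local Notation mU := (measurable_half Omega_open).
Local Notation HUU := (HUU mU).

Lemma half_fin x : (mu [set y | U y /\ U (x - y)%R] < +oo)%E.
Proof.
have [c [c0 h]] := weight_bound Omega_open Omega_cvx Omega_lines.
have [Ox|nO] := pselect (Omega x); first by have [/andP[_]] := h x Ox.
by rewrite -/(wset Omega x) wgt_out// measure0 ltry.
Qed.

Section one_function.
Variables (f : V -> R[i]) (f1 : L1c mu f).
Let w x : R := fine (wgt Omega x).
Let u (x : V) : R[i] := ((\1_U x : R)%:C)%C.
Let k (z : V * V) : R[i] := u z.1 * u z.2 * (fourier f (z.1 + z.2) * (((w (z.1 + z.2))^-1)%:C)%C).

Let mk : mc k.
Proof.
have mp : measurable_fun setT (fun z : V * V => z.1 + z.2).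
  by apply: measurable_rVD; [exact: measurable_fst|exact: measurable_snd].
have mw : measurable_fun setT w by apply: measurableT_comp => //; exact: measurable_wgt.
have mu_ : mc u := mc_indic R mU.
apply: mcM; apply: mcM.
- exact: mc_comp measurable_fst mu_.
- exact: mc_comp measurable_snd mu_.
- exact: mc_comp mp (mc_fourier f1.1).
apply: mc_real; apply: measurable_inv_ge0; first exact: measurableT_comp mw mp.
by move=> z; rewrite fine_ge0.
Qed.

Let k_out z : ~ (U `*` U) z -> k z = 0.
Proof.
move=> nz; rewrite /k /u !indicE; have [/set_mem U1|_] := boolP (z.1 \in _); last by rewrite !mul0r.
have [/set_mem U2|_] := boolP (z.2 \in _); last by rewrite mulr0 !mul0r.
by exfalso; apply: nz.
Qed.

Let k_shear x y : k (y, x - y) = ((\1_U y * \1_U (x - y) : R)%:C)%C * (fourier f x * ((w x)^-1%:C)%C).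
Proof.
rewrite /k; have -> : (y, x - y).1 + (y, x - y).2 = x by rewrite addrC subrK.
by rewrite /u rcM.
Qed.

Let k_int x : L2n mu (fun y => k (y, x - y)) = (wgt Omega x * (normc (fourier f x) ^+ 2 * (w x)^-1 ^+ 2)%:E)%E.
Proof.
rewrite (wgtE Omega_open x).
transitivity (\int[mu]_y ((\1_U y * \1_U (x - y))%R%:E * (normc (fourier f x) ^+ 2 * (w x)^-1 ^+ 2)%R%:E))%E; last first.
  rewrite ge0_integralZr//.
  - apply/measurable_EFinP; apply: measurable_funM; first exact: measurable_indic mU.
    apply: measurableT_comp; first exact: measurable_indic mU.
    exact: measurable_rVB.
  - by rewrite lee_fin mulr_ge0 ?exprn_ge0 ?normc_ge0 ?invr_ge0 ?fine_ge0.
apply: eq_integral => y _; rewrite k_shear -EFinM; congr (_%:E).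
rewrite !normcM !normc_real !exprMn !real_normK ?num_real//.
rewrite !indicE; case: (_ \in _); case: (_ \in _); rewrite /= ?(mulr0, mul0r, mulr1, mul1r, expr0n, expr1n)//.
Qed.

(* The kernel [(y, z) |-> fourier f (y + z) / w (y + z)] on [U * U] is pushed forward to [fourier f] and
   its squared norm is the integral of [|fourier f|^2 / w] over [Omega]. *)
Lemma spectral_kernel_bound (c : R) q : 0 < c -> measurable_fun setT q -> (forall x, 0 <= q x)%E ->
  (forall x, Omega x -> (0 < wgt Omega x < +oo)%E /\ (c%:E <= wgt Omega x * q x)%E) ->
  (\int[mu]_x ((\1_Omega x * normc (fourier f x) ^+ 2)%:E * q x) < +oo)%E ->
  {ae mu, forall x, ~ Omega x -> fourier f x = 0} ->
  exists K : HUU, (c%:E * (n2 K)%:E <= \int[mu]_x ((\1_Omega x * normc (fourier f x) ^+ 2)%:E * q x))%E /\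
    {ae mu, forall x, kerT K x = fourier f x}.
Proof.
move=> c0 mq q0 hw fin fO.
have mI : measurable_fun setT (fun x => (\1_Omega x * normc (fourier f x) ^+ 2)%:E).
  apply/measurable_EFinP; apply: measurable_funM; last exact: msq (mc_fourier f1.1).
  by apply: measurable_indic; exact: open_measurable_rV.
have I0 x : (0 <= (\1_Omega x * normc (fourier f x) ^+ 2)%:E * q x)%E.
  by rewrite mule_ge0// lee_fin mulr_ge0// exprn_ge0// normc_ge0.
have [_ msh _] := shear_pres R n; have mks := mc_comp msh mk.
have key : (c%:E * L2n mm k <= \int[mu]_x ((\1_Omega x * normc (fourier f x) ^+ 2)%:E * q x))%E.
  have := mscales_L2n (shear_pres R n) mk; rewrite mul1e => <-.
  rewrite L2n_prod1//.
  have mF : measurable_fun setT (fun x : V => L2n mu (fun y : V => k (y, x - y))).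
    rewrite /L2n; apply: (@measurable_fun_fubini_tonelli_F _ _ _ _ _ mu (fun z : V * V => (normc (k (z.2, z.1 - z.2)) ^+ 2)%:E)).
      by apply/measurable_EFinP; exact: msq mks.
    by move=> z; rewrite lee_fin exprn_ge0 ?normc_ge0.
  rewrite -ge0_integralZl//; first last.
  - by rewrite lee_fin ltW.
  - by move=> x _; exact: L2n_ge0.
  apply: ge0_le_integral => //.
  - by move=> x _; rewrite mule_ge0 ?L2n_ge0// lee_fin ltW.
  - exact: measurable_funeM.
  - exact: emeasurable_funM.
  move=> x _; rewrite k_int.
  have [Ox|nO] := pselect (Omega x); last by rewrite /wgt wgt_out// measure0 mul0e mule0.
  have [/andP[w0 woo] hc] := hw x Ox.
  have wE : wgt Omega x = (w x)%:E by rewrite fineK// ge0_fin_numE// ltW.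
  rewrite wE in w0 hc *; rewrite lte_fin in w0.
  rewrite indicE mem_set// mul1r.
  rewrite (_ : (w x)%:E * _ = (normc (fourier f x) ^+ 2)%:E * ((w x)^-1)%:E)%E; last first.
    by rewrite -!EFinM; congr (_%:E); field; rewrite gt_eqF.
  rewrite muleCA lee_wpmul2l// ?lee_fin ?exprn_ge0 ?normc_ge0//.
  apply: (@le_trans _ _ (((w x)^-1)%:E * ((w x)%:E * q x))%E).
    by rewrite muleC lee_wpmul2l// lee_fin invr_ge0 ltW.
  by rewrite muleA -EFinM mulVf ?gt_eqF// mul1e.
have k2 : L2c mm k.
  split; first exact: mk.
  have : (c%:E * L2n mm k < +oo)%E by exact: le_lt_trans key fin.
  have := L2n_ge0 mm k; case: (L2n mm k) => [r| |] //; first by move=> _ _; rewrite ltry.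
  by rewrite gt0_muley// lte_fin.
exists (toL2S (measurableX mU mU) k2 k_out); split; first by rewrite n2_fnE.
apply: filterS fO => x fx0.
rewrite /kerT -[fn _]/k.
rewrite (_ : (fun y => k (y, x - y)) = fun y => (fourier f x * ((w x)^-1%:C)%C) * ((\1_(wset Omega x) y : R)%:C)%C); last first.
  apply/funext => y; rewrite k_shear mulrC; congr (_ * (_%:C)%C).
  rewrite !indicE -natrM mulnb; congr (_%:R); congr nat_of_bool.
  by apply/andP/idP; rewrite !inE.
rewrite cintZ; last first.
  by split; [exact: mc_indic (measurable_wset Omega_open x)|rewrite L1n_indic; [exact: half_fin|exact: measurable_wset]].
rewrite cint_real.
rewrite (_ : \int[mu]_y \1_(wset Omega x) y = w x); last first.
  by rewrite /Rintegral integral_indic ?setIT//; exact: measurable_wset.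
have [Ox|nO] := pselect (Omega x); last first.
  by rewrite fx0// !mul0r.
have [/andP[w0 woo] hc] := hw x Ox.
have wE : wgt Omega x = (w x)%:E by rewrite fineK// ge0_fin_numE// ltW.
rewrite wE lte_fin in w0.
by rewrite -mulrA -rcM mulVf ?gt_eqF// mulr1.
Qed.

End one_function.

Lemma spectral_kernel : exists C : R, 0 < C /\ forall f, L1c mu f ->
  {ae mu, forall x, ~ Omega x -> fourier f x = 0} ->
  exists K : HUU, n2 K <= C * fine (L1n mu f) ^+ 2 /\ {ae mu, forall x, kerT K x = fourier f x}.
Proof.
(* The inequality of [carleman] needs a base point; for empty [Omega] the transform vanishes and the
   zero kernel serves. *)
have [[x0 Ox0]|nO] := pselect (exists x0, Omega x0); last first.
  exists 1; split => // f f1 fO; exists hz; split.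
    by rewrite n20 mulr_ge0 ?sqr_ge0.
  apply: filterS fO => x ->; last by move=> Ox; apply: nO; exists x.
  by rewrite -(cint0 mu); apply: eq_cint.
have [c [c0 hc]] := weight_bound Omega_open Omega_cvx Omega_lines.
have [q [mq q0 hq hcar]] := carleman Omega_open Ox0.
pose D := smpvol R n * (2 * pi) ^+ n.
have D0 : 0 < D by rewrite mulr_gt0 ?smpvol_gt0 ?exprn_gt0 ?mulr_gt0 ?pi_gt0.
exists (c^-1 * D); split; first by rewrite mulr_gt0 ?invr_gt0.
move=> f f1 fO; have hf := hcar f f1 fO.
have [|K [Kn KT]] := spectral_kernel_bound f1 c0 mq q0 _ (le_lt_trans hf (ltry _)) fO.
  by move=> x Ox; rewrite hq//; exact: hc.
exists K; split => //.
rewrite -mulrA ler_pdivlMl// -lee_fin EFinM.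
exact: le_trans Kn hf.
Qed.

End spectral_kernel.

Lemma sqrt_n2D (R : realType) (H : preHilb R) (x y : H) :
  Num.sqrt (n2 (hadd x y)) <= Num.sqrt (n2 x) + Num.sqrt (n2 y).
Proof.
rewrite -(ler_pXn2r (n:=2))// ?nnegrE ?addr_ge0 ?sqrtr_ge0//.
rewrite sqrrD !sqr_sqrtr ?n2_ge0// n2D.
have := le_trans (ler_norm _) (le_trans (Re_le_normc (ip x y)) (ip_le x y)).
by rewrite mulr2n; lra.
Qed.

Lemma bounded_subseq (R : realType) (b : nat -> R) (M : R) : (forall l, 0 <= b l <= M) ->
  exists (d : R) (phi : nat -> nat), [/\ d <= M, (forall l, (l <= phi l)%N) & b (phi l) @[l --> \oo] --> d].
Proof.
move=> hb; have cpt := @segment_compact R 0 M.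
have [|d [/= dM cl]] := cpt (b @ \oo) _.
  by exists 0%N => // l _ /=; rewrite in_itv/=; exact: hb.
have ex (l : nat) : exists m, (l <= m)%N /\ `|d - b m| < l.+1%:R^-1.
  have h1 : (b @ \oo) [set b m | m in [set m | (l <= m)%N]].
    by exists l => // m lm; exists m.
  have h2 : nbhs d (ball d (l.+1%:R^-1 : R)) by apply: nbhsx_ballx; rewrite invr_gt0.
  by have [_ [[m lm <-] hm]] := cl _ _ h1 h2; exists m.
have [phi hphi] := choice ex.
exists d, phi; split.
- by move: dM; rewrite in_itv/= => /andP[].
- by move=> l; case: (hphi l).
apply/cvgrPdist_lt => e e0.
have [N _ hN] : \forall k \near \oo, k.+1%:R^-1 < e :> R by exact: near_infty_natSinv_lt (PosNum e0).
by exists N => // l Nl; apply: lt_trans (hphi l).2 (hN l Nl).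
Qed.

(** * The element of the completion and its expansion *)

Section main.
Context (R : realType) (n : nat).
Local Notation V := 'rV[R]_n.
Local Notation mu := (lebn R n).
Variable Omega : set V.
Hypotheses (Omega_open : open Omega) (Omega_cvx : cvx Omega) (Omega_lines : ~ has_affine_line Omega).
Local Notation U := (half_set Omega).
Local Notation mU := (measurable_half Omega_open).
Local Notation HUU := (HUU mU).
Local Notation tsf := (tsum_fun mU).
Local Notation finU := (half_fin Omega_open Omega_cvx Omega_lines).
Variable C : R.
Hypotheses (C0 : 0 < C) (hC : forall f, L1c mu f ->
  {ae mu, forall x, ~ Omega x -> fourier f x = 0} ->
  exists K : HUU, n2 K <= C * fine (L1n mu f) ^+ 2 /\ {ae mu, forall x, kerT K x = fourier f x}).

Lemma tsf_out h x : tsf h -> ~ Omega x -> fourier h x = 0.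
Proof.
move=> [_ [r ->]] nO; rewrite /rsum big1// => ab _.
rewrite -[RHS](cint0 mu); apply: eq_cint => y.
have [U1|/fn_out->] := pselect (U y); last by rewrite mul0r.
have [U2|/fn_out->] := pselect (U (x - y)); last by rewrite mulr0.
by have : wset Omega x y by []; rewrite wgt_out.
Qed.

Local Notation WN := (W_norm 2%:E U).

Lemma sqrt_C (r a : R) : 0 <= r -> a <= C * r ^+ 2 -> Num.sqrt a <= Num.sqrt C * r.
Proof.
move=> r0 h; rewrite -[X in _ * X](@ger0_norm _ r)// -sqrtr_sqr -sqrtrM ?(ltW C0)//.
by rewrite ler_wsqrtr.
Qed.

(** The domination of the W_2 norm by the L^1 norm: it makes L^1-convergent sequences Cauchy, so
    that an L^1 function can be regarded as an element of the completion. *)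
Lemma W_norm_L1 h : tsf h -> (WN h <= (Num.sqrt C * fine (L1n mu h))%:E)%E.
Proof.
move=> Th; have [K [Kn KT]] : exists K : HUU, n2 K <= C * fine (L1n mu h) ^+ 2 /\ {ae mu, forall x, kerT K x = fourier h x}.
  by apply: hC; [exact: Th.1|apply: nearW => x; exact: tsf_out].
apply: le_trans (W_norm_le finU Th KT) _; rewrite lee_fin.
by apply: sqrt_C Kn; rewrite fine_ge0 ?L1n_ge0.
Qed.

Lemma W_norm_subxx s : tsf s -> WN (s \- s) = 0%E.
Proof.
move=> Ts; apply/eqP; rewrite eq_le W_norm_ge0 andbT.
apply: le_trans (W_norm_L1 (tsum_funB Ts Ts)) _; rewrite lee_fin.
rewrite (_ : L1n _ _ = 0%E) ?mulr0//.
by rewrite /L1n; under eq_integral do rewrite subrr normc0; rewrite integral0.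
Qed.

Lemma W_norm_tri s u f : tsf s -> tsf u -> L1c mu f ->
  (WN (s \- u)%R <= (Num.sqrt C * (fine (L1n mu (fun x => (s x - f x)%R)) + fine (L1n mu (fun x => (u x - f x)%R))))%R%:E)%E.
Proof.
move=> Ts Tu f1; apply: le_trans (W_norm_L1 (tsum_funB Ts Tu)) _.
rewrite lee_fin ler_wpM2l ?sqrtr_ge0//.
have L1 := L1cB Ts.1 f1; have L2 := L1cB Tu.1 f1; have L2' := L1cB f1 Tu.1.
rewrite (_ : L1n mu (fun x => u x - f x) = L1n mu (fun x => f x - u x)); last first.
  by apply: eq_integral => x _; rewrite normcBC.
have L3 := L1cB Ts.1 Tu.1.
rewrite -fineD; [|exact: L1n_fin L1|exact: L1n_fin L2'].
apply: fine_le; [exact: L1n_fin L3|by rewrite fin_numD (L1n_fin L1) (L1n_fin L2')|].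
apply: le_trans (L1nD mu L1.1 L2'.1); rewrite le_eqVlt; apply/orP; left; apply/eqP.
by apply: eq_integral => x _; rewrite addrA subrK.
Qed.

Lemma W_embed_ae s s' : {ae mu, forall x, s x = s' x} -> W_space U s -> W_space U s' ->
  W_embed 2%:E U s = W_embed 2%:E U s'.
Proof.
move=> ss Ws Ws'.
have E (v : nat -> V -> R[i]) : (fun k => WN (s \- v k)) = (fun k => WN (s' \- v k)).
  by apply/funext => k; apply: W_norm_ae; apply: filterS ss => x /= ->.
rewrite /W_embed /W_class; apply/seteqP; split => v [cv h]; split => //.
  by move: h; rewrite E.
by move: h; rewrite -E.
Qed.

Section one_f.
Variable f : V -> R[i].
Hypotheses (f1 : L1c mu f) (fO : {ae mu, forall x, ~ Omega x -> fourier f x = 0}).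
Variable u : nat -> V -> R[i].
Hypotheses (Tu : forall k, tsf (u k)) (uf : forall e : R, 0 < e -> exists N, forall k, (N <= k)%N ->
  fine (L1n mu (fun x => u k x - f x)) < e).
Let X := W_class 2%:E U u.

Lemma u_cauchy (phi : nat -> nat) : (forall l, (l <= phi l)%N) -> W_cauchy 2%:E U (fun k => u (phi k)).
Proof.
move=> hphi; split => [k|e e0]; first exact: (W_spaceI (Tu _)).
pose D := 1 + Num.sqrt C; have D0 : 0 < D by rewrite ltr_pwDl ?sqrtr_ge0.
have e4 : 0 < e / (2 * D) by rewrite divr_gt0 ?mulr_gt0.
have [N hN] := uf e4; exists N => k l Nk Nl.
apply: le_lt_trans (W_norm_tri (Tu _) (Tu _) f1) _; rewrite lte_fin.
have h1 := hN _ (leq_trans Nk (hphi k)); have h2 := hN _ (leq_trans Nl (hphi l)).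
apply: (@le_lt_trans _ _ (D * (fine (L1n mu (fun x => u (phi k) x - f x)) + fine (L1n mu (fun x => u (phi l) x - f x))))).
  by rewrite ler_wpM2r ?addr_ge0 ?fine_ge0 ?L1n_ge0// lerDr.
apply: (@lt_le_trans _ _ (D * (e / (2 * D) + e / (2 * D)))); first by rewrite ltr_pM2l// ltrD.
by rewrite le_eqVlt; apply/orP; left; apply/eqP; field; rewrite gt_eqF.
Qed.

Lemma W_norm_to0 (g : nat -> V -> R[i]) : (forall e : R, 0 < e -> exists N, forall k, (N <= k)%N -> (WN (g k) < e%:E)%E) ->
  (fun k => WN (g k)) @ \oo --> (0 : \bar R).
Proof.
move=> h; apply: e0_eps => [k|e e0]; first exact: W_norm_ge0.
by have [N hN] := h e e0; exists N => // k Nk; exact/ltW/hN.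
Qed.

Lemma sub_class (phi : nat -> nat) : (forall l, (l <= phi l)%N) -> X (fun k => u (phi k)).
Proof.
move=> hphi; split; first exact: u_cauchy.
apply: W_norm_to0 => e e0; have [_ /(_ e e0)[N hN]] := @u_cauchy id (fun l => leqnn l).
by exists N => k Nk; apply: hN => //; exact: leq_trans (hphi k).
Qed.

(* [W_dist] is an infimum over representatives for which the distances converge, so a subsequence of
   [u] along which they do is extracted. *)
Lemma W_dist_le s (kap : HUU) : tsf s -> {ae mu, forall x, kerT kap x = fourier s x - fourier f x} ->
  (W_dist 2%:E U (W_embed 2%:E U s) X <= (Num.sqrt (n2 kap))%:E)%E.
Proof.
move=> Ts hk; apply/lee_addgt0Pr => e e0.
pose D := 1 + Num.sqrt C; have D0 : 0 < D by rewrite ltr_pwDl ?sqrtr_ge0.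
have [L hL] := uf (divr_gt0 e0 D0).
pose M := Num.sqrt (n2 kap) + e.
have bound l : (L <= l)%N -> (WN (s \- u l)%R <= M%:E)%E.
  move=> Ll; have gl1 : L1c mu (fun x => f x - u l x) by exact: L1cB f1 (Tu l).1.
  have [|K [Kn KT]] := hC gl1.
    by apply: filterS fO => x fx0 nO; rewrite (fourierB x f1 (Tu l).1) fx0// (tsf_out (Tu l))// subrr.
  have KT' : {ae mu, forall x, kerT (hadd kap K) x = fourier (s \- u l) x}.
    apply: filterS2 (filterI hk KT) (filterI (kerT_L1 finU kap) (kerT_L1 finU K)) => x [h1 h2] [l1 l2].
    rewrite -[LHS]/(cint mu (fun y => fn kap (y, x - y) + fn K (y, x - y))) (cintD l1 l2).
    rewrite -/(kerT kap x) -/(kerT K x) h1 h2 (fourierB x f1 (Tu l).1) (fourierB x Ts.1 (Tu l).1).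
    by rewrite addrA subrK.
  apply: le_trans (W_norm_le finU (tsum_funB Ts (Tu l)) KT') _; rewrite lee_fin.
  apply: le_trans (sqrt_n2D _ _) _; rewrite lerD2l.
  apply: le_trans (sqrt_C _ Kn) _; first by rewrite fine_ge0 ?L1n_ge0.
  rewrite (_ : L1n mu (fun x => f x - u l x) = L1n mu (fun x => u l x - f x)); last first.
    by apply: eq_integral => x _; rewrite normcBC.
  have /ltW := hL l Ll; rewrite ler_pdivlMr// mulrC; apply: le_trans.
  by rewrite ler_wpM2r ?fine_ge0 ?L1n_ge0// lerDr.
have fin l : (L <= l)%N -> WN (s \- u l) = (fine (WN (s \- u l)))%:E.
  move=> Ll; rewrite fineK// ge0_fin_numE ?W_norm_ge0//.
  exact: le_lt_trans (bound l Ll) (ltry _).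
have [|d [phi [dM hphi bd]]] := @bounded_subseq R (fun l => fine (WN (s \- u (l + L)%N))) M.
  move=> l; have h : (L <= l + L)%N by rewrite leq_addl.
  by rewrite fine_ge0 ?W_norm_ge0//= -lee_fin -fin//; exact: bound.
apply: le_trans (_ : (d%:E <= _)%E); last by rewrite -EFinD lee_fin.
apply: ereal_inf_lbound; exists (fun=> s), (fun l => u (phi l + L)%N); split.
- split; last first.
    by apply: W_norm_to0 => e' e'0; exists 0%N => k _; rewrite W_norm_subxx ?lte_fin.
  split => [k|e' e'0]; first exact: (W_spaceI Ts).
  by exists 0%N => k l _ _; rewrite W_norm_subxx// lte_fin.
- by apply: (@sub_class (fun l => phi l + L)%N) => l; rewrite (leq_trans (hphi l))// leq_addr.
rewrite (_ : (fun k => _) = fun l => (fine (WN (s \- u (phi l + L)%N)))%:E).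
  by apply/fine_cvgP; split => //; exact: nearW.
by apply/funext => l; apply: fin; rewrite leq_addl.
Qed.

Lemma W_dist_ge0 s : (0 <= W_dist 2%:E U (W_embed 2%:E U s) X)%E.
Proof.
apply: le_ereal_inf_tmp => d [v [w [_ _ vw]]].
rewrite -(cvg_lim (@ereal_hausdorff R) vw); apply: lime_ge; first by apply/cvg_ex; exists d.
by apply: nearW => k; exact: W_norm_ge0.
Qed.

Lemma W_cvg_le (s : nat -> V -> R[i]) (kap : nat -> HUU) : (forall k, tsf (s k)) ->
  (forall k, {ae mu, forall x, kerT (kap k) x = fourier (s k) x - fourier f x}) ->
  n2 (kap k) @[k --> \oo] --> (0 : R) -> W_cvg 2%:E U s X.
Proof.
move=> Ts hk k0; apply: (@e0_le _ _ (fun k => (Num.sqrt (n2 (kap k)))%:E)) => [k|].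
  by rewrite W_dist_ge0/=; exact: W_dist_le.
by apply/fine_cvgP; split; [exact: nearW|exact: cvg_sqrt0].
Qed.

(** Any other approximating sequence differs from [f] by a function of small L^1 norm, whose
    spectral kernel is small as well; [W_cvg_le] converts this into convergence to the class of
    [u]. *)
Lemma regardedX : regarded_in_W 2%:E U f X.
Proof.
split.
- by exists u => //; exact: (@u_cauchy id (fun l => leqnn l)).
- exists u; split; first by move=> k; exact: (W_spaceI (Tu _)).
  apply/cvg_Lp1; apply: e0_eps => [k|e e0]; first exact: L1n_ge0.
  have [N hN] := uf e0; exists N => // k Nk.
  by rewrite -(fineK (L1n_fin (L1cB (Tu k).1 f1))) lee_fin; exact/ltW/hN.
move=> v Wv /cvg_Lp1 vf.
(* Members of [W_space] are fixed only up to null sets; the [v' k] are measurable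
   representatives. *)
have [v' hv'] := choice (fun k => W_spaceE mU (Wv k)).
have Tv k := (hv' k).1; have av k := (hv' k).2.
have [kap hkap] : exists kap : nat -> HUU, forall k, n2 (kap k) <= C * fine (L1n mu (fun x => v' k x - f x)) ^+ 2 /\
    {ae mu, forall x, kerT (kap k) x = fourier (v' k) x - fourier f x}.
  suff h k : exists K : HUU, n2 K <= C * fine (L1n mu (fun x => v' k x - f x)) ^+ 2 /\
      {ae mu, forall x, kerT K x = fourier (v' k) x - fourier f x}.
    by have [kap hkap] := choice h; exists kap.
  have [|K [Kn KT]] := hC (L1cB (Tv k).1 f1).
    by apply: filterS fO => x fx0 nO; rewrite (fourierB x (Tv k).1 f1) fx0// (tsf_out (Tv k))// subrr.
  by exists K; split => //; apply: filterS KT => x ->; rewrite (fourierB x (Tv k).1 f1).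
have : W_cvg 2%:E U v' X.
  apply: (W_cvg_le Tv (fun k => (hkap k).2)).
  have vf' : fine (L1n mu (fun x => v' k x - f x)) @[k --> \oo] --> (0 : R).
    rewrite (_ : (fun k => _) = fun k => fine (L1n mu (fun x => v k x - f x))).
      by move/fine_cvgP : vf => [].
    by apply/funext => k; congr fine; apply: L1n_ae_any; apply: filterS (av k) => x ->.
  apply: (@squeeze_cvgr _ _ _ _ (fun=> 0) (fun k => C * fine (L1n mu (fun x => v' k x - f x)) ^+ 2)).
  - by apply: nearW => k; rewrite n2_ge0 (hkap k).1.
  - exact: cvg_cst.
  - rewrite [X in _ --> X](_ : _ = C * 0 ^+ 2); last by rewrite expr0n mulr0.
    apply: cvgM; first exact: cvg_cst.
    by under eq_fun do rewrite expr2; rewrite expr2; exact: cvgM.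
rewrite /W_cvg.
suff -> : (fun k => W_dist 2%:E U (W_embed 2%:E U (v k)) X) = (fun k => W_dist 2%:E U (W_embed 2%:E U (v' k)) X) by [].
by apply/funext => k; rewrite (W_embed_ae (av k))//; exact: (W_spaceI (Tv k)).
Qed.

(** The remainder of the decomposition after [N] terms, with opposite sign, is pushed forward to the
    transform of the partial sum minus [f], so its Hilbert-Schmidt norm bounds the distance in the
    completion. *)
Lemma svd_expansion : exists f_ g_ : nat -> V -> R[i],
  [/\ (forall j, PW2 U (f_ j)) /\ orthogonal_family f_, (forall j, PW2 U (g_ j)) /\ orthogonal_family g_,
      W_cvg 2%:E U (fun N x => \sum_(0 <= j < N) f_ j x * g_ j x) X &
      (\sum_(0 <= j <oo) ((Lpnorm 2%:E (f_ j) * Lpnorm 2%:E (g_ j)) ^+ 2)%:E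
          <= (C * Lpnorm 1%:E f ^+ 2)%:E)%E].
Proof.
have [K [Kn KT]] := hC f1 fO.
have [A [B [oA oB sumle rem0]]] := svd (@tensU_ip _ _ _ mU) (@tensU_dense _ _ _ mU) K.
have [f_ hf] := choose_ft A; have [g_ hg] := choose_ft B.
have pf j : PW2 U (f_ j) by exact: PW2I (hf j).1 (hf j).2.
have pg j : PW2 U (g_ j) by exact: PW2I (hg j).1 (hg j).2.
exists f_, g_; split.
- split => // i j ij; rewrite (L2dot_ip (hf i).1 (hf j).1 (hf i).2 (hf j).2); exact: oA.
- split => // i j ij; rewrite (L2dot_ip (hg i).1 (hg j).1 (hg i).2 (hg j).2); exact: oB.
- pose s N x := \sum_(j < N) f_ j x * g_ j x.
  have Ts N : tsf (s N) by apply: tsum_fun_sum => j.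
  rewrite (_ : (fun N x => _) = s); last first.
    by apply/funext => N; apply/funext => x; rewrite big_mkord.
  apply: (@W_cvg_le s (fun N => hscl (-1) (hrem (@tensU _ _ _ mU) K A B N))) => //; last first.
    rewrite (_ : (fun k => _) = fun k => n2 (hrem (@tensU _ _ _ mU) K A B k))//.
    by apply/funext => k; rewrite n2Z normcN normc1 expr1n mul1r.
  move=> N; apply: filterS2 KT (kerT_L1 finU K) => x hx Lx.
  have Lj (j : 'I_N) : L1c mu (fun x => f_ j x * g_ j x) by exact: L2cM (hf j).1 (hg j).1.
  have Ls : L1c mu (fun y => \sum_(j < N) fn (A j) y * fn (B j) (x - y)) by apply: L1c_sum => j; exact: conv_L1.
  transitivity (cint mu (fun y => (\sum_(j < N) fn (A j) y * fn (B j) (x - y)) - fn K (y, x - y))).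
    by apply: eq_cint => y; rewrite -[LHS]/(-1 * fn (hrem _ K A B N) (y, x - y)) fn_hrem mulN1r opprB.
  rewrite (cintB Ls Lx) -/(kerT K x) hx; congr (_ - _).
  rewrite cint_sum; last by move=> j; exact: conv_L1.
  rewrite /s fourier_sum//; apply: eq_bigr => j _.
  by rewrite (fourier_tens x (hf j).1 (hg j).1 (hf j).2 (hg j).2).
apply: lime_le; first by apply: is_cvg_nneseries => j _ _; rewrite lee_fin sqr_ge0.
apply: nearW => N; rewrite big_mkord sumEFin lee_fin Lp1E; apply: le_trans Kn.
apply: le_trans (sumle N); apply: ler_sum => j _.
by rewrite exprMn (ft2_n2 (hf j).1 (hf j).2) (ft2_n2 (hg j).1 (hg j).2).
Qed.

End one_f.
End main.

(** * Density of W_2 in the Paley-Wiener space PW^1 *)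

Section box_functions.
Context (R : realType) (n : nat).
Local Notation V := 'rV[R]_n.
Local Notation mu := (lebn R n).
Implicit Types Q : set V.

Let ind Q (x : V) : R[i] := ((\1_Q x : R)%:C)%C.

Lemma ind_L12 Q : measurable Q -> (mu Q < +oo)%E -> L1c mu (ind Q) /\ L2c mu (ind Q).
Proof.
by move=> mQ fQ; split; [split; [exact: mc_indic|rewrite L1n_indic]|exact: L2c_indic].
Qed.

(** The inverse Fourier transform of the indicator of [Q], expressed through the forward one since
    the indicator is real. *)
Definition beta Q (y : V) : R[i] := (fourier (ind Q) y)^*%C.

Section one_box.
Variable Q : set V.
Hypotheses (mQ : measurable Q) (fQ : (mu Q < +oo)%E).
Let Q1 := (ind_L12 mQ fQ).1.
Let Q2 := (ind_L12 mQ fQ).2.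

Lemma beta_L2 : L2c mu (beta Q).
Proof. by apply: L2c_conj; exact: (plancherel_L12 Q1 Q2).1. Qed.
Lemma beta_ft2 : ft2 (beta Q) (ind Q).
Proof.
apply: ft2_inv => //; first exact: (plancherel_L12 Q1 Q2).1.
rewrite (_ : (fun x => _) = ind Q); first exact: ft2_L12.
by apply/funext => x; rewrite conjc_real.
Qed.
Lemma beta_bound y : normc (beta Q y) <= fine (mu Q).
Proof. by rewrite normc_conj; apply: le_trans (fourier_bound y Q1) _; rewrite L1n_indic. Qed.
Lemma beta_sqr : cint mu (fun y => beta Q y * (beta Q y)^*%C) = ((fine (mu Q))%:C)%C.
Proof.
under eq_cint do rewrite mul_conj; rewrite cint_real; congr (_%:C)%C.
rewrite -[LHS]/(fine (L2n mu (beta Q))) -(ft2_norm beta_L2 Q2 beta_ft2); congr fine.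
rewrite -(L1n_indic mu mQ); apply: eq_integral => x _.
by rewrite normc_real real_normK ?num_real// ger0_norm// indicE expr2; case: (_ \in _); rewrite ?mul0r ?mul1r.
Qed.
End one_box.

Definition kap Q Q' (y : V) : R[i] := beta Q y * (beta Q' y)^*%C.

Section two_boxes.
Variables Q Q' : set V.
Hypotheses (mQ : measurable Q) (fQ : (mu Q < +oo)%E) (mQ' : measurable Q') (fQ' : (mu Q' < +oo)%E).

Lemma kap_L1 : L1c mu (kap Q Q').
Proof. by apply: L2cM; [exact: beta_L2|apply: L2c_conj; exact: beta_L2]. Qed.
Lemma kap_bound y : normc (kap Q Q' y) <= fine (mu Q) * fine (mu Q').
Proof. by rewrite normcM normc_conj; apply: ler_pM; rewrite ?normc_ge0// beta_bound. Qed.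
Lemma kap_spectrum x : fourier (kap Q Q') x <> 0 -> exists a b, [/\ Q a, Q' b & x = a - b].
Proof.
have [_ Q2] := ind_L12 mQ fQ; have [_ Q2'] := ind_L12 mQ' fQ'.
have b2 := beta_L2 mQ fQ; have b2' := beta_L2 mQ' fQ'.
rewrite (fourier_prod x b2 (L2c_conj b2') Q2 (L2c_conj (mscales_L2c (lebn_opp R n) Q2')) (beta_ft2 mQ fQ)); last first.
  by apply: ft2_conj (beta_ft2 mQ' fQ'); [exact: b2'.1|exact: Q2'.1].
move=> h; apply: contrapT => nex; apply: h; rewrite -[RHS](cint0 mu); apply: eq_cint => y.
rewrite conjc_real -rcM !indicE.
have [/set_mem Qy|_] := boolP (y \in Q); last by rewrite mul0r.
have [/set_mem Qy'|_] := boolP (- (x - y) \in Q'); last by rewrite mulr0.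
by exfalso; apply: nex; exists y, (- (x - y)); split => //; rewrite opprK addrC subrK.
Qed.
End two_boxes.

End box_functions.

(** * Transforms of smoothed functions *)

Section convk_facts.
Context (R : realType) (n : nat).
Local Notation V := 'rV[R]_n.
Local Notation mu := (lebn R n).
Variables (f k : V -> R[i]) (s : R).
Hypotheses (f1 : L1c mu f) (k1 : L1c mu k) (s0 : 0 < s).

Lemma convk_int : L1c mu (convk k s f).
Proof. exact: (L1c_cint1 (convk_L1 k1 s f1)). Qed.

Lemma fourier_convk x : fourier (convk k s f) x = fourier f x * fourier k (- (s *: x)).
Proof.
have L : L1c (mu \x mu)%E (fun p : V * V => f (p.1 + s *: p.2) * k p.2 * ec x (- p.1)).
  apply: (L1c_bound (convk_L1 k1 s f1) _ (M := 1)) => [|p]; last by rewrite normc_ec.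
  by apply: mc_ec => //; apply: measurable_rVN; exact: measurable_fst.
rewrite fourierE.
transitivity (cint mu (fun z => cint mu (fun u => f (z + s *: u) * k u * ec x (- z)))).
  apply: ae_eq_cint.
  - by apply: mcM; [exact: convk_int.1|exact: mc_ecNr].
  - exact: (mc_cint1 mu L.1).
  by apply: filterS (L1c_slice1 (convk_L1 k1 s f1)) => z Lz; rewrite cintZr.
rewrite (cint_swap L) (fourierE k) -cintZ; last exact: ft_L1.
apply: eq_cint => u.
transitivity (k u * fourier (fun z => f (z + s *: u)) x).
  rewrite fourierE -cintZ; last first.
    by apply: ft_L1; exact: (mscales_L1c (lebn_translate (s *: u)) f1).
  by apply: eq_cint => z; rewrite /=; ring.
rewrite (fourier_translate _ _ f1) /ec dotrVNl dotrVNr opprK dotrVZl dotrVZr; ring.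
Qed.

(** A bounded kernel makes the smoothing of an L^1 function bounded, and a bounded function in L^1
    is in L^2. *)
Lemma convk_L2 (M : R) : (forall u, normc (k u) <= M) -> L2c mu (convk k s f).
Proof.
move=> kM; have M0 : 0 <= M by apply: le_trans (kM 0); rewrite normc_ge0.
pose B := M * ((s ^+ n)^-1 * fine (L1n mu f)).
have bnd z : normc (convk k s f z) <= B.
  have Lz := mscales_L1c (lebn_affine z s0) f1.
  apply: le_trans (cint_le (L1c_bound Lz k1.1 kM)) _.
  rewrite -lee_fin fineK; last exact: L1n_fin (L1c_bound Lz k1.1 kM).
  rewrite /B !EFinM fineK ?L1n_fin// -(mscales_L1n (lebn_affine z s0) f1.1).
  rewrite /L1n -ge0_integralZl//; first last.
  - by move=> u _; rewrite lee_fin normc_ge0.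
  - by apply/measurable_EFinP; apply: mc_normc; exact: Lz.1.
  apply: ge0_le_integral => //.
  - by move=> u _; rewrite lee_fin normc_ge0.
  - by apply/measurable_EFinP; apply: mc_normc; apply: mcM; [exact: Lz.1|exact: k1.1].
  - by apply: measurable_funeM; apply/measurable_EFinP; apply: mc_normc; exact: Lz.1.
  by move=> u _; rewrite -EFinM lee_fin normcM mulrC ler_wpM2r ?normc_ge0.
apply: (@L2c_dom _ _ _ mu _ (fun z => B * normc (convk k s f z))).
- exact: convk_int.1.
- by apply: rintZ; exact: L1c_int convk_int.
- by move=> z; rewrite expr2 ler_wpM2r ?normc_ge0.
Qed.

End convk_facts.

(** * Partition of the unit cube into small cells *)

Section grid.
Context (R : realType) (n N : nat).
Local Notation V := 'rV[R]_n.
Hypothesis N0 : (0 < N)%N.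
(** On the closed cube [N (x_i + 1)] ranges over [[0, 2 N]] with both ends included, hence [2 N + 1]
    half-open intervals per coordinate. *)
Local Notation I := {ffun 'I_n -> 'I_(2 * N).+1}.

Definition cell (c : I) : set V :=
  [set x | cube 1 x /\ forall i, (c i)%:R <= N%:R * (x 0 i + 1) < (c i).+1%:R].

Lemma measurable_cell c : measurable (cell c).
Proof.
rewrite (_ : cell c = cube 1 `&` \bigcap_(i in [set: 'I_n]) [set x : V | (c i)%:R <= N%:R * (x 0 i + 1) < (c i).+1%:R]).
  apply: measurableI; first exact: measurable_cube.
  apply: fin_bigcap_measurable => // i _.
  have mf : measurable_fun setT (fun x : V => N%:R * (x 0 i + 1)).
    by apply: measurable_funM => //; apply: measurable_funD => //; exact: measurable_rV_coord.
  have := mf measurableT `[(c i)%:R, (c i).+1%:R[%classic (measurable_itv _).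
  by rewrite setTI; congr (measurable _); apply/seteqP; split => x /=; rewrite in_itv.
by apply/seteqP; split => x [cx hx]; split => // i; [move=> _|]; exact: hx.
Qed.

Lemma cell_fin c : (lebn R n (cell c) < +oo)%E.
Proof.
apply: (@le_lt_trans _ _ (lebn R n (cube 1))); last by rewrite [lebn _ _ _]lebesgue_cube ?ltry.
by apply: le_measure; rewrite ?inE; [exact: measurable_cell|exact: measurable_cube|move=> x []].
Qed.

Lemma cell_uniq (a b : nat) (t : R) : a%:R <= t < a.+1%:R -> b%:R <= t < b.+1%:R -> a = b.
Proof.
move=> /andP[a1 a2] /andP[b1 b2]; apply/eqP; rewrite eqn_leq; apply/andP.
by split; rewrite -ltnS -(ltr_nat R); [exact: le_lt_trans a1 b2|exact: le_lt_trans b1 a2].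
Qed.

Lemma cell_sum (x : V) : \1_(cube 1) x = \sum_(c : I) \1_(cell c) x :> R.
Proof.
rewrite indicE; have [/set_mem cx|nx] := boolP (x \in cube 1); last first.
  rewrite big1// => c _; rewrite indicE memNset// => -[cx _].
  by move/negP: nx; apply; exact/mem_set.
have hx i : 0 <= N%:R * (x 0 i + 1) :> R.
  by have := cx i; rewrite ler_norml => /andP[h _]; rewrite mulr_ge0//; lra.
have tr i : (Num.truncn (N%:R * (x 0 i + 1))%R < (2 * N).+1)%N.
  rewrite ltnS -(ler_nat R); have /andP[h _] := truncn_itv (hx i).
  apply: le_trans h _; have := cx i; rewrite ler_norml natrM mulrC => /andP[_ h].
  by rewrite ler_wpM2r//; lra.
pose c0 : I := [ffun i => Ordinal (tr i)].
rewrite (bigD1 c0)//= indicE mem_set; last first.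
  by split => // i; rewrite ffunE; exact: truncn_itv.
rewrite big1 ?addr0// => c cc0; rewrite indicE memNset// => -[_ h].
move/eqP: cc0; apply; apply/ffunP => i; apply: val_inj; rewrite ffunE /=.
exact: cell_uniq (h i) (truncn_itv (hx i)).
Qed.

Lemma cell_diam c x y i : cell c x -> cell c y -> `|x 0 i - y 0 i| < N%:R^-1.
Proof.
move=> [_ /(_ i)/andP[x1 x2]] [_ /(_ i)/andP[y1 y2]].
have NR : 0 < N%:R :> R by rewrite ltr0n.
rewrite -(ltr_pM2l NR) mulfV ?gt_eqF// -{1}(gtr0_norm NR) -normrM.
rewrite -natr1 in x2 y2.
by rewrite ltr_norml; apply/andP; split; lra.
Qed.

End grid.

(** * Bump functions with small spectrum *)

Section bump.
Context (R : realType) (n : nat).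
Local Notation V := 'rV[R]_n.
Local Notation mu := (lebn R n).

Let q (m : nat) : set V := cube (m.+1%:R^-1).
Let q_ge0 m : 0 <= m.+1%:R^-1 :> R. Proof. by rewrite invr_ge0. Qed.
Let mq m : measurable (q m). Proof. exact: measurable_cube. Qed.
Let volq m : mu (q m) = ((2 * m.+1%:R^-1) ^+ n)%:E. Proof. exact: lebesgue_cube. Qed.
Let fq m : (mu (q m) < +oo)%E. Proof. by rewrite volq ltry. Qed.
Let c m : R := fine (mu (q m)).
Let c0 m : 0 < c m. Proof. by rewrite /c volq exprn_gt0// mulr_gt0// invr_gt0. Qed.

(** The inverse transform of the normalised indicator of a shrinking cube: it stays bounded by 1 and
    tends to 1 pointwise, so multiplying by it hardly changes an L^1 function. *)
Definition bump m (y : V) : R[i] := (((c m)^-1)%:C)%C * beta (q m) y.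
Definition bumpF m (x : V) : R[i] := (((c m)^-1)%:C)%C * ((\1_(q m) x : R)%:C)%C.

Lemma bump_L2 m : L2c mu (bump m). Proof. by apply: L2cZ; exact: beta_L2. Qed.
Lemma bumpF_L2 m : L2c mu (bumpF m).
Proof. by apply: L2cZ; apply: L2c_indic; [exact: mq|exact: fq]. Qed.
Lemma bump_ft2 m : ft2 (bump m) (bumpF m).
Proof.
apply: ft2Z; [exact: (beta_L2 (mq m) (fq m)).1|exact: mc_indic|exact: beta_ft2].
Qed.
Lemma bump_le1 m y : normc (bump m y) <= 1.
Proof.
rewrite normcM normc_real ger0_norm ?invr_ge0 ?(ltW (c0 m))// mulrC ler_pdivrMr// mul1r.
exact: beta_bound.
Qed.
Lemma bumpF_out m x : bumpF m x <> 0 -> forall i, `|x 0 i| <= m.+1%:R^-1.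
Proof.
rewrite /bumpF indicE; have [/set_mem qx _|_] := boolP (x \in _); first exact: qx.
by rewrite mulr0.
Qed.

Lemma bump_cvg y : ccvg \oo (fun m => bump m y) 1.
Proof.
pose I : V -> R[i] := fun x => ((\1_(cube 1) x : R)%:C)%C.
have f1 : (mu (cube 1) < +oo)%E by rewrite [mu _]lebesgue_cube// ltry.
have I1 : L1c mu I := (ind_L12 (@measurable_cube R n 1) f1).1.
pose v : R := fine (mu (cube 1)).
have v0 : 0 < v by rewrite /v [mu _]lebesgue_cube// exprn_gt0// mulr1.
have E m : bump m y = ((v^-1)%:C)%C * (fourier I (m.+1%:R^-1 *: y))^*%C.
  have m0 : 0 < m.+1%:R :> R by rewrite ltr0n.
  rewrite /bump /beta.
  have -> : (fun x => ((\1_(q m) x : R)%:C)%C) = fun x => I (m.+1%:R *: x).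
    apply/funext => x; rewrite /I !indicE; congr ((_%:R)%:C)%C; congr nat_of_bool.
    apply/idP/idP; rewrite !inE => h i; have := h i; rewrite ?mxE normrM (gtr0_norm m0).
      by rewrite -(ler_pM2l m0) mulfV ?gt_eqF.
    by rewrite -(ler_pM2l m0 _ m.+1%:R^-1) mulfV ?gt_eqF.
  rewrite fourier_dilate// conjcM conjc_real mulrA; congr (_ * _).
  rewrite -rcM; congr (_%:C)%C; rewrite /c volq /v [mu _]lebesgue_cube//= mulr1 exprMn.
  by rewrite exprVn; field; rewrite !expf_neq0// gt_eqF.
rewrite (_ : (fun m => bump m y) = fun m => ((v^-1)%:C)%C * (fourier I (m.+1%:R^-1 *: y))^*%C); last first.
  by apply/funext => m; exact: E.
have F0 : fourier I 0 = ((v)%:C)%C.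
  rewrite fourierE; under eq_cint do rewrite ecC ec0 mulr1.
  by rewrite /I cint_real /Rintegral integral_indic ?setIT//; exact: measurable_cube.
have -> : 1 = ((v^-1)%:C)%C * (fourier I 0)^*%C.
  by rewrite F0 conjc_real -rcM mulVf ?gt_eqF.
apply: ccvgM; first exact: ccvg_cst.
suff h : ccvg \oo (fun m => fourier I (m.+1%:R^-1 *: y)) (fourier I 0).
  by apply: norm0_cvg h => m; rewrite normc_ge0 andTb -conjcB normc_conj.
rewrite fourierE; under eq_fun do rewrite fourierE.
apply: (@dct_cint _ _ _ _ _ _ (fun x => normc (I x))).
- by move=> m; exact: (ft_L1 _ I1).1.
- exact: (ft_L1 _ I1).1.
- exact: L1c_int.
- by move=> m x; rewrite normcM normc_ec mulr1.
- by move=> x; rewrite normcM normc_ec mulr1.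
apply: nearW => x; apply: ccvgM; first exact: ccvg_cst.
have h : 2 * pi * dotrV (m.+1%:R^-1 *: y) (- x) @[m --> \oo] --> (2 * pi * dotrV (0 : V) (- x) : R).
  apply: cvgM; first exact: cvg_cst.
  rewrite dotrV0l; under eq_fun do rewrite dotrVZl.
  suff : m.+1%:R^-1 * dotrV y (- x) @[m --> \oo] --> (0 * dotrV y (- x) : R) by rewrite mul0r.
  by apply: cvgM; [exact: invS_cvg0|exact: cvg_cst].
apply/ccvg_ReIm; split.
  exact: (continuous_cvg _ (@continuous_cos R _) h).
exact: (continuous_cvg _ (@continuous_sin R _) h).
Qed.

Lemma bump_L1_cvg P : L1c mu P -> L1n mu (fun z => P z * bump m z - P z) @[m --> \oo] --> (0 : \bar R).
Proof.
move=> P1; apply: (@dct_L1 _ _ _ _ _ _ (fun x => normc (P x))).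
- by move=> m; apply: mcM; [exact: P1.1|exact: (bump_L2 m).1].
- exact: P1.1.
- exact: L1c_int.
- by move=> m x; rewrite normcM ler_piMr ?normc_ge0// bump_le1.
- by [].
by apply: nearW => x; rewrite -[X in ccvg _ _ X]mulr1; apply: ccvgM; [exact: ccvg_cst|exact: bump_cvg].
Qed.

End bump.

(** * Approximation by finite sums of products *)

Section density.
Context (R : realType) (n : nat).
Local Notation V := 'rV[R]_n.
Local Notation mu := (lebn R n).
Variable Omega : set V.
Hypotheses (Omega_open : open Omega) (Omega_cvx : cvx Omega).
Local Notation U := (half_set Omega).
Local Notation tsf := (tsum_fun (measurable_half Omega_open)).

Definition margin (eta : R) : set V := [set x | forall b : V, (forall i, `|b 0 i| < eta) -> Omega (x + b)].

Lemma PW2_ft f F : L2c mu f -> L2c mu F -> ft2 f F -> {ae mu, forall x, ~ U x -> F x = 0} -> PW2 U f.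
Proof.
move=> f2 F2 fF h; split; first exact/in_Lp2.
by exists F; split; [exact/in_Lp2|exact/is_fourier2E|].
Qed.

Lemma tsf_prod f g : PW2 U f -> PW2 U g -> tsf (fun x => f x * g x).
Proof.
move=> hf hg.
have := @tsum_fun_sum _ _ _ (measurable_half Omega_open) 1 (fun=> f) (fun=> g) (fun=> hf) (fun=> hg).
by congr (tsum_fun _); apply/funext => x; rewrite big_ord1.
Qed.

Definition approximable (P : V -> R[i]) := L1c mu P /\ forall e : R, 0 < e ->
  exists h, tsf h /\ (L1n mu (fun x => (h x - P x)%R) <= e%:E)%E.

Lemma approximable_lim P : L1c mu P -> (forall e : R, 0 < e -> exists Q, approximable Q /\
  (L1n mu (fun x => (Q x - P x)%R) <= e%:E)%E) -> approximable P.
Proof.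
move=> P1 h; split => // e e0; have e2 : 0 < e / 2 by rewrite divr_gt0.
have [Q [[Q1 /(_ _ e2)[k [Tk kQ]]] QP]] := h _ e2; exists k; split => //.
rewrite (_ : (fun x => _) = fun x => (k x - Q x) + (Q x - P x)); last first.
  by apply/funext => x; rewrite addrA subrK.
apply: le_trans (L1nD _ _ _) _; [exact: mcB Tk.1.1 Q1.1|exact: mcB Q1.1 P1.1|].
by rewrite [X in (_ <= X%:E)%E](splitr e) EFinD leeD.
Qed.

Lemma approximableD P Q : approximable P -> approximable Q -> approximable (fun x => P x + Q x).
Proof.
move=> [P1 hP] [Q1 hQ]; split; first exact: L1cD.
move=> e e0; have e2 : 0 < e / 2 by rewrite divr_gt0.
have [h [Th hh]] := hP _ e2; have [k [Tk kk]] := hQ _ e2.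
exists (fun x => h x - (0 - k x)); split.
  by apply: tsum_funB => //; apply: tsum_funB => //; exact: tsum_fun0.
rewrite (_ : (fun x => _) = fun x => (h x - P x) + (k x - Q x)); last by apply/funext => x; ring.
apply: le_trans (L1nD _ _ _) _; [exact: mcB Th.1.1 P1.1|exact: mcB Tk.1.1 Q1.1|].
by rewrite [X in (_ <= X%:E)%E](splitr e) EFinD leeD.
Qed.

Lemma approximable_sum (I : Type) (r : seq I) (P : I -> V -> R[i]) : (forall i, approximable (P i)) ->
  approximable (fun x => \sum_(i <- r) P i x).
Proof.
move=> hP; elim: r => [|i r IH].
  rewrite (_ : (fun x => _) = fun=> 0); last by apply/funext => x; rewrite big_nil.
  split => [|e e0]; first exact: L1c0.
  exists (fun=> 0); split; first exact: tsum_fun0.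
  rewrite /L1n; under eq_integral do rewrite subrr normc0.
  by rewrite integral0 lee_fin ltW.
rewrite (_ : (fun x => _) = fun x => P i x + \sum_(j <- r) P j x); last by apply/funext => x; rewrite big_cons.
exact: approximableD.
Qed.

(* A function whose spectrum lies in a small part of [Omega] near [xi] is nearly the product of its
   modulation by [- xi / 2] and a wide bump modulated by [xi / 2]. *)
Lemma approximable_local P (xi : V) (eta : R) : 0 < eta -> L1c mu P -> L2c mu P -> margin eta xi ->
  {ae mu, forall x, fourier P x <> 0 -> forall i, `|2 * (x 0 i - xi 0 i)| < eta} -> approximable P.
Proof.
move=> eta0 P1 P2 mxi hP; split => // e e0.
have := e0_near (fun m => L1n_ge0 mu _) (bump_L1_cvg P1) e0 => -[M1 _ hM1].
(* Membership in [U] is tested after doubling, so the bump may use half of the margin. *)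
have [M2 _ hM2] : \forall k \near \oo, k.+1%:R^-1 < eta / 2 :> R.
  by apply: near_infty_natSinv_lt (PosNum _); rewrite divr_gt0.
pose m := maxn M1 M2; pose v := 2^-1 *: xi.
have vE : 2 *: v = xi by rewrite scalerA mulfV ?scale1r.
exists (fun x => P x * bump m x); split; last by apply: hM1; rewrite /= leq_maxl.
have b2 := @bump_L2 R n m; have bF2 := @bumpF_L2 R n m.
have F2 := (plancherel_L12 P1 P2).1.
have A : PW2 U (fun x => P x * ec (- v) x).
  apply: (@PW2_ft _ (fun x => fourier P (x - (- v)))).
  - exact: mod_L2.
  - exact: shift_L2.
  - by apply: ft2_mod (ft2_L12 P1 P2); [exact: P2.1|exact: F2.1].
  apply: filterS (ae_pull (lebn_translate v) hP) => x hx nU; apply: contrapT.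
  rewrite opprK => /hx h; apply: nU; apply/half_setE.
  have -> : 2 *: x = xi + 2 *: (x + v - xi) by rewrite -{1}vE; apply/rowP => i; rewrite !mxE; field.
  by apply: mxi => i; have := h i; rewrite !mxE.
have B : PW2 U (fun x => bump m x * ec v x).
  apply: (@PW2_ft _ (fun x => bumpF m (x - v))).
  - exact: mod_L2.
  - exact: shift_L2.
  - by apply: ft2_mod (@bump_ft2 R n m); [exact: b2.1|exact: bF2.1].
  apply: nearW => x nU; apply: contrapT => /bumpF_out h; apply: nU; apply/half_setE.
  have -> : 2 *: x = xi + 2 *: (x - v) by rewrite -{1}vE; apply/rowP => i; rewrite !mxE; ring.
  apply: mxi => i; rewrite mxE normrM gtr0_norm//.
  have h1 := h i; have h2 : m.+1%:R^-1 < eta / 2 := hM2 m (leq_maxr _ _).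
  by move: h1 h2; move: (m.+1%:R^-1) (`|(x - v) 0 i|) => a b; lra.
have := tsf_prod A B; congr (tsum_fun _); apply/funext => x.
by rewrite mulrACA -ecDl addNr ecC ec0 mulr1.
Qed.

(** [f] is smoothed by [phi], the normalised square modulus of [beta Q]. Cutting [Q] into cells
    writes [phi] as a finite sum of kernels [K ij] whose spectra lie in differences of two cells, so
    each smoothed piece has its spectrum in a tiny set and falls under [approximable_local]. *)
Lemma approximable_margin f (eta : R) (x0 : V) : 0 < eta -> L1c mu f -> margin eta x0 ->
  {ae mu, forall x, ~ margin eta x -> fourier f x = 0} -> approximable f.
Proof.
move=> eta0 f1 mx0 hf; apply: approximable_lim => // e e0.
pose Q : set V := cube 1.
have mQ : measurable Q by exact: measurable_cube.
have vQ : mu Q = ((2 * 1) ^+ n)%:E by exact: lebesgue_cube.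
have fQ : (mu Q < +oo)%E by rewrite vQ ltry.
pose c : R := fine (mu Q).
have c0 : 0 < c by rewrite /c vQ exprn_gt0// mulr1.
pose phi y := ((c^-1)%:C)%C * kap Q Q y.
have phi1 : L1c mu phi by apply: L1cZ; exact: kap_L1.
have phione : cint mu phi = 1.
  rewrite cintZ; last exact: kap_L1.
  by rewrite beta_sqr// -rcM mulVf ?gt_eqF.
have := e0_near (fun m => L1n_ge0 mu _) (convk_cvg phi1 phione (@invS_cvg0 R) f1) e0 => -[k _ /(_ k (leqnn k)) hk].
set s : R := k.+1%:R^-1 in hk; have s0 : 0 < s by rewrite invr_gt0.
exists (convk phi s f); split; last exact: hk.
(* Two points of the spectrum of one piece satisfy [s |x_l - xi_l| < 2 / N]; doubling as in
   [approximable_local] requires [4 / (N s) < eta]. *)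
pose N := (Num.truncn (4 / (s * eta))).+1.
have N0 : (0 < N)%N by [].
have Nbig : 4 / (s * eta) < N%:R by exact: truncnS_gt.
pose I := {ffun 'I_n -> 'I_(2 * N).+1}.
pose K (ij : I * I) y := ((c^-1)%:C)%C * kap (cell ij.1) (cell ij.2) y.
have mc_ i := @measurable_cell R n N i; have fc i := @cell_fin R n N i.
have K1 ij : L1c mu (K ij) by apply: L1cZ; exact: kap_L1.
have phiE y : phi y = \sum_(ij : I * I) K ij y.
  have bE : beta Q y = \sum_(i : I) beta (cell i) y.
    transitivity ((\sum_(i : I) fourier (fun x => ((\1_(cell i) x : R)%:C)%C) y)^*%C); last exact: rmorph_sum.
    rewrite -fourier_sum; last by move=> i; exact: (ind_L12 (mc_ i) (fc i)).1.
    rewrite /beta; suff -> : (fun x => ((\1_Q x : R)%:C)%C) = (fun x => \sum_(i : I) ((\1_(cell i) x : R)%:C)%C) by [].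
    apply/funext => x; rewrite /Q (@cell_sum R n N x).
    by apply: (big_morph (fun r : R => (r%:C)%C)) => // a b; rewrite rcD.
  have bEc : (beta Q y)^*%C = \sum_(i : I) (beta (cell i) y)^*%C by rewrite bE; exact: rmorph_sum.
  rewrite /phi /kap bEc bE mulr_suml mulr_sumr.
  under eq_bigr do rewrite !mulr_sumr.
  by rewrite pair_bigA.
have app ij : approximable (convk (K ij) s f).
  case: ij => i j.
  have P1 := convk_int s f1 (K1 (i, j)).
  have P2 : L2c mu (convk (K (i, j)) s f).
    apply: (convk_L2 f1 (K1 (i, j)) s0 (M := c^-1 * (fine (mu (cell i)) * fine (mu (cell j))))) => u.
    rewrite normcM normc_real ger0_norm ?invr_ge0 ?(ltW c0)// ler_wpM2l ?invr_ge0 ?(ltW c0)//.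
    exact: kap_bound.
  pose S := [set x : V | margin eta x /\ exists a b, [/\ cell i a, cell j b & - (s *: x) = a - b]].
  have hS : {ae mu, forall x, fourier (convk (K (i, j)) s f) x <> 0 -> S x}.
    have E x : fourier (convk (K (i, j)) s f) x = fourier f x * fourier (K (i, j)) (- (s *: x)).
      exact: (fourier_convk s f1 (K1 (i, j))).
    apply: filterS hf => x hx; rewrite (E x) => ne.
    have nz1 : fourier f x <> 0 by move=> h; apply: ne; rewrite h mul0r.
    have nz2 : fourier (K (i, j)) (- (s *: x)) <> 0 by move=> h; apply: ne; rewrite h mulr0.
    split; first by apply: contrapT => /hx.
    apply: kap_spectrum => // h; apply: nz2.
    by rewrite fourierZ ?h ?mulr0//; exact: kap_L1.
  have [[xi [mxi [a [b [ia jb ab]]]]]|nS] := pselect (S !=set0).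
    apply: (@approximable_local _ xi eta eta0 P1 P2 mxi); apply: filterS hS => x h /h[_ [a' [b' [ia' jb' ab']]]] l.
    have d1 := cell_diam N0 l ia ia'; have d2 := cell_diam N0 l jb jb'.
    have := congr1 (fun z : V => z 0 l) ab; have := congr1 (fun z : V => z 0 l) ab'.
    rewrite !mxE => e' e''.
    have NN : N%:R^-1 < s * eta / 4.
      by rewrite -[ltRHS]invrK invf_div ltf_pV2 ?posrE ?ltr0n// divr_gt0// mulr_gt0.
    have : `|s * (2 * (x 0 l - xi 0 l))| < s * eta.
      move: d1 d2; rewrite !ltr_norml => /andP[d1 d1'] /andP[d2 d2'].
      by apply/andP; split; nra.
    by rewrite normrM (gtr0_norm s0) ltr_pM2l.
  (* An empty spectrum satisfies the localisation vacuously, with [x0] as a dummy centre. *)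
  apply: (@approximable_local _ x0 eta eta0 P1 P2 mx0); apply: filterS hS => x h /h Sx.
  by exfalso; apply: nS; exists x.
have [L1 hL] := approximable_sum (index_enum (I * I)%type) app.
have aeE : {ae mu, forall z, \sum_(ij : I * I) convk (K ij) s f z = convk phi s f z}.
  have hz : {ae mu, forall z, forall ij : I * I, L1c mu (fun u => f (z + s *: u) * K ij u)}.
    by apply: filter_forall => ij; exact: L1c_slice1 (convk_L1 (K1 ij) s f1).
  apply: filterS hz => z Lz; rewrite /convk -cint_sum//; apply: eq_cint => u.
  by rewrite phiE mulr_sumr.
split; first exact: convk_int.
move=> e' e'0; have [h [Th hh]] := hL _ e'0; exists h; split => //.
apply: le_trans hh; rewrite le_eqVlt; apply/orP; left; apply/eqP; apply: L1n_ae_any.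
by apply: filterS aeE => z ->.
Qed.

(** By convexity, contracting [Omega] towards [x0] leaves a uniform margin to the complement. On the
    side of functions this is a dilation of ratio near 1, which moves [f] little in L^1; the
    modulation by [x0] places the fixed point of the contraction at the origin. *)
Lemma dilate_margin f (x0 : V) (e : R) : Omega x0 -> L1c mu f ->
  {ae mu, forall x, ~ Omega x -> fourier f x = 0} -> 0 < e ->
  exists g (eta : R), [/\ 0 < eta, L1c mu g, margin eta x0,
    {ae mu, forall x, ~ margin eta x -> fourier g x = 0} & (L1n mu (fun x => (g x - f x)%R) <= e%:E)%E].
Proof.
move=> Ox0 f1 hf e0; pose g y := f y * ec (- x0) y.
have g1 : L1c mu g by exact: mod_L1.
pose s (k : nat) : R := 1 + k.+1%:R^-1; pose r k := (s k)^-1.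
have s1 k : 1 < s k by rewrite ltrDl invr_gt0.
have s0 k : 0 < s k by exact: lt_trans ltr01 (s1 k).
have r0 k : 0 < r k by rewrite invr_gt0.
have r1 k : r k < 1 by rewrite invf_lt1.
have sc : s k @[k --> \oo] --> (1 : R).
  suff : s k @[k --> \oo] --> (1 + 0 : R) by rewrite addr0.
  by apply: cvgD; [exact: cvg_cst|exact: invS_cvg0].
have rc : r k @[k --> \oo] --> (1 : R).
  by rewrite -[X in _ --> X]invr1; apply: cvgV => //; exact: oner_neq0.
have cc : ((r k ^+ n)^-1 : R) @[k --> \oo] --> (1 : R).
  rewrite (_ : (fun k => _) = fun k => s k ^+ n); last by apply/funext => k; rewrite exprVn invrK.
  by rewrite -[X in _ --> X](expr1n _ n); elim: n => [|m IH]; [exact: cvg_cst|under eq_fun do rewrite exprS; rewrite exprS; exact: cvgM].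
have gc (x : V) : r k *: x @[k --> \oo] --> x.
  by rewrite -[X in _ --> X]scale1r; exact: cvgZr_tmp.
have := e0_near (fun m => L1n_ge0 mu _) (@shrink_L1 R n (fun k x => r k *: x) (fun k => (r k ^+ n)^-1)
  (fun k => lebn_dilate n (r0 k)) cc gc g g1) e0 => -[k _ /(_ k (leqnn k)) hk].
have /nbhs_ballP[rho /= rho0 hrho] : nbhs x0 Omega by exact: open_nbhs_nbhs.
have r1' : 0 < 1 - r k by rewrite subr_gt0.
pose eta := (1 - r k) * rho; have eta0 : 0 < eta by rewrite mulr_gt0.
(* The perturbed point is the convex combination of [y], with weight [r k], and of
   [x0 + b / (1 - r k)], which lies in the ball of radius [rho] around [x0]. *)
have mar y : Omega y -> margin eta (x0 + r k *: (y - x0)).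
  move=> Oy b hb.
  have Ob : Omega (x0 + (1 - r k)^-1 *: b).
    apply: hrho; apply/ball_rVE => // i; rewrite !mxE opprD addrA subrr sub0r normrN normrM.
    by rewrite gtr0_norm ?invr_gt0// ltr_pdivrMl//; exact: hb.
  have := Omega_cvx Oy Ob (ltW (r0 k)) (ltW (r1 k)).
  congr (Omega _); apply/rowP => i; rewrite !mxE; field; rewrite gt_eqF//.
pose fr y := g (r k *: y) * ec x0 y.
have gr1 : L1c mu (fun y => g (r k *: y)) by exact: (mscales_L1c (lebn_dilate n (r0 k)) g1).
exists fr, eta; split => //.
- exact: mod_L1.
- by have := mar _ Ox0; rewrite subrr scaler0 addr0.
- apply: filterS (ae_pull (lebn_affine (x0 - s k *: x0) (s0 k)) hf) => x hx nm.
  rewrite /fr fourier_mod (fourier_dilate _ (r0 k) g1) /g fourier_mod invrK opprK.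
  rewrite (_ : s k *: (x - x0) + x0 = x0 - s k *: x0 + s k *: x); last first.
    by apply/rowP => i; rewrite !mxE; ring.
  rewrite hx ?mulr0// => Oy; apply: nm; have := mar _ Oy.
  congr (margin _ _); apply/rowP => i; rewrite !mxE /r; field; rewrite gt_eqF//.
rewrite (_ : L1n _ _ = L1n mu (fun x => g (r k *: x) - g x))//.
apply: eq_integral => x _; congr (_%:E).
rewrite -[LHS]mulr1 -(normc_ec (- x0) x) -normcM; congr normc.
rewrite /fr mulrBl -mulrA -ecDl addrN ecC ec0 mulr1; congr (_ - _).
Qed.

Theorem tsum_fun_dense f : L1c mu f -> {ae mu, forall x, ~ Omega x -> fourier f x = 0} ->
  forall e : R, 0 < e -> exists h, tsf h /\ (L1n mu (fun x => (h x - f x)%R) <= e%:E)%E.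
Proof.
move=> f1 hf; have [[x0 Ox0]|nO] := pselect (exists x0, Omega x0); last first.
  move=> e e0; exists (fun=> 0); split; first exact: tsum_fun0.
  have f0 : {ae mu, forall x, f x = 0}.
    by apply: fourier_inj => //; apply: filterS hf => x; apply => Ox; apply: nO; exists x.
  rewrite (_ : L1n _ _ = L1n mu (fun=> 0)).
    by rewrite /L1n; under eq_integral do rewrite normc0; rewrite integral0 lee_fin ltW.
  by apply: L1n_ae_any; apply: filterS f0 => x ->; rewrite subr0.
suff : approximable f by case.
apply: approximable_lim => // e e0.
have [g [eta [eta0 g1 mx0 hg gf]]] := dilate_margin Ox0 f1 hf e0.
by exists g; split => //; exact: approximable_margin eta0 g1 mx0 hg.
Qed.

End density.

Lemma convex_set_cvx (R : realType) n (Omega : set 'rV[R]_n) :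
  convex_set (Omega : set (convex_lmodType 'rV[R]_n)) -> cvx Omega.
Proof.
move=> h x y s Ox Oy s0 s1.
by have /set_mem := h x y (Itv01 s0 s1) (mem_set Ox) (mem_set Oy).
Qed.

Theorem corollary1p3 (R : realType) (n : nat) (Omega : set 'rV[R]_n)
    (Omega_open : open Omega)
    (Omega_convex : convex_set (Omega : set (convex_lmodType 'rV[R]_n)))
    (Omega_lines : ~ has_affine_line Omega) :
  exists C : R, 0 < C /\
  forall f : 'rV[R]_n -> R[i], PW1 Omega f ->
  exists X : set (nat -> 'rV[R]_n -> R[i]),
    regarded_in_W 2%:E (half_set Omega) f X /\
  exists f_ g_ : nat -> 'rV[R]_n -> R[i],
    [/\ (forall j, PW2 (half_set Omega) (f_ j)) /\ orthogonal_family f_,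
        (forall j, PW2 (half_set Omega) (g_ j)) /\ orthogonal_family g_,
        W_cvg 2%:E (half_set Omega)
          (fun N x => \sum_(0 <= j < N) f_ j x * g_ j x) X &
        (\sum_(0 <= j <oo)
            ((Lpnorm 2%:E (f_ j) * Lpnorm 2%:E (g_ j)) ^+ 2)%:E
          <= (C * Lpnorm 1%:E f ^+ 2)%:E)%E].
Proof.
have Omega_cvx := convex_set_cvx Omega_convex.
have [C [C0 hC]] := spectral_kernel Omega_open Omega_cvx Omega_lines.
exists C; split => // f [/in_Lp1 f1 fO].
have step k : exists h, tsum_fun (measurable_half Omega_open) h /\
    (L1n (lebn R n) (fun x => (h x - f x)%R) <= (k.+1%:R^-1)%:E)%E.
  by apply: tsum_fun_dense => //; rewrite invr_gt0.
have [u hu] := choice step.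
have Tu k := (hu k).1.
have uf (e : R) : 0 < e -> exists N, forall k, (N <= k)%N -> fine (L1n (lebn R n) (fun x => u k x - f x)) < e.
  move=> e0; have [N _ hN] : \forall k \near \oo, k.+1%:R^-1 < e :> R by exact: near_infty_natSinv_lt (PosNum e0).
  exists N => k Nk; apply: le_lt_trans (hN k Nk).
  by rewrite -lee_fin fineK ?(hu k).2// (L1n_fin (L1cB (Tu k).1 f1)).
exists (W_class 2%:E (half_set Omega) u); split.
  exact: (regardedX Omega_cvx Omega_lines C0 hC f1 fO Tu uf).
exact: (svd_expansion Omega_cvx Omega_lines C0 hC f1 fO Tu uf).
Qed.
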